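(* Let $-A$ generate an exponentially stable $C_0$-semigroup $(T(t))_{t\geq0}$ on a Banach space $X$ with type $p\in[1,2]$ and cotype $q\in[2,\infty)$. Suppose that $T(t)$ is invertible for all $t\geq0$. Let $\alpha>\tfrac1p-\tfrac1q$ and $a\in(0,\alpha-\tfrac1p+\tfrac1q)$. Then there exists a constant $C\geq0$ such that $$\|r_n(-tA)x-T(t)x\|_X\leq Ct^a(n+1)^{-a}\|A^\alpha x\|_X$$ for all $t\in(0,\infty)$, all $n\in\mathbb{N}$ with $n>\frac\alpha2-1$ and all $x\in D(A^\alpha)$. Moreover, $(r_n(-tA))_{n\in\mathbb{N}}$ converges strongly on $D_A(\tfrac1p-\tfrac1q,1)$ to $T(t)$ as $n\to\infty$, locally uniformly in $t$.
   Context: All Banach spaces are complex and nonzero; $\mathbb{N}=\{1,2,\dots\}$. A $C_0$-semigroup is exponentially stable if there are $M\geq1$, $\omega>0$ with $\|T(t)\|\leq Me^{-\omega t}$ for all $t\geq0$. $A^\alpha$ is the standard fractional power. Padé approximation: for $n\in\mathbb{N}$ let $p_n$ and $q_n$ be the unique polynomials of degree $n$ and $n+1$, respectively, such that $p_n(0)=q_n(0)=1$ and $|\frac{p_n(z)}{q_n(z)}-e^z|\leq C|z|^{2n+2}$ for all $z$ in a neighborhood of $0\in\mathbb{C}$ (for some constant $C$); $r_n:=p_n/q_n$ is the $n$-th subdiagonal Padé approximation of the exponential function. Type and cotype: let $(\gamma_k)_{k\in\mathbb{N}}$ be independent standard complex Gaussian random variables. $X$ has type $p\in[1,2]$ if there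 is $C$ with $(\mathbb{E}\|\sum_{k=1}^n\gamma_kx_k\|^2)^{1/2}\leq C(\sum_{k=1}^n\|x_k\|^p)^{1/p}$ for all $n$ and $x_1,\dots,x_n\in X$; $X$ has cotype $q\in[2,\infty)$ if there is $C$ with $(\sum_{k=1}^n\|x_k\|^q)^{1/q}\leq C(\mathbb{E}\|\sum_{k=1}^n\gamma_kx_k\|^2)^{1/2}$ for all $n$ and $x_1,\dots,x_n\in X$. Real interpolation: $D_A(\theta,r):=(X,D(A))_{\theta,r}$ is the real interpolation space (K-method) between $X$ and $D(A)$ with graph norm; in particular $D_A(0,1)=\{0\}$. *)

(* Defs.v *)
From mathcomp Require Import all_boot all_order all_algebra.
From mathcomp Require Import all_classical all_reals all_analysis.
From mathcomp Require Export complex.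

Set Implicit Arguments.
Unset Strict Implicit.
Unset Printing Implicit Defensive.

Import Order.TTheory GRing.Theory Num.Theory.
Import numFieldNormedType.Exports.

Local Open Scope classical_set_scope.
Local Open Scope complex_scope.
Local Open Scope ring_scope.

(* Over the scalar field R[i] library norms take values in R[i]; they are
   nonnegative reals there, and nrm is the same number seen in R. *)
Definition nrm (R : realType) (V : normedZmodType R[i]) (x : V) : R :=
  complex.Re `|x|.

(** Unbounded operators, identified with their graphs *)

Definition operator (X : Type) : Type := set (X * X).

Section Operators.
Context {R : realType} {X : completeNormedModType R[i]}.
Implicit Types (B : operator X) (p q : {poly R[i]}).

Definition dom B : set X := [set x | exists y, B (x, y)].

(* The value B x, and 0 when x is not in the domain of B. *)
Definition app B (x : X) : X := xget 0 [set y | B (x, y)].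

Definition scale_op (c : R[i]) B : operator X :=
  [set xy | exists2 y, B (xy.1, y) & xy.2 = c *: y].

Definition inv_op B : operator X := [set xy | B (xy.2, xy.1)].

(* p(B), with domain D(B ^ deg p): the sequence v lists u, B u, B^2 u, and so
   on up to the degree (size p).-1. *)
Definition poly_op p B : operator X :=
  [set uy | exists v : nat -> X,
     [/\ v 0%N = uy.1,
         forall k, (k < (size p).-1)%N -> B (v k, v k.+1) &
         uy.2 = \sum_(k < size p) p`_k *: v k]].

(* The operator p(B) q(B)^-1, that is r(B) for r = p / q. *)
Definition rat_op p q B : operator X :=
  [set xy | exists2 u, inv_op (poly_op q B) (xy.1, u) & poly_op p B (u, xy.2)].

End Operators.

(** Semigroups *)

Section Semigroups.
Context {R : realType} {X : completeNormedModType R[i]}.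
Implicit Type T : R -> {linear X -> X}.

(* Only the values T t with t >= 0 matter. *)
Record C0_semigroup T : Prop := {
  sg_continuous : forall t, 0 <= t -> continuous (T t) ;
  sg_0 : forall x, T 0 x = x ;
  sg_add : forall s t x, 0 <= s -> 0 <= t -> T (s + t) x = T s (T t x) ;
  sg_strong : forall x, T t x @[t --> (0 : R)^'+] --> x }.

Definition generator T : operator X :=
  [set xy | (h^-1)%:C *: (T h xy.1 - xy.1) @[h --> (0 : R)^'+] --> xy.2].

Definition exponentially_stable T : Prop :=
  exists M omega : R, [/\ 1 <= M, 0 < omega &
    forall t x, 0 <= t -> nrm (T t x) <= M * expR (- (omega * t)) * nrm x].

Definition invertible_op (S : {linear X -> X}) : Prop :=
  exists S' : {linear X -> X}, [/\ continuous S', cancel S S' & cancel S' S].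

End Semigroups.

(** Fractional powers *)

Section FractionalPowers.
Context {R : realType} {X : completeNormedModType R[i]}.
Implicit Types (f : R -> X) (T : R -> {linear X -> X}).

(* Riemann integral over [a, b], with tagged partitions. *)
Definition is_rint f (a b : R) (I : X) : Prop :=
  forall e : R, 0 < e -> exists2 delta : R, 0 < delta &
    forall (n : nat) (s c : nat -> R),
      s 0%N = a -> s n = b ->
      (forall i, (i < n)%N ->
         [/\ s i <= c i, c i <= s i.+1 & s i.+1 - s i < delta]) ->
      nrm (\sum_(i < n) (s i.+1 - s i)%:C *: f (c i) - I) < e.

(* Improper Riemann integral over the open half-line from 0. *)
Definition is_rint0y f (I : X) : Prop :=
  forall e : R, 0 < e ->
    \forall a \near (0 : R)^'+ & b \near +oo%R,
      exists2 J, is_rint f a b J & nrm (J - I) < e.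

Definition Gamma (alpha : R) : R :=
  \int[lebesgue_measure]_(t in `]0, +oo[%classic)
     (t `^ (alpha - 1) * expR (- t)).

(* When - A generates the exponentially stable semigroup T and alpha > 0,
   A^(-alpha) x = Gamma(alpha)^-1 * int_0^oo t^(alpha - 1) T(t) x dt, which is
   bounded and injective, and A^alpha is its inverse. *)
Definition fpow_neg T (alpha : R) : operator X :=
  [set xy | exists2 I,
     is_rint0y (fun t => (t `^ (alpha - 1))%:C *: T t xy.1) I &
     xy.2 = ((Gamma alpha)^-1)%:C *: I].

Definition fpow T (alpha : R) : operator X := inv_op (fpow_neg T alpha).

End FractionalPowers.

(** Subdiagonal Pade approximation of the exponential *)

Section Pade.
Context {R : realType}.

Definition cexp (z : R[i]) : R[i] :=
  (expR (complex.Re z))%:C * (cos (complex.Im z) +i* sin (complex.Im z)).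

Definition is_subdiagonal_pade (n : nat) (p q : {poly R[i]}) : Prop :=
  [/\ size p = n.+1, size q = n.+2, p.[0] = 1, q.[0] = 1 &
      exists C rho : R, 0 < rho /\ forall z : R[i], nrm z < rho ->
        nrm (p.[z] / q.[z] - cexp z) <= C * nrm z ^+ (2 * n + 2)].

End Pade.

(** Type and cotype *)

Section TypeCotype.
Context {R : realType} d {Omega : measurableType d} (P : probability Omega R).

(* Real part (b = false) or imaginary part (b = true) of the k-th variable. *)
Definition part (gam : nat -> Omega -> R[i]) (i : nat * bool) (w : Omega) : R :=
  if i.2 then complex.Im (gam i.1 w) else complex.Re (gam i.1 w).

(* Independent standard complex Gaussians: all real and imaginary parts are
   jointly independent with law N(0, 1/2), so that E |gam k| ^ 2 = 1.  The
   second argument of normal_prob is the standard deviation. *)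
Definition gaussian_sequence (gam : nat -> Omega -> R[i]) : Prop :=
  [/\ forall i, measurable_fun [set: Omega] (part gam i),
      forall i (B : set R), measurable B ->
        P (part gam i @^-1` B) = normal_prob 0 (Num.sqrt 2)^-1 B &
      forall (s : seq (nat * bool)) (B : nat * bool -> set R),
        uniq s -> (forall i, measurable (B i)) ->
        P (\bigcap_(i in [set` s]) (part gam i @^-1` B i)) =
        (\big[*%E/1]_(i <- s) P (part gam i @^-1` B i))%E].

Context (X : completeNormedModType R[i]).
Implicit Types (gam : nat -> Omega -> R[i]) (p q : R).

(* (E || sum_k gam_k x_k ||^2)^(1/2) *)
Definition gauss_norm gam n (x : 'I_n -> X) : \bar R :=
  ('E_P[fun w => (nrm (\sum_(k < n) gam k w *: x k) ^+ 2)%R] `^ 2^-1)%E.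

Definition has_type gam p : Prop :=
  exists C : R, forall n (x : 'I_n -> X),
    (gauss_norm gam x <= (C * (\sum_(k < n) nrm (x k) `^ p) `^ p^-1)%:E)%E.

Definition has_cotype gam q : Prop :=
  exists C : R, forall n (x : 'I_n -> X),
    (((\sum_(k < n) nrm (x k) `^ q) `^ q^-1)%:E <= C%:E * gauss_norm gam x)%E.

End TypeCotype.

(** Real interpolation between X and D(A) *)

Section RealInterpolation.
Context {R : realType} {X : completeNormedModType R[i]}.
Implicit Type A : operator X.

Definition graph_norm A (z : X) : R := nrm z + nrm (app A z).

Definition K_functional A (t : R) (x : X) : R :=
  inf [set nrm yz.1 + t * graph_norm A yz.2 | yz in
         [set yz : X * X | dom A yz.2 /\ x = yz.1 + yz.2]].

(* D_A(theta, r) for finite r. *)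
Definition interp A (theta r : R) : set X :=
  [set x | (\int[lebesgue_measure]_(t in `]0%R, +oo[%classic)
              (((t `^ (- theta) * K_functional A t x) `^ r) / t)%:E < +oo)%E].

End RealInterpolation.

(* Main.v *)
(* Let theta = 1/p - 1/q, S = T(h) and B = r_n(-tA) - T(t).

   1. Gaussian sums are invariant under unitary matrices, and a circulant matrix
   whose symbol is bounded by 1 is a half-sum of two unitary ones.  Applying type to
   the orbit of x, which is bounded by stability, and cotype to the orbit of m(S) x
   over a unit of time, which is bounded below by invertibility, gives
   |m(S)| <= C h^(-theta) sup |m| over the unit circle, for polynomials m.

   2. For h = h'/k, averaging over the k-th roots of unity replaces this bound by
   h'^(-theta) times the supremum of sum_c |m(z zeta^c)|.  The Cayley transform turns
   functions of A into limits of functions of T(t/m), and Parseval then yields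
   |B R(l)^N| <= C (t/(n+1))^a l^(theta+a-N) for the resolvent R(l), l >= 1, since
   |r_n(iy) - e^(iy)| <= C (|y|/(n+1))^a.  That estimate and the stability of r_n
   come from the kernel X^n (X-1)^(n+1), of which the coefficients of q_n and p_n
   are the derivatives at 0 and 1.

   3. The weight s^(al-1) of A^(-al) is approximated in L^1 by combinations of
   e^(-l s) (1 - e^(-l s))^(N-1), with l in e^(h Z), which represent multiples of
   R(l) R(2l) ... R(Nl); summing the bounds of 2 gives the rate.

   4. Telescoping gives |B R(l)| <= C l^(theta-1).  Write x in the interpolation
   space as a series of differences z_(k+1) - z_k of near minimizers of the
   K-functional at 2^(-k): the bound makes the tail of the series of images
   uniformly small, and the first terms converge by 2 and density. *)

From HB Require Import structures.
Require Import Defs.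
From mathcomp Require Import all_boot all_order all_algebra.
From mathcomp Require Import all_classical all_reals all_analysis.
From mathcomp Require Import measurable_realfun.
From mathcomp Require cyclic separable cyclotomic.
From mathcomp Require Import zify ring lra.
Import Order.TTheory GRing.Theory Num.Theory.
Import numFieldNormedType.Exports.
Local Open Scope classical_set_scope.
Local Open Scope complex_scope.
Local Open Scope ring_scope.
Set Implicit Arguments.
Unset Strict Implicit.
Unset Printing Implicit Defensive.

(** The loss h^(-theta) in the transference bound shapes the argument. The operators B are limits of
    functions of T(t/m) as m -> oo, so the bound taken at the step t/m would diverge. Grouping steps
    into blocks of length about 1/l replaces (t/m)^(-theta) by l^theta, at the price of a sum of the
    symbol over points of the circle instead of its supremum. That sum stays bounded as m grows if
    the symbol carries two resolvent factors, because Parseval controls sums of squares: hence the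
    exponent theta - 2 and the products of at least two resolvents. In the rate, resolvent factors
    worth |y|^(-a) absorb the growth of the symbol error, and two more absorb the error made in
    replacing e^(-ty) by a power of the Cayley transform. The estimate must then reach A^(-al),
    which is not a product of resolvents; smooth weights whose Laplace transforms are such products
    bridge the gap, and their number, of order 1/h, is compensated by a normalization of order h.
    The condition on n enters as a <= 2n + 2, where 2n + 2 is the order at 0 of r_n - exp. *)

Section Nrm.
Context {R : realType}.
Implicit Type V : normedModType R[i].

Lemma nrmE (V : normedZmodType R[i]) (x : V) : `|x| = (nrm x)%:C.
Proof. by rewrite /nrm RRe_real// normr_real. Qed.

Lemma nrm_ge0 (V : normedZmodType R[i]) (x : V) : 0 <= nrm x.
Proof. by rewrite -(@lecR R) -nrmE; exact: normr_ge0. Qed.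

Lemma nrm0 (V : normedZmodType R[i]) : nrm (0 : V) = 0.
Proof. by rewrite /nrm normr0. Qed.

Lemma nrm_eq0 (V : normedZmodType R[i]) (x : V) : (nrm x == 0) = (x == 0).
Proof. by rewrite -(normr_eq0 x) nrmE eq_complex /= eqxx andbT. Qed.

Lemma nrmN (V : normedZmodType R[i]) (x : V) : nrm (- x) = nrm x.
Proof. by rewrite /nrm normrN. Qed.

Lemma nrm_dist (V : normedZmodType R[i]) (x y : V) : nrm (x - y) = nrm (y - x).
Proof. by rewrite -nrmN opprB. Qed.

Lemma nrmD (V : normedZmodType R[i]) (x y : V) : nrm (x + y) <= nrm x + nrm y.
Proof. by rewrite -(@lecR R) -nrmE rmorphD/= -!nrmE ler_normD. Qed.

Lemma nrmB (V : normedZmodType R[i]) (x y : V) : nrm (x - y) <= nrm x + nrm y.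
Proof. by rewrite (le_trans (nrmD _ _))// nrmN. Qed.

Lemma nrm_triangle (V : normedZmodType R[i]) (y x z : V) :
  nrm (x - z) <= nrm (x - y) + nrm (y - z).
Proof. by rewrite (le_trans _ (nrmD _ _))// addrA subrK. Qed.

Lemma nrm_sum (V : normedZmodType R[i]) (I : Type) (r : seq I) (Q : pred I)
    (F : I -> V) :
  nrm (\sum_(i <- r | Q i) F i) <= \sum_(i <- r | Q i) nrm (F i).
Proof.
elim/big_ind2 : _ => [|x a y b xa yb|//]; first by rewrite nrm0.
by rewrite (le_trans (nrmD _ _))// lerD.
Qed.

Lemma nrmZ V (c : R[i]) (x : V) : nrm (c *: x) = nrm c * nrm x.
Proof.
by apply: (@complexI R); rewrite rmorphM/= -!nrmE normrZ.
Qed.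

Lemma nrm_real (r : R) : nrm (r%:C : R[i]) = `|r|.
Proof.
apply: (@complexI R); rewrite -nrmE normc_def /= expr0n /= addr0.
by rewrite sqrtr_sqr.
Qed.

Lemma nrmM (a b : R[i]) : nrm (a * b) = nrm a * nrm b.
Proof. by apply: (@complexI R); rewrite rmorphM/= -!nrmE normrM. Qed.

Lemma nrmX (a : R[i]) n : nrm (a ^+ n) = nrm a ^+ n.
Proof. by apply: (@complexI R); rewrite rmorphXn/= -!nrmE normrX. Qed.

Lemma nrmV (a : R[i]) : nrm (a^-1) = (nrm a)^-1.
Proof. by apply: (@complexI R); rewrite fmorphV/= -!nrmE normfV. Qed.

Lemma nrm1 : nrm (1 : R[i]) = 1.
Proof. by apply: (@complexI R); rewrite -nrmE normr1. Qed.

Lemma nrmZr V (r : R) (x : V) : nrm (r%:C *: x) = `|r| * nrm x.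
Proof. by rewrite nrmZ nrm_real. Qed.

Lemma ler_nrm_dist (V : normedZmodType R[i]) (x y : V) : `|nrm x - nrm y| <= nrm (x - y).
Proof.
rewrite ler_norml lerBrDr lerBlDr; apply/andP; split; last first.
  by rewrite (le_trans _ (nrmD _ _))// subrK.
rewrite addrC lerBlDr nrm_dist addrC; by rewrite (le_trans _ (nrmD _ _))// subrK.
Qed.

Lemma nrm_sqr (z : R[i]) : nrm z ^+ 2 = complex.Re z ^+ 2 + complex.Im z ^+ 2.
Proof. by apply: (@complexI R); rewrite rmorphXn/= -nrmE -add_Re2_Im2. Qed.
End Nrm.

(** * Gaussian sums and circulant operators *)

Section Measure.
Import HBNNSimple.
Local Open Scope ereal_scope.

(** Monotone convergence along simple functions reduces the formula to indicators, where it is the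
    hypothesis on [nu]. *)
Lemma ge0_integral_density (d : measure_display) (T : measurableType d)
    (R : realType) (mu nu : {measure set T -> \bar R}) (g : T -> R)
    (f : T -> \bar R) :
  measurable_fun setT g -> (forall x, (0 <= g x)%R) ->
  (forall B, measurable B -> nu B = \int[mu]_(x in B) (g x)%:E) ->
  measurable_fun setT f -> (forall x, 0 <= f x) ->
  \int[nu]_x f x = \int[mu]_x (f x * (g x)%:E).
Proof.
move=> mg g0 nuE mf f0.
pose h := nnsfun_approx measurableT mf.
have fE x : f x = lim ((EFin \o h n) x @[n --> \oo]).
  by apply/esym/cvg_lim => //; apply: cvg_nnsfun_approx.
transitivity (lim (\int[nu]_x (EFin \o h n) x @[n --> \oo])).
  under eq_integral => x _ do rewrite fE.
  apply: monotone_convergence => //.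
  - by move=> n; apply/measurable_EFinP.
  - by move=> n x _ /=; rewrite lee_fin.
  - by move=> x _ a b ab /=; rewrite lee_fin; exact/lefP/nd_nnsfun_approx.
transitivity (lim (\int[mu]_x ((h n x)%:E * (g x)%:E) @[n --> \oo])); last first.
  have fgE x : f x * (g x)%:E = lim ((h n x)%:E * (g x)%:E @[n --> \oo]).
    apply/esym/cvg_lim => //; apply: cvgeZr => //.
    by apply: cvg_nnsfun_approx.
  under [RHS]eq_integral => x _ do rewrite fgE.
  apply/esym; apply: monotone_convergence => //.
  - move=> n; apply: emeasurable_funM; first exact/measurable_EFinP.
    exact/measurable_EFinP.
  - by move=> n x _ /=; rewrite mule_ge0 // lee_fin.
  - move=> x _ a b ab /=; rewrite lee_wpmul2r ?lee_fin//.
    exact/lefP/nd_nnsfun_approx.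
suff suf n : \int[nu]_x (EFin \o h n) x = \int[mu]_x ((h n x)%:E * (g x)%:E).
  by under eq_fun do rewrite suf.
under eq_integral do rewrite /= fimfunE -fsumEFin//.
rewrite ge0_integral_fsum//; last 2 first.
- by move=> y; exact/measurable_EFinP/measurable_funM.
- by move=> y x _; rewrite nnfun_muleindic_ge0.
transitivity (\sum_(k \in range (h n)) \int[mu]_x ((k * \1_(h n @^-1` [set k]) x)%:E * (g x)%:E)).
  apply: eq_fsbigr => r _.
  rewrite integralZl_indic_nnsfun// integral_indic//= setIT nuE//.
  under [RHS]eq_integral => x _ do rewrite -EFinM -mulrA EFinM.
  (* A negative value is not attained by the nonnegative function [h n], so both sides vanish. *)
  have [r0|r0] := leP 0%R r; last first.
    rewrite preimage_nnfun0// integral_set0 mule0.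
    by under eq_integral do rewrite indic0 mul0r mule0; rewrite integral0.
  rewrite ge0_integralZl_EFin//; last 2 first.
  - by move=> x _; rewrite lee_fin mulr_ge0.
  - by apply/measurable_EFinP/measurable_funM.
  congr (_ * _); rewrite integral_mkcond; apply: eq_integral => x _.
  rewrite patchE indicE; by case: ifPn => _ /=; rewrite ?mul1r ?mul0r.
rewrite -ge0_integral_fsum//; last 2 first.
- move=> y; apply: emeasurable_funM; last exact/measurable_EFinP.
  exact/measurable_EFinP/measurable_funM.
- move=> y x _; rewrite mule_ge0// ?lee_fin// ?nnfun_muleindic_ge0//.
  exact: nnfun_muleindic_ge0.
apply: eq_integral => x _.
rewrite fimfunE -fsumEFin// ge0_mule_fsuml//.
by move=> y; rewrite nnfun_muleindic_ge0.
Qed.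

(** Lebesgue measure is determined by its values on the intervals ]u, v], and the translated measure
    has the same values there. *)
Lemma ge0_integral_translation (R : realType) (f : R -> \bar R) (a : R) :
  measurable_fun setT f -> (forall x, 0 <= f x) ->
  \int[lebesgue_measure]_x f (x + a)%R = \int[lebesgue_measure]_x f x.
Proof.
move=> mf f0.
have mphi : measurable_fun setT ((fun x => (x + a)%R) : measurableTypeR R -> measurableTypeR R).
  exact: measurable_funD.
transitivity (\int[pushforward (@lebesgue_measure R) ((fun x => (x + a)%R) : measurableTypeR R -> measurableTypeR R)]_x f x).
  by rewrite ge0_integral_pushforward.
apply: eq_measure_integral => A mA _.
apply/esym; apply: lebesgue_measure_unique => //= _ [[u v]] _ <-.
rewrite /pushforward /=.
have -> : ((fun x : R => (x + a)%R) @^-1` `]u, v]%classic) = `](u - a)%R, (v - a)%R]%classic.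
  apply/seteqP; split => x /=; rewrite !in_itv /= => /andP[? ?]; apply/andP; split; lra.
rewrite !lebesgue_measure_itv/= !lte_fin.
have -> : (u - a < v - a)%R = (u < v)%R by rewrite ltrD2r.
case: ifP => // _; rewrite -!EFinB; congr _%:E; ring.
Qed.
End Measure.

(** * Rotation invariance of the planar Gaussian law *)

Section Rotation.
Local Open Scope ereal_scope.
Context {R : realType}.
Local Notation leb := (@lebesgue_measure R).
Local Notation mR := (measurableTypeR R).

Lemma ge0_integral_shear1 (W : mR * mR -> \bar R) (a : R) :
  measurable_fun setT W -> (forall z, 0 <= W z) ->
  \int[leb]_x \int[leb]_y W (x + a * y, y)%R = \int[leb]_x \int[leb]_y W (x, y).
Proof.
move=> mW W0.
have mW2 : measurable_fun setT (fun z : mR * mR => W (z.1 + a * z.2, z.2)%R).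
  apply: (measurableT_comp (f := W) mW); apply: measurable_fun_pair => //=.
  by apply: measurable_funD => //; apply: measurable_funM.
rewrite (fubini_tonelli _ mW2 (fun z => W0 _))/= (fubini_tonelli _ mW W0).
apply: eq_integral => y _ /=.
rewrite (ge0_integral_translation (f := fun x => W (x, y)))//.
exact: (measurableT_comp mW).
Qed.

Lemma ge0_integral_shear2 (W : mR * mR -> \bar R) (a : R) :
  measurable_fun setT W -> (forall z, 0 <= W z) ->
  \int[leb]_x \int[leb]_y W (x, y + a * x)%R = \int[leb]_x \int[leb]_y W (x, y).
Proof.
move=> mW W0; apply: eq_integral => x _ /=.
rewrite (ge0_integral_translation (f := fun y => W (x, y)))//.
exact: (measurableT_comp mW).
Qed.

(* A rotation with nonzero sine is a product of three shears. *)
Lemma ge0_integral_rotation (W : mR * mR -> \bar R) (c s : R) :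
  (c ^+ 2 + s ^+ 2 = 1)%R -> s != 0%R ->
  measurable_fun setT W -> (forall z, 0 <= W z) ->
  \int[leb]_x \int[leb]_y W (c * x - s * y, s * x + c * y)%R =
  \int[leb]_x \int[leb]_y W (x, y).
Proof.
move=> cs s0 mW W0.
(* Minus the tangent of half the angle: the shears by [a], [s] and [a] compose to the rotation. *)
pose a := ((c - 1) / s)%R.
have m1 (b : R) : measurable_fun setT (fun z : mR * mR => (z.1 + b * z.2, z.2)%R : mR * mR).
  apply: measurable_fun_pair => //=.
  by apply: measurable_funD => //; apply: measurable_funM.
have m2 (b : R) : measurable_fun setT (fun z : mR * mR => (z.1, z.2 + b * z.1)%R : mR * mR).
  apply: measurable_fun_pair => //=.
  by apply: measurable_funD => //; apply: measurable_funM.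
pose W1 (z : mR * mR) := W (z.1 + a * z.2, z.2)%R.
have mW1 : measurable_fun setT W1 := measurableT_comp mW (m1 a).
pose W2 (z : mR * mR) := W1 (z.1, z.2 + s * z.1)%R.
have mW2 : measurable_fun setT W2 := measurableT_comp mW1 (m2 s).
have as1 : (a * s = c - 1)%R by rewrite /a divfK.
have ac : (a * (1 + c) = - s)%R.
  apply: (mulIf s0); rewrite mulrAC as1.
  have -> : ((c - 1) * (1 + c) = c ^+ 2 - 1)%R by ring.
  by rewrite -cs; ring.
transitivity (\int[leb]_x \int[leb]_y W2 (x + a * y, y)%R); last first.
  rewrite (ge0_integral_shear1 a mW2 (fun z => W0 _)).
  by rewrite (ge0_integral_shear2 s mW1 (fun z => W0 _)) (ge0_integral_shear1 a mW W0).
apply: eq_integral => x _; apply: eq_integral => y _.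
rewrite /W2 /W1 /=; congr (W (_, _)).
- have -> : (x + a * y + a * (y + s * (x + a * y)) =
    (1 + a * s) * x + (a * (1 + (1 + a * s))) * y)%R by ring.
  have -> : (1 + a * s = c)%R by rewrite as1; ring.
  by rewrite ac mulNr.
- have -> : (y + s * (x + a * y) = s * x + (1 + a * s) * y)%R by ring.
  by have -> : (1 + a * s = c)%R by rewrite as1; ring.
Qed.

(** The product of the two densities depends on x^2 + y^2 alone, so it can be moved inside the
    rotated integrand and Lebesgue invariance applies. *)
Lemma ge0_integral_normal_rotation (sigma : R) (F : mR * mR -> \bar R) (c s : R) :
  sigma != 0%R -> (c ^+ 2 + s ^+ 2 = 1)%R -> s != 0%R ->
  measurable_fun setT F -> (forall z, 0 <= F z) ->
  \int[normal_prob 0 sigma]_x \int[normal_prob 0 sigma]_y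
      F (c * x - s * y, s * x + c * y)%R =
  \int[normal_prob 0 sigma]_x \int[normal_prob 0 sigma]_y F (x, y).
Proof.
move=> sig0 cs s0 mF F0.
pose g := normal_pdf 0 sigma.
pose W (z : mR * mR) := F z * ((g z.1)%:E * (g z.2)%:E).
have mg : measurable_fun setT g := measurable_normal_pdf 0 sigma.
have g0 x : (0 <= g x)%R by exact: normal_pdf_ge0.
have key (G : mR * mR -> \bar R) : measurable_fun setT G -> (forall z, 0 <= G z) ->
    \int[normal_prob 0 sigma]_x \int[normal_prob 0 sigma]_y G (x, y) =
    \int[leb]_x \int[leb]_y (G (x, y) * ((g x)%:E * (g y)%:E)).
  move=> mG G0.
  have E x : \int[normal_prob 0 sigma]_y G (x, y) = \int[leb]_y (G (x, y) * (g y)%:E).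
    apply: ge0_integral_density => //; exact: (measurableT_comp mG).
  rewrite (ge0_integral_density (mu := leb) (g := g))//; last 2 first.
  - exact: (measurable_fun_fubini_tonelli_F (m2 := normal_prob 0 sigma)).
  - by move=> x; exact: integral_ge0.
  apply: eq_integral => x _; rewrite E muleC -ge0_integralZl_EFin//.
  - by apply: eq_integral => y _; rewrite muleCA.
  - by move=> y _; rewrite mule_ge0// lee_fin.
  - apply: emeasurable_funM; last exact/measurable_EFinP.
    exact: (measurableT_comp mG).
have mrot : measurable_fun setT (fun z : mR * mR => (c * z.1 - s * z.2, s * z.1 + c * z.2)%R : mR * mR).
  apply: measurable_fun_pair => //=.
    by apply: measurable_funB => //; apply: measurable_funM.
  by apply: measurable_funD => //; apply: measurable_funM.
transitivity (\int[leb]_x \int[leb]_y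
    (F (c * x - s * y, s * x + c * y)%R * ((g x)%:E * (g y)%:E))).
  exact: (key _ (measurableT_comp mF mrot) (fun z => F0 _)).
rewrite (key _ mF F0).
have mW : measurable_fun setT W.
  apply: emeasurable_funM => //; apply: emeasurable_funM; apply/measurable_EFinP.
    exact: (measurableT_comp mg).
  exact: (measurableT_comp mg).
have W0 z : 0 <= W z by rewrite /W !mule_ge0// lee_fin.
transitivity (\int[leb]_x \int[leb]_y W (c * x - s * y, s * x + c * y)%R); last first.
  exact: (ge0_integral_rotation cs s0 mW W0).
apply: eq_integral => x _; apply: eq_integral => y _.
rewrite /W /=; congr (_ * _); rewrite -!EFinM; congr _%:E.
rewrite /g normal_pdfE// /normal_fun.
rewrite mulrACA [RHS]mulrACA -!expRD; congr (_ * expR _)%R.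
rewrite !subr0 -!mulrDl -!opprD; congr (- _ / _)%R.
have -> : ((c * x - s * y) ^+ 2 + (s * x + c * y) ^+ 2 = (c ^+ 2 + s ^+ 2) * (x ^+ 2 + y ^+ 2))%R by ring.
by rewrite cs mul1r.
Qed.
End Rotation.

(** * Measurability of norms of random sums *)

Section NrmMeasurable.
Context {R : realType} (X : completeNormedModType R[i]).

(** [X] carries no measurable structure and may be nonseparable, so only the norm is treated, one
    random coefficient at a time. The norm is Lipschitz in the coefficient of [c j]: it is below [a]
    exactly when, for some rational b, its value with b in place of [f j w], increased by the error
    |f j w - b| nrm (c j), is below [a]. The vector [v] collects the coefficients already frozen. *)
Lemma measurable_nrm_sum (d : measure_display) (W : measurableType d) (I : Type)
    (r : seq I) (f : I -> W -> R) (c : I -> X) (v : X) :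
  (forall i, measurable_fun setT (f i)) ->
  measurable_fun setT (fun w => nrm (v + \sum_(i <- r) (f i w)%:C *: c i)).
Proof.
move=> mf; elim: r v => [|j r IH] v.
  by under eq_fun do rewrite big_nil; exact: measurable_cst.
move=> _; apply: (measurability _ (RGenInftyO.measurableE R)) => //.
move=> _ [_ [a ->] <-]; rewrite setTI.
pose h (b : rat) w : R := nrm (v + (ratr b : R)%:C *: c j + \sum_(i <- r) (f i w)%:C *: c i) + `|f j w - ratr b| * nrm (c j).
have mh b : measurable_fun setT (h b).
  apply: measurable_funD; first exact: IH.
  apply: measurable_funM => //; apply: measurableT_comp => //.
  exact: measurable_funB.
rewrite [X in measurable X](_ : _ = \bigcup_(b : rat) (h b @^-1` `]-oo, a[%classic)); last first.
  apply/seteqP; split => w /=; rewrite in_itv /= big_cons; last first.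
    move=> [b _]; rewrite /= in_itv /=; apply: le_lt_trans.
    rewrite /h -nrmZr (le_trans _ (nrmD _ _))// le_eqVlt; apply/orP; left; apply/eqP.
    congr nrm; rewrite rmorphB/= scalerBl addrACA -!addrA; congr (_ + _).
    by rewrite [RHS]addrCA; congr (_ + _); rewrite [RHS]addrC subrK.
  move=> lta.
  set u := nrm _ in lta.
  (* The error occurs twice, once in passing to the rational coefficient and once in [h]; hence the
     factor 2. *)
  pose e := (a - u) / (2 * (nrm (c j) + 1)).
  have c1 : 0 < nrm (c j) + 1 by rewrite ltr_pwDr// nrm_ge0.
  have e0 : 0 < e by rewrite divr_gt0 ?subr_gt0// mulr_gt0.
  have [b] : exists b : rat, ratr b \in `]f j w - e, f j w + e[ by apply: rat_in_itvoo; lra.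
  rewrite in_itv /= => /andP[b1 b2].
  exists b => //=; rewrite in_itv /= /h.
  have bd : `|f j w - ratr b| * nrm (c j) <= e * nrm (c j).
    apply: ler_wpM2r; first exact: nrm_ge0.
    by rewrite ler_norml; lra.
  have : e * nrm (c j) < (a - u) / 2.
    rewrite /e invfM mulrA -mulrA gtr_pMr ?divr_gt0 ?subr_gt0//.
    by rewrite mulrC ltr_pdivrMr// mul1r ltrDl.
  suff : nrm (v + (ratr b : R)%:C *: c j + \sum_(i <- r) (f i w)%:C *: c i) <= u + `|f j w - ratr b| * nrm (c j).
    by lra.
  rewrite distrC -nrmZr (le_trans _ (nrmD _ _))// le_eqVlt; apply/orP; left; apply/eqP.
  congr nrm; rewrite rmorphB/= scalerBl -!addrA; congr (_ + _).
  by rewrite [RHS]addrC -addrA subrK addrC.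
apply: countable_bigcupT_measurable => // b.
rewrite -[X in measurable X]setTI; exact: mh.
Qed.
End NrmMeasurable.

(** * Independence and joint laws of Gaussian coordinates *)

Section Independence.
Local Open Scope ereal_scope.

(** Dynkin's pi-lambda theorem: the sets obeying the product formula are stable under complements
    and disjoint countable unions. *)
Lemma independent_dynkin (d d' : measure_display) (Om : measurableType d)
    (W : measurableType d') (R : realType) (P : probability Om R)
    (Phi : Om -> W) (G : set (set W)) (E : set Om) :
  d'.-measurable = <<s G >> -> setI_closed G ->
  measurable_fun setT Phi -> measurable E ->
  (forall C, G C -> P (E `&` Phi @^-1` C) = P E * P (Phi @^-1` C)) ->
  forall C, measurable C -> P (E `&` Phi @^-1` C) = P E * P (Phi @^-1` C).
Proof.
move=> GE GI mPhi mE PG C mC.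
have mp (S : set W) : measurable S -> measurable (Phi @^-1` S).
  by move=> mS; rewrite -[X in measurable X]setTI; exact: mPhi.
have : <<s G >> C by rewrite -GE.
apply: (dynkin_induction (P := fun C => P (E `&` Phi @^-1` C) = P E * P (Phi @^-1` C)) GE GI) => //.
- by rewrite preimage_setT setIT probability_setT mule1.
- move=> S mS PS.
  have -> : E `&` Phi @^-1` (~` S) = E `\` (Phi @^-1` S) by [].
  have -> : Phi @^-1` (~` S) = ~` (Phi @^-1` S) by [].
  have fE : P E \is a fin_num by exact: fin_num_measure.
  have fS : P (Phi @^-1` S) \is a fin_num by apply: fin_num_measure; exact: mp.
  rewrite measureD//; [|exact: mp|by rewrite ltey_eq fE].
  transitivity (P E - P E * P (Phi @^-1` S)); first by congr (_ - _); exact: PS.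
  rewrite (probability_setC P (mp _ mS)) muleBr// ?mule1//.
- move=> F mF tF PF.
  rewrite preimage_bigcup setI_bigcupr.
  have tF' : trivIset [set: nat] (fun n => Phi @^-1` F n).
    by apply/trivIsetP => a b _ _ ab; rewrite -preimage_setI; move/trivIsetP : tF => ->.
  have mF' n : measurable (Phi @^-1` F n) by apply: mp.
  rewrite (measure_semi_bigcup _ mF' tF'); last exact: bigcup_measurable.
  have tF2 : trivIset [set: nat] (fun n => E `&` Phi @^-1` F n) by exact: trivIset_setIl.
  rewrite (measure_semi_bigcup _ (fun n => measurableI _ _ mE (mF' n)) tF2); last first.
    by apply: bigcup_measurable => n _; exact: measurableI.
  have fE : P E \is a fin_num by exact: fin_num_measure.
  rewrite -(fineK fE) -nneseriesZl//.
  by apply: eq_eseriesr => n _; rewrite fineK//; exact: PF.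
Qed.
End Independence.

Section GaussianLaw.
Local Open Scope ereal_scope.
Context {R : realType} {d : measure_display} {Omega : measurableType d}
  {P : probability Omega R} {gam : nat -> Omega -> R[i]}
  (gamP : gaussian_sequence P gam) (X : completeNormedModType R[i]).
Local Notation mR := (measurableTypeR R).
Local Notation N := (normal_prob (0 : R) (Num.sqrt 2)^-1).

Section Pair.
Variables (i1 i2 : nat * bool) (s : seq (nat * bool)).
Hypothesis us : uniq [:: i1, i2 & s].

(** The pi-system of the variables indexed by [s]. [OmG] is [Omega] with the sigma-algebra it
    generates, so that the sample point itself carries all the remaining variables and no product of
    copies of the real line is needed. *)
Definition rest_events : set (set Omega) :=
  [set E | exists2 B : nat * bool -> set R, (forall i, measurable (B i)) &
     E = \bigcap_(i in [set` s]) (part gam i @^-1` B i)].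
Local Notation OmG := (g_sigma_algebraType rest_events).

Let mpart i : measurable_fun setT (part gam i : Omega -> mR).
Proof. by case: gamP => + _ _; exact. Qed.

Let mpre i (B : set R) : measurable B -> measurable (part gam i @^-1` B).
Proof. by move=> mB; rewrite -[X in measurable X]setTI; exact: mpart. Qed.

Lemma rest_events_setI : setI_closed rest_events.
Proof.
move=> _ _ [B mB ->] [C mC ->]; exists (fun i => B i `&` C i).
  by move=> i; exact: measurableI.
by rewrite -bigcapI; apply: eq_bigcapr => i _; rewrite preimage_setI.
Qed.

Lemma measurable_rest_events E : rest_events E -> measurable E.
Proof.
move=> [B mB ->]; apply: fin_bigcap_measurable => // i _; exact: mpre.
Qed.

Lemma measurable_id_rest : measurable_fun setT (idfun : Omega -> OmG).
Proof.
move=> _; apply: (measurability (aT := Omega) (rT := OmG) rest_events) => // _ [E rE <-].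
by rewrite setTI; exact: measurable_rest_events.
Qed.

Lemma gaussian_events (A1 A2 : set mR) (E : set Omega) :
  measurable A1 -> measurable A2 -> rest_events E ->
  P (part gam i1 @^-1` A1 `&` (part gam i2 @^-1` A2 `&` E)) = N A1 * (N A2 * P E).
Proof.
move=> m1 m2 [B mB ->]; case: gamP => _ law indep.
pose B' i := if i == i1 then A1 else if i == i2 then A2 else B i.
have mB' i : measurable (B' i) 
  by rewrite /B'; case: ifP => _; [exact: m1|case: ifP => _; [exact: m2|exact: mB]].
have /andP[/[1!inE] /norP[i12 i1s] /andP[i2s us']] := us.
have BE i : i \in s -> B' i = B i.
  move=> si; rewrite /B'; case: eqP => [ei|_]; first by rewrite -ei si in i1s.
  by case: eqP => // ei; rewrite -ei si in i2s.
have B1 : B' i1 = A1 by rewrite /B' eqxx.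
have B2 : B' i2 = A2 by rewrite /B' eqxx eq_sym (negbTE i12).
have Bs : \bigcap_(i in [set` s]) (part gam i @^-1` B' i) =
    \bigcap_(i in [set` s]) (part gam i @^-1` B i).
  by apply: eq_bigcapr => i /= si; rewrite BE.
have := indep _ B' us mB'; rewrite 2!big_cons B1 B2 law// law// => E1.
have := indep _ B' us' mB'; rewrite Bs => ->; rewrite -E1.
congr (P _); apply/seteqP; split => w.
  move=> [w1 [w2 ws]] i /=; rewrite !inE => /orP[/eqP->|/orP[/eqP->|si]].
  - by rewrite B1.
  - by rewrite B2.
  - by rewrite BE//; exact: ws.
move=> ws; split; first by have := ws i1; rewrite /= inE eqxx B1; exact.
split; first by have := ws i2; rewrite /= !inE eqxx orbT B2; exact.
by rewrite -Bs => i /= si; apply: ws; rewrite /= !inE si !orbT.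
Qed.

Let XG : {mfun Omega >-> OmG} := HB.pack (idfun : Omega -> OmG)
  (isMeasurableFun.Build _ _ _ _ _ measurable_id_rest).
Let P1 := distribution P XG.

Let mX2 : measurable_fun setT (fun w => (part gam i2 w, w) : mR * OmG).
Proof. by apply: measurable_fun_pair; [exact: mpart|exact: measurable_id_rest]. Qed.
Let X2 : {mfun Omega >-> (mR * OmG)%type} := HB.pack (fun w => (part gam i2 w, w) : mR * OmG)
  (isMeasurableFun.Build _ _ _ _ _ mX2).
Let P2 := distribution P X2.

Let mX3 : measurable_fun setT (fun w => (part gam i1 w, (part gam i2 w, w)) : mR * (mR * OmG)).
Proof. by apply: measurable_fun_pair; [exact: mpart|exact: mX2]. Qed.
Let X3 : {mfun Omega >-> (mR * (mR * OmG))%type} := HB.pack (fun w => (part gam i1 w, (part gam i2 w, w)) : mR * (mR * OmG))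
  (isMeasurableFun.Build _ _ _ _ _ mX3).
Let P3 := distribution P X3.

Let rest_eventsT : rest_events setT.
Proof.
exists (fun=> setT) => //; apply/esym; rewrite -subTset => w _ i _ //.
Qed.

Let law1 (A : set mR) : measurable A -> P (part gam i1 @^-1` A) = N A.
Proof. by move=> mA; case: gamP => _ + _; exact. Qed.
Let law2 (A : set mR) : measurable A -> P (part gam i2 @^-1` A) = N A.
Proof. by move=> mA; case: gamP => _ + _; exact. Qed.

Let indep2 (A : set mR) (E : set OmG) : measurable A -> measurable E ->
  P (part gam i2 @^-1` A `&` E) = N A * P E.
Proof.
move=> mA mE; rewrite -(law2 mA).
suff PG (C : set Omega) : rest_events C ->
    P (part gam i2 @^-1` A `&` C) = P (part gam i2 @^-1` A) * P C.
  exact: (@independent_dynkin _ _ Omega OmG R P idfun rest_events _ erefl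
    rest_events_setI measurable_id_rest (mpre _ mA) PG E mE).

move=> GC; rewrite law2//.
  have := gaussian_events measurableT mA GC.
  by rewrite preimage_setT setTI probability_setT mul1e.
Qed.

Let indep12 (A1 A2 : set mR) (E : set OmG) :
  measurable A1 -> measurable A2 -> measurable E ->
  P (part gam i1 @^-1` A1 `&` (part gam i2 @^-1` A2 `&` E)) = N A1 * (N A2 * P E).
Proof.
move=> m1 m2 mE; rewrite setIA muleA.
have <- : P (part gam i1 @^-1` A1 `&` part gam i2 @^-1` A2) = N A1 * N A2.
  have := gaussian_events m1 m2 rest_eventsT.
  by rewrite setIT probability_setT mule1.
suff PG (C : set Omega) : rest_events C ->
    P (part gam i1 @^-1` A1 `&` part gam i2 @^-1` A2 `&` C) =
    P (part gam i1 @^-1` A1 `&` part gam i2 @^-1` A2) * P C.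
  exact: (@independent_dynkin _ _ Omega OmG R P idfun rest_events _ erefl
    rest_events_setI measurable_id_rest (measurableI _ _ (mpre _ m1) (mpre _ m2)) PG E mE).
move=> GC; rewrite -setIA gaussian_events// muleA.
  have := gaussian_events m1 m2 rest_eventsT.
  by rewrite setIT probability_setT mule1 => ->.
Qed.

(** Independence makes the joint law agree with the product measure on rectangles, and this
    determines the product measure. The same argument gives [P3E]. *)
Let P2E (C : set (mR * OmG)) : measurable C -> (N \x P1) C = P2 C.
Proof.
move=> mC; apply: product_measure_unique => // A E mA mE; exact: indep2.
Qed.

Let P3E (C : set (mR * (mR * OmG))) : measurable C -> (N \x P2) C = P3 C.
Proof.
move=> mC; apply: product_measure_unique => // A E mA mE.
transitivity (P (part gam i1 @^-1` A `&` (fun w => (part gam i2 w, w) : mR * OmG) @^-1` E)) => //.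
transitivity (N A * P2 E); last by [].
rewrite -(law1 mA).
apply: (independent_dynkin (W := (mR * OmG)%type) (G := [set A `*` B | A in measurable & B in measurable])) => //.
- exact: measurable_prod_measurableType.
- move=> _ _ [A1 mA1 [E1 mE1 <-]] [A2 mA2 [E2 mE2 <-]].
  exists (A1 `&` A2); first exact: measurableI.
  exists (E1 `&` E2); first exact: measurableI.
  by rewrite setXI.
- exact: mpre.
- move=> _ [A2 mA2 [E2 mE2 <-]].
  transitivity (P (part gam i1 @^-1` A `&` (part gam i2 @^-1` A2 `&` E2))) => //.
  by rewrite indep12// -indep2// law1.
Qed.

Lemma gaussian_pair_law (F : mR * (mR * OmG) -> \bar R) :
  measurable_fun setT F -> (forall z, 0 <= F z) ->
  \int[P]_w F (part gam i1 w, (part gam i2 w, w)) =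
  \int[N]_x \int[N]_y \int[P1]_w F (x, (y, w)).
Proof.
move=> mF F0.
transitivity (\int[P3]_z F z).
  rewrite /P3 /distribution ge0_integral_pushforward//.
transitivity (\int[N \x P2]_z F z).
  by apply: eq_measure_integral => A mA _; exact/esym/P3E.
rewrite fubini_tonelli1//; apply: eq_integral => x _.
rewrite /fubini_F; transitivity (\int[N \x P1]_z F (x, z)).
  by apply: eq_measure_integral => A mA _; exact/esym/P2E.
rewrite (fubini_tonelli1 (fun z => F (x, z)))//.
exact: (measurableT_comp mF).
Qed.

Lemma measurable_part_rest i : i \in s -> measurable_fun setT (part gam i : OmG -> mR).
Proof.
move=> si _ B mB; rewrite setTI; apply: sub_sigma_algebra.
exists (fun j => if j == i then B else setT); first by move=> j; case: ifP.
apply/seteqP; split => [w wB j /= _|w /(_ i si)]; last by rewrite eqxx.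
by case: eqP => // ->.
Qed.

Definition gauss_energy (r : seq (nat * bool)) (c : nat * bool -> X) : \bar R :=
  \int[P]_w ((nrm (\sum_(i <- r) (part gam i w)%:C *: c i)%R ^+ 2)%R)%:E.

(** Recombining two coefficient vectors by a matrix is the same as applying the transposed matrix to
    the two variables. If that leaves the product of the two normal laws invariant, the energy does
    not change. *)
Lemma gauss_energy_pair (a11 a12 a21 a22 : R) (c c' : nat * bool -> X) :
  (forall H : mR * mR -> \bar R, measurable_fun setT H -> (forall z, 0 <= H z) ->
    \int[N]_x \int[N]_y H (a11 * x + a12 * y, a21 * x + a22 * y)%R =
    \int[N]_x \int[N]_y H (x, y)) ->
  c' i1 = (a11%:C *: c i1 + a21%:C *: c i2)%R ->
  c' i2 = (a12%:C *: c i1 + a22%:C *: c i2)%R ->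
  (forall i, i \in s -> c' i = c i) ->
  gauss_energy [:: i1, i2 & s] c' = gauss_energy [:: i1, i2 & s] c.
Proof.
move=> HN c1 c2 cs.
have /andP[/[1!inE] /norP[i12 i1s] /andP[i2s us']] := us.
(* For an index outside [s] the variable is not measurable on [OmG]; the default 0 keeps [f i]
   measurable for every index and does not affect the sum. *)
pose f (i : nat * bool) (z : mR * (mR * OmG)) : R :=
  if i == i1 then z.1 else if i == i2 then z.2.1 else
  if i \in s then part gam i z.2.2 else 0%R.
have mf i : measurable_fun setT (f i : _ -> mR).
  rewrite /f; case: (i == i1); first exact: measurable_fst.
  case: (i == i2).
    exact: (measurableT_comp (f := fst) measurable_fst measurable_snd).
  case si : (i \in s); last exact: measurable_cst.
  apply: (measurableT_comp (measurable_part_rest si)).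
  exact: (measurableT_comp (f := snd) measurable_snd measurable_snd).
pose F (e : nat * bool -> X) z : \bar R :=
  ((nrm (0 + \sum_(i <- [:: i1, i2 & s]) (f i z)%:C *: e i)%R ^+ 2)%R)%:E.
have mF e : measurable_fun setT (F e).
  apply/measurable_EFinP; apply: measurable_funX; exact: measurable_nrm_sum.
have F0 e z : 0 <= F e z by rewrite lee_fin exprn_ge0// nrm_ge0.
have GF e : gauss_energy [:: i1, i2 & s] e =
    \int[N]_x \int[N]_y \int[P1]_w F e (x, (y, w)).
  rewrite -gaussian_pair_law//; apply: eq_integral => w _.
  rewrite /F add0r; congr ((nrm _ ^+ 2)%R%:E); apply: eq_big_seq => i ir.
  congr ((_%:C)%C *: _)%R; rewrite /f /=; case: eqP => [-> //|/eqP n1].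
  case: eqP => [-> //|/eqP n2]; move: ir.
  by rewrite !inE (negbTE n1) (negbTE n2) /= => ->.
pose H (z : mR * mR) := \int[P1]_w F c (z.1, (z.2, w)).
have mH : measurable_fun setT H.
  apply: (measurable_fun_fubini_tonelli_F (m2 := P1) (fun z : (mR * mR) * OmG => F c (z.1.1, (z.1.2, z.2)))) => //.
  apply: (measurableT_comp (mF c)); apply: measurable_fun_pair => /=.
    exact: (measurableT_comp (f := fst) measurable_fst measurable_fst).
  apply: measurable_fun_pair => //=.
  exact: (measurableT_comp (f := snd) measurable_snd measurable_fst).
have H0 z : 0 <= H z by exact: integral_ge0.
rewrite !GF -[RHS](HN H mH H0).
apply: eq_integral => x _; apply: eq_integral => y _.
rewrite /H; apply: eq_integral => w _; rewrite /F !add0r.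
congr ((nrm _ ^+ 2)%R%:E); rewrite !big_cons.
have i21 : (i2 == i1) = false by rewrite eq_sym (negbTE i12).
rewrite /f eqxx i21 eqxx /= c1 c2 !addrA; congr (_ + _)%R; last first.
  apply: eq_big_seq => i si; rewrite cs// si.
  case: eqP => [ei|_]; first by rewrite -ei si in i1s.
  by case: eqP => // ei; rewrite -ei si in i2s.
rewrite !rmorphD !rmorphM /= !scalerDl !scalerDr !scalerA.
by rewrite addrACA !(mulrC (x%:C)%C) !(mulrC (y%:C)%C).
Qed.
End Pair.
End GaussianLaw.

(** * Reduction of orthogonal matrices to rotations and sign flips *)

Section OrthogonalInvariance.
Context {R : realType} {V : lmodType R[i]} {I : finType} {T : Type}.
Implicit Types (O : I -> I -> R) (c : I -> V) (Phi : (I -> V) -> T).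

Definition plane_rotation (i j : I) (x y : R) c : I -> V := fun k =>
  if k == i then x%:C *: c i - y%:C *: c j
  else if k == j then y%:C *: c i + x%:C *: c j else c k.

Definition sign_flip (i : I) c : I -> V := fun k => if k == i then - c i else c k.

Definition mx_action O c : I -> V := fun i => \sum_j (O i j)%:C *: c j.

Definition orthogonal O := forall a b, \sum_i O i a * O i b = (a == b)%:R.

Definition fixed_column O b := [forall i, O i b == (i == b)%:R].

Let rotO (i j : I) (x y : R) O : I -> I -> R := fun k b =>
  if k == i then x * O i b - y * O j b
  else if k == j then y * O i b + x * O j b else O k b.

Let flipO (i : I) O : I -> I -> R := fun k b => if k == i then - O i b else O k b.

Let rotOE i j x y O c : plane_rotation i j x y (mx_action O c) = mx_action (rotO i j x y O) c.
Proof.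
apply/funext => k; rewrite /plane_rotation /mx_action /rotO.
case: ifP => _.
  rewrite !scaler_sumr -sumrB; apply: eq_bigr => b _.
  by rewrite !scalerA -scalerBl !rmorphB !rmorphM.
case: ifP => _ //.
rewrite !scaler_sumr -big_split; apply: eq_bigr => b _ /=.
by rewrite !scalerA -scalerDl !rmorphD !rmorphM.
Qed.

Let flipOE i O c : sign_flip i (mx_action O c) = mx_action (flipO i O) c.
Proof.
apply/funext => k; rewrite /sign_flip /mx_action /flipO.
case: ifP => _ //; rewrite -sumrN; apply: eq_bigr => b _.
by rewrite -scaleNr rmorphN.
Qed.

Let orthogonal_rot i j x y O : i != j -> x ^+ 2 + y ^+ 2 = 1 ->
  orthogonal O -> orthogonal (rotO i j x y O).
Proof.
move=> ij xy oO a b; rewrite -oO.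
have ji : j != i by rewrite eq_sym.
rewrite (bigD1 i)//= (bigD1 j)//= [RHS](bigD1 i)//= [in RHS](bigD1 j)//=.
rewrite !addrA; congr (_ + _).
  rewrite /rotO eqxx (negbTE ji) eqxx -[RHS]mul1r -xy; ring.
by apply: eq_bigr => k /andP[ki kj]; rewrite /rotO (negbTE ki) (negbTE kj).
Qed.

Let orthogonal_flip i O : orthogonal O -> orthogonal (flipO i O).
Proof.
move=> oO a b; rewrite -oO; apply: eq_bigr => k _; rewrite /flipO.
by case: eqP => [->|//]; rewrite mulrNN.
Qed.

(** Elimination by Givens rotations. The outer induction is on the number of columns that differ
    from those of the identity; the inner one, for a chosen column [b], is on the number of its
    nonzero entries off the diagonal. *)
Lemma orthogonal_invariance Phi :
  (forall i j x y c, i != j -> x ^+ 2 + y ^+ 2 = 1 -> y != 0 ->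
    Phi (plane_rotation i j x y c) = Phi c) ->
  (forall i c, Phi (sign_flip i c) = Phi c) ->
  forall O c, orthogonal O -> Phi (mx_action O c) = Phi c.
Proof.
move=> Hrot Hflip O c.
pose unfixed O := finset (fun b => ~~ fixed_column O b).
have [n] := ubnP #|unfixed O|; elim: n O => // n IHn O; rewrite ltnS => le_n oO.
have [U0|[b bU]] := finset.set_0Vmem (unfixed O).
  congr Phi; apply/funext => i; rewrite /mx_action (bigD1 i)//= big1 ?addr0.
    have : i \notin unfixed O by rewrite U0 inE.
    rewrite inE negbK => /forallP/(_ i)/eqP ->; rewrite eqxx.
    by rewrite scale1r.
  move=> j ji; have : j \notin unfixed O by rewrite U0 inE.
  rewrite inE negbK => /forallP/(_ i)/eqP ->.
  by rewrite eq_sym (negbTE ji) scale0r.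
(* [U] is detached from [O]: the inner induction changes the matrix and only keeps its unfixed
   columns inside [U]. *)
set U := unfixed O in bU le_n.
have sU : unfixed O \subset U by [].
clearbody U.
pose supp O := finset (fun i => (i != b) && (O i b != 0)).
have [m] := ubnP #|supp O|; elim: m O oO sU => // m IHm O oO sU; rewrite ltnS => le_m.
have fixU O' k : unfixed O' \subset U -> k \notin U -> forall i, O' i k = (i == k)%:R.
  move=> sU' kU i; apply/eqP.
  have : k \notin unfixed O' by apply: contra kU; move/fintype.subsetP: sU'; apply.
  by rewrite inE negbK => /forallP.
have [S0|[i iS]] := finset.set_0Vmem (supp O).
  have Oib i : i != b -> O i b = 0.
    move=> ib; apply/eqP; have : i \notin supp O by rewrite S0 inE.
    by rewrite inE ib /= negbK.
  have Obb : O b b ^+ 2 = 1.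
    have := oO b b; rewrite eqxx (bigD1 b)//= big1 ?addr0 -?expr2 // => i ib.
    by rewrite Oib// mul0r.
  have done' O' : orthogonal O' -> (forall i k, k != b -> i != b -> O' i k = O i k) ->
      (forall k, k \notin U -> O' b k = 0) -> (forall i, O' i b = (i == b)%:R) -> Phi (mx_action O' c) = Phi c.
    move=> oO' O'E O'b O'bb; apply: IHn => //.
    rewrite (leq_trans _ le_n)//; apply: fintype.proper_card; apply/fintype.properP; split; last first.
      exists b => //; rewrite inE negbK; apply/forallP => k; rewrite O'bb eqxx //.
    apply/fintype.subsetP => k; apply: contraLR => kU; rewrite inE negbK.
    have kb : k != b by apply: contraNneq kU => ->.
    apply/forallP => i; have [->|ib] := eqVneq i b; last by rewrite O'E// fixU.
    by rewrite O'b// [b == k]eq_sym (negbTE kb).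
  have Ob0 k : k \notin U -> O b k = 0.
    move=> kU; rewrite fixU//; have kb : k != b by apply: contraNneq kU => ->.
    by rewrite eq_sym (negbTE kb).
  (* A unit column with a single nonzero entry; the entry -1 is turned into 1 by a sign flip. *)
  have /orP[/eqP b1|/eqP b1] : (O b b == 1) || (O b b == -1).
    by rewrite -eqf_sqr Obb expr1n.
  - apply: done' => // i; have [->|ib] := eqVneq i b; first by rewrite b1.
    by rewrite Oib.
  - rewrite -(Hflip b) flipOE; apply: done'.
    + exact: orthogonal_flip.
    + by move=> i k _ ib; rewrite /flipO (negbTE ib).
    + by move=> k kU; rewrite /flipO eqxx Ob0// oppr0.
    + move=> i; rewrite /flipO; have [_|ib] := eqVneq i b; first by rewrite b1 opprK.
      by rewrite Oib.
move: iS; rewrite inE => /andP[ib Oib].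
have bi : b != i by rewrite eq_sym.
(* Otherwise column [i] is that of the identity, and orthogonality to column [b] forces [O i b] = 0.
   Hence the rotation in the rows [b] and [i] leaves the fixed columns alone. *)
have iU : i \in U.
  apply: contraNT Oib => iU; have := oO b i; rewrite (negbTE bi) (bigD1 i)//= big1.
    by rewrite addr0 (fixU O i)// eqxx mulr1 => ->.
  by move=> k ki; rewrite (fixU O i)// (negbTE ki) mulr0.
pose r := Num.sqrt (O b b ^+ 2 + O i b ^+ 2).
have s0 : 0 < O b b ^+ 2 + O i b ^+ 2.
  by rewrite ltr_pwDr ?sqr_ge0// lt_neqAle eq_sym sqrf_eq0 Oib sqr_ge0.
have r0 : r != 0 by rewrite gt_eqF// sqrtr_gt0.
have rr : r ^+ 2 = O b b ^+ 2 + O i b ^+ 2 by rewrite sqr_sqrtr// ltW.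
(* The rotation that annihilates the entry (i, b); its sine is nonzero because this entry is. *)
pose x := O b b / r; pose y := - O i b / r.
have xy : x ^+ 2 + y ^+ 2 = 1.
  by rewrite /x /y !exprMn sqrrN -mulrDl -rr exprVn divff// expf_neq0.
have y0 : y != 0 by rewrite mulf_neq0 ?oppr_eq0 ?invr_eq0.
rewrite -(Hrot b i x y _ bi xy y0) rotOE; apply: IHm.
- exact: orthogonal_rot.
- apply/fintype.subsetP => k; apply: contraLR => kU; rewrite inE negbK; apply/forallP => l.
  have kb : k != b by apply: contraNneq kU => ->.
  have ki : k != i by apply: contraNneq kU => ->.
  rewrite /rotO !(fixU O k)// [b == k]eq_sym [i == k]eq_sym (negbTE kb) (negbTE ki).
  have [->|lb] := eqVneq l b; first by rewrite [b == k]eq_sym (negbTE kb) !mulr0 subr0.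
  have [->|li] := eqVneq l i; first by rewrite [i == k]eq_sym (negbTE ki) !mulr0 addr0.
  exact: eqxx.
- rewrite (leq_trans _ le_m)//; apply: fintype.proper_card; apply/fintype.properP; split; last first.
    exists i; rewrite inE ib //= negbK /rotO (negbTE ib) eqxx /x /y.
    by apply/eqP; move: (r^-1) => z; ring.
  apply/fintype.subsetP => k; rewrite !inE => /andP[kb]; rewrite kb /rotO (negbTE kb).
  by have [->|_] := eqVneq k i; rewrite ?Oib.
Qed.
End OrthogonalInvariance.

Section NormalSymmetry.
Local Open Scope ereal_scope.
Context {R : realType}.
Local Notation leb := (@lebesgue_measure R).
Local Notation mR := (measurableTypeR R).

Lemma ge0_integral_opp (f : mR -> \bar R) :
  measurable_fun setT f -> (forall x, 0 <= f x) ->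
  \int[leb]_x f (- x)%R = \int[leb]_x f x.
Proof.
move=> mf f0.
transitivity (\int[pushforward leb (-%R : _ -> mR)]_x f x).
  by rewrite ge0_integral_pushforward.
by apply: eq_measure_integral => A mA _; exact: lebesgue_measureN.
Qed.

Lemma ge0_integral_normal_opp (sigma : R) (f : mR -> \bar R) :
  sigma != 0%R -> measurable_fun setT f -> (forall x, 0 <= f x) ->
  \int[normal_prob 0 sigma]_x f (- x)%R = \int[normal_prob 0 sigma]_x f x.
Proof.
move=> s0 mf f0; pose g := normal_pdf 0 sigma.
have mg : measurable_fun setT (g : mR -> mR) := measurable_normal_pdf 0 sigma.
have g0 x : (0 <= g x)%R by exact: normal_pdf_ge0.
have E (h : mR -> \bar R) : measurable_fun setT h -> (forall x, 0 <= h x) ->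
    \int[normal_prob 0 sigma]_x h x = \int[leb]_x (h x * (g x)%:E).
  by move=> mh h0; exact: ge0_integral_density.
rewrite (E f mf f0) (E (fun x => f (- x)%R))//; last first.
  exact: (measurableT_comp (f := f) mf).
rewrite -(ge0_integral_opp (f := fun x => f x * (g x)%:E)); last 2 first.
- by apply: emeasurable_funM => //; exact/measurable_EFinP.
- by move=> x; rewrite mule_ge0// lee_fin.
apply: eq_integral => x _; congr (_ * _%:E).
by rewrite /g normal_pdfE// /normal_fun !subr0 sqrrN.
Qed.
End NormalSymmetry.

(** * Unitary invariance of Gaussian sums *)

Section GaussianInvariance.
Context {R : realType} {d : measure_display} {Omega : measurableType d}
  {P : probability Omega R} {gam : nat -> Omega -> R[i]}
  (gamP : gaussian_sequence P gam) (X : completeNormedModType R[i]).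
Local Notation mR := (measurableTypeR R).
Local Notation N := (normal_prob (0 : R) (Num.sqrt 2)^-1).

Section FinType.
Variables (I : finType) (e : I -> nat * bool).
Hypotheses (inje : injective e) (I2 : (1 < #|I|)%N).

Definition finite_energy (c : I -> X) : \bar R :=
  (\int[P]_w ((nrm (\sum_i (part gam (e i) w)%:C *: c i)%R ^+ 2)%R)%:E)%E.

Let finite_energyE (c : I -> X) r : perm_eq (enum I) r ->
  finite_energy c = gauss_energy (P := P) (gam := gam) (map e r)
    (fun k => if [pick i | e i == k] is Some i then c i else 0).
Proof.
move=> pr; apply: eq_integral => w _; congr ((nrm _ ^+ 2)%R%:E).
rewrite big_map -[LHS]big_enum /= (perm_big _ pr); apply: eq_bigr => i _.
congr (_ *: _); case: pickP => [j /eqP/inje -> //|/(_ i)]; by rewrite eqxx.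
Qed.

Lemma finite_energy_pair (i j : I) (a11 a12 a21 a22 : R) (c c' : I -> X) : i != j ->
  (forall H : mR * mR -> \bar R, measurable_fun setT H -> (forall z, (0 <= H z)%E) ->
    (\int[N]_x \int[N]_y H (a11 * x + a12 * y, a21 * x + a22 * y)%R =
    \int[N]_x \int[N]_y H (x, y))%E) ->
  c' i = a11%:C *: c i + a21%:C *: c j ->
  c' j = a12%:C *: c i + a22%:C *: c j ->
  (forall k, k != i -> k != j -> c' k = c k) ->
  finite_energy c' = finite_energy c.
Proof.
move=> ij HN ci cj ck.
pose s := [seq k <- enum I | (k != i) && (k != j)].
have ur : uniq [:: i, j & s].
  rewrite /= !inE !mem_filter !eqxx /= andbF orbF ij /=; exact: filter_uniq (enum_uniq _).
have pr : perm_eq (enum I) [:: i, j & s].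
  apply: uniq_perm => //; first exact: enum_uniq.
  move=> k; rewrite mem_enum !in_cons mem_filter mem_enum !inE andbT.
  by case: (k == i); case: (k == j).
rewrite !(finite_energyE _ pr) /=.
have pk k : [pick i0 | e i0 == e k] = Some k.
  by case: pickP => [l /eqP/inje -> //|/(_ k)]; rewrite eqxx.
apply: (gauss_energy_pair gamP _ HN).
- by rewrite -[_ :: _]/(map e [:: i, j & s]) map_inj_uniq.
- by rewrite !pk.
- by rewrite !pk.
- move=> _ /mapP[k + ->]; rewrite mem_filter => /andP[/andP[ki kj] _].
  by rewrite !pk ck.
Qed.

Lemma finite_energy_orthogonal (O : I -> I -> R) (c : I -> X) :
  orthogonal O -> finite_energy (mx_action O c) = finite_energy c.
Proof.
have s0 : (Num.sqrt 2)^-1 != 0 :> R by rewrite invr_eq0 gt_eqF// sqrtr_gt0.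
apply: orthogonal_invariance => [i j x y {}c ij xy y0|i {}c].
  have ji : (j == i) = false by rewrite eq_sym (negbTE ij).
  apply: (@finite_energy_pair i j x y (- y) x c _ ij).
  - move=> H mH H0; rewrite -(ge0_integral_normal_rotation (c := x) (s := - y) s0 _ _ mH H0).
    + apply: eq_integral => u _; apply: eq_integral => v _.
      by rewrite [(- y) * v]mulNr opprK.
    + by rewrite sqrrN.
    + by rewrite oppr_eq0.
  - by rewrite /plane_rotation eqxx rmorphN /= scaleNr.
  - by rewrite /plane_rotation ji eqxx.
  - by move=> k ki kj; rewrite /plane_rotation (negbTE ki) (negbTE kj).
(* A sign flip acts on one variable only; the lemma on pairs is given an idle partner [j]. *)
have [j ji] : exists j, j != i.
  apply/existsP; apply: contraTT I2; rewrite negb_exists => /forallP I1.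
  suff -> : #|I| = #|pred1 i| by rewrite card1.
  by apply: eq_card => k; rewrite !inE; have := I1 k; rewrite negbK.
have ij : i != j by rewrite eq_sym.
apply: (@finite_energy_pair j i 1 0 0 (-1) c _ ji).
- move=> H mH H0; apply: eq_integral => u _.
  rewrite -(ge0_integral_normal_opp (f := fun v => H (u, v)) s0)//; last first.
    exact: (measurableT_comp (f := H) mH).
  by apply: eq_integral => v _; rewrite !mul0r mul1r mulN1r addr0 add0r.
- by rewrite /sign_flip (negbTE ji) scale1r scale0r addr0.
- by rewrite /sign_flip eqxx rmorphN /= scale0r add0r scaleN1r.
- by move=> k _ ki; rewrite /sign_flip (negbTE ki).
Qed.
End FinType.

Definition complex_energy n (x : 'I_n -> X) : \bar R :=
  'E_P[fun w => (nrm (\sum_(k < n) gam k w *: x k) ^+ 2)%R].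

Definition unitary n (U : 'I_n -> 'I_n -> R[i]) :=
  forall a b, \sum_k (U k a)^*%C * U k b = (a == b)%:R.

(* The real and imaginary parts of the k-th variable multiply x k and i x k. *)
Let coord n (x : 'I_n -> X) (k : 'I_n * bool) : X :=
  if k.2 then 'i%C *: x k.1 else x k.1.

Let complex_energyE n (x : 'I_n -> X) :
  complex_energy x = finite_energy (fun k : 'I_n * bool => (val k.1, k.2)) (coord x).
Proof.
rewrite /complex_energy unlock; apply: eq_integral => w _.
congr ((nrm _ ^+ 2)%R%:E).
transitivity (\sum_(k < n) \sum_(b : bool) (part gam (val k, b) w)%:C *: coord x (k, b)).
  apply: eq_bigr => k _; rewrite big_bool /part /coord /= scalerA -scalerDl.
  by rewrite {1}[gam k w]complexE addrC [_ * 'i%C]mulrC.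
by rewrite pair_bigA; apply: eq_bigr => -[k b] _.
Qed.

(** Separating real and imaginary parts turns [U] into a real matrix [O] of twice the size, acting
    on the vectors x k and i x k. The real and imaginary parts of the unitarity relations say that
    [O] is orthogonal. *)
Lemma complex_energy_unitary n (U : 'I_n -> 'I_n -> R[i]) (x : 'I_n -> X) :
  unitary U -> complex_energy (fun k => \sum_l U k l *: x l) = complex_energy x.
Proof.
move=> uU; case: n U x uU => [|n] U x uU; first by congr expectation; apply/funext => w; rewrite !big_ord0.
rewrite !complex_energyE.
pose O (k l : 'I_n.+1 * bool) : R :=
  if k.2 then (if l.2 then complex.Re (U k.1 l.1) else - complex.Im (U k.1 l.1))
  else (if l.2 then complex.Im (U k.1 l.1) else complex.Re (U k.1 l.1)).
transitivity (finite_energy (fun k : 'I_n.+1 * bool => (val k.1, k.2)) (mx_action O (coord x))).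
  congr finite_energy; apply/funext => -[k b].
  rewrite /mx_action -(pair_bigA _ (fun l c => (O (k, b) (l, c))%:C *: coord x (l, c))) /=.
  rewrite /coord /=; case: b; rewrite ?scaler_sumr; apply: eq_bigr => l _;
    rewrite big_bool /O /= !scalerA -scalerDl; congr (_ *: _);
    rewrite {1}[U k l]complexE.
  - rewrite mulrDr mulrA -expr2 sqr_i mulN1r rmorphN /=.
    by rewrite mulrC.
  - by rewrite addrC [_ * 'i%C]mulrC.
apply: finite_energy_orthogonal.
- by move=> [k b] [l c] /= [/val_inj -> ->].
- by rewrite card_prod card_ord card_bool muln2.
move=> [a b] [a' b'].
rewrite -(pair_bigA _ (fun k c => O (k, c) (a, b) * O (k, c) (a', b'))) /=.
have := uU a a'; move/eqP; rewrite eq_complex !raddf_sum /= => /andP[/eqP re /eqP im].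
have -> : ((a, b) == (a', b'))%:R = (a == a')%:R * (b == b')%:R :> R.
  by rewrite xpair_eqE; case: (a == a'); rewrite ?mul1r ?mul0r.
have ree : complex.Re (a == a')%:R = (a == a')%:R :> R by case: (a == a').
have ime : complex.Im (a == a')%:R = 0 :> R by case: (a == a').
rewrite ree in re; rewrite ime in im.
have re' : \sum_i (complex.Re (U i a) * complex.Re (U i a') +
    complex.Im (U i a) * complex.Im (U i a')) = (a == a')%:R.
  rewrite -re; apply: eq_bigr => k _.
  by case: (U k a) => u v; case: (U k a') => u' v' /=; rewrite mulNr opprK.
have im' : \sum_i (complex.Re (U i a) * complex.Im (U i a') -
    complex.Im (U i a) * complex.Re (U i a')) = 0.
  apply: etrans im; apply: eq_bigr => k _.
  by case: (U k a) => u v; case: (U k a') => u' v' /=; rewrite mulNr.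
have bE k : \sum_j O (k, j) (a, b) * O (k, j) (a', b') =
    O (k, true) (a, b) * O (k, true) (a', b') + O (k, false) (a, b) * O (k, false) (a', b').
  exact: big_bool.
under eq_bigr => k _ do rewrite bE.
clear bE; case: b; case: b'; rewrite /O /= ?mulr1 ?mulr0.
- by rewrite -re'; apply: eq_bigr => k _.
- apply/eqP; rewrite -oppr_eq0 -sumrN; apply/eqP; apply: etrans im'; apply: eq_bigr => k _.
  by rewrite opprD mulrN opprK.
- by apply: etrans im'; apply: eq_bigr => k _; rewrite mulNr addrC.
- by rewrite -re'; apply: eq_bigr => k _; rewrite mulrNN addrC.
Qed.

Lemma measurable_gauss_sum n (x : 'I_n -> X) :
  measurable_fun setT (fun w => (nrm (\sum_(k < n) gam k w *: x k) ^+ 2)%R).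
Proof.
apply: measurable_funX.
have E w : \sum_(k < n) gam k w *: x k =
    0 + \sum_(i : 'I_n * bool) (part gam (val i.1, i.2) w)%:C *: coord x i.
  rewrite add0r; transitivity (\sum_(k < n) \sum_(b : bool) (part gam (val k, b) w)%:C *: coord x (k, b)).
    apply: eq_bigr => k _; rewrite big_bool /part /coord /= scalerA -scalerDl.
    by rewrite {1}[gam k w]complexE addrC [_ * 'i%C]mulrC.
  by rewrite pair_bigA; apply: eq_bigr => -[k b] _.
under eq_fun do rewrite E.
by apply: measurable_nrm_sum => i; case: gamP.
Qed.

Lemma complex_energyZ n (z : R[i]) (x : 'I_n -> X) :
  complex_energy (fun k => z *: x k) = ((nrm z ^+ 2)%:E * complex_energy x)%E.
Proof.
rewrite /complex_energy unlock -ge0_integralZl_EFin//.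
- apply: eq_integral => w _; rewrite -EFinM -exprMn -nrmZ scaler_sumr.
  by congr (nrm _ ^+ 2)%:E; apply: eq_bigr => k _; rewrite !scalerA mulrC.
- by move=> w _; rewrite lee_fin sqr_ge0.
- exact/measurable_EFinP/measurable_gauss_sum.
- by rewrite sqr_ge0.
Qed.

(** Convexity of the squared norm, integrated: the energy of a half-sum is at most the mean of the
    two energies. *)
Lemma complex_energy_half n (x y z : 'I_n -> X) :
  (forall k, z k = (2^-1)%:C *: (x k + y k)) ->
  complex_energy x = complex_energy y -> (complex_energy z <= complex_energy x)%E.
Proof.
move=> zE xy.
have x0 (u : 'I_n -> X) : (0 <= complex_energy u)%E.
  by rewrite /complex_energy unlock; apply: integral_ge0 => w _; rewrite lee_fin sqr_ge0.
have half : (complex_energy x = (2^-1)%:E * (complex_energy x + complex_energy y))%E.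
  rewrite -xy; move: (x0 x); case: (complex_energy x) => [e _| _|//].
    by rewrite -EFinD -EFinM; congr _%:E; field.
  by rewrite addye// gt0_muley// lte_fin invr_gt0.
rewrite half /complex_energy unlock -ge0_integralD//.
- rewrite -ge0_integralZl_EFin//.
  + apply: ge0_le_integral => //.
    * by move=> w _; rewrite lee_fin sqr_ge0.
    * exact/measurable_EFinP/measurable_gauss_sum.
    * apply/measurable_EFinP/measurable_funM => //.
      by apply: measurable_funD; exact: measurable_gauss_sum.
    * move=> w _; rewrite -EFinD -EFinM lee_fin.
      have -> : \sum_(k < n) gam k w *: z k = (2^-1)%:C *:
          (\sum_(k < n) gam k w *: x k + \sum_(k < n) gam k w *: y k).
        rewrite -big_split scaler_sumr; apply: eq_bigr => k _.
        by rewrite zE !scalerA mulrC -scalerA scalerDr.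
      set a := \sum_(k < n) _; set b := \sum_(k < n) _.
      rewrite nrmZr ger0_norm ?invr_ge0// exprMn.
      have h1 : nrm (a + b) ^+ 2 <= (nrm a + nrm b) ^+ 2.
        by rewrite ler_sqr ?nnegrE ?addr_ge0 ?nrm_ge0// nrmD.
      by have := sqr_ge0 (nrm a - nrm b); nra.
  + by move=> w _; rewrite -EFinD lee_fin addr_ge0// sqr_ge0.
  + apply/measurable_EFinP; apply: measurable_funD; exact: measurable_gauss_sum.
- by move=> w _; rewrite lee_fin sqr_ge0.
- exact/measurable_EFinP/measurable_gauss_sum.
- by move=> w _; rewrite lee_fin sqr_ge0.
- exact/measurable_EFinP/measurable_gauss_sum.
Qed.
End GaussianInvariance.

(** X^n - 1 is separable, so it has n distinct roots, and a group of n roots of unity in a field is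
    cyclic. *)
Lemma prim_root_exists (C : numClosedFieldType) n : (0 < n)%N ->
  exists z : C, n.-primitive_root z.
Proof.
move=> n_gt0; pose p : {poly C} := 'X^n - 1; have [r Dp] := closed_field_poly_normal p.
rewrite (monicP _) ?monicXnsubC // scale1r in Dp.
have rn1 : all n.-unity_root r by apply/allP=> z; rewrite -root_prod_XsubC -Dp.
have sz_r : (n < (size r).+1)%N.
  by rewrite -(size_prod_XsubC r id) -Dp size_XnsubC.
have [|z] := hasP (cyclic.has_prim_root n_gt0 rn1 _ sz_r); last by exists z.
by rewrite -separable.separable_prod_XsubC -Dp cyclotomic.separable_Xn_sub_1 // pnatr_eq0 -lt0n.
Qed.

(** * Circulant matrices and the discrete Fourier transform *)

Section Circulant.
Context {R : realType}.

Lemma nrm_unity_root (z : R[i]) n : (0 < n)%N -> z ^+ n = 1 -> nrm z = 1.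
Proof.
move=> n0 zn; apply/eqP; rewrite -(@pexpr_eq1 _ _ n)// ?nrm_ge0//.
by rewrite -nrmX zn nrm1.
Qed.

Lemma mulJ_nrm1 (z : R[i]) : nrm z = 1 -> z^*%C * z = 1.
Proof.
move=> z1; have := nrm_sqr z; rewrite z1 expr1n => E.
apply/eqP; rewrite eq_complex; case: z {z1} E => u v /= E.
by apply/andP; split; apply/eqP; [rewrite E; ring|ring].
Qed.

Lemma sum_unity_root n (z : R[i]) : z ^+ n.+1 = 1 -> z != 1 ->
  \sum_(s < n.+1) z ^+ s = 0.
Proof.
move=> zn z1; apply: (mulfI (x := z - 1)); first by rewrite subr_eq0.
by rewrite mulr0 -subrX1 zn subrr.
Qed.

(** Orthogonality of the characters of the cyclic group of order n + 1. *)
Lemma sum_prim_root n (z : R[i]) (a b : nat) : n.+1.-primitive_root z ->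
  \sum_(s < n.+1) z ^+ (s * a) * (z^*%C) ^+ (s * b) = (n.+1%:R *+ (a == b %[mod n.+1]))%R.
Proof.
move=> pz; have zn := prim_expr_order pz.
have z1 := nrm_unity_root (ltn0Sn n) zn.
have zz := mulJ_nrm1 z1.
have E (s : 'I_n.+1) : z ^+ (s * a) * (z^*%C) ^+ (s * b) = (z ^+ a * z^*%C ^+ b) ^+ s.
  by rewrite exprMn -!exprM ![(s * _)%N]mulnC.
under eq_bigr => s _ do rewrite E.
have [ab|ab] := eqVneq (a %% n.+1)%N (b %% n.+1)%N.
  have -> : z ^+ a * z^*%C ^+ b = 1.
    have /eqP -> : z ^+ a == z ^+ b by rewrite (eq_prim_root_expr pz) ab.
    by rewrite -exprMn mulrC zz expr1n.
  under eq_bigr => s _ do rewrite expr1n.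
  by rewrite sumr_const card_ord mulr1n.
rewrite mulr0n; apply: sum_unity_root.
  rewrite exprMn -!exprM ![(_ * n.+1)%N]mulnC !exprM zn.
  have -> : z^*%C ^+ n.+1 = 1 by rewrite -[LHS]mulr1 -zn -exprMn zz expr1n.
  by rewrite !expr1n mulr1.
apply: contra ab => /eqP h; rewrite -(eq_prim_root_expr pz); apply/eqP.
by rewrite -[LHS]mulr1 -(expr1n _ b) -zz exprMn mulrA h mul1r.
Qed.

(* z = 0 is the half-sum of 1 and -1. *)
Lemma disc_half_sum (z : R[i]) : nrm z <= 1 ->
  exists u v : R[i], [/\ nrm u = 1, nrm v = 1 & z = (2^-1)%:C * (u + v)].
Proof.
move=> z1; have [->|z0] := eqVneq z 0.
  by exists 1, (-1); rewrite nrmN nrm1 subrr mulr0.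
pose r := nrm z; have r0 : 0 < r by rewrite lt_neqAle eq_sym nrm_eq0 z0 nrm_ge0.
pose s := Num.sqrt (1 - r ^+ 2).
have s2 : s ^+ 2 = 1 - r ^+ 2.
  by rewrite sqr_sqrtr// subr_ge0 expr_le1// nrm_ge0.
pose w := z / r%:C.
have w1 : nrm w = 1 by rewrite nrmM nrmV nrm_real ger0_norm ?(ltW r0)// divff// gt_eqF.
have nu (e : R) : e ^+ 2 = s ^+ 2 -> nrm (r +i* e) = 1.
  move=> es; apply/eqP; rewrite -(@pexpr_eq1 _ _ 2)// ?nrm_ge0//.
  by rewrite nrm_sqr /= es s2; apply/eqP; ring.
(* z = r w with |w| = 1, and r is the half-sum of the unimodular numbers r + is and r - is. *)
exists (w * (r +i* s)), (w * (r +i* (- s))); split.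
- by rewrite nrmM w1 mul1r nu.
- by rewrite nrmM w1 mul1r nu// sqrrN.
rewrite -mulrDr; have -> : (r +i* s) + (r +i* - s) = (2 * r)%:C.
  by apply/eqP; rewrite eq_complex /= subrr eqxx andbT; apply/eqP; ring.
rewrite [RHS]mulrCA -[X in w * X]rmorphM /= mulrA mulVf// mul1r /w divfK//.
by rewrite (eq_complex _ 0) /= eqxx andbT gt_eqF.
Qed.

Context {d : measure_display} {Omega : measurableType d}
  {P : probability Omega R} {gam : nat -> Omega -> R[i]}
  (gamP : gaussian_sequence P gam) (X : completeNormedModType R[i]).
Local Notation energy := (complex_energy (P := P) (gam := gam)).

(** The operator with eigenvalues [e s] on the discrete characters k -> conj(z)^(sk), that is, a
    diagonal matrix conjugated by the unitary Fourier matrix. *)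
Definition fourier_multiplier n (z : R[i]) (e : 'I_n.+1 -> R[i]) (k l : 'I_n.+1) : R[i] :=
  (n.+1%:R)^-1 * \sum_s e s * (z ^+ (s * l) * (z^*%C) ^+ (s * k)).

Lemma fourier_multiplier_unitary n z (e : 'I_n.+1 -> R[i]) :
  n.+1.-primitive_root z -> (forall s, nrm (e s) = 1) ->
  unitary (fourier_multiplier z e).
Proof.
move=> pz e1 a b.
have n0 : n.+1%:R != 0 :> R[i] by rewrite pnatr_eq0.
have cn : (n.+1%:R : R[i])^*%C = n.+1%:R by rewrite rmorph_nat.
have zJJ : (z^*%C)^*%C = z by rewrite conjcK.
transitivity ((n.+1%:R)^-1 * (n.+1%:R)^-1 * \sum_s \sum_s' (e s)^*%C * e s' *
    ((z^*%C) ^+ (s * a) * z ^+ (s' * b)) * (\sum_(k < n.+1) (z ^+ (k * s) * (z^*%C) ^+ (k * s')))).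
  rewrite (eq_bigr (fun k : 'I_n.+1 => (n.+1%:R)^-1 * (n.+1%:R)^-1 *
     \sum_s \sum_s' (e s)^*%C * e s' * ((z^*%C) ^+ (s * a) * z ^+ (s' * b)) *
      (z ^+ (k * s) * (z^*%C) ^+ (k * s')))); last first.
    move=> k _; rewrite /fourier_multiplier rmorphM rmorph_sum fmorphV /= cn.
    rewrite mulrACA; congr (_ * _); rewrite mulr_suml; apply: eq_bigr => s _.
    rewrite mulr_sumr; apply: eq_bigr => s' _.
    rewrite !rmorphM !rmorphXn /= zJJ ![(_ * k)%N]mulnC.
    by rewrite mulrACA -[RHS]mulrA; congr (_ * _); exact: mulrACA.
  rewrite -mulr_sumr; congr (_ * _); rewrite exchange_big /=; apply: eq_bigr => s _.
  by rewrite exchange_big /=; apply: eq_bigr => s' _; rewrite mulr_sumr.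
have E (s : 'I_n.+1) : \sum_s' (e s)^*%C * e s' *
    ((z^*%C) ^+ (s * a) * z ^+ (s' * b)) * (\sum_(k < n.+1) (z ^+ (k * s) * (z^*%C) ^+ (k * s')))
    = n.+1%:R * (z ^+ (s * b) * (z^*%C) ^+ (s * a)).
  rewrite [LHS](bigD1 s)//= [X in _ + X]big1 ?addr0; last first.
    move=> s' ss'; rewrite (sum_prim_root _ _ pz) !modn_small// eq_sym (inj_eq val_inj).
    by rewrite (negbTE ss') mulr0n mulr0.
  rewrite (sum_prim_root _ _ pz) eqxx mulr1n mulJ_nrm1// mul1r mulrC.
  by congr (_ * _); rewrite mulrC.
rewrite (eq_bigr _ (fun s _ => E s)) -mulr_sumr (sum_prim_root _ _ pz) !modn_small//.
rewrite eq_sym (inj_eq val_inj); case: (a == b); last by rewrite !mulr0n !mulr0.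
by rewrite mulr1n mulrA mulfVK// mulVf.
Qed.

(** Cyclic convolution with [mu] is a Fourier multiplier whose eigenvalues are the values of the
    symbol at the roots of unity. Divided by [K], every eigenvalue is a half-sum of two unimodular
    numbers, chosen independently for each s; this yields the two unitary matrices. *)
Lemma circulant_energy n (mu : nat -> R[i]) (K : R) (a : 'I_n.+1 -> X) : 0 < K ->
  (forall z : R[i], z ^+ n.+1 = 1 -> nrm (\sum_(j < n.+1) mu j * z ^+ j) <= K) ->
  (energy (fun k : 'I_n.+1 => \sum_(j < n.+1) mu j *: a (inord ((k + j) %% n.+1)))%R
     <= (K ^+ 2)%:E * energy a)%E.
Proof.
move=> K0 HK.
have [z pz] := @prim_root_exists (complex R) n.+1 isT.
have zn := prim_expr_order pz.
have n0 : n.+1%:R != 0 :> R[i] by rewrite pnatr_eq0.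
have K0' : K%:C != 0 by rewrite (eq_complex _ 0) /= eqxx andbT gt_eqF.
have zJn : z^*%C ^+ n.+1 = 1.
  by rewrite -[LHS]mulr1 -zn -exprMn mulJ_nrm1 ?expr1n// (nrm_unity_root _ zn).
(* The forward cyclic shift has eigenvalue conj(z)^s on the character s, hence the conjugate
   root. *)
pose M (s : 'I_n.+1) := \sum_(j < n.+1) mu j * (z^*%C ^+ s) ^+ j.
have HM s : nrm (M s / K%:C) <= 1.
  rewrite nrmM nrmV nrm_real gtr0_norm// ler_pdivrMr// mul1r; apply: HK.
  by rewrite -exprM mulnC exprM zJn expr1n.
have /choice[uv uvP] : forall s, exists uv : R[i] * R[i],
    [/\ nrm uv.1 = 1, nrm uv.2 = 1 & M s / K%:C = (2^-1)%:C * (uv.1 + uv.2)].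
  by move=> s; have [u [v uvP]] := disc_half_sum (HM s); exists (u, v).
pose u s := (uv s).1; pose v s := (uv s).2.
have u1 s : nrm (u s) = 1 by case: (uvP s).
have v1 s : nrm (v s) = 1 by case: (uvP s).
have ME s : M s = K%:C * ((2^-1)%:C * (u s + v s)).
  by case: (uvP s) => _ _ <-; rewrite mulrC divfK.
have Uu := fourier_multiplier_unitary pz u1.
have Uv := fourier_multiplier_unitary pz v1.
pose act e (k : 'I_n.+1) : X := \sum_l fourier_multiplier z e k l *: a l.
have actE (k : 'I_n.+1) : \sum_(j < n.+1) mu j *: a (inord ((k + j) %% n.+1)) =
    K%:C *: ((2^-1)%:C *: (act u k + act v k)).
  have -> : K%:C *: ((2^-1)%:C *: (act u k + act v k)) = act M k.
    rewrite /act -big_split !scaler_sumr; apply: eq_bigr => l _ /=.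
    rewrite -scalerDl !scalerA; congr (_ *: _).
    rewrite /fourier_multiplier -mulrDr -big_split /= !mulrA [_ * (n.+1%:R)^-1]mulrC -!mulrA.
    congr (_ * _); rewrite mulr_sumr mulr_sumr; apply: eq_bigr => s _.
    by rewrite -mulrDl ME !mulrA.
  transitivity (\sum_(l < n.+1) \sum_(j < n.+1) (mu j *+ (l == inord ((k + j) %% n.+1))) *: a l).
    rewrite exchange_big /=; apply: eq_bigr => j _.
    rewrite (bigD1 (inord ((k + j) %% n.+1)))//= eqxx mulr1n big1 ?addr0//.
    by move=> l /negbTE ->; rewrite mulr0n scale0r.
  apply: eq_bigr => l _; rewrite -scaler_suml; congr (_ *: _).
  rewrite /fourier_multiplier /M; under [in RHS]eq_bigr => s _ do rewrite mulr_suml.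
  rewrite exchange_big mulr_sumr; apply: eq_bigr => j _ /=.
  have E : \sum_(s < n.+1) z ^+ (s * l) * (z^*%C) ^+ (s * (k + j)) =
      n.+1%:R *+ (l == inord ((k + j) %% n.+1)).
    rewrite (sum_prim_root _ _ pz) modn_small// -val_eqE /= inordK ?ltn_mod//.
  transitivity ((n.+1%:R)^-1 * (mu j * \sum_(s < n.+1) z ^+ (s * l) * (z^*%C) ^+ (s * (k + j)))).
    by rewrite E; case: (l == _); rewrite ?mulr1n ?mulr0n ?mulr0// mulrCA mulVf// mulr1.
  congr (_ * _); rewrite mulr_sumr; apply: eq_bigr => s _.
  rewrite -!mulrA; congr (_ * _); rewrite mulrCA; congr (_ * _).
  by rewrite -exprM -exprD mulnDr addnC.
have -> : (fun k : 'I_n.+1 => \sum_(j < n.+1) mu j *: a (inord ((k + j) %% n.+1))) =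
    (fun k => K%:C *: ((2^-1)%:C *: (act u k + act v k))) by apply/funext.
rewrite (complex_energyZ gamP) nrm_real gtr0_norm//.
rewrite lee_wpmul2l ?lee_fin ?sqr_ge0//.
rewrite -(complex_energy_unitary gamP a Uu).
apply: (complex_energy_half gamP (y := act v)) => //.
by rewrite (complex_energy_unitary gamP a Uu) (complex_energy_unitary gamP a Uv).
Qed.
End Circulant.

(** * Transference *)

Section Transference.
Context {R : realType} {X : completeNormedModType R[i]}.

Lemma continuous_nrm_bounded (f : {linear X -> X}) : continuous f ->
  exists2 C : R, 0 <= C & forall x, nrm (f x) <= C * nrm x.
Proof.
move=> /linear_bounded_continuous/linear_boundedP [M [Mr HM]].
pose c : R := `|complex.Re M| + 1.
have Mc : M < c%:C.
  rewrite ltcE /=; move: Mr; case: M {HM} @c => u v c; rewrite complex_real /= => /eqP ->.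
  by rewrite eqxx /= /c (le_lt_trans (ler_norm _))// ltrDl.
exists c; first by rewrite /c addr_ge0.
move=> x; have := HM _ Mc x; rewrite !nrmE -rmorphM lecR; exact.
Qed.

Variable T : R -> {linear X -> X}.

Definition sg_horner (h : R) (m : {poly R[i]}) (x : X) : X :=
  \sum_(j < size m) m`_j *: T (j%:R * h) x.

Lemma sg_hornerE h (m : {poly R[i]}) n x : (size m <= n)%N ->
  sg_horner h m x = \sum_(j < n) m`_j *: T (j%:R * h) x.
Proof.
move=> mn; rewrite /sg_horner (big_ord_widen n (fun j => m`_j *: T (j%:R * h) x)) //.
rewrite [RHS](bigID (fun j : 'I_n => (j < size m)%N)) /= [X in _ = _ + X]big1 ?addr0//.
by move=> j; rewrite -leqNgt => jm; rewrite nth_default// scale0r.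
Qed.

Hypothesis Tsg : C0_semigroup T.
Hypothesis Tstable : exponentially_stable T.
Hypothesis Tinv : forall t, 0 <= t -> invertible_op (T t).

(** T(1) = T(1 - s) T(s), where T(1) is bounded below and T(1 - s) is bounded uniformly. *)
Lemma semigroup_lower_bound : exists2 L : R, 0 < L &
  forall s x, 0 <= s <= 1 -> nrm x <= L * nrm (T s x).
Proof.
have [M [w [M1 w0 HM]]] := Tstable.
have [S' [cS S'1 _]] := Tinv ler01.
have [L L0 HL] := continuous_nrm_bounded cS.
exists (L * M + 1); first by rewrite ltr_wpDl// mulr_ge0// (le_trans _ M1).
move=> s x /andP[s0 s1].
rewrite -{1}(S'1 x) (le_trans (HL _))//.
have -> : T 1 x = T (1 - s) (T s x).
  by rewrite -(sg_add Tsg) ?subr_ge0// subrK.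
have s1' : 0 <= 1 - s by rewrite subr_ge0.
rewrite mulrDl mul1r ler_wpDr ?nrm_ge0// -mulrA ler_wpM2l//.
rewrite (le_trans (HM _ _ s1'))// ler_wpM2r ?nrm_ge0//.
rewrite ler_piMr ?(le_trans _ M1)// -[leRHS]expR0 ler_expR oppr_le0 mulr_ge0// ltW//.
Qed.

Context {d : measure_display} {Omega : measurableType d}
  {P : probability Omega R} {gam : nat -> Omega -> R[i]}
  (gamP : gaussian_sequence P gam) {p q : R} (p_range : 1 <= p <= 2)
  (q_range : 2 <= q) (X_type : has_type P X gam p) (X_cotype : has_cotype P X gam q).

Let p0 : 0 < p. Proof. by case/andP: p_range => + _; apply: lt_le_trans. Qed.
Let q0 : 0 < q. Proof. exact: lt_le_trans q_range. Qed.

Let energy_nneg n (x : 'I_n -> X) : (0 <= complex_energy (P := P) (gam := gam) x)%E.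
Proof. by rewrite /complex_energy unlock; apply: integral_ge0 => w _; rewrite lee_fin sqr_ge0. Qed.

Lemma circulant_type_cotype : exists2 C : R, 0 <= C & forall n (mu : nat -> R[i]) (K : R)
    (a : 'I_n.+1 -> X), 0 < K ->
  (forall z : R[i], nrm z = 1 -> nrm (\sum_(j < n.+1) mu j * z ^+ j) <= K) ->
  (\sum_(k < n.+1) nrm (\sum_(j < n.+1) mu j *: a (inord ((k + j) %% n.+1))) `^ q) `^ q^-1
     <= C * K * (\sum_(l < n.+1) nrm (a l) `^ p) `^ p^-1.
Proof.
have [Cp HCp] := X_type; have [Cq HCq] := X_cotype.
exists (`|Cq| * `|Cp|); first by rewrite mulr_ge0.
move=> n mu K a K0 HK.
have HK' (z : R[i]) : z ^+ n.+1 = 1 -> nrm (\sum_(j < n.+1) mu j * z ^+ j) <= K.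
  by move=> zn; apply: HK; exact: nrm_unity_root zn.
have := circulant_energy gamP a K0 HK'.
set b := (fun k => _).
move=> Eb; rewrite -lee_fin.
apply: (le_trans (HCq n.+1 b)).
have g0 (x : 'I_n.+1 -> X) : (0 <= gauss_norm P gam x)%E by exact: poweR_ge0.
apply: (@le_trans _ _ (`|Cq|%:E * (K%:E * gauss_norm P gam a)))%E.
  apply: (@le_trans _ _ (`|Cq|%:E * gauss_norm P gam b))%E.
    by rewrite lee_wpmul2r// lee_fin ler_norm.
  rewrite lee_wpmul2l ?lee_fin//.
  have KE : (K%:E = (K ^+ 2)%:E `^ 2^-1)%E.
    by rewrite poweR_EFin powR12_sqrt ?sqr_ge0// sqrtr_sqr gtr0_norm.
  rewrite {1}KE /gauss_norm -poweRM ?energy_nneg ?lee_fin ?sqr_ge0//.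
  apply: gt0_ler_poweR => //; rewrite ?in_itv/= ?leey ?andbT ?energy_nneg//.
  by rewrite mule_ge0 ?energy_nneg// lee_fin sqr_ge0.
apply: (@le_trans _ _ (`|Cq|%:E * (K%:E * (`|Cp| * (\sum_(l < n.+1) nrm (a l) `^ p) `^ p^-1)%:E)))%E.
  rewrite lee_wpmul2l ?lee_fin// lee_wpmul2l ?lee_fin ?(ltW K0)//.
  by apply: (le_trans (HCp n.+1 a)); rewrite lee_fin ler_wpM2r ?powR_ge0 ?ler_norm.
by rewrite -!EFinM lee_fin le_eqVlt; apply/orP; left; apply/eqP; ring.
Qed.

Lemma transference : exists2 C : R, 0 <= C & forall (h : R) (m : {poly R[i]}) (K : R),
  0 < h <= 1 -> 0 < K -> (forall z : R[i], nrm z = 1 -> nrm m.[z] <= K) ->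
  forall x, nrm (sg_horner h m x) <= C * h `^ (q^-1 - p^-1) * K * nrm x.
Proof.
have [C C0 HC] := circulant_type_cotype.
have [L L0 HL] := semigroup_lower_bound.
have [M [w [M1 w0 HM]]] := Tstable.
have M0 : 0 <= M by exact: le_trans M1.
exists (L * 2 `^ q^-1 * C * (M * ((1 + w) / w) `^ p^-1)).
  by rewrite !mulr_ge0 ?powR_ge0// ltW.
move=> h m K /andP[h0 h1] K0 HK x; set y := sg_horner h m x.
(* The number of steps of length [h] in a unit of time; J h lies between 1/2 and 1. *)
pose J := Num.trunc h^-1.
have /andP[J1 J2] : J%:R <= h^-1 < J.+1%:R by apply: truncn_itv; rewrite invr_ge0 ltW.
clearbody J.
have J0 : (0 < J)%N.
  have : 1 < J.+1%:R :> R by apply: le_lt_trans J2; rewrite invf_ge1.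
  by rewrite ltr1n.
have Jh : J%:R * h <= 1 by rewrite -ler_pdivlMr// mul1r.
have Jh2 : 1 <= J%:R * (2 * h).
  rewrite mulrA -ler_pdivrMr// div1r; apply: (le_trans (ltW J2)).
  by rewrite -natrM ler_nat muln2 -addnn -addn1 leq_add2l.
(* The cycle is padded to length J + size m, so that the first J entries of the cyclic convolution
   involve no wrap-around and equal T(kh) y. *)
pose n := (J + size m).-1.
have nE : n.+1 = (J + size m)%N by rewrite prednK// addn_gt0 J0.
pose a (l : 'I_n.+1) : X := T (l%:R * h) x.
have HK' (z : R[i]) : nrm z = 1 -> nrm (\sum_(j < n.+1) m`_j * z ^+ j) <= K.
  move=> z1; rewrite -horner_coef_wide ?HK// nE leq_addl//.
pose b (k : 'I_n.+1) : X := \sum_(j < n.+1) m`_j *: a (inord ((k + j) %% n.+1)).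
have main : (\sum_(k < n.+1) nrm (b k) `^ q) `^ q^-1
    <= C * K * (\sum_(l < n.+1) nrm (a l) `^ p) `^ p^-1.
  exact: (HC n (fun j => m`_j) K a K0 HK').
have bE (k : 'I_n.+1) : (k < J)%N -> b k = T (k%:R * h) y.
  move=> kJ; rewrite /b /y (@sg_hornerE _ _ n.+1) ?nE ?leq_addl// raddf_sum /=.
  apply: eq_bigr => j _; rewrite linearZ /=.
  have [jm|jm] := ltnP j (size m); last by rewrite nth_default// !scale0r.
  rewrite /a inordK ?ltn_mod// modn_small; last first.
    by rewrite [X in (_ < X)%N]nE -addSn leq_add// ltnW.
  by rewrite -(sg_add Tsg) ?mulr_ge0 ?(ltW h0)// -mulrDl natrD.
have S1 : J%:R * (nrm y / L) `^ q <= \sum_(k < n.+1) nrm (b k) `^ q.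
  rewrite (bigID (fun k : 'I_n.+1 => (k < J)%N)) /= ler_wpDr//.
    by apply: sumr_ge0 => k _; exact: powR_ge0.
  rewrite (eq_bigr (fun k : 'I_n.+1 => nrm (T (k%:R * h) y) `^ q)); last first.
    by move=> k kJ; rewrite bE.
  rewrite -(big_ord_widen n.+1 (fun k => nrm (T (k%:R * h) y) `^ q)) ?nE ?leq_addr//.
  rewrite mulr_natl -[X in _ *+ X]card_ord -sumr_const; apply: ler_sum => k _.
  apply: ge0_ler_powR; rewrite ?(ltW q0)// ?nnegrE ?divr_ge0 ?nrm_ge0 ?(ltW L0)//.
  rewrite ler_pdivrMr// mulrC HL// mulr_ge0 ?(ltW h0)//=.
  by rewrite (le_trans _ Jh)// ler_wpM2r ?(ltW h0)// ler_nat ltnW.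
have Mx0 : 0 <= M * nrm x by rewrite mulr_ge0 ?nrm_ge0.
pose r := expR (- (w * h)).
have r0 : 0 < r by exact: expR_gt0.
have wh0 : 0 < w * h by exact: mulr_gt0.
have r1 : r < 1 by rewrite -[ltRHS]expR0 ltr_expR oppr_lt0.
(* Exponential stability gives a geometric series, so that the bound depends on [h] but not on the
   degree of [m]. *)
have S2 : \sum_(l < n.+1) nrm (a l) `^ p <= (M * nrm x) `^ p * ((1 + w) / w * h^-1).
  apply: (@le_trans _ _ (\sum_(l < n.+1) (M * nrm x) `^ p * r ^+ l)).
    apply: ler_sum => l _.
    have rl : expR (- (w * (l%:R * h))) = r ^+ l.
      by rewrite /r -expRM_natl; congr expR; ring.
    have lh : 0 <= l%:R * h by rewrite mulr_ge0// ltW.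
    apply: (@le_trans _ _ ((M * nrm x * r ^+ l) `^ p)).
      apply: ge0_ler_powR; rewrite ?(ltW p0)// ?nnegrE ?nrm_ge0//.
        by rewrite mulr_ge0// exprn_ge0// ltW.
      by rewrite (le_trans (HM _ x lh))// rl mulrAC.
    rewrite powRM// ?exprn_ge0 ?(ltW r0)// ler_wpM2l ?powR_ge0//.
    (* The p-th power of a number in ]0, 1] is at most the number itself, since p >= 1. *)
    apply: ge1r_powR; last by case/andP: p_range.
    by rewrite exprn_gt0//= exprn_ile1// ltW.
  rewrite -mulr_sumr ler_wpM2l ?powR_ge0//.
  have : (1 - r) * \sum_(l < n.+1) r ^+ l <= 1.
    rewrite -[X in X <= _]opprK -mulNr opprB -subrX1 opprB.
    by rewrite lerBlDr lerDl exprn_ge0// ltW.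
  rewrite mulrC -ler_pdivlMr ?subr_gt0// => /le_trans; apply.
  have rle : r <= (1 + w * h)^-1.
    by rewrite /r expRN lef_pV2 ?posrE ?expR_gt0 ?addr_gt0// expR_ge1Dx.
  have e1 : w * h / (1 + w) <= 1 - r.
    apply: (@le_trans _ _ (w * h / (1 + w * h))).
      rewrite ler_wpM2l ?(ltW wh0)// lef_pV2 ?posrE ?addr_gt0// lerD2l ler_piMr// ltW//.
    have -> : w * h / (1 + w * h) = 1 - (1 + w * h)^-1.
      by field; rewrite gt_eqF// addr_gt0.
    by rewrite lerB.
  have -> : (1 + w) / w * h^-1 = (w * h / (1 + w))^-1 by rewrite invf_div invfM mulrA.
  by rewrite div1r lef_pV2 ?posrE ?subr_gt0 ?divr_gt0 ?addr_gt0.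
have q1 : 0 <= q^-1 by rewrite invr_ge0 ltW.
have p1 : 0 <= p^-1 by rewrite invr_ge0 ltW.
have : J%:R `^ q^-1 * (nrm y / L) <= C * K * (M * nrm x * ((1 + w) / w * h^-1) `^ p^-1).
  have yL : 0 <= nrm y / L by rewrite divr_ge0 ?nrm_ge0// ltW.
  have -> : J%:R `^ q^-1 * (nrm y / L) = (J%:R * (nrm y / L) `^ q) `^ q^-1.
    by rewrite powRM ?powR_ge0// -powRrM divff ?gt_eqF// powRr1.
  have -> : M * nrm x * ((1 + w) / w * h^-1) `^ p^-1 = ((M * nrm x) `^ p * ((1 + w) / w * h^-1)) `^ p^-1.
    rewrite [RHS]powRM ?powR_ge0// -?powRrM ?divff ?gt_eqF// ?powRr1//.
    by rewrite mulr_ge0 ?invr_ge0 ?divr_ge0 ?addr_ge0// ltW.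
  apply: (le_trans _ (le_trans main _)).
    apply: ge0_ler_powR => //; rewrite nnegrE ?mulr_ge0 ?powR_ge0//.
    by apply: sumr_ge0 => k _; exact: powR_ge0.
  rewrite ler_wpM2l// ?mulr_ge0// ?(ltW K0)//.
  apply: ge0_ler_powR => //; rewrite nnegrE.
    by apply: sumr_ge0 => k _; exact: powR_ge0.
  by rewrite !mulr_ge0 ?powR_ge0 ?invr_ge0 ?addr_ge0// ltW.
move=> fin.
have Jq : 1 <= (2 * h) `^ q^-1 * J%:R `^ q^-1.
  rewrite -powRM ?mulr_ge0 ?(ltW h0)// mulrC -[leLHS](powRr0 (J%:R * (2 * h))).
  by apply: ler_powR.
have yL : 0 <= nrm y / L by rewrite divr_ge0 ?nrm_ge0// ltW.
have : nrm y / L <= (2 * h) `^ q^-1 * (C * K * (M * nrm x * ((1 + w) / w * h^-1) `^ p^-1)).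
  apply: (@le_trans _ _ ((2 * h) `^ q^-1 * J%:R `^ q^-1 * (nrm y / L))); first exact: ler_peMl.
  by rewrite -[leLHS]mulrA; apply: ler_wpM2l; rewrite ?powR_ge0.
rewrite ler_pdivrMr// => /le_trans; apply; rewrite le_eqVlt; apply/orP; left; apply/eqP.
have hV : h^-1 `^ p^-1 = h `^ (- p^-1) by rewrite -powR_inv1 ?(ltW h0)// -powRrM mulN1r.
rewrite powRM ?(ltW h0)// powRM ?invr_ge0 ?divr_ge0 ?addr_ge0 ?(ltW w0) ?(ltW h0)// hV.
rewrite powRD; last by apply/implyP => _; rewrite gt_eqF.
ring.
Qed.
End Transference.

(** * Pade approximants of the exponential *)

Section ComplexCalculus.
Context {R : realType}.
Implicit Types (F G dF dG : R -> R[i]) (s : R) (z w : R[i]).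

(** Differentiation of a complex function of a real variable, componentwise, so that the real mean
    value theorem applies to real linear functionals of [F]. *)
Definition has_cderive F dF s :=
  is_derive s 1 (fun t => complex.Re (F t)) (complex.Re (dF s)) /\
  is_derive s 1 (fun t => complex.Im (F t)) (complex.Im (dF s)).

Lemma has_cderive_cst z s : has_cderive (fun=> z) (fun=> 0) s.
Proof. by split; exact: is_derive_cst. Qed.

Lemma has_cderive_id s : has_cderive (fun t => t%:C) (fun=> 1) s.
Proof. by split; [exact: is_derive_id|exact: is_derive_cst]. Qed.

Lemma has_cderiveD F G dF dG s : has_cderive F dF s -> has_cderive G dG s ->
  has_cderive (fun t => F t + G t) (fun t => dF t + dG t) s.
Proof.
move=> [? ?] [? ?]; split.
  rewrite (_ : (fun t => _) = (fun t => complex.Re (F t)) \+ (fun t => complex.Re (G t)))%R.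
    by rewrite raddfD; exact: is_deriveD.
  by apply/funext => t; rewrite raddfD.
rewrite (_ : (fun t => _) = (fun t => complex.Im (F t)) \+ (fun t => complex.Im (G t)))%R.
  by rewrite raddfD; exact: is_deriveD.
by apply/funext => t; rewrite raddfD.
Qed.

Lemma has_cderiveM F G dF dG s : has_cderive F dF s -> has_cderive G dG s ->
  has_cderive (fun t => F t * G t) (fun t => dF t * G t + F t * dG t) s.
Proof.
move=> [f1 f2] [g1 g2]; split.
  rewrite (_ : (fun t => _) = (fun t => complex.Re (F t)) * (fun t => complex.Re (G t))
     - (fun t => complex.Im (F t)) * (fun t => complex.Im (G t))); last first.
    by apply/funext => t; rewrite !fctE; case: (F t) (G t) => a b [c e].
  apply: (is_derive_eq (is_deriveB (is_deriveM f1 g1) (is_deriveM f2 g2))).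
  case: (F s) (dF s) (G s) (dG s) => a b [a' b'] [c e] [c' e'] /=.
  by rewrite /GRing.scale /=; ring.
rewrite (_ : (fun t => _) = (fun t => complex.Re (F t)) * (fun t => complex.Im (G t))
   + (fun t => complex.Im (F t)) * (fun t => complex.Re (G t))); last first.
  by apply/funext => t; rewrite !fctE; case: (F t) (G t) => a b [c e].
apply: (is_derive_eq (is_deriveD (is_deriveM f1 g2) (is_deriveM f2 g1))).
case: (F s) (dF s) (G s) (dG s) => a b [a' b'] [c e] [c' e'] /=.
by rewrite /GRing.scale /=; ring.
Qed.

Lemma has_cderive_eq F dF dG s : has_cderive F dF s -> dF s = dG s -> has_cderive F dG s.
Proof. by move=> [? ?] E; split; rewrite -E. Qed.

Lemma has_cderive_horner (P : {poly R[i]}) s :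
  has_cderive (fun t => P.[t%:C]) (fun t => P^`().[t%:C]) s.
Proof.
elim/poly_ind: P => [|P c IH].
  rewrite (_ : (fun t => _) = fun=> 0); last by apply/funext => t; rewrite horner0.
  apply: has_cderive_eq (has_cderive_cst 0 s) _; by rewrite deriv0 horner0.
rewrite (_ : (fun t => _) = fun t => P.[t%:C] * t%:C + c); last first.
  by apply/funext => t; rewrite hornerMXaddC.
apply: has_cderive_eq (has_cderiveD (has_cderiveM IH (has_cderive_id s)) (has_cderive_cst c s)) _.
by rewrite derivD derivM derivX derivC !hornerE.
Qed.

Lemma cexpE z : cexp z = (expR (complex.Re z) * cos (complex.Im z)) +i*
  (expR (complex.Re z) * sin (complex.Im z)).
Proof. by rewrite /cexp; apply/eqP; rewrite eq_complex /= !mul0r subr0 addr0 !eqxx. Qed.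

Lemma cexp0 : cexp 0 = 1 :> R[i].
Proof. by rewrite cexpE /= expR0 cos0 sin0 mulr1 mulr0. Qed.

Lemma cexpD z w : cexp (z + w) = cexp z * cexp w.
Proof.
rewrite !cexpE; case: z w => a b [c e] /=.
apply/eqP; rewrite eq_complex /= expRD cosD sinD; apply/andP; split; apply/eqP; ring.
Qed.

Lemma cexp_natmul n z : cexp (n%:R * z) = cexp z ^+ n.
Proof.
elim: n => [|n IH]; first by rewrite mul0r cexp0 expr0.
by rewrite -natr1 mulrDl mul1r cexpD IH exprSr.
Qed.

Lemma nrm_cexp z : nrm (cexp z) = expR (complex.Re z).
Proof.
apply/eqP; rewrite -(@eqrXn2 _ 2) ?nrm_ge0 ?expR_ge0//.
rewrite nrm_sqr cexpE /= !exprMn -mulrDr cos2Dsin2 mulr1//.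
Qed.

Lemma has_cderive_cexp z s :
  has_cderive (fun t => cexp (t%:C * z)) (fun t => z * cexp (t%:C * z)) s.
Proof.
case: z => a b.
have E t : cexp (t%:C * (a +i* b)) = (expR (t * a) * cos (t * b)) +i* (expR (t * a) * sin (t * b)).
  by rewrite cexpE /= !mul0r subr0 addr0.
have dl (c : R) : is_derive s 1 (fun t : R => t * c) c.
  rewrite (_ : (fun t => _) = (fun t => id t) * (cst c)); last by [].
  by apply: is_derive_eq; rewrite /GRing.scale /= mulr0 add0r mulr1.
have d3 : is_derive s 1 (fun t => expR (t * a)) (expR (s * a) * a).
  exact: (is_derive1_comp (g := fun t => t * a) (is_derive_expR (s * a)) (dl a)).
have d4 : is_derive s 1 (fun t => cos (t * b)) (- sin (s * b) * b).
  exact: (is_derive1_comp (g := fun t => t * b) (is_derive_cos (s * b)) (dl b)).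
have d5 : is_derive s 1 (fun t => sin (t * b)) (cos (s * b) * b).
  exact: (is_derive1_comp (g := fun t => t * b) (is_derive_sin (s * b)) (dl b)).
split.
  rewrite (_ : (fun t => _) = (fun t => expR (t * a)) * (fun t => cos (t * b))); last first.
    by apply/funext => t; rewrite E.
  apply: (is_derive_eq (is_deriveM d3 d4)); rewrite E /= /GRing.scale /=; ring.
rewrite (_ : (fun t => _) = (fun t => expR (t * a)) * (fun t => sin (t * b))); last first.
  by apply/funext => t; rewrite E.
apply: (is_derive_eq (is_deriveM d3 d5)); rewrite E /= /GRing.scale /=; ring.
Qed.

(* The mean value theorem for Re (conj (F 1 - F 0) F). *)
Lemma nrm_mean_value F dF (K : R) : (forall s, has_cderive F dF s) ->
  (forall s, 0 <= s <= 1 -> nrm (dF s) <= K) -> nrm (F 1 - F 0) <= K.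
Proof.
move=> dFP HK.
set u := F 1 - F 0.
pose f t := complex.Re u * complex.Re (F t) + complex.Im u * complex.Im (F t).
pose df t := complex.Re u * complex.Re (dF t) + complex.Im u * complex.Im (dF t).
have fd s : is_derive s 1 f (df s).
  have [d1 d2] := dFP s.
  rewrite (_ : f = cst (complex.Re u) * (fun t => complex.Re (F t)) + cst (complex.Im u) * (fun t => complex.Im (F t))); last by [].
  apply: (is_derive_eq (is_deriveD (is_deriveM (is_derive_cst _ _ _) d1) (is_deriveM (is_derive_cst _ _ _) d2))).
  by rewrite /GRing.scale /= /df; ring.
have [c c01] : exists2 c, c \in `]0, 1[%R & f 1 - f 0 = df c * (1 - 0).
  apply: (@MVT _ f df 0 1 ltr01 (fun x _ => fd x)).
  apply: continuous_subspaceT => x; apply: differentiable_continuous.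
  by apply/derivable1_diffP; case: (fd x).
rewrite subr0 mulr1 => E.
have u2 : nrm u ^+ 2 = f 1 - f 0.
  by rewrite nrm_sqr /f /u !raddfB /=; ring.
have CS : df c <= nrm u * nrm (dF c).
  apply: (le_trans (ler_norm _)); rewrite -ler_sqr ?nnegrE ?mulr_ge0 ?nrm_ge0// real_normK ?num_real//.
  rewrite exprMn !nrm_sqr /df; set a := complex.Re u; set b := complex.Im u.
  set a' := complex.Re _; set b' := complex.Im _.
  by rewrite -subr_ge0 (_ : _ - _ = (a * b' - b * a') ^+ 2) ?sqr_ge0//; ring.
have [->|u0] := eqVneq (nrm u) 0; first by apply: le_trans (HK 0 _); rewrite ?nrm_ge0// lexx ler01.
have u0' : 0 < nrm u by rewrite lt_neqAle eq_sym u0 nrm_ge0.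
rewrite -(ler_pM2l u0') -expr2 u2 E (le_trans CS)// ler_wpM2l ?nrm_ge0// HK//.
by move: c01; rewrite in_itv /= => /andP[/ltW -> /ltW ->].
Qed.

Lemma nrm_cexpB1 z : complex.Re z <= 0 -> nrm (cexp z - 1) <= nrm z.
Proof.
move=> z0.
have := @nrm_mean_value (fun t => cexp (t%:C * z)) _ (nrm z) (has_cderive_cexp z).
rewrite mul1r mul0r cexp0; apply => s /andP[s0 _].
rewrite nrmM nrm_cexp ler_piMr ?nrm_ge0// -[leRHS]expR0 ler_expR.
by case: z z0 => a b /= a0; rewrite mul0r subr0 mulr_ge0_le0.
Qed.

Lemma nrm_cexpB1D z : complex.Re z <= 0 -> nrm (cexp z - 1 - z) <= nrm z ^+ 2.
Proof.
move=> z0.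
have := @nrm_mean_value (fun t => cexp (t%:C * z) + (- t%:C * z)) (fun t => z * cexp (t%:C * z) - z) (nrm z ^+ 2).
rewrite mul1r mul0r cexp0 oppr0 mul0r addr0 mulN1r => H.
rewrite (_ : _ - 1 - z = cexp z - z - 1); last by rewrite addrAC.
apply: H => [s|s /andP[s0 s1]].
  apply: has_cderive_eq.
    apply: (has_cderiveD (has_cderive_cexp z s)).
    rewrite (_ : (fun t => _) = fun t => (- z) * t%:C); last first.
      by apply/funext => t; rewrite mulrC mulrN mulNr mulrC.
    apply: (has_cderiveM (has_cderive_cst (- z) s) (has_cderive_id s)).
  by rewrite /= mul0r add0r mulr1.
have -> : z * cexp (s%:C * z) - z = z * (cexp (s%:C * z) - 1) by rewrite mulrBr mulr1.
rewrite nrmM expr2 ler_wpM2l ?nrm_ge0// (le_trans (nrm_cexpB1 _))//.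
  by case: z z0 => a b /= a0; rewrite mul0r subr0 mulr_ge0_le0.
by rewrite nrmM nrm_real ger0_norm// ler_piMl ?nrm_ge0.
Qed.
End ComplexCalculus.

(** * Taylor estimates for polynomials and the exponential *)

Section PolyEstimates.
Context {R : realType}.
Implicit Types (P D : {poly R[i]}) (z : R[i]).

Lemma nrm_horner_le P : exists2 B : R, 0 <= B & forall z, nrm z <= 1 -> nrm P.[z] <= B.
Proof.
exists (\sum_(i < size P) nrm P`_i); first by apply: sumr_ge0 => i _; exact: nrm_ge0.
move=> z z1; rewrite horner_coef (le_trans (nrm_sum _ _ _))//; apply: ler_sum => i _.
by rewrite nrmM ler_piMr ?nrm_ge0// nrmX exprn_ile1// nrm_ge0.
Qed.

Lemma poly_split0 P : exists P1 : {poly R[i]}, P = P1 * 'X + (P.[0])%:P.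
Proof.
elim/poly_ind: P => [|P c _]; first by exists 0; rewrite horner0 mul0r addr0.
by exists P; rewrite hornerMXaddC mulr0 add0r.
Qed.

Lemma nrm_horner_dist0 P : exists2 B : R, 0 <= B &
  forall z, nrm z <= 1 -> nrm (P.[z] - P.[0]) <= B * nrm z.
Proof.
have [P1 E] := poly_split0 P; have [B B0 HB] := nrm_horner_le P1; exists B => // z z1.
by rewrite {1}E hornerMXaddC addrK nrmM ler_wpM2r ?nrm_ge0// HB.
Qed.

(** Letting x tend to 0 kills the constant term; division by x then lowers [k] by one. *)
Lemma small_poly_coef D k (C rho : R) : 0 < rho ->
  (forall x : R, 0 < x < rho -> nrm D.[x%:C] <= C * x ^+ k) ->
  forall i, (i < k)%N -> D`_i = 0.
Proof.
elim: k D => // k IH D rho0 H.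
have [D1 E] := poly_split0 D; have [B B0 HB] := nrm_horner_dist0 D.
have D0 : D.[0] = 0.
  apply/eqP; rewrite -nrm_eq0 eq_le nrm_ge0 andbT; apply/ler_addgt0Pr => e e0; rewrite add0r.
  pose x := Num.min (Num.min 1 (rho / 2)) (e / (B + `|C| + 1)).
  have BC : 0 < B + `|C| + 1 by rewrite ltr_wpDl// addr_ge0.
  have x0 : 0 < x by rewrite !lt_min ltr01 !divr_gt0.
  have x1 : x <= 1 by rewrite !ge_min lexx.
  have xr : x < rho.
    by rewrite (@le_lt_trans _ _ (rho / 2))// ?ltr_pdivrMr ?ltr_pMr ?ltr1n// !ge_min lexx orbT.
  have xe : x * (B + `|C| + 1) <= e by rewrite -ler_pdivlMr// /x ge_min lexx orbT.
  have nx : nrm (x%:C : R[i]) = x by rewrite nrm_real gtr0_norm.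
  have -> : D.[0] = D.[x%:C] - (D.[x%:C] - D.[0]) by rewrite subKr.
  rewrite (le_trans (nrmB _ _))// (le_trans _ xe)// mulrC !mulrDl.
  have h1 := HB x%:C; rewrite nx in h1.
  have h2 : nrm D.[x%:C] <= `|C| * x.
    rewrite (le_trans (H x _)) ?x0 ?xr//.
    rewrite (@le_trans _ _ (`|C| * x ^+ k.+1))// ?ler_wpM2r ?ler_norm ?exprn_ge0 ?(ltW x0)//.
    by rewrite ler_wpM2l// exprS ler_piMr ?(ltW x0)// exprn_ile1// ltW.
  by have := h1 x1; lra.
rewrite D0 addr0 in E.
have H1 (x : R) : 0 < x < rho -> nrm D1.[x%:C] <= C * x ^+ k.
  move=> xr; have /andP[x0 _] := xr; have := H x xr.
  by rewrite {1}E hornerMX nrmM nrm_real gtr0_norm// exprSr mulrA ler_pM2r.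
case=> [_|i ik]; first by rewrite -horner_coef0 D0.
by rewrite E coefMX /=; exact: IH rho0 H1 i ik.
Qed.

Definition exp_poly m : {poly R[i]} := \poly_(k < m) (k`!%:R)^-1.

Lemma deriv_exp_poly m : (exp_poly m.+1)^`() = exp_poly m.
Proof.
apply/polyP => i; rewrite coef_deriv !coef_poly ltnS; case: ifP => _; last by rewrite mul0rn.
by rewrite factS natrM invfM -[LHS]mulr_natr mulrAC mulVf ?mul1r// pnatr_eq0.
Qed.

(** Induction on [m]: along the segment s z, the derivative of the remainder of order m + 1 is z
    times the remainder of order m. *)
Lemma nrm_cexp_taylor m z : nrm (cexp z - (exp_poly m).[z]) <= expR (nrm z) * nrm z ^+ m.
Proof.
elim: m z => [|m IH] z.
  rewrite /exp_poly poly_def big_ord0 horner0 subr0 expr0 mulr1 nrm_cexp ler_expR.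
  by rewrite (le_trans (ler_norm _))// -ler_sqr ?nnegrE ?nrm_ge0// real_normK ?num_real// nrm_sqr lerDl sqr_ge0.
pose F (s : R) := cexp (s%:C * z) + (- (exp_poly m.+1 \Po (z%:P * 'X))).[s%:C].
pose dF (s : R) := z * cexp (s%:C * z) + (- (exp_poly m.+1 \Po (z%:P * 'X)))^`().[s%:C].
have dFE s : dF s = z * (cexp (s%:C * z) - (exp_poly m).[s%:C * z]).
  rewrite /dF derivN deriv_comp deriv_exp_poly derivM derivC derivX hornerN hornerM horner_comp.
  rewrite mul0r add0r mulr1 hornerM !hornerC hornerX [z * s%:C]mulrC mulrBr; congr (_ - _); exact: mulrC.
have := @nrm_mean_value _ F dF (expR (nrm z) * nrm z ^+ m.+1).
rewrite /F !hornerN !horner_comp !hornerM !hornerC !hornerX mul1r mul0r !mulr1 mulr0 cexp0.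
have -> : (exp_poly m.+1).[0] = 1.
  by rewrite horner_coef0 coef_poly /= fact0 invr1.
rewrite subrr subr0; apply => [s|s /andP[s0 s1]].
  exact: has_cderiveD (has_cderive_cexp z s) (has_cderive_horner _ s).
have sz : nrm (s%:C * z) <= nrm z by rewrite nrmM nrm_real ger0_norm// ler_piMl ?nrm_ge0.
rewrite dFE nrmM exprS mulrCA ler_wpM2l ?nrm_ge0// (le_trans (IH _))//.
apply: ler_pM; rewrite ?expR_ge0 ?exprn_ge0 ?nrm_ge0 ?ler_expR//.
by apply: lerXn2r; rewrite ?nnegrE ?nrm_ge0.
Qed.
End PolyEstimates.

(** * The kernel of the Pade approximant *)

Section Pade.
Context {R : realType}.
Variables (n : nat) (p q : {poly R[i]}).
Hypothesis pade : is_subdiagonal_pade n p q.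
Let N := (2 * n + 2)%N.

Let q00 : q`_0 = 1. Proof. by case: pade => _ _ _ + _; rewrite horner_coef0. Qed.
Let sp k : (n < k)%N -> p`_k = 0.
Proof. by case: pade => sz _ _ _ _ nk; rewrite nth_default// sz. Qed.
Let sq k : (n.+1 < k)%N -> q`_k = 0.
Proof. by case: pade => _ sz _ _ _ nk; rewrite nth_default// sz. Qed.

(** The analytic definition in algebraic form: p agrees with q exp modulo X^(2n+2). Multiplying the
    error by q, which does not vanish near 0, makes p - q exp_poly of order x^(2n+2). *)
Lemma pade_coef k : (k < N)%N -> p`_k = \sum_(j < k.+1) q`_j * ((k - j)`!%:R)^-1.
Proof.
case: pade => _ _ _ q0 [C [rho [rho0 HC]]].
have [B B0 HB] := nrm_horner_dist0 q; have [B' B'0 HB'] := nrm_horner_le q.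
pose D := p - q * exp_poly N.
(* Below (B + 1)^-1 the value of q stays at distance less than 1 from q(0) = 1, so it is nonzero. *)
pose r := Num.min (Num.min rho 1) (B + 1)^-1.
have B1 : 0 < B + 1 by rewrite ltr_wpDl.
have r0 : 0 < r by rewrite !lt_min rho0 ltr01 invr_gt0.
have HD (x : R) : 0 < x < r -> nrm D.[x%:C] <= B' * (`|C| + expR 1) * x ^+ N.
  move=> /andP[x0 xr].
  have xrho : x < rho by rewrite (lt_le_trans xr)// !ge_min lexx.
  have x1 : x <= 1 by rewrite (le_trans (ltW xr))// !ge_min lexx !orbT.
  have xB : x < (B + 1)^-1 by rewrite (lt_le_trans xr)// !ge_min lexx !orbT.
  have nx : nrm (x%:C : R[i]) = x by rewrite nrm_real gtr0_norm.
  have qx : q.[x%:C] != 0.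
    apply/eqP => qx; have := HB x%:C; rewrite nx qx q0 sub0r nrmN nrm1 => /(_ x1).
    apply/negP; rewrite -ltNge.
    have h : x * (B + 1) < 1 by rewrite -ltr_pdivlMr// div1r.
    by rewrite mulrC (le_lt_trans _ h)// ler_wpM2l ?(ltW x0)// lerDl.
  have := HC x%:C; rewrite nx => /(_ xrho) h1.
  have h2 := @nrm_cexp_taylor R N x%:C; rewrite nx in h2.
  have -> : D.[x%:C] = q.[x%:C] * ((p.[x%:C] / q.[x%:C] - cexp x%:C) + (cexp x%:C - (exp_poly N).[x%:C])).
    by rewrite /D hornerD hornerN hornerM; generalize (cexp (R:=R) x%:C) => u; field.
  rewrite nrmM -mulrA ler_pM ?nrm_ge0 ?HB' ?nx// (le_trans (nrmD _ _))// mulrDl lerD//.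
    by rewrite (le_trans h1)// ler_wpM2r ?exprn_ge0 ?(ltW x0)// ler_norm.
  by rewrite (le_trans h2)// ler_wpM2r ?exprn_ge0 ?(ltW x0)// ler_expR.
move=> kN; have := small_poly_coef r0 HD kN; rewrite coefB => /eqP; rewrite subr_eq0 => /eqP ->.
rewrite coefM; apply: eq_bigr => j _; rewrite coef_poly (leq_ltn_trans (leq_subr _ _) kN)//.
Qed.

(* The iterated antiderivative of q(d/ds) whose derivatives at 0 and 1 are the
   coefficients of q and p. *)
Definition pade_kernel : {poly R[i]} := \poly_(m < N) (q`_(N.-1 - m) / m`!%:R).
Local Notation Lam := pade_kernel.

Lemma derivn_pade_kernel i : (i < N)%N ->
  Lam^`(i) = \poly_(l < N - i) (q`_(N.-1 - i - l) / l`!%:R).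
Proof.
move=> iN; apply/polyP => l; rewrite coef_derivn !coef_poly ltn_subRL.
case: ifP => _; last by rewrite mul0rn.
rewrite subnDA -[LHS]mulr_natr -mulrA; congr (_ * _).
have -> : (i + l)`! = (l`! * (i + l) ^_ i)%N.
  by rewrite -(ffact_fact (leq_addr l i)) addKn mulnC.
rewrite natrM invfM mulrAC mulfK// pnatr_eq0 -lt0n ffact_gt0 leq_addr//.
Qed.

Lemma pade_kernel_at0 k : (k < N)%N -> Lam^`(N.-1 - k).[0] = q`_k.
Proof.
move=> kN; rewrite derivn_pade_kernel; last by rewrite /N in kN *; lia.
rewrite horner_coef0 coef_poly.
have -> : (0 < N - (N.-1 - k))%N by rewrite /N in kN *; lia.
rewrite fact0 divr1; congr (_`__); rewrite /N in kN *; lia.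
Qed.

(** Taylor expansion of the kernel at 0, evaluated at 1, forms the coefficient of X^k in q exp,
    which is that of p. *)
Lemma pade_kernel_at1 k : (k < N)%N -> Lam^`(N.-1 - k).[1] = p`_k.
Proof.
move=> kN; rewrite derivn_pade_kernel; last by rewrite /N in kN *; lia.
rewrite pade_coef// horner_poly.
have E : (N - (N.-1 - k) = k.+1)%N by rewrite /N in kN *; lia.
rewrite E (reindex_inj rev_ord_inj) /=; apply: eq_bigr => j _.
rewrite expr1n mulr1 subSS; congr (q`__ / _); have := ltn_ord j.
by rewrite /N in kN *; lia.
Qed.

(** These derivatives are coefficients of q and p of index 2n + 1 - k > n + 1, beyond both
    degrees. *)
Lemma pade_kernel_low k : (k < n)%N -> Lam^`(k).[0] = 0 /\ Lam^`(k).[1] = 0.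
Proof.
move=> kn; have E : k = (N.-1 - (N.-1 - k))%N by rewrite /N; lia.
rewrite E pade_kernel_at0 ?pade_kernel_at1; try by rewrite /N; lia.
by rewrite sp ?sq//; rewrite /N; lia.
Qed.

Lemma pade_kernel_n1 : Lam^`(n).[1] = 0.
Proof.
have E : n = (N.-1 - n.+1)%N by rewrite /N; lia.
by rewrite {1}E pade_kernel_at1 ?sp//; rewrite /N; lia.
Qed.

(** The kernel has a zero of order n at 0 and of order n + 1 at 1, because deg q = n + 1 and deg p =
    n. These exhaust its degree 2n + 1, and its leading coefficient is q(0) / (2n + 1)!. *)
Lemma pade_kernelE : Lam = (N.-1`!%:R)^-1 *: ('X^n * ('X - 1) ^+ n.+1).
Proof.
have dvd1 : ('X - 1%:P) ^+ n.+1 %| Lam.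
  have := @nderiv_taylor _ (map_poly polyC Lam) 1%:P ('X - 1%:P) (mulrC _ _).
  rewrite addrC subrK (_ : (map_poly polyC Lam).['X] = Lam); last first.
    by rewrite -/(comp_poly 'X Lam) comp_polyXr.
  move=> E; rewrite E; apply: (big_ind (fun u => ('X - 1%:P) ^+ n.+1 %| u)) => [|u v|i _]; first exact: dvdp0.
    exact: dvdp_add.
  have [ni|ni] := ltnP n i; first by rewrite dvdp_mull// dvdp_exp2l.
  rewrite nderivn_map horner_map /=.
  suff -> : Lam^`N(i).[1] = 0 by rewrite mul0r dvdp0.
  apply: (mulIf (x := i`!%:R)); first by rewrite pnatr_eq0 -lt0n fact_gt0.
  rewrite mul0r mulr_natr -hornerMn -nderivn_def.
  move: ni; rewrite leq_eqVlt => /orP[/eqP ->|/pade_kernel_low[]//].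
  exact: pade_kernel_n1.
have dvdX : 'X^n %| Lam.
  apply/dvdpP; exists (\poly_(m < N - n) Lam`_(n + m)); apply/polyP => k.
  rewrite coefMXn [in RHS]coef_poly; case: ltnP => kn.
    rewrite [LHS]coef_poly; case: ifP => // kN; rewrite sq ?mul0r//; rewrite /N; lia.
  rewrite subnKC// ltn_subLR//; case: ifP => // kN.
  by rewrite [LHS]coef_poly ifF//; apply/negbTE; rewrite -leqNgt in kN *; lia.
have c1 : coprimep ('X : {poly R[i]}) ('X - 1%:P).
  by rewrite coprimep_XsubC /root hornerX oner_eq0.
have cop := coprimep_expl n (coprimep_expr n.+1 c1).
have : 'X^n * ('X - 1%:P) ^+ n.+1 %| Lam by rewrite Gauss_dvdp// dvdX.
have LN : Lam`_N.-1 = (N.-1`!%:R)^-1.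
  rewrite /Lam coef_poly (_ : (N.-1 < N)%N); last by rewrite /N; lia.
  by rewrite subnn q00 div1r.
have Ln0 : Lam`_N.-1 != 0 by rewrite LN invr_eq0 pnatr_eq0 -lt0n fact_gt0.
have szL : size Lam = N.
  apply/eqP; rewrite eqn_leq size_poly /=.
  rewrite leqNgt; apply: contraNN Ln0 => h.
  by rewrite nth_default// -ltnS prednK// /N addn2.
set U := 'X^n * _.
have mU : U \is monic by rewrite monicMr ?monicXn// monic_exp// monicXsubC.
have szU : size U = N.
  rewrite size_Mmonic ?monic_neq0 ?monicXn ?monic_exp ?monicXsubC//.
  by rewrite size_polyXn size_exp_XsubC /N; lia.
move=> /dvdpP[V E].
have V0 : V != 0 by apply: contraNneq Ln0 => V0; rewrite E V0 mul0r coef0.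
have szV : size V = 1%N.
  have := size_Mmonic V0 mU; rewrite -E szL szU /N; lia.
move: E; rewrite (size1_polyC (eq_leq szV)) mul_polyC => E.
have : lead_coef Lam = V`_0 by rewrite E lead_coefZ (monicP mU) mulr1.
by rewrite /lead_coef szL LN => ->.
Qed.
End Pade.

(** * Stability and error of the Pade approximant on the left half-plane *)

Section PadeStability.
Context {R : realType}.

Lemma poly_Re_mean_value (P : {poly R[i]}) (a b c : R) : a < b ->
  (forall s : R, a <= s <= b -> complex.Re P^`().[s%:C] <= c) ->
  complex.Re P.[b%:C] - complex.Re P.[a%:C] <= c * (b - a).
Proof.
move=> ab H.
have fd s := (has_cderive_horner P s).1.
have [s sab ->] : exists2 s, s \in `]a, b[%R &
    complex.Re P.[b%:C] - complex.Re P.[a%:C] = complex.Re P^`().[s%:C] * (b - a).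
  apply: (@MVT _ (fun t => complex.Re P.[t%:C]) (fun t => complex.Re P^`().[t%:C]) a b ab (fun x _ => fd x)).
  apply: continuous_subspaceT => x; apply: differentiable_continuous.
  by apply/derivable1_diffP; case: (fd x).
rewrite ler_wpM2r ?subr_ge0 ?(ltW ab)// H//.
by move: sab; rewrite in_itv /= => /andP[/ltW -> /ltW ->].
Qed.

(** The middle half of [0, 1] alone produces the drop D / 2; elsewhere the real part does not
    increase. *)
Lemma poly_Re_drop (P : {poly R[i]}) (D : R) :
  (forall s : R, 0 <= s <= 1 -> complex.Re P^`().[s%:C] <= 0) ->
  (forall s : R, 4^-1 <= s <= 1 - 4^-1 -> complex.Re P^`().[s%:C] <= - D) ->
  complex.Re P.[1] + D / 2 <= complex.Re P.[0].
Proof.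
move=> H0 H1.
have h1 : complex.Re P.[(4^-1)%:C] - complex.Re P.[0%:C] <= 0 * (4^-1 - 0).
  apply: poly_Re_mean_value => [|s /andP[s0 s1]]; first lra.
  by apply: H0; rewrite s0 (le_trans s1)//; lra.
have h2 : complex.Re P.[(1 - 4^-1)%:C] - complex.Re P.[(4^-1)%:C] <= - D * (1 - 4^-1 - 4^-1).
  by apply: poly_Re_mean_value => //; lra.
have h3 : complex.Re P.[1%:C] - complex.Re P.[(1 - 4^-1)%:C] <= 0 * (1 - (1 - 4^-1)).
  apply: poly_Re_mean_value => [|s /andP[s0 s1]]; first lra.
  by apply: H0; rewrite s1 (le_trans _ s0)//; lra.
move: h1 h2 h3; move: (complex.Re _) (complex.Re _) (complex.Re _) (complex.Re _) => x y z t; lra.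
Qed.

Lemma derivn_comp (P : {poly R[i]}) i j : P^`(i)^`(j) = P^`(j + i).
Proof. by rewrite /derivn iterD. Qed.

Variables (n : nat) (p q : {poly R[i]}).
Hypothesis pade : is_subdiagonal_pade n p q.
Local Notation N := (2 * n + 2)%N.
Local Notation Lam := (pade_kernel n q).
Let kap : R := (N.-1`!%:R)^-1.

Let kap_gt0 : 0 < kap. Proof. by rewrite invr_gt0 ltr0n fact_gt0. Qed.

(** The explicit form shows that the kernel is real, although [p] and [q] are given as complex
    polynomials. *)
Let LamR : {poly R} := kap *: ('X^n * ('X - 1) ^+ n.+1).

Let LamE : Lam = map_poly (real_complex R) LamR.
Proof.
rewrite (pade_kernelE pade) map_polyZ rmorphM !rmorphXn /= rmorphB /= map_polyX rmorph1.
by rewrite /kap fmorphV/= rmorph_nat.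
Qed.

Let Lam_real k (s : R) : Lam^`(k).[s%:C] = (LamR^`(k).[s])%:C.
Proof. by rewrite LamE derivn_map horner_map. Qed.

Lemma pade_kernel_value (s : R) : Lam.[s%:C] = ((N.-1`!%:R)^-1 * (s ^+ n * (s - 1) ^+ n.+1))%:C.
Proof. by have := Lam_real 0 s; rewrite !derivn0 => ->; rewrite /LamR !(hornerZ, hornerM, horner_exp, hornerD, hornerN, hornerX, hornerC). Qed.

Section Interpolant.
Variable w : R[i].

(** The sum of w^(N-1-k) Lam^(k) is a path from q(w) at 0 to p(w) at 1. It solves a linear equation
    with rate w, up to a small forcing term, which makes it comparable with the exponential. *)
Lemma pade_interpolant0 : (\sum_(k < N) w ^+ (N.-1 - k) *: Lam^`(k)).[0] = q.[w].
Proof.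
have [_ sq _ _ _] := pade.
rewrite horner_sum (horner_coef_wide w (n := N)); last by rewrite sq; lia.
rewrite (reindex_inj rev_ord_inj) /=; apply: eq_bigr => k _; rewrite hornerZ.
have kN := ltn_ord k.
have -> : (N - k.+1 = N.-1 - k)%N by lia.
rewrite (pade_kernel_at0 q kN) mulrC; congr (_ * w ^+ _); lia.
Qed.

Lemma pade_interpolant1 : (\sum_(k < N) w ^+ (N.-1 - k) *: Lam^`(k)).[1] = p.[w].
Proof.
have [sp _ _ _ _] := pade.
rewrite horner_sum (horner_coef_wide w (n := N)); last by rewrite sp; lia.
rewrite (reindex_inj rev_ord_inj) /=; apply: eq_bigr => k _; rewrite hornerZ.
have kN := ltn_ord k.
have -> : (N - k.+1 = N.-1 - k)%N by lia.
rewrite (pade_kernel_at1 pade kN) mulrC; congr (_ * w ^+ _); lia.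
Qed.

Let LamN k : (N <= k)%N -> Lam^`(k) = 0.
Proof. by move=> Nk; apply: derivn_poly0; apply: leq_trans Nk; exact: size_poly. Qed.

(** Differentiation shifts the sum by one index; the top term vanishes since Lam has degree less
    than N, and the bottom one is the forcing term. *)
Lemma deriv_pade_interpolant m : (m < N)%N ->
  (\sum_(m <= k < N) w ^+ (N.-1 - k) *: Lam^`(k))^`() =
  w *: (\sum_(m <= k < N) w ^+ (N.-1 - k) *: Lam^`(k)) - w ^+ (N - m) *: Lam^`(m).
Proof.
move=> mN; apply/eqP; rewrite eq_sym subr_eq -subr_eq0 opprD addrA; apply/eqP.
rewrite scaler_sumr linear_sum -sumrB /= (eq_big_nat _ _ (F2 := fun k =>
  - (w ^+ (N - k.+1) *: Lam^`(k.+1) - w ^+ (N - k) *: Lam^`(k)))); last first.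
  move=> k /andP[_ kN]; rewrite scalerA -exprS derivZ -derivnS opprB.
  by congr (w ^+ _ *: _ - w ^+ _ *: _); lia.
rewrite sumrN (telescope_sumr (fun k => w ^+ (N - k) *: Lam^`(k)) (ltnW mN)) LamN// scaler0 sub0r opprK.
by rewrite subrr.
Qed.

(** Derivatives of the kernel of order less than n vanish at 0 and 1, so dropping them keeps the end
    values. What is left has degree n + 1 and a constant derivative of that order. *)
Let Y : {poly R[i]} := \sum_(n <= k < N) w ^+ (N.-1 - k) *: Lam^`(k).

Let Y_end (e : R[i]) : (e = 0) \/ (e = 1) -> Y.[e] = (\sum_(k < N) w ^+ (N.-1 - k) *: Lam^`(k)).[e].
Proof.
move=> he; rewrite -(big_mkord xpredT (fun k => w ^+ (N.-1 - k) *: Lam^`(k))).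
rewrite (big_cat_nat (n := n))//=; last by lia.
rewrite hornerD -[LHS]add0r; congr (_ + _); rewrite horner_sum big_nat big1// => k /andP[_ kn].
have [l0 l1] := pade_kernel_low pade kn.
by rewrite hornerZ; case: he => ->; rewrite ?l0 ?l1 mulr0.
Qed.

Let dY : Y^`() = w *: (Y - w ^+ n.+1 *: Lam^`(n)).
Proof.
rewrite /Y deriv_pade_interpolant; last by lia.
by rewrite scalerBr scalerA -exprS; congr (_ - w ^+ _ *: _); lia.
Qed.

Let dYn : Y^`(n.+1) = (w ^+ n.+1)%:P.
Proof.
have E k : (w ^+ (N.-1 - k) *: Lam^`(k))^`(n.+1) = w ^+ (N.-1 - k) *: Lam^`(n.+1 + k).
  by rewrite derivnZ derivn_comp.
rewrite /Y linear_sum big_ltn; last by lia.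
rewrite big_nat big1 ?addr0; last first.
  move=> k /andP[nk kN]; transitivity (w ^+ (N.-1 - k) *: Lam^`(n.+1 + k)); first exact: E.
  by rewrite LamN ?scaler0//; lia.
transitivity (w ^+ (N.-1 - n) *: Lam^`(n.+1 + n)); first exact: E.
rewrite derivn_pade_kernel; last by lia.
have -> : (N - (n.+1 + n) = 1)%N by lia.
rewrite poly_def big_ord1 /= expr0 fact0 divr1 alg_polyC -mul_polyC -polyCM.
rewrite (_ : (_ - _ - 0 = 0)%N); last by lia.
have [_ _ _ q0 _] := pade; rewrite -horner_coef0 q0 mulr1; congr (w ^+ _)%:P; lia.
Qed.

(** The boundary terms of n integrations by parts of Y' Lam^(n). They vanish at both ends, and what
    remains of the integrand is a multiple of Lam. *)
Let Br : {poly R[i]} := \sum_(0 <= j < n) (-1) ^+ j *: (Y^`(j.+1) * Lam^`(n - j.+1)).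

Let dBr : Br^`() = Y^`() * Lam^`(n) - ((-1) ^+ n * w ^+ n.+1) *: Lam.
Proof.
rewrite /Br linear_sum /= (eq_big_nat _ _ (F2 := fun j =>
  - ((-1) ^+ j.+1 *: (Y^`(j.+2) * Lam^`(n - j.+1)) - (-1) ^+ j *: (Y^`(j.+1) * Lam^`(n - j))))); last first.
  move=> j /andP[_ jn]; rewrite derivZ derivM -!derivnS exprS mulN1r scaleNr opprB opprK scalerDr addrC.
  by congr (_ *: (_ * Lam^`(_)) + _); lia.
rewrite sumrN (telescope_sumr (fun j => (-1) ^+ j *: (Y^`(j.+1) * Lam^`(n - j))))// opprB.
by rewrite subn0 expr0 scale1r derivn1 subnn derivn0 dYn mul_polyC scalerA.
Qed.

Let Br_end (e : R[i]) : (e = 0) \/ (e = 1) -> Br.[e] = 0.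
Proof.
move=> he; rewrite horner_sum big_nat big1// => j /andP[_ jn].
have [l0 l1] := pade_kernel_low pade (k := n - j.+1) ltac:(lia).
by rewrite hornerZ hornerM; case: he => ->; rewrite ?l0 ?l1 !mulr0.
Qed.

(** |Y|^2 corrected by a multiple of [Br], which does not change the end values |q(w)|^2 and
    |p(w)|^2. The correction completes the square in the derivative and leaves a term of fixed sign,
    as Lam has constant sign on [0, 1]. *)
Let Psi : {poly R[i]} := Y * map_poly conjc Y - (2 * conjc w ^+ n.+1) *: Br.

Let Psi_end (e : R[i]) : (e = 0) \/ (e = 1) -> complex.Re Psi.[e] = nrm Y.[e] ^+ 2.
Proof.
move=> he; rewrite hornerD hornerN hornerZ hornerM (Br_end he) mulr0 subr0.
have -> : (map_poly conjc Y).[e] = conjc Y.[e].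
  rewrite -horner_map; congr (_.[_]); by case: he => ->; rewrite ?rmorph0 ?rmorph1.
by rewrite nrm_sqr; case: (Y.[e]) => a b /=; ring.
Qed.

Let dPsi (s : R) : complex.Re w <= 0 -> complex.Re Psi^`().[s%:C] <=
  - (2 * nrm w ^+ N * kap * (s ^+ n * (1 - s) ^+ n.+1)).
Proof.
move=> w0; rewrite /Psi derivB derivZ derivM dBr deriv_map !(hornerD, hornerN, hornerZ, hornerM).
have CJ (Q : {poly R[i]}) : (map_poly conjc Q).[s%:C] = conjc Q.[s%:C].
  rewrite -[in LHS](_ : conjc s%:C = s%:C) ?horner_map//; by rewrite /= oppr0.
rewrite !CJ dY !(hornerD, hornerN, hornerZ, hornerM) (_ : Lam^`(n).[s%:C] = (LamR^`(n).[s])%:C) ?Lam_real//.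
set l := LamR^`(n).[s]; set y := Y.[s%:C]; rewrite pade_kernel_value -/kap.
have -> : kap * (s ^+ n * (s - 1) ^+ n.+1) = (-1) ^+ n * - (kap * (s ^+ n * (1 - s) ^+ n.+1)).
  rewrite -(opprB 1 s) [in LHS]exprNn exprS; ring.
set L := kap * _; rewrite -(rmorphN1 (real_complex R)) -rmorphXn /= -rmorphXn.
set W := w ^+ n.+1; have -> : nrm w ^+ N = nrm W ^+ 2 by rewrite nrmX -exprM; congr (_ ^+ _); lia.
have sg : ((-1) ^+ n) ^+ 2 = 1 :> R by rewrite -exprM mulnC exprM sqrrN !expr1n.
rewrite nrm_sqr; move: sg; set e := (-1) ^+ n => sg.
rewrite (_ : _ * kap * _ = 2 * (complex.Re W ^+ 2 + complex.Im W ^+ 2) * L); last by rewrite /L; ring.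
rewrite -subr_le0; set Z := (X in X <= 0).
(* The completed square: 2 Re w |Y - w^(n+1) Lam^(n)|^2, nonpositive on the left half-plane. *)
suff -> : Z = 2 * complex.Re w * (complex.Re (y - W * l%:C) ^+ 2 + complex.Im (y - W * l%:C) ^+ 2).
  rewrite mulr_le0_ge0 ?addr_ge0 ?sqr_ge0// mulr_ge0_le0//.
rewrite /Z; case: (w) (y) (W) => a b [c d'] [x z] /=.
ring: sg.
Qed.

(** The drop of Re Psi over [0, 1], using s^n (1 - s)^(n+1) >= 4^(-(2n+1)) on the middle half.
    Besides |p| <= |q| it gives a lower bound for |q(w)|, which the error estimate needs. *)
Lemma pade_energy : complex.Re w <= 0 ->
  nrm p.[w] ^+ 2 + nrm w ^+ N * kap * (4^-1) ^+ N <= nrm q.[w] ^+ 2.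
Proof.
move=> w0.
have H0 : nrm q.[w] ^+ 2 = complex.Re Psi.[0%:C] by rewrite Psi_end ?Y_end ?pade_interpolant0//; left.
have H1 : nrm p.[w] ^+ 2 = complex.Re Psi.[1%:C] by rewrite Psi_end ?Y_end ?pade_interpolant1//; right.
have K0 : 0 <= 2 * nrm w ^+ N * kap by rewrite !mulr_ge0 ?exprn_ge0 ?nrm_ge0// ltW.
have neg (s : R) : 0 <= s <= 1 -> complex.Re Psi^`().[s%:C] <= 0.
  move=> /andP[s0 s1]; rewrite (le_trans (dPsi s w0))// oppr_le0 !mulr_ge0 ?exprn_ge0 ?nrm_ge0 ?subr_ge0//.
  exact: ltW.
have a2 (s : R) : 4^-1 <= s <= 1 - 4^-1 ->
    complex.Re Psi^`().[s%:C] <= - (2 * nrm w ^+ N * kap * (4^-1) ^+ N.-1).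
  move=> /andP[s1 s2]; rewrite (le_trans (dPsi s w0))// lerN2 ler_wpM2l//.
  have q0 : (0 : R) <= 4^-1 by rewrite invr_ge0.
  have s1' : 4^-1 <= 1 - s by rewrite lerBrDr -lerBrDl.
  rewrite (_ : N.-1 = n + n.+1)%N; last by lia.
  by rewrite exprD ler_pM ?exprn_ge0 ?lerXn2r ?nnegrE ?(le_trans q0 s1) ?(le_trans q0 s1').
rewrite H0 H1 (le_trans _ (poly_Re_drop neg a2))// lerD2l.
have -> : (4^-1) ^+ N = 4^-1 * (4^-1) ^+ N.-1 :> R by rewrite -exprS; congr (_ ^+ _); lia.
have half (x y z : R) : 2 * x * y * z / 2 = x * y * z by field.
rewrite half ler_wpM2l//.
  by rewrite mulr_ge0 ?exprn_ge0 ?nrm_ge0 ?ltW.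
by rewrite ler_piMl ?exprn_ge0 ?invr_ge0// invf_le1 ?ler1n.
Qed.

Lemma pade_denominator_neq0 : complex.Re w <= 0 -> q.[w] != 0.
Proof.
move=> w0; have [->|wn0] := eqVneq w 0; first by case: pade => _ _ _ -> _; exact: oner_neq0.
apply/eqP => q0; have := pade_energy w0; rewrite q0 nrm0 expr0n /=; apply/negP; rewrite -ltNge.
rewrite ltr_wpDl ?sqr_ge0//.
by rewrite !mulr_gt0 ?exprn_gt0 ?invr_gt0// lt_neqAle nrm_ge0 eq_sym nrm_eq0 wn0.
Qed.

Lemma pade_contractive : complex.Re w <= 0 -> nrm (p.[w] / q.[w]) <= 1.
Proof.
move=> w0; rewrite nrmM nrmV ler_pdivrMr ?mul1r; last first.
  by rewrite lt_neqAle nrm_ge0 eq_sym nrm_eq0 pade_denominator_neq0.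
rewrite -ler_sqr ?nnegrE ?nrm_ge0// (le_trans _ (pade_energy w0))// lerDl.
by rewrite !mulr_ge0 ?exprn_ge0 ?invr_ge0 ?nrm_ge0// ltW.
Qed.

(** Variation of constants: e^(-sw) W(s), with W the full interpolant, has derivative -e^(-sw) w^N
    Lam(s). Hence |q(w)| times the error is at most |w|^N / (2n + 1)!. Squaring and dividing by the
    lower bound |w|^N 4^(-N) / (2n + 1)! of |q(w)|^2 leaves a single factor |w|^N. *)
Lemma pade_exp_error : complex.Re w = 0 ->
  nrm (p.[w] / q.[w] - cexp w) ^+ 2 <= nrm w ^+ N * kap * 4 ^+ N.
Proof.
move=> w0; have w0' : complex.Re w <= 0 by rewrite w0.
have qw := pade_denominator_neq0 w0'.
pose Wp : {poly R[i]} := \sum_(k < N) w ^+ (N.-1 - k) *: Lam^`(k).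
have dWp : Wp^`() = w *: Wp - w ^+ N *: Lam.
  by rewrite /Wp -(big_mkord xpredT (fun k => w ^+ (N.-1 - k) *: Lam^`(k))) deriv_pade_interpolant ?subn0//; lia.
have nw (s : R) : nrm (cexp (s%:C * w)) = 1.
  by rewrite nrm_cexp; case: (w) w0 => a b /= ->; rewrite mulr0 mul0r subr0 expR0.
have nwN (s : R) : nrm (cexp (s%:C * - w)) = 1.
  by rewrite nrm_cexp; case: (w) w0 => a b /= ->; rewrite oppr0 mulr0 mul0r subr0 expR0.
pose F (s : R) := cexp (s%:C * - w) * Wp.[s%:C].
have := @nrm_mean_value _ F (fun s => (- w * cexp (s%:C * - w)) * Wp.[s%:C] + cexp (s%:C * - w) * Wp^`().[s%:C])
   (nrm w ^+ N * kap).
have -> : F 1 - F 0 = - (cexp (- w) * q.[w]) * (cexp w - p.[w] / q.[w]).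
  rewrite /F mul1r mul0r cexp0 mul1r pade_interpolant1 pade_interpolant0 mulrBr.
  have cc : cexp (- w) * cexp w = 1 by rewrite -cexpD addNr cexp0.
  rewrite !mulNr opprK [_ * q.[w] * cexp w]mulrAC cc mul1r addrC; congr (_ + _).
  by move: (cexp (- w)) => u; field.
rewrite nrmM nrmN nrmM -[- w]mul1r (_ : nrm (cexp (1 * - w)) = 1); last first.
  by rewrite mulrN -mulNr; have := nw (-1); rewrite rmorphN1.
rewrite mul1r nrm_dist => H; rewrite mul1r in H.
have {}H : nrm q.[w] * nrm (p.[w] / q.[w] - cexp w) <= nrm w ^+ N * kap.
  apply: H => [s|s /andP[s0 s1]].
    exact: has_cderiveM (has_cderive_cexp _ s) (has_cderive_horner _ s).
  rewrite dWp !(hornerD, hornerN, hornerZ) pade_kernel_value -/kap.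
  rewrite (_ : _ + _ = - (cexp (s%:C * - w) * (w ^+ N * (kap * (s ^+ n * (s - 1) ^+ n.+1))%:C))); last first.
    have alg (u v x y : R[i]) : - w * u * v + u * (w * v - y * x) = - (u * (y * x)) by ring.
    exact: alg.
  rewrite nrmN nrmM nwN mul1r nrmM nrmX ler_wpM2l ?exprn_ge0 ?nrm_ge0//.
  rewrite nrm_real normrM (gtr0_norm kap_gt0) ler_piMr ?(ltW kap_gt0)// normrM !normrX.
  by rewrite mulr_ile1 ?exprn_ge0// exprn_ile1// ler_norml; lra.
have E := pade_energy w0'.
have q2 : nrm w ^+ N * kap * 4^-1 ^+ N <= nrm q.[w] ^+ 2.
  by rewrite (le_trans _ E)// lerDr sqr_ge0.
have H2 : nrm q.[w] ^+ 2 * nrm (p.[w] / q.[w] - cexp w) ^+ 2 <= (nrm w ^+ N * kap) ^+ 2.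
  by rewrite -exprMn lerXn2r ?nnegrE ?mulr_ge0 ?exprn_ge0 ?nrm_ge0// ltW.
have [wz|wn0] := eqVneq w 0.
  rewrite wz; case: pade => _ _ -> -> _; rewrite cexp0 divr1 subrr nrm0 expr0n /=.
  by rewrite !mulr_ge0 ?exprn_ge0 ?nrm_ge0 ?(ltW kap_gt0).
have A0 : 0 < nrm w ^+ N * kap by rewrite mulr_gt0// exprn_gt0// lt_neqAle nrm_ge0 eq_sym nrm_eq0 wn0.
move: A0 H2 q2; set A := nrm w ^+ N * kap; set e := nrm (_ - _) => A0 H2 q2.
have c0 : (0 : R) < 4^-1 ^+ N by rewrite exprn_gt0 ?invr_gt0.
rewrite -(ler_pM2l (mulr_gt0 A0 c0)) (@le_trans _ _ (A ^+ 2))//.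
  by rewrite (le_trans _ H2)// ler_wpM2r ?sqr_ge0.
by rewrite [leRHS]mulrACA -exprMn mulVf ?pnatr_eq0// expr1n mulr1 -expr2.
Qed.
End Interpolant.
End PadeStability.

(** * The symbol error, uniformly in the degree *)

Section PadeErrorBound.
Context {R : realType}.

(** From N^N / N! <= e^N with N = 2(n + 1); the extra factor N is absorbed by 2^N. *)
Lemma inv_fact_le n : ((2 * n + 1)`!%:R)^-1 <= (expR 1 / n.+1%:R) ^+ (2 * n + 2) :> R.
Proof.
have E : (2 * n + 2 = (2 * n + 1).+1)%N by lia.
set N := (2 * n + 2)%N.
have h : N%:R ^+ N / (N`!%:R) <= expR 1 ^+ N :> R.
  rewrite -expRM_natl mulr1; apply: le_trans (expR_ge1Dxn (2 * n + 1) (ler0n R N)).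
  by rewrite -E lerDr.
have f0 k : 0 < k`!%:R :> R by rewrite ltr0n fact_gt0.
move: h; rewrite ler_pdivrMr// => h.
have -> : ((2 * n + 1)`!%:R)^-1 = N%:R / N`!%:R :> R.
  rewrite {2}/N E factS natrM -E invfM mulrA mulfV ?mul1r// pnatr_eq0 /N; lia.
rewrite ler_pdivrMr// expr_div_n mulrAC ler_pdivlMr ?exprn_gt0 ?ltr0n//.
apply: le_trans h; rewrite {2}/N (_ : 2 * n + 2 = 2 * n.+1)%N; last by lia.
have -> : (2 * n.+1 = N)%N by rewrite /N; lia.
have {2}-> : N%:R = 2 * n.+1%:R :> R by rewrite -natrM; congr _%:R; rewrite /N; lia.
rewrite exprMn; apply: ler_wpM2r; first by rewrite exprn_ge0.
by rewrite -natrX ler_nat ltnW// ltn_expl.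
Qed.

(* [b] is at most [2] and at most [u ^ k]: interpolate between the two. *)
Lemma powR_cover (u a b : R) (k : nat) : 0 <= u -> 0 <= a <= k%:R ->
  b <= 2 -> b <= u ^+ k -> b <= 2 * u `^ a.
Proof.
move=> u0 /andP[a0 ak] b2 bu; have [u1|/ltW u1] := leP u 1; last first.
  by rewrite (le_trans b2)// ler_pMr// -[leLHS](powRr0 u) ler_powR.
rewrite (le_trans bu)// -powR_mulrn//; have [->|un0] := eqVneq u 0.
  by rewrite (le_trans _ (ler_peMl (powR_ge0 _ _) _)) ?ler1n//; move: ak; rewrite le_eqVlt => /predU1P[->//|ak]; rewrite powR0 ?powR_ge0// gt_eqF// (le_lt_trans a0).
have u0' : 0 < u by rewrite lt_neqAle eq_sym un0.
rewrite (le_trans _ (ler_peMl (powR_ge0 _ _) _)) ?ler1n//.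
by rewrite ger_powR// u0' u1.
Qed.

(** With u = 4 e |w| / (n + 1), the error is at most 2 by contractivity and at most u^(n+1) by the
    error bound and the estimate of the factorial. Interpolation reaches every exponent a <= n + 1
    with a constant independent of n. *)
Lemma pade_symbol_large (p q : nat -> {poly R[i]}) (a : R) :
  (forall n, (0 < n)%N -> is_subdiagonal_pade n (p n) (q n)) -> 0 <= a ->
  exists2 C : R, 0 <= C & forall n, (0 < n)%N -> a <= n.+1%:R ->
    forall w, complex.Re w = 0 ->
    nrm ((p n).[w] / (q n).[w] - cexp w) <= C * (nrm w / n.+1%:R) `^ a.
Proof.
move=> padeP a0; exists (2 * (4 * expR 1) `^ a); first by rewrite mulr_ge0 ?powR_ge0.
move=> n n0 an w w0; have pn := padeP n n0.
have e0 : 0 <= expR 1 :> R by exact: expR_ge0.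
have w0' : complex.Re w <= 0 by rewrite w0.
rewrite -mulrA -powRM ?mulr_ge0 ?nrm_ge0 ?invr_ge0//.
apply: (powR_cover (k := n.+1)); rewrite ?a0 ?mulr_ge0 ?nrm_ge0 ?invr_ge0//.
  rewrite (le_trans (nrmB _ _))// nrm_cexp w0 expR0 (_ : 2 = 1 + 1)//.
  by rewrite lerD2r (pade_contractive pn w0').
rewrite -ler_sqr ?nnegrE ?nrm_ge0 ?exprn_ge0 ?mulr_ge0 ?nrm_ge0 ?invr_ge0//.
rewrite (le_trans (pade_exp_error pn w0))// -exprM.
rewrite (_ : (n.+1 * 2 = 2 * n + 2)%N); last by lia.
have -> : 4 * expR 1 * (nrm w / n.+1%:R) = nrm w * (expR 1 / n.+1%:R) * 4.
  by move: (expR 1) (n.+1%:R^-1) => x y; ring.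
rewrite !exprMn; apply: ler_wpM2r; first by rewrite exprn_ge0.
apply: ler_wpM2l; first by rewrite exprn_ge0 ?nrm_ge0.
have := inv_fact_le n; rewrite exprMn; by have -> : ((2 * n + 2).-1 = 2 * n + 1)%N by lia.
Qed.

(** Exponents up to 2n + 2 come from the order of contact at 0; the constant depends on n. *)
Lemma pade_symbol_fixed n (p q : {poly R[i]}) (a : R) :
  is_subdiagonal_pade n p q -> 0 <= a <= (2 * n + 2)%:R ->
  exists2 C : R, 0 <= C & forall w, complex.Re w = 0 ->
    nrm (p.[w] / q.[w] - cexp w) <= C * (nrm w / n.+1%:R) `^ a.
Proof.
move=> pn /andP[a0 aN]; have [_ _ _ _ [C [rho [rho0 HC]]]] := pn.
pose r := Num.min rho 1; have r0 : 0 < r by rewrite lt_min rho0 ltr01.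
have n0 : 0 < n.+1%:R :> R by rewrite ltr0n.
exists ((`|C| + 2 * (r^-1) `^ a) * n.+1%:R `^ a).
  by rewrite mulr_ge0 ?addr_ge0 ?mulr_ge0 ?powR_ge0.
move=> w w0; have w0' : complex.Re w <= 0 by rewrite w0.
rewrite -mulrA -powRM ?mulr_ge0 ?nrm_ge0 ?invr_ge0 ?(ltW n0)// mulrCA mulfV ?gt_eqF// mulr1 mulrDl.
have [wr|rw] := ltP (nrm w) r.
  rewrite (le_trans (HC w _))//; first by rewrite (lt_le_trans wr)// ge_min lexx.
  rewrite (le_trans _ (ler_wpDr _ (lexx _)))//; last by rewrite !mulr_ge0 ?powR_ge0.
  rewrite (@le_trans _ _ (`|C| * nrm w ^+ (2 * n + 2)))//.
    by rewrite ler_wpM2r ?exprn_ge0 ?nrm_ge0 ?ler_norm.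
  rewrite ler_wpM2l//; have [w00|wn0] := eqVneq (nrm w) 0.
    by rewrite w00 expr0n addn2 /= powR_ge0.
  have wp : 0 < nrm w by rewrite lt_neqAle eq_sym wn0 nrm_ge0.
  by rewrite -powR_mulrn ?nrm_ge0// ger_powR// wp (le_trans (ltW wr))// ge_min lexx orbT.
rewrite (le_trans _ (ler_wpDl _ (lexx _)))//; last by rewrite mulr_ge0 ?powR_ge0.
rewrite -mulrA -powRM ?nrm_ge0 ?invr_ge0 ?(ltW r0)//.
have b2 : nrm (p.[w] / q.[w] - cexp w) <= 2.
  rewrite (le_trans (nrmB _ _))// nrm_cexp w0 expR0 (_ : 2 = 1 + 1)//.
  by rewrite lerD2r (pade_contractive pn w0').
rewrite (le_trans b2)// ler_pMr// -[leLHS](powRr0 (r^-1 * nrm w)) ler_powR//.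
by rewrite mulrC ler_pdivlMr// mul1r.
Qed.

(** Only finitely many n have n + 1 < a; the sum of their separate constants covers them. *)
Lemma pade_symbol_error (p q : nat -> {poly R[i]}) (a : R) :
  (forall n, (0 < n)%N -> is_subdiagonal_pade n (p n) (q n)) -> 0 <= a ->
  exists2 C : R, 0 <= C & forall n, (0 < n)%N -> a <= (2 * n + 2)%:R ->
    forall w, complex.Re w = 0 ->
    nrm ((p n).[w] / (q n).[w] - cexp w) <= C * (nrm w / n.+1%:R) `^ a.
Proof.
move=> padeP a0; have [C1 C10 H1] := pade_symbol_large padeP a0.
have ex n : exists Cn : R, 0 <= Cn /\
   ((0 < n)%N -> a <= (2 * n + 2)%:R -> forall w, complex.Re w = 0 ->
    nrm ((p n).[w] / (q n).[w] - cexp w) <= Cn * (nrm w / n.+1%:R) `^ a).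
  have [n0|n0] := posnP n; first by exists 0; split.
  have [aN|aN] := leP a (2 * n + 2)%:R; last by exists 0; split=> // _ /le_gtF; rewrite aN.
  have := @pade_symbol_fixed n (p n) (q n) a (padeP n n0).
  by rewrite a0 aN => -[]// C C0 HC; exists C; split.
have [Cf HCf] := choice ex.
pose M := (Num.truncn a).+1.
have S0 : 0 <= \sum_(i < M) Cf i by apply: sumr_ge0 => i _; case: (HCf i).
exists (C1 + \sum_(i < M) Cf i); first by rewrite addr_ge0.
move=> n n0 aN w w0; rewrite mulrDl; have [an|na] := leP a n.+1%:R.
  by rewrite (le_trans (H1 n n0 an w w0))// lerDl mulr_ge0 ?powR_ge0.
have nM : (n < M)%N.
  by rewrite -(ltr_nat R) (le_lt_trans _ (lt_trans na (truncnS_gt a)))// ler_nat.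
rewrite (le_trans ((HCf n).2 n0 aN w w0))// -mulrDl ler_wpM2r ?powR_ge0//.
rewrite (bigD1 (Ordinal nM))//= addrCA lerDl addr_ge0//.
by apply: sumr_ge0 => i _; case: (HCf i).
Qed.
End PadeErrorBound.

(** * Functions of the semigroup at a fixed step *)

Section StrongLimits.
Context {R : realType} {X : completeNormedModType R[i]}.
Implicit Types (u v : nat -> X) (l : X).

Definition tends u l := forall e : R, 0 < e ->
  exists N, forall n, (N <= n)%N -> nrm (u n - l) <= e.

Lemma nrm_le0_eq (x : X) : (forall e : R, 0 < e -> nrm x <= e) -> x = 0.
Proof.
move=> H; apply/eqP; rewrite -nrm_eq0 eq_le nrm_ge0 andbT.
by apply/ler_addgt0Pr => e e0; rewrite add0r H.
Qed.

Lemma tends_unique u l l' : tends u l -> tends u l' -> l = l'.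
Proof.
move=> ul ul'; apply/eqP; rewrite -subr_eq0; apply/eqP; apply: nrm_le0_eq => e e0.
have [N HN] := ul _ (divr_gt0 e0 (ltr0n R 2)); have [N' HN'] := ul' _ (divr_gt0 e0 (ltr0n R 2)).
rewrite (le_trans (nrm_triangle (u (maxn N N')) _ _))// (splitr e) lerD//.
  by rewrite nrm_dist HN// leq_maxl.
by rewrite HN'// leq_maxr.
Qed.

Lemma tends_cst l : tends (fun=> l) l.
Proof. by move=> e e0; exists 0%N => n _; rewrite subrr nrm0 ltW. Qed.

Lemma tendsD u v l l' : tends u l -> tends v l' -> tends (fun n => u n + v n) (l + l').
Proof.
move=> ul vl e e0.
have [N HN] := ul _ (divr_gt0 e0 (ltr0n R 2)); have [N' HN'] := vl _ (divr_gt0 e0 (ltr0n R 2)).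
exists (maxn N N') => n; rewrite geq_max => /andP[nN nN'].
by rewrite opprD addrACA (le_trans (nrmD _ _))// (splitr e) lerD ?HN ?HN'.
Qed.

Lemma tendsZ (c : R[i]) u l : tends u l -> tends (fun n => c *: u n) (c *: l).
Proof.
move=> ul e e0; have c0 : 0 < nrm c + 1 by rewrite ltr_wpDl ?nrm_ge0.
have [N HN] := ul _ (divr_gt0 e0 c0); exists N => n nN.
rewrite -scalerBr nrmZ (@le_trans _ _ ((nrm c + 1) * nrm (u n - l)))//.
  by rewrite ler_wpM2r ?nrm_ge0// lerDl.
by rewrite mulrC -ler_pdivlMr// HN.
Qed.

Lemma tendsB u v l l' : tends u l -> tends v l' -> tends (fun n => u n - v n) (l - l').
Proof.
move=> ul vl; have := tendsD ul (tendsZ (-1) vl).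
rewrite scaleN1r (_ : (fun n => _) = (fun n => u n - v n))//.
by apply/funext => n; rewrite scaleN1r.
Qed.

Lemma tends_le u l (B : R) : tends u l -> (forall n, nrm (u n) <= B) -> nrm l <= B.
Proof.
move=> ul HB; apply/ler_addgt0Pr => e e0; have [N HN] := ul _ e0.
rewrite -[l](subrK (u N)) (le_trans (nrmD _ _))// addrC lerD ?HB//.
by rewrite nrm_dist HN.
Qed.

Lemma tends_eventually u v l : tends u l -> (exists N, forall n, (N <= n)%N -> u n = v n) -> tends v l.
Proof.
move=> ul [N HN] e e0; have [N' HN'] := ul _ e0; exists (maxn N N') => n.
by rewrite geq_max => /andP[nN nN']; rewrite -HN// HN'.
Qed.

Lemma tends_app (F : nat -> X -> X) G u l (B : R) :
  (forall n x y, nrm (F n x - F n y) <= B * nrm (x - y)) ->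
  tends (fun n => F n l) (G l) -> tends u l -> tends (fun n => F n (u n)) (G l).
Proof.
move=> FB Fl ul e e0; have e2 := divr_gt0 e0 (ltr0n R 2).
have B0 : 0 < `|B| + 1 by rewrite ltr_wpDl.
have [N HN] := Fl _ e2; have [N' HN'] := ul _ (divr_gt0 e2 B0).
exists (maxn N N') => n; rewrite geq_max => /andP[nN nN'].
rewrite (le_trans (nrm_triangle (F n l) _ _))// (splitr e) lerD ?HN//.
rewrite (le_trans (FB _ _ _))// (@le_trans _ _ ((`|B| + 1) * nrm (u n - l)))//.
  by rewrite ler_wpM2r ?nrm_ge0// (le_trans (ler_norm _))// lerDl.
by rewrite mulrC -ler_pdivlMr// HN'.
Qed.

Lemma tends_cauchy u : (forall e : R, 0 < e -> exists N, forall m n, (N <= m)%N -> (N <= n)%N ->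
   nrm (u m - u n) <= e) -> exists l, tends u l.
Proof.
move=> H; have cu : cvgn u.
  apply/cauchy_cvgP/cauchy_ballP => e e0.
  have er : e = (complex.Re e)%:C by move: e0; case: e => a b; rewrite ltcE /= => /andP[/eqP -> _].
  have e0' : 0 < complex.Re e / 2 by move: e0; rewrite er ltcR => e0; rewrite divr_gt0.
  have [N HN] := H _ e0'; near=> x y.
  have xP : exists2 m, (N <= m)%N & x = u m by near: x; exists N => // m mN; exists m.
  have yP : exists2 m, (N <= m)%N & y = u m by near: y; exists N => // m mN; exists m.
  case: xP yP => m mN -> [n nN ->].
  rewrite -ball_normE /ball_ /= nrmE er ltcR.
  by rewrite (le_lt_trans (HN m n mN nN))// ltr_pdivrMr// ltr_pMr ?ltr1n//; move: e0; rewrite er ltcR.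
exists (limn u) => e e0; have e0C : (0 : R[i]) < e%:C by rewrite ltcR.
have /cvgrPdist_le /(_ _ e0C) := cu; case=> N _ HN.
by exists N => n /HN /=; rewrite nrmE lecR nrm_dist.
Unshelve. all: by end_near. Qed.
End StrongLimits.

Section Geometric.
Context {R : realType}.
Lemma expr_small (q e : R) : 0 <= q < 1 -> 0 < e -> exists n, q ^+ n <= e.
Proof.
move=> /andP[q0 q1] e0; have := @cvg_geometric R 1 q; rewrite ger0_norm// => /(_ q1).
move=> /cvgrPdist_le /(_ _ e0) [N _ /(_ N (leqnn N))] /=.
by rewrite /geometric /= mul1r sub0r normrN normrX ger0_norm// => ?; exists N.
Qed.

Lemma geometric_sum_le (q : R) m n : 0 <= q < 1 -> \sum_(m <= j < n) q ^+ j <= q ^+ m / (1 - q).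
Proof.
move=> /andP[q0 q1]; have q1' : 0 < 1 - q by rewrite subr_gt0.
rewrite ler_pdivlMr// mulr_suml (eq_bigr (fun j => - (q ^+ j.+1 - q ^+ j))); last first.
  by move=> j _; rewrite mulrBr mulr1 opprB exprSr.
have [mn|nm] := leqP m n; last by rewrite big_geq ?exprn_ge0// ltnW.
by rewrite sumrN telescope_sumr// opprB lerBlDr lerDl exprn_ge0.
Qed.
End Geometric.

(** * Limits of polynomials in T(h) *)

Section DiscCalculus.
Context {R : realType} {X : completeNormedModType R[i]}.
Variable T : R -> {linear X -> X}.
Hypothesis Tsg : C0_semigroup T.
Variables (M omega : R).
Hypotheses (M1 : 1 <= M) (omega0 : 0 < omega).
Hypothesis TM : forall t x, 0 <= t -> nrm (T t x) <= M * expR (- (omega * t)) * nrm x.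

Let M0 : 0 <= M. Proof. exact: le_trans M1. Qed.

Lemma sg_bounded t x : 0 <= t -> nrm (T t x) <= M * nrm x.
Proof.
move=> t0; rewrite (le_trans (TM _ t0))// ler_wpM2r ?nrm_ge0// ler_piMr//.
by rewrite -[leRHS]expR0 ler_expR oppr_le0 mulr_ge0// ltW.
Qed.

Local Notation sgh := (sg_horner T).

Lemma sg_horner_lin h m (c : R[i]) x y : sgh h m (c *: x + y) = c *: sgh h m x + sgh h m y.
Proof.
rewrite /sg_horner scaler_sumr -big_split /=; apply: eq_bigr => j _.
by rewrite linearP scalerDr !scalerA mulrC.
Qed.

Lemma sg_horner_addp h (m m' : {poly R[i]}) x : sgh h (m + m') x = sgh h m x + sgh h m' x.
Proof.
have k := size_polyD m m'; rewrite (sg_hornerE _ _ _ k) (sg_hornerE _ _ _ (leq_maxl _ (size m'))) (sg_hornerE _ _ _ (leq_maxr (size m) _)).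
by rewrite -big_split /=; apply: eq_bigr => j _; rewrite coefD scalerDl.
Qed.

Lemma sg_horner_scalep h c (m : {poly R[i]}) x : sgh h (c *: m) x = c *: sgh h m x.
Proof.
rewrite (sg_hornerE _ _ _ (size_scale_leq c m)) /sg_horner scaler_sumr.
by apply: eq_bigr => j _; rewrite coefZ scalerA.
Qed.

Lemma sg_hornerC h c x : sgh h c%:P x = c *: x.
Proof.
rewrite (sg_hornerE _ _ _ (size_polyC_leq1 c)) big_ord1 coefC eqxx mul0r.
by rewrite (sg_0 Tsg).
Qed.

Lemma sg_hornerMX h (m : {poly R[i]}) x : 0 <= h -> sgh h (m * 'X) x = sgh h m (T h x).
Proof.
move=> h0; have [->|m0] := eqVneq m 0; first by rewrite mul0r /sg_horner size_poly0 !big_ord0.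
rewrite /sg_horner size_mulX// big_ord_recl coefMX eqxx scale0r add0r.
apply: eq_bigr => j _; rewrite coefMX /= -(sg_add Tsg) ?mulr_ge0// -natr1 mulrDl mul1r//.
Qed.

Lemma sg_hornerM h (m m' : {poly R[i]}) x : 0 <= h -> sgh h (m * m') x = sgh h m (sgh h m' x).
Proof.
move=> h0; elim/poly_ind: m' x => [|m' c IH] x.
  by rewrite mulr0 /sg_horner size_poly0 !big_ord0 big1// => j _; rewrite linear0 scaler0.
rewrite mulrDr mulrA [m * c%:P]mulrC mul_polyC !sg_horner_addp !sg_hornerMX// IH sg_horner_scalep sg_hornerC.
by rewrite addrC [in RHS]addrC sg_horner_lin.
Qed.

(** One polynomial approximates [g] uniformly on the unit circle and [G] in operator norm at the
    same time. Bounds for m(T(h)) in terms of the values of m on the circle therefore pass to [G],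
    while [g] is unconstrained off the circle. *)
Definition disc_calc (h : R) (g : R[i] -> R[i]) (G : X -> X) : Prop :=
  forall e : R, 0 < e -> exists2 m : {poly R[i]},
    forall z, nrm z = 1 -> nrm (m.[z] - g z) <= e &
    forall x, nrm (sgh h m x - G x) <= e * nrm x.

Section FixedStep.
Variable h : R.
Hypothesis h0 : 0 <= h.
Local Notation dc := (disc_calc h).

Lemma sg_horner_bounded (m : {poly R[i]}) : exists2 K : R, 0 <= K &
  (forall z, nrm z = 1 -> nrm m.[z] <= K) /\ forall x, nrm (sgh h m x) <= K * nrm x.
Proof.
have S0 : 0 <= \sum_(j < size m) nrm m`_j by apply: sumr_ge0 => j _; exact: nrm_ge0.
exists (M * \sum_(j < size m) nrm m`_j); first by rewrite mulr_ge0.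
split=> [z z1|x].
  rewrite horner_coef (le_trans (nrm_sum _ _ _))// (@le_trans _ _ (\sum_(j < size m) nrm m`_j))//.
    by apply: ler_sum => j _; rewrite nrmM nrmX z1 expr1n mulr1.
  by rewrite ler_peMl.
rewrite mulr_sumr mulr_suml (le_trans (nrm_sum _ _ _))//; apply: ler_sum => j _.
by rewrite nrmZ mulrAC mulrC ler_wpM2r ?nrm_ge0// mulrC (le_trans (sg_bounded _ _)) ?mulr_ge0.
Qed.

Lemma dc_bounded g G : dc g G -> exists2 K : R, 0 <= K &
  (forall z, nrm z = 1 -> nrm (g z) <= K) /\ forall x, nrm (G x) <= K * nrm x.
Proof.
move=> /(_ 1 ltr01)[m m1 m2]; have [K K0 [K1 K2]] := sg_horner_bounded m.
exists (K + 1); first by rewrite addr_ge0.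
split=> [z z1|x].
  by rewrite -(subKr (m.[z]) (g z)) (le_trans (nrmB _ _))// lerD ?K1 ?m1.
by rewrite -(subKr (sgh h m x) (G x)) (le_trans (nrmB _ _))// mulrDl lerD ?K2// (le_trans (m2 x)).
Qed.

Lemma dc_lin g G : dc g G -> forall c x y, G (c *: x + y) = c *: G x + G y.
Proof.
move=> gG c x y; apply/eqP; rewrite -subr_eq0; apply/eqP; apply: nrm_le0_eq => e e0.
pose K := nrm (c *: x + y) + nrm c * nrm x + nrm y + 1.
have K0 : 0 < K by rewrite ltr_wpDl// !addr_ge0 ?mulr_ge0 ?nrm_ge0.
have [m _ m2] := gG _ (divr_gt0 e0 K0).
rewrite (_ : G _ - _ = - (sgh h m (c *: x + y) - G (c *: x + y)) + (c *: (sgh h m x - G x) + (sgh h m y - G y))); last first.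
  by rewrite sg_horner_lin scalerBr [in RHS](addrACA (c *: sgh h m x)) -opprD opprB addrA subrK.
rewrite (le_trans (nrmD _ _))// nrmN (@le_trans _ _ (e / K * (nrm (c *: x + y) + nrm c * nrm x + nrm y)))//.
  rewrite !mulrDr -addrA lerD// (le_trans (nrmD _ _))// lerD// nrmZ mulrCA ler_wpM2l ?nrm_ge0//.
by rewrite mulrAC ler_pdivrMr// ler_wpM2l ?(ltW e0)// /K lerDl.
Qed.

Lemma dcB g G x y : dc g G -> G (x - y) = G x - G y.
Proof. by move=> gG; rewrite -scaleN1r addrC (dc_lin gG) scaleN1r addrC. Qed.

Lemma dc_poly (m : {poly R[i]}) : dc (fun z => m.[z]) (sgh h m).
Proof. by move=> e e0; exists m => *; rewrite subrr nrm0 ?mulr_ge0 ?nrm_ge0 ?ltW. Qed.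

Lemma dc_eq g g' G G' : (forall z, nrm z = 1 -> g z = g' z) -> (forall x, G x = G' x) ->
  dc g G -> dc g' G'.
Proof. by move=> gg GG H e /H[m m1 m2]; exists m => [z z1|x]; rewrite -?gg -?GG ?m1 ?m2. Qed.

Lemma dc_cst c : dc (fun=> c) (fun x => c *: x).
Proof. by apply: dc_eq (dc_poly c%:P) => [z _|x]; rewrite ?hornerC ?sg_hornerC. Qed.

Lemma dc_T : dc (fun z => z) (T h).
Proof.
apply: dc_eq (dc_poly 'X) => [z _|x]; rewrite ?hornerX//.
by rewrite -[X in sgh _ X _]mul1r sg_hornerMX// sg_hornerC scale1r.
Qed.

Lemma dcD g G g' G' : dc g G -> dc g' G' -> dc (fun z => g z + g' z) (fun x => G x + G' x).
Proof.
move=> H H' e e0; have e2 := divr_gt0 e0 (ltr0n R 2).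
have [m m1 m2] := H _ e2; have [m' m'1 m'2] := H' _ e2; exists (m + m') => [z z1|x].
  by rewrite hornerD opprD addrACA (le_trans (nrmD _ _))// (splitr e) lerD ?m1 ?m'1.
by rewrite sg_horner_addp opprD addrACA (le_trans (nrmD _ _))// (splitr e) mulrDl lerD ?m2 ?m'2.
Qed.

Let approx m g G (d : R) := (forall z, nrm z = 1 -> nrm (m.[z] - g z) <= d) /\
  forall x, nrm (sgh h m x - G x) <= d * nrm x.

Let dcM_approx g G g' G' (e : R) : dc g G -> dc g' G' -> 0 < e -> exists2 d : R, 0 < d &
  forall m m', approx m g G d -> approx m' g' G' d ->
  approx (m * m') (fun z => g z * g' z) (fun x => G (G' x)) e.
Proof.
move=> H H' e0.
have [K K0 [K1 K2]] := dc_bounded H; have [K' K'0 [K'1 K'2]] := dc_bounded H'.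
pose c := K + (K' + 1); have c0 : 0 < c by rewrite ltr_wpDl// ltr_wpDl.
pose d := Num.min (e / c) 1; have d0 : 0 < d by rewrite lt_min divr_gt0//= ltr01.
have d1 : d <= 1 by rewrite ge_min lexx orbT.
have dce : d * (K + (K' + 1)) <= e by rewrite -ler_pdivlMr// ge_min lexx.
exists d => // m m' [m1 m2] [m'1 m'2]; split=> [z z1|x].
  rewrite hornerM (_ : _ - _ = (m.[z] - g z) * m'.[z] + g z * (m'.[z] - g' z)); last first.
    by move: (g z) (g' z) => a b; ring.
  have b' : nrm m'.[z] <= K' + 1.
    by rewrite -(subrK (g' z) m'.[z]) (le_trans (nrmD _ _))// addrC lerD ?K'1// (le_trans (m'1 _ _)).
  rewrite (le_trans (nrmD _ _))// !nrmM (le_trans _ dce)// addrC mulrDr lerD//.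
    by rewrite mulrC ler_pM ?nrm_ge0 ?m'1 ?K1.
  by rewrite ler_pM ?nrm_ge0 ?m1.
rewrite sg_hornerM// (_ : _ - _ = (sgh h m (sgh h m' x) - G (sgh h m' x)) + G (sgh h m' x - G' x)); last first.
  by rewrite (dcB _ _ H) addrA subrK.
have b' : nrm (sgh h m' x) <= (K' + 1) * nrm x.
  by rewrite -(subrK (G' x) (sgh h m' x)) (le_trans (nrmD _ _))// addrC mulrDl lerD ?K'2// (le_trans (m'2 _))// ler_wpM2r ?nrm_ge0.
rewrite (le_trans (nrmD _ _))// (@le_trans _ _ (d * (K + (K' + 1)) * nrm x))//; last first.
  by rewrite ler_wpM2r ?nrm_ge0.
rewrite addrC mulrDr mulrDl lerD//.
  by rewrite (le_trans (K2 _))// [d * K]mulrC -mulrA ler_wpM2l.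
by rewrite (le_trans (m2 _))// -mulrA ler_wpM2l// ltW.
Qed.

Lemma dcM g G g' G' : dc g G -> dc g' G' -> dc (fun z => g z * g' z) (fun x => G (G' x)).
Proof.
move=> H H' e e0; have [d d0 Hd] := dcM_approx H H' e0.
have [m m1 m2] := H _ d0; have [m' m'1 m'2] := H' _ d0.
by have [? ?] := Hd m m' (conj m1 m2) (conj m'1 m'2); exists (m * m').
Qed.

(** Polynomials commute: both compositions are approximated by the same product m m'. *)
Lemma dc_comm g G g' G' : dc g G -> dc g' G' -> forall x, G (G' x) = G' (G x).
Proof.
move=> H H' x; apply/eqP; rewrite -subr_eq0; apply/eqP; apply: nrm_le0_eq => e e0.
have xp : 0 < nrm x + 1 by rewrite ltr_wpDl ?nrm_ge0.
have e1 : 0 < e / 2 / (nrm x + 1) by rewrite !divr_gt0.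
have [d d0 Hd] := dcM_approx H H' e1; have [d' d'0 Hd'] := dcM_approx H' H e1.
have dd : 0 < Num.min d d' by rewrite lt_min d0.
have [m m1 m2] := H _ dd; have [m' m'1 m'2] := H' _ dd.
have wk (f : R -> R) D : Num.min d d' <= D -> 0 <= D -> forall m g G, (forall z, nrm z = 1 -> nrm (m.[z] - g z) <= Num.min d d') ->
   (forall x, nrm (sgh h m x - G x) <= Num.min d d' * nrm x) -> approx m g G D.
  move=> dD D0 m3 g3 G3 h1 h2; split=> [z z1|y]; first exact: le_trans (h1 z z1) dD.
  by rewrite (le_trans (h2 y))// ler_wpM2r ?nrm_ge0.
have l1 : Num.min d d' <= d by rewrite ge_min lexx.
have l2 : Num.min d d' <= d' by rewrite ge_min lexx orbT.
have [_ /(_ x) a1] := Hd m m' (wk id d l1 (ltW d0) _ _ _ m1 m2) (wk id d l1 (ltW d0) _ _ _ m'1 m'2).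
have [_ /(_ x) a2] := Hd' m' m (wk id d' l2 (ltW d'0) _ _ _ m'1 m'2) (wk id d' l2 (ltW d'0) _ _ _ m1 m2).
rewrite mulrC in a2; rewrite (le_trans (nrm_triangle (sgh h (m * m') x) _ _))// (splitr e).
have le2 : e / 2 / (nrm x + 1) * nrm x <= e / 2.
  by rewrite -mulrA ler_piMr ?divr_ge0 ?(ltW e0)// mulrC ler_pdivrMr// mul1r lerDl.
by rewrite lerD ?(le_trans _ le2)// nrm_dist.
Qed.

Lemma dcZ c g G : dc g G -> dc (fun z => c * g z) (fun x => c *: G x).
Proof. by move=> H; exact: dcM (dc_cst c) H. Qed.

Lemma dcX g G n : dc g G -> dc (fun z => g z ^+ n) (fun x => iter n G x).
Proof.
move=> H; elim: n => [|n IH].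
  by apply: dc_eq (dc_cst 1) => [z _|x]; rewrite ?expr0 ?scale1r.
by apply: dc_eq (dcM H IH) => // z _; rewrite exprS.
Qed.

(** The Neumann series of (1 - kap T(h))^-1. It converges on the circle with ratio |kap| and on [X]
    with the smaller ratio |kap| e^(-omega h), which stability provides and which gives the norm
    bound. *)
Lemma dc_geometric kap : nrm kap < 1 -> exists G,
  [/\ dc (fun z => (1 - kap * z)^-1) G, forall x, G (x - kap *: T h x) = x,
      forall x, G x - kap *: T h (G x) = x &
      forall x, nrm (G x) <= M / (1 - nrm kap * expR (- (omega * h))) * nrm x].
Proof.
move=> k1; pose q := nrm kap * expR (- (omega * h)).
have e1 : expR (- (omega * h)) <= 1 by rewrite -[leRHS]expR0 ler_expR oppr_le0 mulr_ge0// ltW.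
have q0 : 0 <= q by rewrite mulr_ge0 ?nrm_ge0 ?expR_ge0.
have qk : q <= nrm kap by rewrite ler_piMr ?nrm_ge0.
have q01 : 0 <= q < 1 by rewrite q0 (le_lt_trans qk).
have k01 : 0 <= nrm kap < 1 by rewrite nrm_ge0.
have q1 : 0 < 1 - q by rewrite subr_gt0; case/andP: q01.
have kk1 : 0 < 1 - nrm kap by rewrite subr_gt0.
pose m n : {poly R[i]} := \poly_(j < n) kap ^+ j.
have mS n x : sgh h (m n) x = \sum_(0 <= j < n) kap ^+ j *: T (j%:R * h) x.
  rewrite (sg_hornerE _ _ _ (size_poly _ _)) big_mkord; apply: eq_bigr => j _.
  by rewrite coef_poly ltn_ord.
have term j x : nrm (kap ^+ j *: T (j%:R * h) x) <= q ^+ j * (M * nrm x).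
  rewrite nrmZ nrmX /q exprMn -mulrA ler_wpM2l ?exprn_ge0 ?nrm_ge0//.
  rewrite (le_trans (TM _ _)) ?mulr_ge0// [leRHS]mulrCA -mulrA ler_wpM2l// ler_wpM2r ?nrm_ge0//.
  by rewrite -expRM_natl mulrN mulrCA.
have tail n n' x : (n <= n')%N -> nrm (sgh h (m n') x - sgh h (m n) x) <= q ^+ n / (1 - q) * (M * nrm x).
  move=> nn; rewrite !mS (big_cat_nat (leq0n n) nn) /= addrAC subrr add0r (le_trans (nrm_sum _ _ _))//.
  rewrite (@le_trans _ _ (\sum_(n <= j < n') q ^+ j * (M * nrm x)))//.
    by apply: ler_sum => j _; exact: term.
  by rewrite -mulr_suml ler_wpM2r ?mulr_ge0 ?nrm_ge0// geometric_sum_le.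
have lim x : exists l, tends (fun n => sgh h (m n) x) l.
  apply: tends_cauchy => e e0; have K0 : 0 < M * nrm x / (1 - q) *+ 2 + 1.
    by rewrite ltr_wpDl// mulrn_wge0// divr_ge0 ?mulr_ge0 ?nrm_ge0// ltW.
  have [N HN] := expr_small q01 (divr_gt0 e0 K0); exists N => n n' nN n'N.
  rewrite (le_trans (nrm_triangle (sgh h (m N) x) _ _))// [X in _ + X]nrm_dist.
  rewrite (le_trans (lerD (tail _ _ x nN) (tail _ _ x n'N)))// -mulr2n -mulrnAr.
  rewrite -mulrA [_^-1 * _]mulrC mulrnAl.
  rewrite (@le_trans _ _ (q ^+ N * (M * nrm x / (1 - q) *+ 2 + 1)))//.
    by rewrite ler_wpM2l ?exprn_ge0// lerDl.
  by rewrite -ler_pdivlMr.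
have [G GP] := choice lim.
have Gtail n x : nrm (sgh h (m n) x - G x) <= q ^+ n / (1 - q) * (M * nrm x).
  rewrite nrm_dist; apply: (@tends_le _ _ (fun n' => sgh h (m (maxn n n')) x - sgh h (m n) x)).
    apply: tendsB (tends_cst _) => e e0; have [N HN] := GP x _ e0; exists N => n' n'N.
    by rewrite HN// (leq_trans n'N)// leq_maxr.
  by move=> n'; exact: tail (leq_maxl _ _).
have symb n z : nrm z = 1 -> nrm ((m n).[z] - (1 - kap * z)^-1) <= nrm kap ^+ n / (1 - nrm kap).
  move=> z1; have kz : nrm (kap * z) = nrm kap by rewrite nrmM z1 mulr1.
  have d1 : 1 - nrm kap <= nrm (1 - kap * z).
    by rewrite -kz -(@nrm1 R) (le_trans (ler_norm _))// ler_nrm_dist.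
  have d0 : 1 - kap * z != 0 by rewrite -nrm_eq0 gt_eqF// (lt_le_trans kk1).
  have E : (m n).[z] * (1 - kap * z) = 1 - (kap * z) ^+ n.
    rewrite horner_poly -opprB -[in RHS]opprB mulrN subrX1 mulrC; congr (- (_ * _)).
    by apply: eq_bigr => j _; rewrite exprMn.
  have -> : (m n).[z] - (1 - kap * z)^-1 = - ((kap * z) ^+ n) / (1 - kap * z).
    by rewrite -[(m n).[z]](mulfK d0) E -[X in _ - X]mul1r -mulrBl addrAC subrr add0r.
  by rewrite nrmM nrmN nrmX nrmV kz ler_wpM2l ?exprn_ge0 ?nrm_ge0// lef_pV2// posrE ?(lt_le_trans kk1).
have Gdc : dc (fun z => (1 - kap * z)^-1) G.
  move=> e e0; pose c := (1 + M) / (1 - nrm kap) + 1.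
  have c0 : 0 < c by rewrite ltr_wpDl// divr_ge0 ?(ltW kk1)// addr_ge0.
  have [N HN] := expr_small k01 (divr_gt0 e0 c0); rewrite ler_pdivlMr// in HN.
  have HN' : nrm kap ^+ N * ((1 + M) / (1 - nrm kap)) <= e.
    by rewrite (le_trans _ HN)// ler_wpM2l ?exprn_ge0 ?nrm_ge0// lerDl.
  exists (m N) => [z z1|x].
    rewrite (le_trans (symb N z z1))// (le_trans _ HN')// ler_wpM2l ?exprn_ge0 ?nrm_ge0//.
    by rewrite ler_peMl ?invr_ge0 ?(ltW kk1)// lerDl.
  rewrite (le_trans (Gtail N x))// mulrA ler_wpM2r ?nrm_ge0// (le_trans _ HN')// -mulrA.
  rewrite ler_pM ?exprn_ge0 ?mulr_ge0 ?invr_ge0 ?(ltW q1) ?nrm_ge0//.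
    by rewrite lerXn2r ?nnegrE ?nrm_ge0.
  by rewrite mulrC ler_pM ?invr_ge0 ?(ltW q1) ?lerDr// lef_pV2 ?posrE// lerD2l lerN2.
have I1 x : G x - kap *: T h (G x) = x.
  have comm := dc_comm Gdc dc_T x.
  apply: (@tends_unique _ _ (fun n => sgh h (m n) x - kap *: T h (sgh h (m n) x))).
    apply: tendsB (GP x) _; apply: tendsZ.
    move=> e e0; have [N HN] := GP x _ (divr_gt0 e0 (lt_le_trans ltr01 M1)); exists N => n nN.
    rewrite -linearB (le_trans (sg_bounded _ h0))// mulrC -ler_pdivlMr ?(lt_le_trans ltr01 M1)//.
    exact: HN.
  have E n : sgh h (m n) x - kap *: T h (sgh h (m n) x) = x - kap ^+ n *: T (n%:R * h) x.
    rewrite mS linear_sum scaler_sumr -sumrB (eq_bigr (fun j => - (kap ^+ j.+1 *: T (j.+1%:R * h) x - kap ^+ j *: T (j%:R * h) x))); last first.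
      move=> j _; rewrite opprB [T h _]linearZ_LR scalerA -exprS; congr (_ - _ *: _).
      by rewrite -(sg_add Tsg) ?mulr_ge0// -natr1 mulrDl mul1r addrC.
    by rewrite sumrN telescope_sumr// opprB expr0 scale1r mul0r (sg_0 Tsg).
  move=> e e0; have c0 : 0 < M * nrm x + 1 by rewrite ltr_wpDl ?mulr_ge0 ?nrm_ge0.
  have [N HN] := expr_small q01 (divr_gt0 e0 c0); rewrite ler_pdivlMr// in HN.
  exists N => n nN; rewrite E addrAC subrr add0r nrmN (le_trans (term n x))// (le_trans _ HN)//.
  rewrite ler_pM ?exprn_ge0 ?mulr_ge0 ?nrm_ge0 ?lerDl//.
  by rewrite ler_wiXn2l// ltW//; case/andP: q01.
exists G; split=> // x; last by have := Gtail 0 x; rewrite mS big_geq// sub0r nrmN expr0 mul1r mulrCA mulrA.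
rewrite (dcB _ _ Gdc) -[X in _ = X]I1; congr (_ - _).
by have := dc_lin Gdc kap (T h x) 0; rewrite !addr0 (dc_comm Gdc dc_T) => ->; rewrite -(subrr 0) (dcB 0 0 Gdc) subrr addr0.
Qed.
End FixedStep.
End DiscCalculus.

(** * Transference over blocks of steps *)

Section Decimation.
Context {R : realType} {X : completeNormedModType R[i]}.

Lemma sum_blocks (V : nmodType) (F : nat -> V) (J k : nat) :
  \sum_(j < J * k.+1) F j = \sum_(r < k.+1) \sum_(l < J) F (r + l * k.+1)%N.
Proof.
elim: J => [|J IH].
  by rewrite mul0n big_ord0 big1// => r _; rewrite big_ord0.
rewrite mulSnr big_split_ord /= IH -big_split /=; apply: eq_bigr => r _.
by rewrite big_ord_recr /= addnC.
Qed.

(** Averaging over the roots of unity extracts the coefficients whose index is congruent to r modulo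
    k + 1. *)
Lemma decimated_symbol (m : {poly R[i]}) (k r : nat) (zeta z : R[i]) : (r < k.+1)%N ->
  k.+1.-primitive_root zeta ->
  k.+1%:R * (z ^+ r * (\poly_(l < size m) m`_(r + l * k.+1)).[z ^+ k.+1]) =
  \sum_(c < k.+1) (zeta^*%C) ^+ (c * r) * m.[z * zeta ^+ c].
Proof.
move=> rk pz; have szm : (size m <= size m * k.+1)%N by rewrite leq_pmulr.
under [RHS]eq_bigr => c _ do rewrite (horner_coef_wide _ szm) mulr_sumr.
rewrite exchange_big /= (eq_bigr (fun j : 'I__ => m`_j * z ^+ j * (k.+1%:R *+ (j == r %[mod k.+1]))%R)); last first.
  move=> j _; rewrite -(sum_prim_root _ _ pz) mulr_sumr; apply: eq_bigr => c _.
  by rewrite exprMn -exprM; ring.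
rewrite (sum_blocks (fun j => m`_j * z ^+ j * (k.+1%:R *+ (j == r %[mod k.+1]))%R)).
rewrite (bigD1 (Ordinal rk))//= [X in _ + X]big1 ?addr0; last first.
  move=> r' r'r; rewrite big1// => l _; rewrite (addnC r') modnMDl !modn_small//.
  by rewrite -(inj_eq val_inj) /= in r'r; rewrite (negbTE r'r) mulr0.
rewrite horner_poly mulrA mulr_sumr; apply: eq_bigr => l _.
by rewrite addnC modnMDl eqxx mulr1n exprD mulnC exprM; ring.
Qed.

Variable T : R -> {linear X -> X}.
Hypothesis Tsg : C0_semigroup T.
Variables (M omega : R).
Hypotheses (M1 : 1 <= M) (omega0 : 0 < omega).
Hypothesis TM : forall t x, 0 <= t -> nrm (T t x) <= M * expR (- (omega * t)) * nrm x.
Variables (Ct theta : R).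
Hypothesis Ct0 : 0 <= Ct.
Hypothesis trans : forall h (m : {poly R[i]}) K, 0 < h <= 1 -> 0 < K ->
  (forall z, nrm z = 1 -> nrm m.[z] <= K) ->
  forall x, nrm (sg_horner T h m x) <= Ct * h `^ (- theta) * K * nrm x.

(** Sorting the coefficients by residue gives m(T(eta)) as the sum of T(r eta) Q_r(T(h)). Each of
    the k + 1 polynomials Q_r is bounded on the circle by K / (k + 1), so their sum costs nothing
    but M, and transference acts at the longer step h. *)
Lemma decimated_transference (eta K : R) (k : nat) (m : {poly R[i]}) (zeta : R[i]) :
  0 < eta -> k.+1%:R * eta <= 1 -> 0 < K -> k.+1.-primitive_root zeta ->
  (forall z, nrm z = 1 -> \sum_(c < k.+1) nrm m.[z * zeta ^+ c] <= K) ->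
  forall x, nrm (sg_horner T eta m x) <= M * Ct * (k.+1%:R * eta) `^ (- theta) * K * nrm x.
Proof.
move=> eta0 keta K0 pz HK x; set h := k.+1%:R * eta.
have M0 : 0 <= M := le_trans ler01 M1.
have h0 : 0 < h by rewrite mulr_gt0 ?ltr0n.
have k0 : 0 < k.+1%:R :> R by rewrite ltr0n.
have nz : nrm zeta = 1 := nrm_unity_root (ltn0Sn k) (prim_expr_order pz).
pose Q r : {poly R[i]} := \poly_(l < size m) m`_(r + l * k.+1).
have HQ (r : 'I_k.+1) z : nrm z = 1 -> nrm (Q r).[z] <= K / k.+1%:R.
  (* A point of the circle is a (k + 1)-st power of another one, at which the sum over the roots of
     unity is formed. *)
  move=> z1; have zz : (k.+1).-root z ^+ k.+1 = z by rewrite rootCK.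
  have z'1 : nrm ((k.+1).-root z) = 1.
    by apply/eqP; rewrite -(@pexpr_eq1 _ _ k.+1)// ?nrm_ge0// -nrmX zz z1.
  rewrite ler_pdivlMr// mulrC -[in X in X <= _](@ger0_norm _ k.+1%:R)// -(@nrm_real R) rmorph_nat -nrmM.
  rewrite -[Q r]/(\poly_(l < _) _) -{1}zz; set y := _.-root z.
  have -> (u : R[i]) : nrm (k.+1%:R * u) = nrm (k.+1%:R * (y ^+ r * u)).
    by rewrite !nrmM nrmX z'1 expr1n mul1r.
  rewrite (decimated_symbol _ _ (ltn_ord r) pz) (le_trans (nrm_sum _ _ _))// (le_trans _ (HK y z'1))//.
  apply: ler_sum => c _; rewrite nrmM nrmX (_ : nrm zeta^*%C = 1) ?expr1n ?mul1r//.
  by rewrite -nz /nrm; case: (zeta) => a b; rewrite !normc_def /= sqrrN.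
have E : sg_horner T eta m x = \sum_(r < k.+1) T (r%:R * eta) (sg_horner T h (Q r) x).
  rewrite (@sg_hornerE _ _ T eta m (size m * k.+1)) ?leq_pmulr//.
  rewrite (sum_blocks (fun j => m`_j *: T (j%:R * eta) x)); apply: eq_bigr => r _.
  rewrite (sg_hornerE _ _ _ (size_poly _ _)) linear_sum; apply: eq_bigr => l _ /=.
  rewrite linearZ_LR coef_poly ltn_ord -(sg_add Tsg) ?mulr_ge0 ?(ltW h0) ?(ltW eta0)//.
  by rewrite natrD mulrDl natrM mulrA.
rewrite E (le_trans (nrm_sum _ _ _))//.
rewrite (@le_trans _ _ (\sum_(r < k.+1) M * (Ct * h `^ (- theta) * (K / k.+1%:R) * nrm x)))//.
  apply: ler_sum => r _; rewrite (le_trans (sg_bounded M1 omega0 TM _ _)) ?mulr_ge0 ?(ltW eta0)//.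
  by rewrite ler_wpM2l// trans ?h0 ?divr_gt0// => z; exact: HQ.
rewrite sumr_const card_ord -[leLHS]mulr_natr.
have -> : M * (Ct * h `^ (- theta) * (K / k.+1%:R) * nrm x) * k.+1%:R = M * Ct * h `^ (- theta) * K * nrm x * (k.+1%:R^-1 * k.+1%:R).
  by move: (h `^ _) (nrm x) (k.+1%:R) (k.+1%:R^-1) => a b c d; ring.
by rewrite mulVf ?mulr1// gt_eqF.
Qed.

Lemma dc_transference (eta K : R) (k : nat) (zeta : R[i]) g G :
  0 < eta -> k.+1%:R * eta <= 1 -> 0 <= K -> k.+1.-primitive_root zeta ->
  (forall z, nrm z = 1 -> \sum_(c < k.+1) nrm (g (z * zeta ^+ c)) <= K) ->
  disc_calc T eta g G ->
  forall x, nrm (G x) <= M * Ct * (k.+1%:R * eta) `^ (- theta) * K * nrm x.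
Proof.
move=> eta0 keta K0 pz HK gG x; apply/ler_addgt0Pr => e e0.
have M0 : 0 <= M := le_trans ler01 M1.
set W := M * Ct * _; have W0 : 0 <= W by rewrite !mulr_ge0 ?powR_ge0.
have nz : nrm zeta = 1 := nrm_unity_root (ltn0Sn k) (prim_expr_order pz).
(* The approximation error enters k + 1 times through the sum of symbols and once through the
   operator. *)
pose b := (W * k.+1%:R + 1) * nrm x + 1.
have b0 : 0 < b by rewrite ltr_wpDl// mulr_ge0 ?nrm_ge0// addr_ge0// mulr_ge0.
have d0 : 0 < e / b by rewrite divr_gt0.
have [m m1 m2] := gG _ d0.
have Kd : 0 < K + k.+1%:R * (e / b) by rewrite ltr_wpDl// mulr_gt0 ?ltr0n.
have := decimated_transference (m := m) eta0 keta Kd pz _ x; rewrite -/W => H.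
have {}H : nrm (sg_horner T eta m x) <= W * (K + k.+1%:R * (e / b)) * nrm x.
  apply: H => z z1; rewrite (@le_trans _ _ (\sum_(c < k.+1) (nrm (g (z * zeta ^+ c)) + e / b)))//.
    apply: ler_sum => c _; rewrite -(subrK (g (z * zeta ^+ c)) (m.[_])) (le_trans (nrmD _ _))// addrC lerD2l.
    by rewrite m1// nrmM nrmX nz expr1n mulr1.
  by rewrite big_split /= sumr_const card_ord lerD ?HK// -[leLHS]mulr_natl.
rewrite -(subKr (sg_horner T eta m x) (G x)) (le_trans (nrmB _ _))//.
rewrite (le_trans (lerD H (m2 x)))// mulrDr mulrDl -addrA lerD2l.
rewrite (_ : _ + _ = e / b * ((W * k.+1%:R + 1) * nrm x)); last first.
  by move: (nrm x) (e / b) => u v; ring.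
by rewrite mulrAC ler_pdivrMr// ler_wpM2l ?(ltW e0)// /b lerDl.
Qed.
End Decimation.

(** * Resolvents and rational functions of the generator *)

Section Zmodule.
Variable V : zmodType.
Implicit Types a b c y v : V.

Lemma subr_insert2 y v a b : y - b = (y - v) - (a - v) + (a - b).
Proof. by rewrite opprB !addrA !subrK. Qed.

Lemma subrACA a b c y : a - b - (y - c) = (c - b) - (y - a).
Proof. by rewrite !opprB addrACA [RHS]addrACA (addrC a). Qed.
End Zmodule.

Section RightLimits.
Context {R : realType} {X : completeNormedModType R[i]}.
Implicit Types (f g : R -> X) (l : X).

Definition rtends f l := forall e : R, 0 < e ->
  exists2 dl : R, 0 < dl & forall h, 0 < h < dl -> nrm (f h - l) <= e.

Lemma rtendsP f l : f h @[h --> (0 : R)^'+] --> l <-> rtends f l.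
Proof.
split=> [/cvgrPdist_le H e e0|H].
  have /H : (0 : R[i]) < e%:C by rewrite ltcR.
  rewrite /at_right near_withinE => -[dl /= dl0 Hd]; exists dl => // h /andP[h0 hd].
  rewrite nrm_dist -(@lecR R) -nrmE; apply: Hd => //=.
  by rewrite sub0r normrN gtr0_norm.
apply/cvgrPdist_le => e e0.
have er : e = (complex.Re e)%:C by move: e0; case: e => a b; rewrite ltcE /= => /andP[/eqP -> _].
have [dl dl0 Hd] : exists2 dl : R, 0 < dl & forall h, 0 < h < dl -> nrm (f h - l) <= complex.Re e.
  by apply: H; move: e0; rewrite er ltcR.
rewrite /at_right near_withinE; exists dl => // h /=; rewrite sub0r normrN => hd h0.
by rewrite nrmE er lecR nrm_dist Hd// h0 (le_lt_trans (ler_norm _) hd).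
Qed.

Lemma rtends_seq f l (h : nat -> R) : rtends f l -> (forall n, 0 < h n) ->
  (forall e : R, 0 < e -> exists N, forall n, (N <= n)%N -> h n < e) -> tends (fun n => f (h n)) l.
Proof.
move=> fl h0 Hh e e0; have [dl dl0 Hd] := fl _ e0; have [N HN] := Hh _ dl0.
by exists N => n nN; rewrite Hd// h0 HN.
Qed.

Lemma dyadic_small (e : R) : 0 < e -> exists N, forall n, (N <= n)%N -> (2^-1 : R) ^+ n < e.
Proof.
move=> e0; have q : 0 <= (2^-1 : R) < 1 by rewrite invr_ge0 ler0n /= invf_lt1// ltr1n.
have [N HN] := expr_small q (divr_gt0 e0 (ltr0n R 2)); exists N => n nN.
rewrite (@le_lt_trans _ _ (e / 2))// ?ltr_pdivrMr ?ltr_pMr ?ltr1n// (le_trans _ HN)//.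
by rewrite ler_wiXn2l// ?invr_ge0// ltW//; case/andP: q.
Qed.

Lemma rtends_unique f l l' : rtends f l -> rtends f l' -> l = l'.
Proof.
move=> fl fl'; have hp n : 0 < (2^-1 : R) ^+ n by rewrite exprn_gt0 ?invr_gt0.
exact: tends_unique (rtends_seq fl hp dyadic_small) (rtends_seq fl' hp dyadic_small).
Qed.

Lemma rtendsD f g l l' : rtends f l -> rtends g l' -> rtends (fun h => f h + g h) (l + l').
Proof.
move=> fl gl e e0; have e2 := divr_gt0 e0 (ltr0n R 2).
have [d1 d10 H1] := fl _ e2; have [d2 d20 H2] := gl _ e2.
exists (Num.min d1 d2); first by rewrite lt_min d10.
move=> h /andP[h0]; rewrite lt_min => /andP[hd1 hd2].
by rewrite opprD addrACA (le_trans (nrmD _ _))// (splitr e) lerD ?H1 ?H2 ?h0.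
Qed.

Lemma rtendsZ (c : R[i]) f l : rtends f l -> rtends (fun h => c *: f h) (c *: l).
Proof.
move=> fl e e0; have c0 : 0 < nrm c + 1 by rewrite ltr_wpDl ?nrm_ge0.
have [dl dl0 H] := fl _ (divr_gt0 e0 c0); exists dl => // h hd.
rewrite -scalerBr nrmZ (@le_trans _ _ ((nrm c + 1) * nrm (f h - l)))//.
  by rewrite ler_wpM2r ?nrm_ge0// lerDl.
by rewrite mulrC -ler_pdivlMr// H.
Qed.

Lemma rtends_eq f g l : (forall h, 0 < h -> f h = g h) -> rtends f l -> rtends g l.
Proof.
move=> fg fl e e0; have [dl dl0 H] := fl _ e0; exists dl => // h /andP[h0 hd].
by rewrite -fg// H// h0.
Qed.

Lemma rtends_squeeze f l (C : R) : 0 <= C -> (forall h, 0 < h -> h <= 1 -> nrm (f h - l) <= C * h) ->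
  rtends f l.
Proof.
move=> C0 H e e0; have c0 : 0 < C + 1 by rewrite ltr_wpDl.
exists (Num.min 1 (e / (C + 1))); first by rewrite lt_min ltr01 divr_gt0.
move=> h /andP[h0]; rewrite lt_min => /andP[h1 he]; rewrite (le_trans (H h h0 (ltW h1)))//.
rewrite (@le_trans _ _ ((C + 1) * h))// ?ler_wpM2r ?(ltW h0) ?lerDl//.
by rewrite mulrC -ler_pdivlMr// ltW.
Qed.

Lemma rtends_app (F : R -> X -> X) (B : R) f l z :
  (forall h x y, 0 < h <= 1 -> nrm (F h x - F h y) <= B * nrm (x - y)) ->
  rtends (fun h => F h l) z -> rtends f l -> rtends (fun h => F h (f h)) z.
Proof.
move=> FB Fl fl e e0; have e2 := divr_gt0 e0 (ltr0n R 2).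
have B0 : 0 < `|B| + 1 by rewrite ltr_wpDl.
have [d1 d10 H1] := Fl _ e2; have [d2 d20 H2] := fl _ (divr_gt0 e2 B0).
exists (Num.min 1 (Num.min d1 d2)); first by rewrite !lt_min ltr01 d10.
move=> h /andP[h0]; rewrite !lt_min => /and3P[h1 hd1 hd2].
rewrite (le_trans (nrm_triangle (F h l) _ _))// (splitr e) lerD ?H1 ?h0//.
rewrite (le_trans (FB _ _ _ _)) ?h0 ?(ltW h1)// (@le_trans _ _ ((`|B| + 1) * nrm (f h - l)))//.
  by rewrite ler_wpM2r ?nrm_ge0// (le_trans (ler_norm _))// lerDl.
by rewrite mulrC -ler_pdivlMr// H2// h0.
Qed.
End RightLimits.

(** * The resolvent as a limit of discrete Laplace transforms *)

Section Resolvent.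
Context {R : realType} {X : completeNormedModType R[i]}.
Variable T : R -> {linear X -> X}.
Hypothesis Tsg : C0_semigroup T.
Variables (M omega : R).
Hypotheses (M1 : 1 <= M) (omega0 : 0 < omega).
Hypothesis TM : forall t x, 0 <= t -> nrm (T t x) <= M * expR (- (omega * t)) * nrm x.
Let Tb := sg_bounded M1 omega0 TM.
Let M0 : 0 <= M. Proof. exact: le_trans M1. Qed.

Let TZ h c x : T h (c *: x) = c *: T h x. Proof. exact: linearZ_LR. Qed.
Let TBr h x y : T h (x - y) = T h x - T h y. Proof. exact: linearB. Qed.

Lemma sg_rtends x : rtends (fun h => T h x) x.
Proof. exact/rtendsP/(sg_strong Tsg). Qed.

Section FixedLambda.
Variable lam : R[i].
Hypothesis lam0 : 0 < complex.Re lam.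
Let kap (h : R) := cexp (- (h%:C * lam)).
Let mu := complex.Re lam + omega.
Let mu0 : 0 < mu. Proof. by rewrite addr_gt0. Qed.

Let ReN (h : R) : complex.Re (- (h%:C * lam)) = - (h * complex.Re lam).
Proof. by case: (lam) => a b /=; rewrite mul0r subr0. Qed.

Let nrm_kap h : nrm (kap h) = expR (- (h * complex.Re lam)).
Proof. by rewrite nrm_cexp ReN. Qed.

Let kap_le1 h : 0 <= h -> nrm (kap h) <= 1.
Proof. by move=> h0; rewrite nrm_kap -[leRHS]expR0 ler_expR oppr_le0 mulr_ge0// ltW. Qed.

Let kapD h k : kap (h + k) = kap h * kap k.
Proof. by rewrite /kap -cexpD rmorphD mulrDl opprD. Qed.

Let kapB1 h : 0 <= h -> nrm (kap h - 1) <= h * nrm lam.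
Proof.
move=> h0; rewrite (le_trans (nrm_cexpB1 _))//; first by rewrite ReN oppr_le0 mulr_ge0// ltW.
by rewrite nrmN nrmM nrm_real ger0_norm.
Qed.

Let kap_deriv (v : X) : rtends (fun h => (h^-1)%:C *: ((kap h - 1) *: T h v)) (- lam *: v).
Proof.
apply: (@rtends_eq _ _ (fun h => ((h^-1)%:C * (kap h - 1) + lam) *: T h v + (- lam *: T h v))).
  by move=> h h0; rewrite -scalerDl addrK scalerA.
rewrite -[X in rtends _ X]add0r; apply: rtendsD; last exact: rtendsZ (sg_rtends v).
apply: (@rtends_squeeze _ _ _ _ (nrm lam ^+ 2 * (M * nrm v))); first by rewrite !mulr_ge0 ?exprn_ge0 ?nrm_ge0.
move=> h h0 _; rewrite subr0 nrmZ.
have -> : (h^-1)%:C * (kap h - 1) + lam = (h^-1)%:C * (kap h - 1 - - (h%:C * lam)).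
  have hh : (h^-1)%:C * h%:C = 1 :> R[i] by rewrite -rmorphM /= mulVf ?gt_eqF.
  by rewrite opprK [RHS]mulrDr mulrA hh mul1r.
rewrite nrmM nrm_real gtr0_norm ?invr_gt0//.
have h1 : nrm (kap h - 1 - - (h%:C * lam)) <= (h * nrm lam) ^+ 2.
  rewrite (le_trans (nrm_cexpB1D _))//; first by rewrite ReN oppr_le0 mulr_ge0 ?ltW.
  by rewrite nrmN nrmM nrm_real gtr0_norm.
rewrite [leRHS]mulrAC; apply: ler_pM; rewrite ?mulr_ge0 ?invr_ge0 ?nrm_ge0 ?(ltW h0)//; last exact: Tb (ltW h0).
rewrite (le_trans (ler_wpM2l _ h1)) ?invr_ge0 ?(ltW h0)// exprMn [h ^+ 2]expr2 !mulrA mulVf ?gt_eqF// mul1r mulrC [nrm lam * _]mulrCA -expr2 mulrC//.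
Qed.

Let shift_cont x : rtends (fun h => kap h *: T h x) x.
Proof.
apply: (@rtends_eq _ _ (fun h => (kap h - 1) *: T h x + T h x)).
  by move=> h _; rewrite scalerBl scale1r subrK.
rewrite -[X in rtends _ X]add0r; apply: rtendsD (sg_rtends x).
apply: (@rtends_squeeze _ _ _ _ (nrm lam * (M * nrm x))); first by rewrite !mulr_ge0 ?nrm_ge0.
move=> h h0 _; rewrite subr0 nrmZ mulrAC ler_pM ?nrm_ge0 ?(Tb _ (ltW h0))//.
by rewrite mulrC kapB1// ltW.
Qed.

Let shift_small x (e : R) : 0 < e -> exists2 dl : R, 0 < dl &
  forall h, 0 <= h < dl -> nrm (kap h *: T h x - x) <= e.
Proof.
move=> e0; have [dl dl0 H] := shift_cont x e0; exists dl => // h /andP[].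
rewrite le_eqVlt => /predU1P[<- _|h0 hd]; last by rewrite H// h0.
by rewrite /kap mul0r oppr0 cexp0 scale1r (sg_0 Tsg) subrr nrm0 ltW.
Qed.

Let kT_bound h x : 0 <= h -> nrm (kap h *: T h x) <= M * nrm x.
Proof.
by move=> h0; rewrite nrmZ -[leRHS]mul1r ler_pM ?nrm_ge0 ?kap_le1 ?Tb.
Qed.

(** h (1 - e^(-lam h) T(h))^-1 is the left Riemann sum of step h of the Laplace integral for the
    resolvent. Its norm is controlled by h / (1 - e^(-mu h)) <= 1/mu + h. *)
Lemma disc_resolvent_exists : exists D : R -> X -> X, forall h, 0 < h ->
  [/\ disc_calc T h (fun z => h%:C / (1 - kap h * z)) (D h),
      forall x, D h (x - kap h *: T h x) = h%:C *: x,
      forall x, D h x - kap h *: T h (D h x) = h%:C *: x &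
      forall x, nrm (D h x) <= M * (mu^-1 + h) * nrm x].
Proof.
have ex h : exists D : X -> X, 0 < h -> [/\ disc_calc T h (fun z => h%:C / (1 - kap h * z)) D,
      forall x, D (x - kap h *: T h x) = h%:C *: x,
      forall x, D x - kap h *: T h (D x) = h%:C *: x &
      forall x, nrm (D x) <= M * (mu^-1 + h) * nrm x]; last first.
  by have [D DP] := choice ex; exists D.
have [h0|hn] := ltP 0 h; last by exists id.
have k1 : nrm (kap h) < 1 by rewrite nrm_kap -[ltRHS]expR0 ltr_expR oppr_lt0 mulr_gt0.
have [G [G1 G2 G3 G4]] := dc_geometric Tsg M1 omega0 TM (ltW h0) k1.
exists (fun x => h%:C *: G x) => _; split.
- exact: (dcZ Tsg M1 omega0 TM (ltW h0) h%:C G1).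
- by move=> x; rewrite G2.
- by move=> x; rewrite TZ scalerA mulrC -scalerA -scalerBr G3.
move=> x; rewrite nrmZ nrm_real gtr0_norm//; move: (G4 x); rewrite nrm_kap -expRD -opprD.
rewrite (_ : h * complex.Re lam + omega * h = mu * h); last by rewrite /mu mulrDl mulrC.
have s0 : 0 < mu * h by rewrite mulr_gt0.
have e1 : (mu * h) / (1 + mu * h) <= 1 - expR (- (mu * h)).
  rewrite expRN lerBrDr -lerBrDl (_ : 1 - _ = (1 + mu * h)^-1).
    by rewrite lef_pV2 ?posrE ?expR_gt0 ?addr_gt0// expR_ge1Dx.
  by field; rewrite gt_eqF// addr_gt0.
have e0 : 0 < 1 - expR (- (mu * h)) by rewrite (lt_le_trans _ e1)// divr_gt0// addr_gt0.
move=> H; rewrite (le_trans (ler_wpM2l (ltW h0) H))// mulrA ler_wpM2r ?nrm_ge0// mulrCA ler_wpM2l//.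
have -> : mu^-1 + h = h * ((mu * h) / (1 + mu * h))^-1.
  by field; rewrite !gt_eqF// addr_gt0.
by rewrite ler_wpM2l ?(ltW h0)// lef_pV2 ?posrE// divr_gt0// addr_gt0.
Qed.

Section WithD.
Variable D : R -> X -> X.
Hypothesis DP : forall h, 0 < h ->
  [/\ disc_calc T h (fun z => h%:C / (1 - kap h * z)) (D h),
      forall x, D h (x - kap h *: T h x) = h%:C *: x,
      forall x, D h x - kap h *: T h (D h x) = h%:C *: x &
      forall x, nrm (D h x) <= M * (mu^-1 + h) * nrm x].

Let DZ h c x : 0 < h -> D h (c *: x) = c *: D h x.
Proof.
move=> h0; have [d1 _ _ _] := DP h0; have := dc_lin d1 c x 0; rewrite !addr0 => ->.
have := dcB 0 0 d1; rewrite !subrr => ->.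
by rewrite addr0.
Qed.

Let DB h x y : 0 < h -> D h (x - y) = D h x - D h y.
Proof. by move=> h0; have [d1 _ _ _] := DP h0; exact: dcB d1. Qed.

Let D_iter h (n : nat) x : 0 < h ->
  D h x - kap (n%:R * h) *: T (n%:R * h) (D h x) = h%:C *: \sum_(i < n) kap (i%:R * h) *: T (i%:R * h) x.
Proof.
move=> h0; have [d1 _ d3 _] := DP h0; rewrite -(big_mkord xpredT (fun i => kap (i%:R * h) *: T (i%:R * h) x)).
rewrite scaler_sumr (eq_bigr (fun j => - (kap (j.+1%:R * h) *: T (j.+1%:R * h) (D h x) - kap (j%:R * h) *: T (j%:R * h) (D h x)))); last first.
  move=> j _; rewrite opprB scalerA mulrC -scalerA -TZ -d3 TBr TZ scalerBr scalerA.
  by rewrite -(sg_add Tsg) ?mulr_ge0 ?(ltW h0)// -kapD -natr1 mulrDl mul1r.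
by rewrite sumrN telescope_sumr// opprB mul0r /kap mul0r oppr0 cexp0 scale1r (sg_0 Tsg).
Qed.

Let avg_small (n : nat) h x (e dl : R) : 0 < h -> 0 <= e ->
  (forall s, 0 <= s < dl -> nrm (kap s *: T s x - x) <= e) -> n%:R * h <= dl ->
  nrm (h%:C *: \sum_(i < n) kap (i%:R * h) *: T (i%:R * h) x - (n%:R * h)%:C *: x) <= n%:R * h * e.
Proof.
move=> h0 e0 H nh.
have -> : (n%:R * h)%:C *: x = h%:C *: \sum_(i < n) x.
  by rewrite sumr_const card_ord -[x *+ n]scaler_nat scalerA mulrC rmorphM /= rmorph_nat.
rewrite -scalerBr -sumrB nrmZr gtr0_norm// [n%:R * h]mulrC -mulrA ler_wpM2l ?(ltW h0)//.
rewrite (le_trans (nrm_sum _ _ _))// (@le_trans _ _ (\sum_(i < n) e))//; last first.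
  by rewrite sumr_const card_ord mulr_natl.
apply: ler_sum => i _; apply: H; rewrite mulr_ge0 ?(ltW h0)//= (lt_le_trans _ nh)//.
by rewrite ltr_pM2r// ltr_nat.
Qed.

Let dy n : R := 2^-1 ^+ n.
Let dy0 n : 0 < dy n. Proof. by rewrite exprn_gt0 ?invr_gt0. Qed.
Let dy1 n : dy n <= 1. Proof. by rewrite exprn_ile1 ?invr_ge0// invf_le1 ?ler1n. Qed.

Let CD := M * (mu^-1 + 1).
Let CD0 : 0 <= CD. Proof. by rewrite mulr_ge0// addr_ge0// invr_ge0 ltW. Qed.

Let D_bound h x : 0 < h -> h <= 1 -> nrm (D h x) <= CD * nrm x.
Proof.
move=> h0 h1; have [_ _ _ d4] := DP h0; rewrite (le_trans (d4 x))// ler_wpM2r ?nrm_ge0//.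
by rewrite ler_wpM2l// lerD2l.
Qed.

(** [D] of the coarse step is applied to the identity [D_iter] for the fine step, taken over one
    coarse step. The left side becomes a multiple of the fine approximation, and the right side is
    the coarse one at an average of the orbit near x. *)
Let D_dyadic_lim x : exists l, tends (fun n => D (dy n) x) l.
Proof.
have key (e dl : R) l l' : 0 <= e -> (forall s, 0 <= s < dl -> nrm (kap s *: T s x - x) <= e) ->
    dy l <= dl -> (l <= l')%N -> nrm (D (dy l') x - D (dy l) x) <= CD * e.
  move=> e0 H ld ll; pose n := (2 ^ (l' - l))%N.
  have nE : n%:R * dy l' = dy l.
    rewrite /dy -[in LHS](subnK ll) exprD mulrA /n natrX -exprMn mulfV ?pnatr_eq0// expr1n mul1r//.
  have [_ d2 _ _] := DP (dy0 l).
  have := D_iter n x (dy0 l'); rewrite nE => E.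
  have := avg_small (n := n) (dy0 l') e0 H; rewrite nE -E => /(_ ld) B.
  have := D_bound (D (dy l') x - kap (dy l) *: T (dy l) (D (dy l') x) - (dy l)%:C *: x) (dy0 l) (dy1 l).
  rewrite DB// d2 DZ// -scalerBr nrmZr gtr0_norm// => B'.
  rewrite -(ler_pM2l (dy0 l)) (le_trans B')// mulrCA ler_wpM2l//.
apply: tends_cauchy => e e0.
have c0 : 0 < (CD + 1) * 2 by rewrite mulr_gt0// ltr_wpDl.
have e1 := divr_gt0 e0 c0.
have [dl dl0 H] := shift_small x e1; have [N HN] := dyadic_small dl0.
exists N => m n mN nN; rewrite (le_trans (nrm_triangle (D (dy N) x) _ _))// [X in _ + X]nrm_dist.
have k1 := key _ _ _ _ (ltW e1) H (ltW (HN N (leqnn N))) mN.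
have k2 := key _ _ _ _ (ltW e1) H (ltW (HN N (leqnn N))) nN.
rewrite (le_trans (lerD k1 k2))//.
have : (CD + 1) * 2 * (e / ((CD + 1) * 2)) = e by rewrite mulrCA mulfV ?mulr1// gt_eqF.
by move: e1; set e' := e / _ => e1; rewrite !mulrDl mul1r; move: (CD * e') (CD * 2 * e') (mulrAC CD 2 e') => u v ->; lra.
Qed.

(** The limit is known along dyadic steps only, whereas the increment h is arbitrary. It is split
    into a multiple of a much finer dyadic step, where [D_iter] applies, and a remainder over which
    the orbit hardly moves. *)
Let resolvent_step (Rl : X -> X) x : (forall x, tends (fun n => D (dy n) x) (Rl x)) ->
  rtends (fun h => (h^-1)%:C *: (Rl x - kap h *: T h (Rl x))) x.
Proof.
move=> RlP e e0; have [dl dl0 H] := shift_small x e0; exists dl => // h /andP[h0 hd].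
suff S : nrm (Rl x - kap h *: T h (Rl x) - h%:C *: x) <= h * e.
  have -> : (h^-1)%:C *: (Rl x - kap h *: T h (Rl x)) - x = (h^-1)%:C *: (Rl x - kap h *: T h (Rl x) - h%:C *: x).
    by rewrite [RHS]scalerBr scalerA -rmorphM /= mulVf ?gt_eqF// scale1r.
  by rewrite nrmZr gtr0_norm ?invr_gt0// mulrC ler_pdivrMr// mulrC.
apply/ler_addgt0Pr => b b0.
pose B := nrm x + M * (2 + M) + (1 + M) + 1.
have B0 : 0 < B by rewrite ltr_wpDl// !addr_ge0 ?mulr_ge0 ?addr_ge0 ?nrm_ge0.
have bB := divr_gt0 b0 B0.
have [d' d'0 H'] := shift_small (Rl x) bB.
have [N HN] := dyadic_small (e := Num.min d' (b / B)) ltac:(by rewrite lt_min d'0).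
have [N' HN'] := RlP x _ bB.
pose n := maxn N N'; have := HN n (leq_maxl _ _); rewrite lt_min => /andP[nd nb].
have Dn := HN' n (leq_maxr _ _).
set y := D (dy n) x in Dn *.
(* h = k dy + r with 0 <= r < dy. *)
pose k := Num.truncn (h / dy n).
have /andP[k1 k2] : k%:R <= h / dy n < k.+1%:R by apply: truncn_itv; rewrite divr_ge0 ?ltW.
rewrite ler_pdivlMr ?dy0// in k1; rewrite ltr_pdivrMr ?dy0// -natr1 mulrDl mul1r in k2.
pose r := h - k%:R * dy n.
have r0 : 0 <= r by rewrite subr_ge0.
have rd : r < dy n by rewrite ltrBlDl.
have kd0 : 0 <= k%:R * dy n by rewrite mulr_ge0// ltW.
have E1 : y - kap h *: T h y = (y - kap (k%:R * dy n) *: T (k%:R * dy n) y) +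
    kap (k%:R * dy n) *: T (k%:R * dy n) (y - kap r *: T r y).
  rewrite TBr scalerBr addrA subrK TZ scalerA -(sg_add Tsg)// -kapD.
  by rewrite /r [_ + (h - _)]addrC subrK.
have A1 : nrm (y - kap (k%:R * dy n) *: T (k%:R * dy n) y - h%:C *: x) <= h * e + dy n * nrm x.
  rewrite D_iter//; have := avg_small (n := k) (dy0 n) (ltW e0) H (le_trans k1 (ltW hd)) => B1.
  rewrite (le_trans (nrm_triangle ((k%:R * dy n)%:C *: x) _ _))// lerD//.
    by rewrite (le_trans B1)// ler_wpM2r ?(ltW e0).
  rewrite -scalerBl -rmorphB nrmZr ler_wpM2r ?nrm_ge0// distrC ger0_norm//.
  exact: ltW.
have A2 : nrm (y - kap r *: T r y) <= b / B * (2 + M).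
  rewrite (subr_insert2 y (Rl x) (kap r *: T r (Rl x))) -scalerBr -TBr.
  rewrite (_ : b / B * (2 + M) = b / B + b / B + M * (b / B)); last by ring.
  rewrite (le_trans (nrmD _ _))// lerD//; last first.
    by rewrite (le_trans (kT_bound _ r0))// ler_wpM2l// nrm_dist.
  by rewrite (le_trans (nrmB _ _))// lerD// H'// r0 (lt_trans rd).
have A3 : nrm (Rl x - kap h *: T h (Rl x) - (y - kap h *: T h y)) <= (1 + M) * (b / B).
  rewrite subrACA.
  rewrite -scalerBr -TBr (le_trans (nrmB _ _))// addrC mulrDl mul1r lerD//.
  by rewrite (le_trans (kT_bound _ (ltW h0)))// ler_wpM2l.
rewrite (le_trans (nrm_triangle (y - kap h *: T h y) _ _))//.
rewrite E1 in A3 *; rewrite [X in _ + nrm X <= _]addrAC.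
rewrite (@le_trans _ _ ((1 + M) * (b / B) + (h * e + dy n * nrm x + M * (b / B * (2 + M)))))//.
  rewrite lerD// (le_trans (nrmD _ _))// lerD//.
  by rewrite (le_trans (kT_bound _ kd0))// ler_wpM2l.
rewrite (@le_trans _ _ (h * e + b / B * ((1 + M) + nrm x + M * (2 + M))))//.
  rewrite !mulrDr !addrA -!addrA addrCA lerD2l.
  have : dy n * nrm x <= b / B * nrm x by rewrite ler_wpM2r ?nrm_ge0// ltW.
  by move: (nrm x) (b / B) (dy n) => u v w ?; lra.
by rewrite lerD2l mulrAC ler_pdivrMr// ler_wpM2l ?(ltW b0)// /B; lra.
Qed.

(** [D h] maps the difference quotient of [Rl x] exactly to [Rl x]. Since this quotient tends to x
    and the [D h] are uniformly bounded, convergence holds along all h. *)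
Let resolvent_lim (Rl : X -> X) : (forall x, tends (fun n => D (dy n) x) (Rl x)) ->
  forall x, rtends (fun h => D h x) (Rl x).
Proof.
move=> RlP x e e0; have c0 : 0 < CD + 1 by rewrite ltr_wpDl.
have [dl dl0 H] := resolvent_step x RlP (divr_gt0 e0 c0).
exists (Num.min dl 1); first by rewrite lt_min dl0 ltr01.
move=> h /andP[h0]; rewrite lt_min => /andP[hd h1].
have [_ d2 _ _] := DP h0; set y := (h^-1)%:C *: (Rl x - kap h *: T h (Rl x)) in H.
have E : D h ((h^-1)%:C *: (Rl x - kap h *: T h (Rl x))) = Rl x.
  by rewrite DZ// d2 scalerA -rmorphM /= mulVf ?gt_eqF// scale1r.
rewrite -E -DB// (le_trans (D_bound _ h0 (ltW h1)))// nrm_dist.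
rewrite (@le_trans _ _ ((CD + 1) * (e / (CD + 1))))//; last by rewrite mulrCA mulfV ?mulr1// gt_eqF.
by rewrite ler_pM ?nrm_ge0 ?lerDl ?H ?h0.
Qed.

Let resolvent_bound (Rl : X -> X) : (forall x, tends (fun n => D (dy n) x) (Rl x)) ->
  forall x, nrm (Rl x) <= M / mu * nrm x.
Proof.
move=> RlP x; apply/ler_addgt0Pr => e e0; have c0 : 0 < M * nrm x + 1 by rewrite ltr_wpDl ?mulr_ge0 ?nrm_ge0.
have [N HN] := dyadic_small (divr_gt0 e0 c0).
apply: (@tends_le _ _ (fun n => D (dy (maxn n N)) x)).
  by move=> b b0; have [N' H] := RlP x b b0; exists N' => n nN; apply: H; rewrite (leq_trans nN)// leq_maxl.
move=> n; have [_ _ _ d4] := DP (dy0 (maxn n N)); rewrite (le_trans (d4 x))// mulrDr mulrDl lerD2l.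
have := HN (maxn n N) (leq_maxr _ _); rewrite -/(dy _) => hn; rewrite mulrAC mulrC.
rewrite (@le_trans _ _ (e / (M * nrm x + 1) * (M * nrm x + 1)))//.
  by rewrite ler_pM ?mulr_ge0 ?nrm_ge0 ?(ltW hn) ?(ltW (dy0 _)) ?lerDl.
by rewrite divfK// gt_eqF.
Qed.

Lemma resolvent_of_disc : exists Rl : X -> X,
  [/\ forall x, rtends (fun h => (h^-1)%:C *: (Rl x - kap h *: T h (Rl x))) x,
      forall x, rtends (fun h => D h x) (Rl x) &
      forall x, nrm (Rl x) <= M / mu * nrm x].
Proof.
have [Rl RlP] := choice D_dyadic_lim.
exists Rl; split=> [x|x|x]; [exact: resolvent_step|exact: resolvent_lim|exact: resolvent_bound].
Qed.
End WithD.

Variable A : operator X.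
Hypothesis A_gen : scale_op (-1) A = generator T.

Lemma generatorP v w : A (v, w) <-> rtends (fun h => (h^-1)%:C *: (v - T h v)) w.
Proof.
have E h : (h^-1)%:C *: (v - T h v) = -1 *: ((h^-1)%:C *: (T h v - v)).
  by rewrite scaleN1r -scalerN opprB.
have G z : generator T (v, z) <-> rtends (fun h => (h^-1)%:C *: (T h v - v)) z by exact: rtendsP.
split=> [Avw|/(rtendsZ (-1)) H].
  have /G/(rtendsZ (-1)) : generator T (v, - w) by rewrite -A_gen; exists w; rewrite //= scaleN1r.
  rewrite scaleN1r opprK => H; apply: rtends_eq H => h _; by rewrite E.
have : generator T (v, - w).
  apply/G; rewrite -[- w]scaleN1r; apply: rtends_eq H => h _.
  by rewrite E !scaleN1r opprK.
by rewrite -A_gen => -[y Ay /= /eqP]; rewrite scaleN1r eqr_opp => /eqP ->.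
Qed.

(** e^(-lam h) T(h) is the semigroup generated by -(lam + A). *)
Lemma shifted_generatorP v w : A (v, w) <->
  rtends (fun h => (h^-1)%:C *: (v - kap h *: T h v)) (lam *: v + w).
Proof.
rewrite generatorP; split=> [H|H].
  have := rtendsD (rtendsZ (-1) (kap_deriv v)) H; rewrite scalerA mulN1r opprK.
  apply: rtends_eq => h _; rewrite scaleN1r -scalerN -scalerDr; congr (_ *: _).
  by rewrite scalerBl scale1r opprB addrC addrA subrK.
have := rtendsD (kap_deriv v) H; rewrite addrA scaleNr addNr add0r.
apply: rtends_eq => h _; rewrite -scalerDr; congr (_ *: _).
by rewrite scalerBl scale1r addrC addrA subrK.
Qed.

(** [Rl] is the inverse of lam + A, that is, the resolvent at [lam] of the generator -A. *)
Definition is_resolvent (Rl : X -> X) :=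
  (forall x, A (Rl x, x - lam *: Rl x)) /\ (forall v w, A (v, w) -> Rl (lam *: v + w) = v).

Lemma resolvent_exists : exists Rl : X -> X, [/\ is_resolvent Rl,
  forall x, nrm (Rl x) <= M / mu * nrm x &
  exists D : R -> X -> X,
   [/\ forall h, 0 < h -> disc_calc T h (fun z => h%:C / (1 - kap h * z)) (D h),
       forall h x, 0 < h -> nrm (D h x) <= M * (mu^-1 + h) * nrm x &
       forall x, rtends (fun h => D h x) (Rl x)]].
Proof.
have [D DP] := disc_resolvent_exists; have [Rl [R1 R2 R3]] := resolvent_of_disc DP.
exists Rl; split=> //; last first.
  by exists D; split=> // h h0; [case: (DP _ h0)|move=> h0'; case: (DP _ h0')].
split=> [x|v w /shifted_generatorP H].
  by apply/shifted_generatorP; rewrite addrC subrK.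
have DB h x y : 0 < h -> D h (x - y) = D h x - D h y by move=> h0; have [d1 _ _ _] := DP _ h0; exact: dcB d1.
apply: (@rtends_unique _ _ (fun h => D h ((h^-1)%:C *: (v - kap h *: T h v)))).
  apply: (@rtends_app _ _ D (M * (mu^-1 + 1))) H => //.
  move=> h x y /andP[h0 h1]; rewrite -DB//; have [_ _ _ d4] := DP _ h0.
  by rewrite (le_trans (d4 _))// ler_wpM2r ?nrm_ge0// ler_wpM2l// lerD2l.
apply: (@rtends_eq _ _ (fun=> v)) => [h h0|e e0].
  have [d1 d2 _ _] := DP _ h0; have := dc_lin d1 (h^-1)%:C (v - kap h *: T h v) 0.
  rewrite !addr0 d2 scalerA -rmorphM /= mulVf ?gt_eqF// scale1r => ->.
  by have := DB h 0 0 h0; rewrite !subrr => ->; rewrite addr0.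
by exists 1 => // h _; rewrite subrr nrm0 ltW.
Qed.
End FixedLambda.
End Resolvent.

Section PointwiseLimits.
Context {R : realType} {X : completeNormedModType R[i]}.

Lemma rtends_cst (l : X) : rtends (fun _ : R => l) l.
Proof. by move=> e e0; exists 1 => // h _; rewrite subrr nrm0 ltW. Qed.

Lemma rtends_app_conv (F : R -> X -> X) (B : R) (f : R -> X) l z :
  (forall h x y, 0 < h <= 1 -> nrm (F h x - F h y) <= B * nrm (x - y)) ->
  rtends (fun h => F h (f h)) z -> rtends f l -> rtends (fun h => F h l) z.
Proof.
move=> FB Ff fl e e0; have e2 := divr_gt0 e0 (ltr0n R 2).
have B0 : 0 < `|B| + 1 by rewrite ltr_wpDl.
have [d1 d10 H1] := Ff _ e2; have [d2 d20 H2] := fl _ (divr_gt0 e2 B0).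
exists (Num.min 1 (Num.min d1 d2)); first by rewrite !lt_min ltr01 d10.
move=> h /andP[h0]; rewrite !lt_min => /and3P[h1 hd1 hd2].
rewrite (le_trans (nrm_triangle (F h (f h)) _ _))// (splitr e) lerD ?H1 ?h0//.
rewrite (le_trans (FB _ _ _ _)) ?h0 ?(ltW h1)// (@le_trans _ _ ((`|B| + 1) * nrm (l - f h)))//.
  by rewrite ler_wpM2r ?nrm_ge0// (le_trans (ler_norm _))// lerDl.
by rewrite mulrC -ler_pdivlMr// nrm_dist H2// h0.
Qed.
End PointwiseLimits.

(** * The Cayley transform of the semigroup *)

Section Cayley.
Context {R : realType} {X : completeNormedModType R[i]}.

(* The generator symbol at z = e^{-i s h}, by the Cayley transform; [None] is
   the point at infinity. *)
Definition cayley (h : R) (z : R[i]) : option R[i] :=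
  if z == -1 then None else Some ((2 / h)%:C * ((1 - z) / (1 + z))).

Definition resolvent_symbol (lam : R[i]) (o : option R[i]) : R[i] :=
  if o is Some u then (lam + u)^-1 else 0.

(** On the circle conj(z) = 1/z, so conjugation changes the sign of (1 - z) / (1 + z). *)
Lemma Re_cayley h z u : nrm z = 1 -> cayley h z = Some u -> complex.Re u = 0.
Proof.
move=> z1; rewrite /cayley; case: eqP => // /eqP zn1 [<-].
have zz := mulJ_nrm1 z1; have z0 : z != 0 by apply: contra_eq_neq z1 => ->; rewrite nrm0 eq_sym oner_neq0.
have s0 : 1 + z != 0 by rewrite addrC addr_eq0.
have cz : z^*%C = z^-1 by apply: (mulIf z0); rewrite zz mulVf.
set v := (1 - z) / (1 + z).
have cv : v^*%C = - v.
  have -> : v^*%C = (1 - z^*%C) / (1 + z^*%C) by rewrite /v rmorphM fmorphV rmorphB rmorphD rmorph1.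
  have s0' : z + 1 != 0 by rewrite addrC.
  by rewrite cz /v; field; rewrite z0 ?s0 ?s0'.
move: cv; case: (v) => a b /= /eqP; rewrite eq_complex /= => /andP[/eqP E _].
have a0 : a = 0 by move: E; lra.
by rewrite a0 mulr0 mul0r subr0.
Qed.

(** With w = h lam / 2, the resolvent symbol becomes a geometric one of ratio (1 - w) / (1 + w),
    times 1 + z. The factor 1 + z makes 1 + T(h) appear without being inverted. *)
Lemma cayley_identity (h lam z : R[i]) : h != 0 -> 1 + z != 0 -> 1 + h / 2 * lam != 0 ->
  lam + 2 / h * ((1 - z) / (1 + z)) != 0 ->
  h / 2 / (1 + h / 2 * lam) * ((1 - (1 - h / 2 * lam) / (1 + h / 2 * lam) * z)^-1 +
    z * (1 - (1 - h / 2 * lam) / (1 + h / 2 * lam) * z)^-1) =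
  (lam + 2 / h * ((1 - z) / (1 + z)))^-1.
Proof.
move=> h0 z0 w0 u0; have dd (d : R[i]) : d^-1 + z * d^-1 = (1 + z) * d^-1 by rewrite mulrDl mul1r.
have w2 : 2 + h * lam != 0.
  apply: contraNN w0 => /eqP E; apply/eqP; apply: (mulfI (x := 2)); rewrite ?pnatr_eq0// mulr0 -E.
  by field.
rewrite dd.
have -> : 1 - (1 - h / 2 * lam) / (1 + h / 2 * lam) * z =
    h / 2 * (1 + z) * (lam + 2 / h * ((1 - z) / (1 + z))) / (1 + h / 2 * lam).
  by field; rewrite h0 z0 w2.
by move: u0; set u := lam + _ => u0; field; rewrite u0 h0 z0 w2.
Qed.

Lemma Re_neq0 (lam u : R[i]) : 0 < complex.Re lam -> complex.Re u = 0 -> lam + u != 0.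
Proof.
move=> l0 u0; apply/eqP => E; move: l0.
by have := congr1 (@complex.Re R) E; rewrite raddfD /= u0 addr0 => ->; rewrite ltxx.
Qed.

Lemma nrm_Re (z : R[i]) : `|complex.Re z| <= nrm z.
Proof. by rewrite -ler_sqr ?nnegrE ?nrm_ge0// real_normK ?num_real// nrm_sqr lerDl sqr_ge0. Qed.

(** |1 + w|^2 - |1 - w|^2 = 4 Re w. The gap keeps the geometric ratio away from 1 by an amount of
    order h, which cancels the factor h in front. *)
Lemma cayley_gap (w : R[i]) : 0 < complex.Re w ->
  2 * complex.Re w / (1 + nrm w) <= nrm (1 + w) - nrm (1 - w).
Proof.
move=> w0; have n0 : 0 < 1 + nrm w by rewrite ltr_wpDr ?nrm_ge0.
have p0 : 0 < nrm (1 + w).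
  rewrite (lt_le_trans _ (nrm_Re _))// (lt_le_trans _ (ler_norm _))// raddfD /= ltr_wpDl ?ler01//.
have E : nrm (1 + w) ^+ 2 - nrm (1 - w) ^+ 2 = 4 * complex.Re w.
  by rewrite !nrm_sqr; case: (w) => a b /=; ring.
have s0 : 0 < nrm (1 + w) + nrm (1 - w) by rewrite ltr_wpDr ?nrm_ge0.
have s1 : nrm (1 + w) + nrm (1 - w) <= 2 * (1 + nrm w).
  have := nrmD 1 w; have := nrmB 1 w; rewrite nrm1; lra.
have -> : nrm (1 + w) - nrm (1 - w) = 4 * complex.Re w / (nrm (1 + w) + nrm (1 - w)).
  by rewrite -E subr_sqr mulfK// gt_eqF.
rewrite ler_pdivrMr// mulrAC ler_pdivlMr//.
have := ler_wpM2l (ltW w0) s1; set a := nrm (1 + w) + _; move: (complex.Re w) (1 + nrm w) => x y; lra.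
Qed.

Variable T : R -> {linear X -> X}.
Hypothesis Tsg : C0_semigroup T.
Variables (M omega : R).
Hypotheses (M1 : 1 <= M) (omega0 : 0 < omega).
Hypothesis TM : forall t x, 0 <= t -> nrm (T t x) <= M * expR (- (omega * t)) * nrm x.
Variable A : operator X.
Hypothesis A_gen : scale_op (-1) A = generator T.
Let M0 : 0 <= M. Proof. exact: le_trans M1. Qed.
Let dM := dcM Tsg M1 omega0 TM.
Let dZ := dcZ Tsg M1 omega0 TM.
Let dT := dc_T Tsg.

(** [F h] is the inverse of lam + A_h, where A_h = (2/h) (1 - T(h)) (1 + T(h))^-1 formally; being a
    function of T(h) with a symbol on the circle, it enters the discrete calculus. *)
Lemma cayley_approx (lam : R[i]) (Rl : X -> X) : 0 < complex.Re lam -> is_resolvent lam A Rl ->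
  exists F : R -> X -> X,
   [/\ forall h, 0 < h -> disc_calc T h (fun z => resolvent_symbol lam (cayley h z)) (F h),
       forall h x, 0 < h -> nrm (F h x) <= (1 + M) * M * ((1 + nrm lam * h) / complex.Re lam) * nrm x &
       forall x, rtends (fun h => F h x) (Rl x)].
Proof.
move=> l0 [R1 R2]; pose w (h : R) := (h / 2)%:C * lam; pose kc h := (1 - w h) / (1 + w h).
have wR h : complex.Re (w h) = h / 2 * complex.Re lam by rewrite /w; case: (lam) => a b /=; rewrite mul0r subr0.
have w0 h : 0 < h -> 0 < complex.Re (w h) by move=> h0; rewrite wR mulr_gt0 ?divr_gt0.
have gap0 h : 0 < h -> 0 < nrm (1 + w h) - nrm (1 - w h).
  move=> h0; rewrite (lt_le_trans _ (cayley_gap (w0 h h0)))// divr_gt0 ?mulr_gt0 ?w0//.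
  by rewrite ltr_wpDr ?nrm_ge0.
have p0 h : 0 < h -> 0 < nrm (1 + w h).
  by move=> /gap0; rewrite subr_gt0; apply: le_lt_trans; exact: nrm_ge0.
have wn0 h : 0 < h -> 1 + w h != 0 by move=> h0; rewrite -nrm_eq0 gt_eqF// p0.
have nkc h : nrm (kc h) = nrm (1 - w h) / nrm (1 + w h) by rewrite nrmM nrmV.
have kc1 h : 0 < h -> nrm (kc h) < 1.
  by move=> h0; rewrite nkc ltr_pdivrMr ?p0// mul1r -subr_gt0 gap0.
have ex h : exists Q : X -> X, 0 < h -> [/\ disc_calc T h (fun z => (1 - kc h * z)^-1) Q,
      forall x, Q (x - kc h *: T h x) = x &
      forall x, nrm (Q x) <= M / (1 - nrm (kc h)) * nrm x].
  have [h0|hn] := ltP 0 h; last by exists id.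
  have [G [G1 G2 _ G4]] := dc_geometric Tsg M1 omega0 TM (ltW h0) (kc1 h h0).
  exists G => _; split=> // x; rewrite (le_trans (G4 x))// ler_wpM2r ?nrm_ge0// ler_wpM2l//.
  have k0 : 0 < 1 - nrm (kc h) by rewrite subr_gt0 kc1.
  have kle : nrm (kc h) * expR (- (omega * h)) <= nrm (kc h).
    by rewrite ler_piMr ?nrm_ge0// -[leRHS]expR0 ler_expR oppr_le0 mulr_ge0 ?ltW.
  by rewrite lef_pV2 ?posrE ?subr_gt0 ?(le_lt_trans kle) ?kc1// lerD2l lerN2.
have [Q QP] := choice ex.
pose a h := (h / 2)%:C / (1 + w h).
pose F h x := a h *: (Q h x + T h (Q h x)).
have Fdc h : 0 < h -> disc_calc T h (fun z => resolvent_symbol lam (cayley h z)) (F h).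
  move=> h0; have [Q1 _ _] := QP h h0.
  have D1 := dcD Q1 (dM (ltW h0) (dT (ltW h0)) Q1).
  apply: dc_eq (dZ (ltW h0) (a h) D1) => // z z1.
  rewrite /cayley; case: eqP => [->|/eqP zn1] /=.
    by rewrite mulN1r subrr mulr0.
  have s0 : 1 + z != 0 by rewrite addrC addr_eq0.
  have u0 := Re_neq0 l0 (Re_cayley (h := h) z1 _); rewrite /cayley (negbTE zn1) in u0.
  have {}u0 := u0 _ erefl; rewrite /a /kc.
  have hn : (h%:C : R[i]) != 0 by rewrite (eq_complex _ 0) /= eqxx andbT gt_eqF.
  have h2 : (h / 2)%:C = h%:C / 2 :> R[i] by rewrite rmorphM fmorphV /= rmorph_nat.
  have h2' : (2 / h)%:C = 2 / h%:C :> R[i] by rewrite rmorphM fmorphV /= rmorph_nat.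
  have := wn0 h h0; move: u0; rewrite /w h2 h2' => u0 W0.
  exact: cayley_identity.
have Fb h x : 0 < h -> nrm (F h x) <= (1 + M) * M * ((1 + nrm lam * h) / complex.Re lam) * nrm x.
  move=> h0; have [_ _ Q3] := QP h h0.
  rewrite nrmZ (le_trans (ler_wpM2l (nrm_ge0 _) (nrmD _ _)))//.
  have k0 : 0 < 1 - nrm (kc h) by rewrite subr_gt0 kc1.
  have b1 : nrm (Q h x) + nrm (T h (Q h x)) <= (1 + M) * (M / (1 - nrm (kc h)) * nrm x).
    rewrite mulrDl mul1r lerD ?Q3// (le_trans (sg_bounded M1 omega0 TM _ (ltW h0)))//.
    by rewrite ler_wpM2l.
  rewrite (le_trans (ler_wpM2l (nrm_ge0 _) b1))// !mulrA ler_wpM2r ?nrm_ge0//.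
  rewrite -!mulrA mulrCA ler_wpM2l ?addr_ge0// mulrCA ler_wpM2l//.
  have -> : nrm (a h) / (1 - nrm (kc h)) = h / 2 / (nrm (1 + w h) - nrm (1 - w h)).
    rewrite /a nrmM nrmV nrm_real gtr0_norm ?divr_gt0// nkc.
    have := gap0 _ h0; have := p0 _ h0; move: (nrm (1 + _)) (nrm (1 - _)) => u v u0 g0.
    by field; rewrite !gt_eqF.
  have nw : nrm (w h) = h / 2 * nrm lam by rewrite nrmM nrm_real gtr0_norm// divr_gt0.
  rewrite ler_pdivrMr ?gap0//.
  have g := cayley_gap (w0 h h0); rewrite wR nw in g.
  have n0 : 0 < 1 + h / 2 * nrm lam by rewrite ltr_wpDr ?mulr_ge0 ?nrm_ge0 ?divr_ge0 ?ltW.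
  have L0 : 0 <= (1 + nrm lam * h) / complex.Re lam.
    by rewrite divr_ge0 ?(ltW l0)// addr_ge0// mulr_ge0 ?nrm_ge0 ?ltW.
  apply: le_trans (ler_wpM2l L0 g).
  have -> : (1 + nrm lam * h) / complex.Re lam * (2 * (h / 2 * complex.Re lam) / (1 + h / 2 * nrm lam)) =
     h * ((1 + nrm lam * h) / (1 + h / 2 * nrm lam)).
    by move: (complex.Re lam) l0 (nrm lam) n0 => u u0 v v0; field; rewrite !gt_eqF//; move: v0; lra.
  rewrite ler_wpM2l ?(ltW h0)// ler_pdivlMr//.
  have : 0 <= h * nrm lam by rewrite mulr_ge0 ?nrm_ge0 ?ltW.
  by rewrite [nrm lam * h]mulrC mulrAC; move: (h * nrm lam) => u; lra.
exists F; split=> // x.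
have FB h y z : 0 < h -> F h (y - z) = F h y - F h z by move=> h0; exact: dcB (Fdc h h0).
have hinv (h : R) : 0 < h -> (h^-1)%:C * w h = lam / 2.
  move=> h0; rewrite /w mulrA -rmorphM /= mulrA mulVf ?gt_eqF// mul1r fmorphV /= rmorph_nat.
  by rewrite mulrC.
(* Chosen so that [F h (y h)] is the mean of [Rl x] and [T h (Rl x)], while [y h] tends to x. The
   uniform bound on [F h] then replaces [y h] by x. *)
pose y h := (h^-1)%:C *: (Rl x - T h (Rl x)) + (lam / 2) *: (Rl x + T h (Rl x)).
have two : Rl x + Rl x = 2 *: Rl x by rewrite scaler_nat mulr2n.
have yx : rtends y x.
  have h1 := (generatorP A_gen _ _).1 (R1 x).
  have h2 := rtendsZ (lam / 2) (rtendsD (rtends_cst (Rl x)) (sg_rtends Tsg (Rl x))).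
  have := rtendsD h1 h2.
  by rewrite two scalerA divfK ?pnatr_eq0// subrK.
have Fy h : 0 < h -> F h (y h) = 2^-1 *: (Rl x + T h (Rl x)).
  move=> h0; have [_ Q2 _] := QP h h0.
  have E1 : (h^-1)%:C * (1 + w h) = (h^-1)%:C + lam / 2 by rewrite mulrDr mulr1 hinv.
  have E2 : (h^-1)%:C * (1 + w h) * kc h = (h^-1)%:C - lam / 2.
    by rewrite /kc mulrA mulrAC mulfK ?wn0// mulrBr mulr1 hinv.
  have -> : y h = ((h^-1)%:C * (1 + w h)) *: (Rl x - kc h *: T h (Rl x)).
    rewrite [RHS]scalerBr scalerA E2 E1 /y scalerBr scalerDr scalerDl scalerBl opprB.
    by rewrite addrACA; congr (_ + _); rewrite addrC.
  have := dc_lin (Fdc h h0) ((h^-1)%:C * (1 + w h)) (Rl x - kc h *: T h (Rl x)) 0.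
  have := FB h 0 0 h0; rewrite !subrr => ->; rewrite !addr0 => ->.
  rewrite /F Q2 scalerA; congr (_ *: _); rewrite /a mulrACA mulfV ?wn0// mulr1.
  by rewrite -rmorphM /= mulrA mulVf ?gt_eqF// mul1r fmorphV /= rmorph_nat.
have lim1 : rtends (fun h => F h (y h)) (Rl x).
  apply: (@rtends_eq _ _ (fun h => 2^-1 *: (Rl x + T h (Rl x)))) => [h h0|]; first by rewrite Fy.
  have := rtendsZ (2^-1) (rtendsD (rtends_cst (Rl x)) (sg_rtends Tsg (Rl x))).
  by rewrite two scalerA mulVf ?scale1r// pnatr_eq0.
apply: (@rtends_app_conv _ _ F ((1 + M) * M * ((1 + nrm lam * 1) / complex.Re lam)) y _ _ _ lim1 yx).
move=> h u v /andP[h0 h1]; rewrite -FB// (le_trans (Fb h _ h0))// ler_wpM2r ?nrm_ge0//.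
  rewrite ler_wpM2l ?mulr_ge0 ?addr_ge0// ler_wpM2r ?invr_ge0 ?(ltW l0)// lerD2l.
  by rewrite ler_wpM2l ?nrm_ge0.
Qed.
End Cayley.

(** * Rational functions of the generator *)

Section StepCalculus.
Context {R : realType} {X : completeNormedModType R[i]}.
Variable T : R -> {linear X -> X}.
Hypothesis Tsg : C0_semigroup T.
Variables (M omega : R).
Hypotheses (M1 : 1 <= M) (omega0 : 0 < omega).
Hypothesis TM : forall t x, 0 <= t -> nrm (T t x) <= M * expR (- (omega * t)) * nrm x.
Variable A : operator X.
Hypothesis A_gen : scale_op (-1) A = generator T.
Variable t : R.
Hypothesis t0 : 0 < t.
Let M0 : 0 <= M. Proof. exact: le_trans M1. Qed.

Local Notation step m := (t / m.+1%:R).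
Let step0 m : 0 < step m. Proof. by rewrite divr_gt0// ltr0n. Qed.
Let step0' m : 0 <= step m. Proof. exact: ltW. Qed.

Lemma step_small (e : R) : 0 < e -> exists N, forall m, (N <= m)%N -> step m < e.
Proof.
move=> e0; exists (Num.truncn (t / e)) => m mN; rewrite ltr_pdivrMr ?ltr0n// mulrC -ltr_pdivrMr//.
by rewrite (lt_le_trans (truncnS_gt _))// ler_nat ltnS.
Qed.

(* G = g(A), realized as a strong limit of functions of T (t / m). *)
Definition step_calc (G : X -> X) (g : option R[i] -> R[i]) : Prop :=
  exists (F : nat -> X -> X) (B : R),
  [/\ forall m, disc_calc T (step m) (fun z => g (cayley (step m) z)) (F m),
      forall m x, nrm (F m x) <= B * nrm x &
      forall x, tends (fun m => F m x) (G x)].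

Lemma step_calc_lin G g c x y : step_calc G g -> G (c *: x + y) = c *: G x + G y.
Proof.
move=> [F [B [F1 F2 F3]]]; apply: (tends_unique (F3 _)).
apply: tends_eventually (tendsD (tendsZ c (F3 x)) (F3 y)) _; exists 0%N => m _.
by rewrite (dc_lin (F1 m)).
Qed.

Lemma step_calcB G g x y : step_calc G g -> G (x - y) = G x - G y.
Proof. by move=> H; rewrite -scaleN1r addrC (step_calc_lin _ _ _ H) scaleN1r addrC. Qed.

Lemma step_calc0 G g : step_calc G g -> G 0 = 0.
Proof. by move=> H; have := step_calcB 0 0 H; rewrite !subrr. Qed.

Lemma step_calcZ G g c x : step_calc G g -> G (c *: x) = c *: G x.
Proof. by move=> H; have := step_calc_lin c x 0 H; rewrite (step_calc0 H) !addr0. Qed.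

Lemma step_calc_bounded G g : step_calc G g -> exists2 B : R, 0 <= B & forall x, nrm (G x) <= B * nrm x.
Proof.
move=> [F [B [_ F2 F3]]]; exists `|B| => // x; apply: (tends_le (F3 x)) => m.
by rewrite (le_trans (F2 m x))// ler_wpM2r ?nrm_ge0// ler_norm.
Qed.

Lemma step_calc_eq G G' g g' : (forall x, G x = G' x) -> (forall o, g o = g' o) ->
  step_calc G g -> step_calc G' g'.
Proof.
move=> GG gg [F [B [F1 F2 F3]]]; exists F, B; split=> // [m|x]; last by rewrite -GG.
exact: dc_eq (F1 m).
Qed.

Lemma step_calc_cst c : step_calc (fun x => c *: x) (fun=> c).
Proof.
exists (fun _ x => c *: x), (nrm c); split=> [m|m x|x]; [|by rewrite nrmZ|exact: tends_cst].
exact: dc_cst.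
Qed.

Lemma step_calcD G g G' g' : step_calc G g -> step_calc G' g' ->
  step_calc (fun x => G x + G' x) (fun o => g o + g' o).
Proof.
move=> [F [B [F1 F2 F3]]] [F' [B' [F'1 F'2 F'3]]].
exists (fun m x => F m x + F' m x), (B + B'); split=> [m|m x|x].
- exact: dcD (F1 m) (F'1 m).
- by rewrite mulrDl (le_trans (nrmD _ _))// lerD.
- exact: tendsD (F3 x) (F'3 x).
Qed.

Lemma step_calcM G g G' g' : step_calc G g -> step_calc G' g' ->
  step_calc (fun x => G (G' x)) (fun o => g o * g' o).
Proof.
move=> [F [B [F1 F2 F3]]] [F' [B' [F'1 F'2 F'3]]].
exists (fun m x => F m (F' m x)), (`|B| * B'); split=> [m|m x|x].
- exact (dcM Tsg M1 omega0 TM (step0' m) (F1 m) (F'1 m)).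
- rewrite (le_trans (F2 _ _))// -mulrA (@le_trans _ _ (`|B| * nrm (F' m x)))//.
    by rewrite ler_wpM2r ?nrm_ge0// ler_norm.
  exact: ler_wpM2l.
apply: (@tends_app _ _ F G _ _ B) (F'3 x) => // m y z.
by rewrite -(dcB _ _ (F1 m)).
Qed.

Lemma step_calc_comm G g G' g' x : step_calc G g -> step_calc G' g' -> G (G' x) = G' (G x).
Proof.
move=> [F [B [F1 F2 F3]]] [F' [B' [F'1 F'2 F'3]]].
have L (H : nat -> X -> X) b h : (forall m, disc_calc T (step m) (h m) (H m)) -> (forall m x, nrm (H m x) <= b * nrm x) ->
    forall m y z, nrm (H m y - H m z) <= b * nrm (y - z).
  by move=> H1 H2 m y z; rewrite -(dcB _ _ (H1 m)).
have l1 := tends_app (L F B _ F1 F2) (F3 _) (F'3 x).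
have l2 := tends_app (L F' B' _ F'1 F'2) (F'3 _) (F3 x).
apply: (tends_unique l1); apply: tends_eventually l2 _; exists 0%N => m _.
exact (dc_comm Tsg M1 omega0 TM (step0' m) (F'1 m) (F1 m) x).
Qed.

Lemma step_calcX G g n : step_calc G g -> step_calc (iter n G) (fun o => g o ^+ n).
Proof.
move=> H; elim: n => [|n IH].
  by apply: step_calc_eq (step_calc_cst 1) => [x|o]; rewrite /= ?scale1r ?expr0.
by apply: step_calc_eq (step_calcM H IH) => // o; rewrite exprS.
Qed.

Lemma step_calc_resolvent lam Rl : 0 < complex.Re lam -> is_resolvent lam A Rl ->
  step_calc Rl (resolvent_symbol lam).
Proof.
move=> l0 Rlp; have [F [F1 F2 F3]] := cayley_approx Tsg M1 omega0 TM A_gen l0 Rlp.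
exists (fun m => F (step m)), ((1 + M) * M * ((1 + nrm lam * t) / complex.Re lam)); split=> [m|m x|x].
- exact: F1.
- rewrite (le_trans (F2 _ _ (step0 m)))// ler_wpM2r ?nrm_ge0//.
  rewrite ler_wpM2l ?mulr_ge0 ?addr_ge0// ler_wpM2r ?invr_ge0 ?(ltW l0)// lerD2l ler_wpM2l ?nrm_ge0//.
  by rewrite ler_pdivrMr ?ltr0n// ler_peMr ?(ltW t0)// ler1n.
- exact: rtends_seq (F3 x) step0 step_small.
Qed.

(** The steps divide [t], so T(t) is exactly a power of T(t / (m + 1)). *)
Lemma step_calc_semigroup m : disc_calc T (step m) (fun z => z ^+ m.+1) (T t).
Proof.
have D := dcX Tsg M1 omega0 TM (step0' m) m.+1 (dc_T Tsg (step0' m)).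
apply: dc_eq D => // x.
have E n : iter n (T (step m)) x = T (n%:R * step m) x.
  elim: n => [|n IH]; first by rewrite mul0r (sg_0 Tsg).
  by rewrite iterS IH -(sg_add Tsg) ?(mulr_ge0 (ler0n _ _) (step0' m)) ?step0'// -[n.+1%:R]natr1 mulrDl mul1r addrC.
by rewrite E mulrC divfK// pnatr_eq0.
Qed.

Lemma resolvent_identity lam mu Rl Rm x : is_resolvent lam A Rl -> is_resolvent mu A Rm ->
  Rl x = Rm (x + (mu - lam) *: Rl x).
Proof.
move=> [R1 _] [_ S2]; rewrite -[LHS](S2 _ _ (R1 x)); congr Rm.
by rewrite addrCA -scalerBl.
Qed.

Lemma resolvent_identity' lam mu Rl Rm x : 0 < complex.Re mu -> is_resolvent lam A Rl -> is_resolvent mu A Rm ->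
  Rl x = Rm x + (mu - lam) *: Rm (Rl x).
Proof.
move=> m0 RR SS; have H := step_calc_resolvent m0 SS.
by rewrite {1}(resolvent_identity x RR SS) addrC (step_calc_lin _ _ _ H) addrC.
Qed.

Section RationalFunctions.
Variables (pn qn : {poly R[i]}).
Let B := scale_op (- t%:C) A.

Let AB v w : A (v, w) -> B (v, - t%:C *: w). Proof. by move=> H; exists w. Qed.

Let B_lin c x y x' y' : B (x, y) -> B (x', y') -> B (c *: x + x', c *: y + y').
Proof.
move=> [w Aw /= ->] [w' Aw' /= ->]; exists (c *: w + w') => /=; last by rewrite scalerDr !scalerA mulrC.
move: Aw Aw' => /(generatorP A_gen) H1 /(generatorP A_gen) H2; apply/(generatorP A_gen).
apply: rtends_eq (rtendsD (rtendsZ c H1) H2) => h _ /=.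
by rewrite scalerA mulrC -scalerA -scalerDr [T h (_ + _)]linearP scalerBr opprD addrACA.
Qed.

Let B_fun x y y' : B (x, y) -> B (x, y') -> y = y'.
Proof.
move=> [w /(generatorP A_gen) H1 /= ->] [w' /(generatorP A_gen) H2 /= ->].
by rewrite (rtends_unique H1 H2).
Qed.

Let B0 : B (0, 0).
Proof.
rewrite -[X in B (_, X)](scaler0 _ (- t%:C)).
apply: AB; apply/(generatorP A_gen); apply: rtends_eq (rtends_cst 0) => h _.
by rewrite linear0 subr0 scaler0.
Qed.

Let B_sum (I : Type) (r : seq I) (c : I -> R[i]) (u v : I -> X) (Q : pred I) : (forall i, Q i -> B (u i, v i)) ->
  B (\sum_(i <- r | Q i) c i *: u i, \sum_(i <- r | Q i) c i *: v i).
Proof.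
move=> H; elim: r => [|i r IH]; first by rewrite !big_nil.
by rewrite !big_cons; case: ifP => // Qi; exact: B_lin (H i Qi) IH.
Qed.

Let root_resolvent w : 0 < complex.Re w -> exists Rw, [/\ forall x, B (Rw x, x + w *: Rw x),
  forall u v, B (u, v) -> Rw (v - w *: u) = u &
  step_calc Rw (fun o => - (t^-1)%:C * resolvent_symbol (w / t%:C) o)].
Proof.
move=> w0; pose lam := w / t%:C.
have tn : (t%:C : R[i]) != 0 by rewrite (eq_complex _ 0) /= eqxx andbT gt_eqF.
have tV : (t^-1)%:C = (t%:C)^-1 :> R[i] by rewrite fmorphV.
have l0 : 0 < complex.Re lam.
  rewrite /lam -tV; case: (w) w0 => a b /= a0; rewrite mulr0 subr0 mulr_gt0// invr_gt0//.
have [Rl [[R1 R2] _ _]] := resolvent_exists Tsg M1 omega0 TM l0 A_gen.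
have S := step_calc_resolvent l0 (conj R1 R2).
exists (fun x => - (t^-1)%:C *: Rl x); split=> [x|u v [y Ay /= ->]|].
- have /AB := R1 (- (t^-1)%:C *: x); rewrite (step_calcZ _ _ S).
  congr (B (_, _)); rewrite scalerBr !scalerA -scaleNr -[X in _ = X + _]scale1r.
  by congr (_ *: _ + _ *: _); rewrite tV /lam; field.
- have -> : - t%:C *: y - w *: u = - t%:C *: (lam *: u + y).
    by rewrite scalerDr scalerA mulNr /lam [t%:C * _]mulrC divfK// scaleNr scaleNr addrC.
  by rewrite (step_calcZ _ _ S) R2// scalerA tV mulrNN mulVf// scale1r.
- exact: step_calc_eq (step_calcM (step_calc_cst _) S).
Qed.

Let chain n (v : nat -> X) := forall k, (k < n)%N -> B (v k, v k.+1).

(** Induction on the roots. A chain lists u, B u, B^2 u and so on. Dividing p by X - w gives p / ((X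
    - w) q) = p' / q + c / ((X - w) q), so the two functions p'/q and 1/q of the smaller denominator
    and one more resolvent are enough. *)
Let chain_calc (ws : seq R[i]) : (forall w, w \in ws -> 0 < complex.Re w) ->
  let q := \prod_(w <- ws) ('X - w%:P) in
  (forall x, exists2 v, chain (size ws) v & \sum_(k < (size ws).+1) q`_k *: v k = x) /\
  forall p : {poly R[i]}, (size p <= (size ws).+1)%N -> exists G g,
   [/\ step_calc G g,
       forall u, complex.Re u = 0 -> g (Some u) = p.[- t%:C * u] / q.[- t%:C * u] &
       forall v, chain (size ws) v ->
         \sum_(k < (size ws).+1) p`_k *: v k = G (\sum_(k < (size ws).+1) q`_k *: v k)].
Proof.
elim: ws => [_|w ws IH Hws].
  split=> [x|p].
    exists (fun=> x) => //=; rewrite big_ord1 big_nil coefC eqxx scale1r//.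
  move=> sp; exists (fun x => p`_0 *: x), (fun=> p`_0); split; first exact: step_calc_cst.
    by move=> u _; rewrite big_nil hornerC divr1 (size1_polyC sp) hornerC coefC eqxx.
  by move=> v _ /=; rewrite !big_ord1 big_nil coefC eqxx scale1r.
have Hws' : forall w, w \in ws -> 0 < complex.Re w by move=> w' w'ws; apply: Hws; rewrite inE w'ws orbT.
have w0 : 0 < complex.Re w by apply: Hws; rewrite inE eqxx.
have [IH1 IH2] := IH Hws'; move: IH1 IH2; set q := \prod_(w <- ws) _ => IH1 IH2.
have [Rw [Rw1 Rw2 Rw3]] := root_resolvent w0.
have qm : q \is monic by rewrite monic_prod_XsubC.
have sq : size q = (size ws).+1 by rewrite size_prod_XsubC.
rewrite /= big_cons -/q; set n := size ws.
have mulX (p : {poly R[i]}) (v : nat -> X) : (size p <= n.+1)%N ->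
    \sum_(k < n.+2) (('X - w%:P) * p)`_k *: v k = \sum_(k < n.+1) p`_k *: v k.+1 - w *: \sum_(k < n.+1) p`_k *: v k.
  move=> sp; rewrite mulrBl mul_polyC.
  under eq_bigr => k _ do rewrite coefB coefZ scalerBl.
  rewrite sumrB big_ord_recl coefXM eqxx scale0r add0r; congr (_ - _).
    by apply: eq_bigr => k _; rewrite coefXM.
  rewrite big_ord_recr /= [p`_n.+1]nth_default// mulr0 scale0r addr0 scaler_sumr.
  by apply: eq_bigr => k _; rewrite scalerA.
have Bsum (v : nat -> X) : chain n.+1 v ->
    B (\sum_(k < n.+1) q`_k *: v k, \sum_(k < n.+1) q`_k *: v k.+1).
  by move=> cv; apply: B_sum => k _; exact: cv.
have Rwq (v : nat -> X) : chain n.+1 v ->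
    Rw (\sum_(k < n.+2) (('X - w%:P) * q)`_k *: v k) = \sum_(k < n.+1) q`_k *: v k.
  by move=> cv; rewrite mulX ?sq// Rw2//; exact: Bsum.
split=> [x|p sp].
  have [v cv Ev] := IH1 (Rw x); rewrite -/n in cv Ev.
  have qn1 : q`_n = 1 by have := monicP qm; rewrite lead_coefE sq.
  (* Since q is monic, the last entry is [Rw x] minus a combination of earlier entries; all of these
     lie in the domain of B, so the chain can be prolonged. *)
  have [y By] : exists y, B (v n, y).
    have -> : v n = -1 *: (\sum_(k < n) q`_k *: v k) + Rw x.
      by rewrite -Ev big_ord_recr /= qn1 scale1r scaleN1r addrA addNr add0r.
    exists (-1 *: (\sum_(k < n) q`_k *: v k.+1) + (x + w *: Rw x)); apply: B_lin => //.
    by apply: B_sum => k _; exact: cv.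
  pose v' k := if (k <= n)%N then v k else y.
  have cv' : chain n.+1 v'.
    move=> k; rewrite ltnS leq_eqVlt /v' => /predU1P[->|kn]; first by rewrite leqnn ltnn.
    by rewrite (ltnW kn) kn; exact: cv.
  have Ev' : \sum_(k < n.+1) q`_k *: v' k = Rw x.
    by rewrite -Ev; apply: eq_bigr => k _; rewrite /v' -ltnS ltn_ord.
  exists v' => //; rewrite mulX ?sq// Ev'.
  have := Bsum v' cv'; rewrite Ev' => /(B_fun (Rw1 x)) <-.
  by rewrite addrK.
have [p' [c Ep]] : exists p' c, p = ('X - w%:P) * p' + c%:P.
  exists (p %/ ('X - w%:P)), (p %% ('X - w%:P))`_0; rewrite {1}(divp_eq p ('X - w%:P)) mulrC; congr (_ + _).
  by apply: size1_polyC; have := ltn_modp p ('X - w%:P); rewrite polyXsubC_eq0 size_XsubC.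
have sp' : (size p' <= n.+1)%N.
  have [->|p'0] := eqVneq p' 0; first by rewrite size_poly0.
  have : size (('X - w%:P) * p') = (size p').+1 by rewrite size_monicM ?monicXsubC// size_XsubC.
  move=> E; rewrite -ltnS -E; apply: leq_trans (_ : maxn (size p) 1 <= _)%N.
    have -> : ('X - w%:P) * p' = p - c%:P by rewrite Ep addrK.
    by rewrite (leq_trans (size_polyD _ _))// size_polyN geq_max leq_maxl (leq_trans (size_polyC_leq1 c))// leq_maxr.
  by rewrite geq_max sp.
have [G [g [G1 G2 G3]]] := IH2 p' sp'.
have s1 : (size (1%:P : {poly R[i]}) <= n.+1)%N by rewrite (leq_trans (size_polyC_leq1 1)).
have [H [h [H1 H2 H3]]] := IH2 1%:P s1.
exists (fun x => G x + c *: H (Rw x)), (fun o => g o + c * (h o * (- (t^-1)%:C * resolvent_symbol (w / t%:C) o))); split.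
- exact: step_calcD G1 (step_calcM (step_calc_cst c) (step_calcM H1 Rw3)).
- move=> u u0; rewrite G2// H2// Ep hornerD !hornerM hornerXsubC !hornerC /=.
  have tn : (t%:C : R[i]) != 0 by rewrite (eq_complex _ 0) /= eqxx andbT gt_eqF.
  have tV : (t^-1)%:C = (t%:C)^-1 :> R[i] by rewrite fmorphV.
  have rt0 : complex.Re (- t%:C * u) = 0.
    by case: (u) u0 => a b /= ->; rewrite mulr0 oppr0 mul0r subr0.
  have wt : w + t%:C * u != 0.
    by apply: Re_neq0 => //; have := rt0; rewrite mulNr raddfN /= => /eqP; rewrite oppr_eq0 => /eqP.
  have wt' : - t%:C * u - w != 0 by rewrite mulNr -opprD oppr_eq0 addrC.
  have q0 : q.[- t%:C * u] != 0.
    rewrite horner_prod prodf_seq_neq0; apply/allP => w' w'ws /=; rewrite hornerXsubC subr_eq0.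
    by apply/eqP => E; have := Hws' _ w'ws; rewrite -E rt0 ltxx.
  rewrite tV; move: tn wt wt' q0; move: (t%:C) (p'.[_]) (q.[_]) => tt a b tn wt wt' q0.
  have -> : - tt * u - w = - (w + tt * u) by ring.
  have -> : w / tt + u = (w + tt * u) / tt by field.
  by move: (w + tt * u) wt => s s0; field; rewrite q0 tn s0.
move=> v cv; rewrite Ep.
have cv0 : chain n v by move=> k kn; apply: cv; rewrite ltnW.
have cv1 : chain n (fun k => v k.+1) by move=> k kn; exact: cv.
under eq_bigr => k _ do rewrite coefD scalerDl.
rewrite big_split /= mulX// (G3 _ cv0) (G3 _ cv1) -/n.
have -> : \sum_(k < n.+2) (c%:P)`_k *: v k = c *: \sum_(k < n.+1) (1%:P : {poly R[i]})`_k *: v k.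
  rewrite big_ord_recl [X in _ = _ *: X]big_ord_recl !coefC eqxx scale1r !big1 ?addr0// => k _.
    by rewrite coefC scale0r.
  by rewrite coefC scale0r.
rewrite (H3 _ cv0) Rwq//; congr (_ + _).
by rewrite -(step_calcZ _ _ G1) -(step_calcB _ _ G1) mulX ?sq.
Qed.

(** All roots of the denominator lie in the open right half-plane, where [root_resolvent] applies.
    The graph of [rat_op] is that of an everywhere defined operator, so [app] never falls back on
    its default value. *)
Lemma rational_step_calc : (size pn <= size qn)%N -> (forall z, complex.Re z <= 0 -> qn.[z] != 0) ->
  exists G g, [/\ step_calc G g,
    forall u, complex.Re u = 0 -> g (Some u) = pn.[- t%:C * u] / qn.[- t%:C * u] &
    forall x, app (rat_op pn qn (scale_op (- t%:C) A)) x = G x].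
Proof.
move=> spq qne.
have [ws Eq] := closed_field_poly_normal qn.
have c0 : lead_coef qn != 0.
  rewrite lead_coef_eq0; apply/eqP => q0; have := qne 0; rewrite q0 horner0 eqxx => H.
  by have := H (lexx _).
have Hws w : w \in ws -> 0 < complex.Re w.
  move=> wws; rewrite ltNge; apply/negP => w0; have := qne w w0.
  by rewrite Eq hornerZ mulf_eq0 negb_or -rootE root_prod_XsubC wws andbF.
have sq : size qn = (size ws).+1 by rewrite Eq size_scale// size_prod_XsubC.
have [C1 C2] := chain_calc Hws; move: C1 C2 Eq; set q := \prod_(w <- ws) _ => C1 C2 Eq.
have sp : (size pn <= (size ws).+1)%N by rewrite -sq.
have [G [g [G1 G2 G3]]] := C2 pn sp.
have [H [h [H1 _ H3]]] : exists H h, [/\ step_calc H h, forall u, complex.Re u = 0 -> h (Some u) = (1%:P).[- t%:C * u] / q.[- t%:C * u] &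
    forall v, chain (size ws) v -> \sum_(k < (size ws).+1) (1%:P : {poly R[i]})`_k *: v k = H (\sum_(k < (size ws).+1) q`_k *: v k)].
  by apply: C2; rewrite (leq_trans (size_polyC_leq1 1)).
exists (fun x => G ((lead_coef qn)^-1 *: x)), (fun o => g o * (lead_coef qn)^-1); split.
- exact: step_calcM G1 (step_calc_cst _).
- by move=> u u0; rewrite G2// Eq hornerZ lead_coefZ (monicP (monic_prod_XsubC _ _ _)) mulr1 invfM mulrA mulrAC.
move=> x; rewrite /app.
suff E y : rat_op pn qn B (x, y) <-> y = G ((lead_coef qn)^-1 *: x).
  case: xgetP => [y _ /E //|/(_ (G ((lead_coef qn)^-1 *: x))) /= N].
  by exfalso; apply: N; apply/E.
have sumq (v : nat -> X) : \sum_(k < size qn) qn`_k *: v k = lead_coef qn *: \sum_(k < (size ws).+1) q`_k *: v k.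
  by rewrite sq scaler_sumr; apply: eq_bigr => k _; rewrite {1}Eq coefZ scalerA.
split=> [[u [v [/= v0 cv Ev]] [v' [/= v'0 cv' Ev']]]|->].
  rewrite sq in cv; rewrite sumq in Ev.
  have Ex : (lead_coef qn)^-1 *: x = \sum_(k < (size ws).+1) q`_k *: v k by rewrite Ev scalerA mulVf// scale1r.
  rewrite Ex -(G3 v)// Ev'.
  have vv k : (k < size pn)%N -> v' k = v k.
    elim: k => [_|k IH kp]; first by rewrite v0 v'0.
    have kp' : (k < (size pn).-1)%N by rewrite -ltnS prednK// (leq_ltn_trans _ kp).
    have k2 : (k < size ws)%N by rewrite -ltnS -sq (leq_trans kp).
    apply: (B_fun (cv' k kp')); rewrite IH ?(ltnW kp)//; exact: cv.
  rewrite (big_ord_widen (size ws).+1 (fun k => pn`_k *: v' k)) //.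
  rewrite [RHS](bigID (fun j : 'I_ _ => (j < size pn)%N)) /= [X in _ = _ + X]big1 ?addr0.
    by apply: eq_bigr => k kp; rewrite vv.
  by move=> j; rewrite -leqNgt => jm; rewrite nth_default// scale0r.
have [v cv Ev] := C1 ((lead_coef qn)^-1 *: x).
exists (v 0%N).
  exists v; split=> //= [k|]; first by rewrite sq; exact: cv.
  by rewrite sumq Ev scalerA mulfV// scale1r.
exists v; split=> //= [k kp|].
  by apply: cv; rewrite -ltnS -sq (leq_trans _ spq)//; move: kp; case: (size pn).
rewrite -Ev -G3// [RHS](big_ord_widen (size ws).+1 (fun k => pn`_k *: v k)) //.
rewrite [LHS](bigID (fun j : 'I_ _ => (j < size pn)%N)) /= [X in _ + X]big1 ?addr0//.
by move=> j; rewrite -leqNgt => jm; rewrite nth_default// scale0r.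
Qed.
End RationalFunctions.
End StepCalculus.

(** * The key estimate *)

Section Parseval.
Context {R : realType}.

Lemma nrm_sqrC (x : R[i]) : (nrm x ^+ 2)%:C = x * x^*%C.
Proof.
rewrite nrm_sqr; case: x => a b; apply/eqP; rewrite eq_complex /=.
by apply/andP; split; apply/eqP; ring.
Qed.

Lemma parseval (a : nat -> R[i]) k (zeta : R[i]) : k.+1.-primitive_root zeta ->
  \sum_(c < k.+1) nrm (\sum_(j < k.+1) a j * zeta ^+ (c * j)) ^+ 2 = k.+1%:R * \sum_(j < k.+1) nrm (a j) ^+ 2.
Proof.
move=> pz; apply: (@complexI R); rewrite rmorph_sum rmorphM rmorph_sum /= rmorph_nat mulr_sumr.
under eq_bigr => c _ do rewrite nrm_sqrC rmorph_sum big_distrlr /=.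
rewrite exchange_big /=; apply: eq_bigr => j _; rewrite exchange_big /= (bigD1 j)//= [X in _ + X]big1 ?addr0.
  rewrite nrm_sqrC (eq_bigr (fun c : 'I_k.+1 => a j * (a j)^*%C * (zeta ^+ (c * j) * (zeta^*%C) ^+ (c * j)))); last first.
    by move=> c _; rewrite rmorphM rmorphXn /=; ring.
  by rewrite -mulr_sumr sum_prim_root// eqxx mulr1n mulrC.
move=> l lj; rewrite (eq_bigr (fun c : 'I_k.+1 => a j * (a l)^*%C * (zeta ^+ (c * j) * (zeta^*%C) ^+ (c * l)))); last first.
  by move=> c _; rewrite rmorphM rmorphXn /=; ring.
rewrite -mulr_sumr sum_prim_root// !modn_small// (inj_eq val_inj) eq_sym (negbTE lj) mulr0//.
Qed.

(** Modulo the n-th power, the geometric series is a polynomial of n terms: with s = (kap z)^n, each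
    summand is (1 - s)^-1 times a discrete Fourier sum of the (kap z)^j, to which Parseval
    applies. *)
Lemma sum_sqr_geometric (kap z zeta : R[i]) k : nrm kap < 1 -> nrm z = 1 -> k.+1.-primitive_root zeta ->
  \sum_(c < k.+1) nrm ((1 - kap * (z * zeta ^+ c))^-1) ^+ 2 <= (k.+1%:R / (1 - nrm kap ^+ k.+1)) ^+ 2.
Proof.
move=> k1 z1 pz; set n := k.+1.
have kn1 : nrm kap ^+ n < 1 by rewrite exprn_ilt1// nrm_ge0.
have d0 : 0 < 1 - nrm kap ^+ n by rewrite subr_gt0.
have nz : nrm zeta = 1 := nrm_unity_root (ltn0Sn k) (prim_expr_order pz).
pose s := (kap * z) ^+ n.
have ns : nrm s = nrm kap ^+ n by rewrite nrmX nrmM z1 mulr1.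
have s1 : 1 - nrm kap ^+ n <= nrm (1 - s).
  by rewrite -ns -(@nrm1 R) (le_trans (ler_norm _))// ler_nrm_dist.
have E (c : 'I_n) : (1 - kap * (z * zeta ^+ c))^-1 = (1 - s)^-1 * \sum_(j < n) (kap * z) ^+ j * zeta ^+ (c * j).
  have zc : nrm (kap * (z * zeta ^+ c)) < 1 by rewrite !nrmM nrmX nz z1 expr1n !mulr1.
  have nz1 : 1 - kap * (z * zeta ^+ c) != 0.
    rewrite -nrm_eq0 gt_eqF// (lt_le_trans _ (le_trans (ler_norm _) (ler_nrm_dist _ _)))//.
    by rewrite nrm1 subr_gt0.
  have nz2 : 1 - s != 0 by rewrite -nrm_eq0 gt_eqF// (lt_le_trans d0).
  apply: (mulfI nz2); rewrite [RHS]mulrA mulfV// mul1r; apply: (mulIf nz1); rewrite mulfVK//.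
  have -> : s = (kap * (z * zeta ^+ c)) ^+ n.
    by rewrite /s mulrA [RHS]exprMn -exprM mulnC exprM (prim_expr_order pz) expr1n mulr1.
  apply: oppr_inj; rewrite opprB subrX1 [LHS]mulrC -mulrN opprB; congr (_ * _).
  by apply: eq_bigr => j _; rewrite mulrA exprMn -exprM mulnC.
rewrite (eq_bigr (fun c : 'I_n => nrm (1 - s)^-1 ^+ 2 * nrm (\sum_(j < n) (kap * z) ^+ j * zeta ^+ (c * j)) ^+ 2)); last first.
  by move=> c _; rewrite E nrmM exprMn.
rewrite -mulr_sumr (parseval (fun j => (kap * z) ^+ j) pz) nrmV exprMn mulrC.
rewrite ler_pM ?mulr_ge0 ?exprn_ge0 ?sumr_ge0 ?invr_ge0 ?nrm_ge0//.
- by move=> j _; rewrite exprn_ge0 ?nrm_ge0.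
- rewrite expr2 ler_wpM2l// (@le_trans _ _ (\sum_(j < n) 1))//; last by rewrite sumr_const card_ord.
  apply: ler_sum => j _; rewrite exprn_ile1 ?nrm_ge0// nrmX exprn_ile1 ?nrm_ge0//.
  by rewrite nrmM z1 mulr1 ltW.
- by rewrite lerXn2r ?nnegrE ?invr_ge0 ?nrm_ge0 ?(ltW d0)// lef_pV2 ?posrE// (lt_le_trans d0).
Qed.

Lemma resolvent_symbol_le (lam h : R) z : 0 < lam -> 0 < h -> nrm z = 1 ->
  nrm (resolvent_symbol lam%:C (cayley h z)) <=
  h * nrm ((1 - ((1 - lam * h / 2) / (1 + lam * h / 2))%:C * z)^-1).
Proof.
move=> l0 h0 z1; have lC : 0 < complex.Re (lam%:C : R[i]) by [].
case: (eqVneq z (-1)) => [->|zn1]; first by rewrite /cayley eqxx /= nrm0 mulr_ge0 ?nrm_ge0// ltW.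
have s0 : 1 + z != 0 by rewrite addrC addr_eq0.
rewrite /cayley (negbTE zn1) /=.
have u0 := Re_neq0 lC (Re_cayley (h := h) z1 _); rewrite /cayley (negbTE zn1) in u0.
have {}u0 := u0 _ erefl.
have hn : (h%:C : R[i]) != 0 by rewrite (eq_complex _ 0) /= eqxx andbT gt_eqF.
have h2' : (2 / h)%:C = 2 / h%:C :> R[i] by rewrite rmorphM fmorphV /= rmorph_nat.
have w0 : 0 < 1 + lam * h / 2 by rewrite addr_gt0// divr_gt0 ?mulr_gt0.
have wE : (1 + lam * h / 2)%:C = 1 + h%:C / 2 * lam%:C :> R[i].
  by rewrite rmorphD !rmorphM fmorphV /= rmorph_nat rmorph1; ring.
have wE' : (1 - lam * h / 2)%:C = 1 - h%:C / 2 * lam%:C :> R[i].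
  by rewrite rmorphB !rmorphM fmorphV /= rmorph_nat rmorph1; ring.
have W0 : 1 + h%:C / 2 * lam%:C != 0 by rewrite -wE (eq_complex _ 0) /= eqxx andbT gt_eqF.
rewrite h2' in u0 *; rewrite -(cayley_identity hn s0 W0 u0).
have -> : ((1 - lam * h / 2) / (1 + lam * h / 2))%:C = (1 - h%:C / 2 * lam%:C) / (1 + h%:C / 2 * lam%:C) :> R[i].
  by rewrite rmorphM fmorphV /= -wE -wE'.
have n2 : nrm (2 : R[i]) = 2 by rewrite -(rmorph_nat (real_complex R)) nrm_real ger0_norm.
set d := (1 - _ * z)^-1; clearbody d; rewrite -wE nrmM [nrm (_ * _^-1)]nrmM [nrm (_ / 2)]nrmM !nrmV n2 !nrm_real !gtr0_norm//.
have h1 : nrm (d + z * d) <= 2 * nrm d.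
  by rewrite (le_trans (nrmD _ _))// nrmM z1 mul1r -mulr2n mulr_natl.
have h3 : h / 2 / (1 + lam * h / 2) <= h / 2.
  by rewrite ler_pdivrMr// ler_peMr ?divr_ge0 ?(ltW h0)// lerDl divr_ge0 ?mulr_ge0 ?ltW.
rewrite (le_trans (ler_pM _ _ h3 h1)) ?nrm_ge0 ?divr_ge0 ?(ltW w0) ?(ltW h0)//.
by rewrite mulrA divfK ?pnatr_eq0.
Qed.

(** The block has floor(1 / (lam h)) steps, so its length is between 1/(2 lam) and 1/lam. Over such
    a block the geometric ratio, at most (1 + lam h)^-1, decays by a fixed factor by Bernoulli's
    inequality. *)
Lemma decimation_exists (lam h : R) : 0 < lam -> 0 < h -> lam * h <= 1 ->
  exists k : nat, [/\ k.+1%:R * h <= lam^-1, (2 * lam)^-1 <= k.+1%:R * h &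
   ((1 - lam * h / 2) / (1 + lam * h / 2)) ^+ k.+1 <= 2 / 3].
Proof.
move=> l0 h0 lh; have lh0 : 0 < lam * h by rewrite mulr_gt0.
have [] := truncn_itv (x := (lam * h)^-1) ltac:(by rewrite invr_ge0 ltW) => /andP[].
set n := Num.truncn _ => n1 n2.
have n0 : (0 < n)%N.
  rewrite lt0n; apply/eqP => n0; move: n2; rewrite n0; apply/negP; rewrite -leNgt.
  by rewrite invf_ge1// .
exists n.-1; rewrite prednK//.
have a1 : n%:R * (lam * h) <= 1 by rewrite -ler_pdivlMr// div1r.
have a2 : 1 < n.+1%:R * (lam * h) by rewrite -ltr_pdivrMr// div1r.
have a3 : 2^-1 <= n%:R * (lam * h).
  have : n.+1%:R <= 2 * n%:R :> R by rewrite -natrM ler_nat mul2n -addnn -addn1 leq_add2l.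
  move=> /(ler_wpM2r (ltW lh0)); move: a2; move: (n.+1%:R * (lam * h)) => u; rewrite -mulrA; move: (n%:R * (lam * h)) => v; lra.
split.
- by rewrite -[leRHS]mul1r ler_pdivlMr// -mulrA [h * _]mulrC.
- by rewrite invfM ler_pdivrMr// -mulrA [h * _]mulrC.
set w := lam * h / 2; have w0 : 0 < w by rewrite divr_gt0.
have w1 : w <= 1 / 2 by rewrite /w ler_pM2r ?invr_gt0.
have k1 : (1 - w) / (1 + w) <= (1 + lam * h)^-1.
  have -> : lam * h = 2 * w by rewrite /w [RHS]mulrC divfK ?pnatr_eq0.
  rewrite ler_pdivrMr ?addr_gt0// mulrC ler_pdivlMr ?addr_gt0 ?mulr_gt0//; nra.
have k0 : 0 <= (1 - w) / (1 + w) by apply: divr_ge0; move: w0 w1; move: (w) => u; lra.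
rewrite (@le_trans _ _ ((1 + lam * h)^-1 ^+ n))//.
  by rewrite lerXn2r ?nnegrE ?invr_ge0 ?addr_ge0 ?(ltW lh0).
rewrite exprVn; have bern : 1 + n%:R * (lam * h) <= (1 + lam * h) ^+ n.
  elim: (n) => [|j IH]; first by rewrite mul0r addr0 expr0.
  rewrite exprS (le_trans _ (ler_wpM2l _ IH)) ?addr_ge0 ?(ltW lh0)// -natr1.
  have := mulr_ge0 (mulr_ge0 (ler0n R j) (ltW lh0)) (ltW lh0).
  by move: (lam * h) (j%:R : R) => u v; nra.
have b3 : 3 / 2 <= (1 + lam * h) ^+ n by rewrite (le_trans _ bern)//; lra.
by rewrite -[leRHS]invrK lef_pV2 ?posrE ?invr_gt0 ?divr_gt0// ?(lt_le_trans _ b3)// ?invf_div.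
Qed.
(** Both functions equal 1 - 2v up to second order; the remainders contribute 4 |v|^2 and 2
    |v|^2. *)
Lemma cexp_cayley (v : R[i]) : complex.Re v = 0 -> nrm (cexp (- (2 * v)) - (1 - v) / (1 + v)) <= 6 * nrm v ^+ 2.
Proof.
move=> v0; have n2 : nrm (2 : R[i]) = 2 by rewrite -(rmorph_nat (real_complex R)) nrm_real ger0_norm.
have v1 : 1 <= nrm (1 + v).
  by rewrite (le_trans _ (nrm_Re _))// raddfD /= v0 addr0 normr1.
have vn : 1 + v != 0 by rewrite -nrm_eq0 gt_eqF// (lt_le_trans ltr01).
have -> : cexp (- (2 * v)) - (1 - v) / (1 + v) = (cexp (- (2 * v)) - 1 - - (2 * v)) - 2 * v ^+ 2 / (1 + v).
  by move: (cexp _) => w; field.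
rewrite (le_trans (nrmB _ _))// (_ : 6 * nrm v ^+ 2 = 4 * nrm v ^+ 2 + 2 * nrm v ^+ 2); last by ring.
apply: lerD.
  have := @nrm_cexpB1D R (- (2 * v)); rewrite nrmN nrmM n2 exprMn (_ : 2 ^+ 2 = 4 :> R); last by rewrite -natrX.
  apply; rewrite -(rmorph_nat (real_complex R)).
  by case: (v) v0 => a b /= ->; rewrite mulr0 mul0r subr0 oppr0.
rewrite nrmM [nrm (2 * _)]nrmM n2 nrmX nrmV ler_piMr ?mulr_ge0 ?exprn_ge0 ?nrm_ge0// invf_le1// (lt_le_trans ltr01)//.
Qed.

Lemma powers_dist (n : nat) (x y : R[i]) : nrm x <= 1 -> nrm y <= 1 -> nrm (x ^+ n - y ^+ n) <= n%:R * nrm (x - y).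
Proof.
move=> x1 y1; elim: n => [|n IH]; first by rewrite subrr nrm0 mul0r.
have -> : x ^+ n.+1 - y ^+ n.+1 = x * (x ^+ n - y ^+ n) + (x - y) * y ^+ n by rewrite !exprS; ring.
rewrite (le_trans (nrmD _ _))// -[n.+1%:R]natr1 [leRHS]mulrDl mul1r !nrmM lerD//.
  by rewrite (le_trans _ IH)// ler_piMl ?nrm_ge0.
by rewrite ler_piMr ?nrm_ge0// nrmX exprn_ile1// nrm_ge0.
Qed.

End Parseval.

(** * Bounds for the error on ranges of resolvents *)

Section KeyEstimate.
Context {R : realType} {X : completeNormedModType R[i]}.
Variable T : R -> {linear X -> X}.
Hypothesis Tsg : C0_semigroup T.
Variables (M omega : R).
Hypotheses (M1 : 1 <= M) (omega0 : 0 < omega).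
Hypothesis TM : forall t x, 0 <= t -> nrm (T t x) <= M * expR (- (omega * t)) * nrm x.
Variable A : operator X.
Hypothesis A_gen : scale_op (-1) A = generator T.
Variables (Ct theta : R).
Hypotheses (Ct0 : 0 <= Ct) (theta0 : 0 <= theta).
Hypothesis trans : forall h (m : {poly R[i]}) K, 0 < h <= 1 -> 0 < K ->
  (forall z, nrm z = 1 -> nrm m.[z] <= K) ->
  forall x, nrm (sg_horner T h m x) <= Ct * h `^ (- theta) * K * nrm x.
Let M0 : 0 <= M. Proof. exact: le_trans M1. Qed.

(** M comes from the shifts inside a block, Ct from transference, 2^theta from block lengths at
    least 1/(2 lam), and 9 from the square of 1 / (1 - kap^n) <= 3. *)
Definition key_const := M * Ct * 2 `^ theta * 9.

Lemma key_const_ge0 : 0 <= key_const.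
Proof. by rewrite !mulr_ge0 ?powR_ge0. Qed.

(** With n steps of length h in a block, the sum of |symbol|^2 is at most h^2 n^2 / (1 - kap^n)^2 <=
    9 / lam^2, whatever h is. Transference at block length about 1/lam adds lam^theta. *)
Lemma key_bound_step (lam h kappa : R) e E : 1 <= lam -> 0 < h -> lam * h <= 1 -> 0 <= kappa ->
  disc_calc T h e E ->
  (forall z, nrm z = 1 -> nrm (e z) <= kappa * nrm (resolvent_symbol lam%:C (cayley h z)) ^+ 2) ->
  forall x, nrm (E x) <= key_const * kappa * lam `^ (theta - 2) * nrm x.
Proof.
move=> l1 h0 lh k0 eE He x; have l0 : 0 < lam := lt_le_trans ltr01 l1.
have [k [n1 n2 n3]] := decimation_exists l0 h0 lh.
have [zeta pz] := prim_root_exists R[i] (ltn0Sn k).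
set n := k.+1 in n1 n2 n3; pose kap := (1 - lam * h / 2) / (1 + lam * h / 2); rewrite -/kap in n3.
have nz : nrm zeta = 1 := nrm_unity_root (ltn0Sn k) (prim_expr_order pz).
have lh0 : 0 < lam * h by rewrite mulr_gt0.
have kap0 : 0 <= kap by apply: divr_ge0; move: lh lh0; move: (lam * h) => u; lra.
have kap1 : kap < 1.
  rewrite /kap ltr_pdivrMr ?mul1r; move: lh lh0; move: (lam * h) => u; lra.
have nk : nrm (kap%:C : R[i]) = kap by rewrite nrm_real ger0_norm.
pose K := kappa * (9 / lam ^+ 2).
have nh1 : n%:R * h <= 1 by rewrite (le_trans n1)// invf_le1.
have K0 : 0 <= K by rewrite mulr_ge0// divr_ge0// exprn_ge0// ltW.
have HK z : nrm z = 1 -> \sum_(c < n) nrm (e (z * zeta ^+ c)) <= K.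
  move=> z1; apply: (@le_trans _ _ (\sum_(c < n) kappa * (h ^+ 2 * nrm ((1 - kap%:C * (z * zeta ^+ c))^-1) ^+ 2))).
    apply: ler_sum => c _; have zc : nrm (z * zeta ^+ c) = 1 by rewrite nrmM nrmX nz z1 expr1n mulr1.
    rewrite (le_trans (He _ zc))// ler_wpM2l// -exprMn lerXn2r ?nnegrE ?mulr_ge0 ?nrm_ge0 ?(ltW h0)//.
    exact: resolvent_symbol_le.
  rewrite -mulr_sumr ler_wpM2l// -mulr_sumr.
  have S := @sum_sqr_geometric R kap%:C z zeta k ltac:(by rewrite nk) z1 pz.
  rewrite (le_trans (ler_wpM2l (sqr_ge0 h) S))// -exprMn nk -/n.
  have -> : 9 / lam ^+ 2 = (3 / lam) ^+ 2 :> R by rewrite expr_div_n; congr (_ / _); rewrite -natrX.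
  have d0 : 1 / 3 <= 1 - kap ^+ n by move: n3; move: (kap ^+ n) => u; lra.
  have d1 : 0 < 1 - kap ^+ n by rewrite (lt_le_trans _ d0)// divr_gt0.
  apply: lerXn2r; rewrite ?nnegrE ?mulr_ge0 ?invr_ge0 ?(ltW h0) ?(ltW l0) ?(ltW d1)//.
  rewrite mulrA [h * _]mulrC [leRHS]mulrC; apply: ler_pM => //; rewrite ?invr_ge0 ?mulr_ge0 ?(ltW d1) ?(ltW h0)//.
  by rewrite -[leRHS]invrK lef_pV2 ?posrE ?invr_gt0// -div1r.
have := dc_transference Tsg M1 omega0 TM Ct0 trans h0 nh1 K0 pz HK eE x.
move=> H; apply: (le_trans H); apply: ler_wpM2r; first exact: nrm_ge0.
have nh0 : 0 < n%:R * h by rewrite mulr_gt0// ltr0n.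
have p1 : (n%:R * h) `^ (- theta) <= (2 * lam) `^ theta.
  rewrite powRN -[(2 * lam) `^ theta]invrK lef_pV2 ?posrE ?powR_gt0 ?invr_gt0 ?mulr_gt0//.
    rewrite -powRN -[in leLHS](invrK (2 * lam)) -powR_inv1 ?invr_ge0 ?mulr_ge0 ?(ltW l0)//.
    by rewrite -powRrM mulN1r opprK; apply: ge0_ler_powR; rewrite ?nnegrE ?invr_ge0 ?mulr_ge0 ?(ltW l0) ?(ltW h0).
  by rewrite powR_gt0// mulr_gt0.
rewrite (@le_trans _ _ (M * Ct * (2 * lam) `^ theta * K))//.
  by rewrite ler_wpM2r// ler_wpM2l// mulr_ge0.
rewrite powRM ?(ltW l0)// /K /key_const powRB; last by apply/implyP => _; rewrite gt_eqF.
rewrite (powR_mulrn 2 (ltW l0)) le_eqVlt; apply/orP; left; apply/eqP.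
by move: (2 `^ theta) (lam `^ theta) ((lam ^+ 2)^-1) => u v w; ring.
Qed.

(** Passage to the limit in the step; the symbol bound [kap m] has to be close to [kappa] only
    eventually, which leaves room for discretization errors. *)
Lemma key_bound (lam t kappa : R) (kap : nat -> R) (e : nat -> R[i] -> R[i]) (F : nat -> X -> X) E :
  1 <= lam -> 0 < t -> (forall m, 0 <= kap m) ->
  (forall r : R, 0 < r -> exists N, forall m, (N <= m)%N -> kap m <= kappa + r) ->
  (forall m, disc_calc T (t / m.+1%:R) (e m) (F m)) ->
  (forall m z, t / m.+1%:R <= 1 -> nrm z = 1 ->
     nrm (e m z) <= kap m * nrm (resolvent_symbol lam%:C (cayley (t / m.+1%:R) z)) ^+ 2) ->
  (forall x, tends (fun m => F m x) (E x)) ->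
  forall x, nrm (E x) <= key_const * kappa * lam `^ (theta - 2) * nrm x.
Proof.
move=> l1 t0 kap0 kapk Fe He FE x; have l0 : 0 < lam := lt_le_trans ltr01 l1.
set W := key_const * _ * _ * _; apply/ler_addgt0Pr => r r0.
pose b := key_const * lam `^ (theta - 2) * nrm x + 1.
have b0 : 0 < b by rewrite ltr_wpDl// !mulr_ge0 ?key_const_ge0 ?powR_ge0 ?nrm_ge0.
have [N HN] := kapk _ (divr_gt0 r0 b0).
have li0 : 0 < lam^-1 by rewrite invr_gt0.
have [N' HN'] := step_small t li0.
apply: (@tends_le _ _ (fun m => F (m + (N + N'))%N x)).
  by move=> d d0; have [K HK] := FE x d d0; exists K => m Km; apply: HK; rewrite (leq_trans Km)// leq_addr.
move=> m; set m' := (m + _)%N.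
have mN : (N <= m')%N by rewrite /m' addnCA leq_addr.
have mN' : (N' <= m')%N by rewrite /m' addnA leq_addl.
have s0 : 0 < t / m'.+1%:R by rewrite divr_gt0 ?ltr0n.
have ls : t / m'.+1%:R <= lam^-1 by rewrite ltW// HN'.
have ls' : lam * (t / m'.+1%:R) <= 1 by rewrite mulrC -ler_pdivlMr// div1r.
have s1 : t / m'.+1%:R <= 1 by rewrite (le_trans ls)// invf_le1.
rewrite (le_trans (key_bound_step l1 s0 ls' (kap0 m') (Fe m') (He m' ^~ s1) x))//.
rewrite (@le_trans _ _ (key_const * (kappa + r / b) * lam `^ (theta - 2) * nrm x))//.
  by rewrite ler_wpM2r ?nrm_ge0// ler_wpM2r ?powR_ge0// ler_wpM2l ?key_const_ge0 ?HN.
rewrite mulrDr !mulrDl lerD2l (_ : _ * (r / b) * _ * _ = r / b * (key_const * lam `^ (theta - 2) * nrm x)); last first.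
  by move: (lam `^ _) (r / b) => u v; ring.
by rewrite mulrAC ler_pdivrMr// ler_wpM2l ?(ltW r0)// lerDl.
Qed.

Section Approximant.
Variables (t : R) (G : X -> X) (g : option R[i] -> R[i]).
Hypotheses (t0 : 0 < t) (GP : step_calc T t G g).
Hypothesis g_le1 : forall u, complex.Re u = 0 -> nrm (g (Some u)) <= 1.
Local Notation B x := (G x - T t x).

Let T_tends (u : nat -> X) l : tends u l -> tends (fun m => T t (u m)) (T t l).
Proof.
have Tb y z : nrm (T t y - T t z) <= M * nrm (y - z).
  by rewrite -linearB; apply: (sg_bounded M1 omega0 TM _ (ltW t0)).
exact: (@tends_app _ _ (fun=> T t) (T t) _ _ M (fun=> Tb) (tends_cst _)).
Qed.

(** Without a rate: both symbols have modulus at most 1, and on the imaginary axis the symbol of R(2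
    lam) is smaller than that of R(lam). *)
Lemma key_bound_2 (lam : R) Rl R2 : 1 <= lam -> is_resolvent lam%:C A Rl -> is_resolvent (2 * lam)%:C A R2 ->
  forall x, nrm (B (Rl (R2 x))) <= key_const * 2 * lam `^ (theta - 2) * nrm x.
Proof.
move=> l1 P1 P2; have l0 : 0 < lam := lt_le_trans ltr01 l1.
have l2 : 0 < 2 * lam by rewrite mulr_gt0.
have [H1 [b1 [h1 h1' h1'']]] := step_calc_resolvent Tsg M1 omega0 TM A_gen t0 (l0 : 0 < complex.Re lam%:C) P1.
have [H2 [b2 [h2 h2' h2'']]] := step_calc_resolvent Tsg M1 omega0 TM A_gen t0 (l2 : 0 < complex.Re (2 * lam)%:C) P2.
have S1 : step_calc T t Rl (resolvent_symbol lam%:C) by exists H1, b1.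
have S2 : step_calc T t R2 (resolvent_symbol (2 * lam)%:C) by exists H2, b2.
have [F [b [f1 f2 f3]]] := step_calcM Tsg M1 omega0 TM t0 S1 S2.
have [F' [b' [f'1 f'2 f'3]]] := step_calcM Tsg M1 omega0 TM t0 GP (step_calcM Tsg M1 omega0 TM t0 S1 S2).
have s0 m : 0 < t / m.+1%:R by rewrite divr_gt0 ?ltr0n.
pose e m z := (g (cayley (t / m.+1%:R) z) + (-1) * z ^+ m.+1) * (resolvent_symbol lam%:C (cayley (t / m.+1%:R) z) *
    resolvent_symbol (2 * lam)%:C (cayley (t / m.+1%:R) z)).
apply: (@key_bound lam t 2 (fun=> 2) e (fun m x => F' m x + (-1) *: T t (F m x))) => //.
- by move=> r r0; exists 0%N => m _; rewrite lerDl ltW.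
- move=> m; have D := dcM Tsg M1 omega0 TM (ltW (s0 m)) (step_calc_semigroup Tsg M1 omega0 TM t0 m) (f1 m).
  have D' := dcD (f'1 m) (dcZ Tsg M1 omega0 TM (ltW (s0 m)) (-1) D).
  by apply: dc_eq D' => // z _; rewrite /e; ring.
- move=> m z s1 z1; rewrite /e !nrmM.
  case E : (cayley _ z) => [u|] /=; last by rewrite nrm0 !mul0r mulr0 expr0n /= mulr0.
  have u0 := Re_cayley z1 E.
  have b2' : nrm (g (Some u) + -1 * z ^+ m.+1) <= 2.
    by rewrite (le_trans (nrmD _ _))// nrmM nrmN nrm1 nrmX z1 expr1n mul1r (_ : 2 = 1 + 1)// lerD2r g_le1.
  rewrite expr2; apply: ler_pM; rewrite ?mulr_ge0 ?nrm_ge0// ler_wpM2l ?nrm_ge0//.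
  have n0 v : 0 < v -> 0 < nrm (v%:C + u).
    by move=> v0; rewrite lt_neqAle eq_sym nrm_eq0 Re_neq0// nrm_ge0.
  rewrite !nrmV lef_pV2 ?posrE ?n0// -ler_sqr ?nnegrE ?nrm_ge0// !nrm_sqr.
  case: (u) u0 => a c /= ->; rewrite lerD2r !addr0 lerXn2r ?nnegrE ?(ltW l0) ?(ltW l2)//.
  by rewrite ler_peMl ?(ltW l0)// ler1n.
by move=> x; have := tendsD (f'3 x) (tendsZ (-1) (T_tends (f3 x))); rewrite scaleN1r.
Qed.

(** With rho the modulus of the resolvent symbol, |u| rho <= 1 and rho <= 1/lam. Of the N factors,
    rho^a absorbs |u|^a, two are kept for [key_bound], and the rest gives lam^(a + 2 - N). The
    discretization error grows like |u|^2 and consumes two factors, hence N >= 4; it disappears in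
    the limit. *)
Lemma key_bound_N (lam a c : R) (N : nat) Rl : 1 <= lam -> is_resolvent lam%:C A Rl ->
  0 <= a -> a + 4 <= N%:R -> 0 <= c ->
  (forall u, complex.Re u = 0 -> nrm (g (Some u) - cexp (- (t%:C * u))) <= c * nrm u `^ a) ->
  forall x, nrm (B (iter N Rl x)) <= key_const * c * lam `^ (theta + a - N%:R) * nrm x.
Proof.
move=> l1 P1 a0 aN c0 Hc x; have l0 : 0 < lam := lt_le_trans ltr01 l1.
have SR := step_calc_resolvent Tsg M1 omega0 TM A_gen t0 (l0 : 0 < complex.Re lam%:C) P1.
have SN := step_calcX Tsg M1 omega0 TM t0 N SR.
have [F [b [f1 f2 f3]]] := SN.
have [F' [b' [f'1 f'2 f'3]]] := step_calcM Tsg M1 omega0 TM t0 GP SN.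
have s0 m : 0 < t / m.+1%:R by rewrite divr_gt0 ?ltr0n.
have N4 : (4 <= N)%N by rewrite -(ler_nat R) (le_trans _ aN)// lerDr.
pose e m z := (g (cayley (t / m.+1%:R) z) + (-1) * z ^+ m.+1) * resolvent_symbol lam%:C (cayley (t / m.+1%:R) z) ^+ N.
pose kinf := c * lam `^ (a + 2 - N%:R).
have main : nrm (B (iter N Rl x)) <= key_const * kinf * lam `^ (theta - 2) * nrm x.
  apply: (@key_bound lam t kinf (fun m => kinf + 2 * t * (t / m.+1%:R)) e (fun m x => F' m x + (-1) *: T t (F m x))
     (fun x => B (iter N Rl x))) => //.
  - by move=> m; rewrite addr_ge0 ?mulr_ge0 ?powR_ge0 ?(ltW t0)// invr_ge0.
  - move=> r r0; have t2 : 0 < 2 * t by rewrite mulr_gt0.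
    have [K HK] := step_small t (divr_gt0 r0 t2); exists K => m /HK; rewrite ltr_pdivlMr// => h.
    by rewrite lerD2l mulrC ltW.
  - move=> m; have D := dcM Tsg M1 omega0 TM (ltW (s0 m)) (step_calc_semigroup Tsg M1 omega0 TM t0 m) (f1 m).
    have D' := dcD (f'1 m) (dcZ Tsg M1 omega0 TM (ltW (s0 m)) (-1) D).
    by apply: dc_eq D' => // z _; rewrite /e; ring.
  - move=> m z s1 z1; rewrite /e nrmM nrmX.
    case E : (cayley _ z) => [u|] /=; last by rewrite nrm0 !expr0n gtn_eqF ?(leq_trans _ N4)//= !mulr0.
    have u0 := Re_cayley z1 E.
    set rho := nrm (lam%:C + u)^-1.
    have n0 : 0 < nrm (lam%:C + u) by rewrite lt_neqAle eq_sym nrm_eq0 Re_neq0// nrm_ge0.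
    have rho0 : 0 < rho by rewrite /rho nrmV invr_gt0.
    have n2 : nrm (lam%:C + u) ^+ 2 = lam ^+ 2 + nrm u ^+ 2.
      by rewrite !nrm_sqr; case: (u) u0 => a' b'' /= ->; ring.
    have rl : rho <= lam^-1.
      rewrite /rho nrmV lef_pV2 ?posrE// -ler_sqr ?nnegrE ?nrm_ge0 ?(ltW l0)// n2 lerDl sqr_ge0//.
    have ru : nrm u * rho <= 1.
      rewrite /rho nrmV ler_pdivrMr// mul1r -ler_sqr ?nnegrE ?nrm_ge0// n2 lerDr sqr_ge0//.
    have r1 : rho <= 1 by rewrite (le_trans rl)// invf_le1.
    (* With v = hu/2, z is (1 - v) / (1 + v). Each of the m + 1 steps costs 6 |v|^2 = (3/2) h^2
       |u|^2, and (m + 1) h = t. *)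
    have Hstep : nrm (cexp (- (t%:C * u)) - z ^+ m.+1) <= 2 * t * (t / m.+1%:R) * nrm u ^+ 2.
      set h := t / m.+1%:R in s1 E *; have h0 : 0 < h := s0 m.
      have tE : t = m.+1%:R * h by rewrite /h mulrC divfK// pnatr_eq0.
      pose v := (h / 2)%:C * u.
      have v0 : complex.Re v = 0 by rewrite /v; case: (u) u0 => a' b'' /= ->; rewrite mulr0 mul0r subr0.
      have zE : z = (1 - v) / (1 + v).
        have vn : 1 + v != 0 by apply: (Re_neq0 (lam := 1)) v0; rewrite /= ltr01.
        move: E; rewrite /cayley; case: eqVneq => // zn1 [uE].
        have zp : 1 + z != 0 by rewrite addrC addr_eq0.
        have vE : v = (1 - z) / (1 + z).
          have hh : h / 2 * (2 / h) = 1 by field; rewrite gt_eqF.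
          by rewrite /v -uE mulrA -rmorphM /= hh mul1r.
        apply: (mulIf vn); rewrite mulfVK// vE; field; exact: zp.
      have -> : cexp (- (t%:C * u)) = cexp (- (2 * v)) ^+ m.+1.
        have tC : t%:C = m.+1%:R * h%:C :> R[i] by rewrite {1}tE rmorphM /= rmorph_nat.
        have hC : (h / 2)%:C = h%:C / 2 :> R[i] by rewrite rmorphM /= fmorphV /= rmorph_nat.
        rewrite -cexp_natmul; congr cexp; rewrite tC /v hC.
        have alg (x1 x2 x3 : R[i]) : - (x1 * x2 * x3) = x1 * - (2 * (x2 / 2 * x3)) by field.
        exact: alg.
      have e1 : nrm (cexp (- (2 * v))) <= 1.
        rewrite nrm_cexp -[leRHS]expR0 ler_expR.
        rewrite -(rmorph_nat (real_complex R)).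
        by case: (v) v0 => a' b'' /= ->; rewrite mulr0 mul0r subr0 oppr0.
      rewrite (le_trans (powers_dist _ e1 _)) ?z1//.
      rewrite {1}zE (le_trans (ler_wpM2l _ (cexp_cayley v0)))//.
      rewrite /v nrmM nrm_real gtr0_norm ?divr_gt0// tE.
      have := mulr_ge0 (ler0n R m.+1) (mulr_ge0 (sqr_ge0 h) (sqr_ge0 (nrm u))).
      have -> : m.+1%:R * (6 * (h / 2 * nrm u) ^+ 2) = 3 / 2 * (m.+1%:R * (h ^+ 2 * nrm u ^+ 2)) by field.
      have -> : 2 * (m.+1%:R * h) * h * nrm u ^+ 2 = 2 * (m.+1%:R * (h ^+ 2 * nrm u ^+ 2)) by ring.
      by move: (m.+1%:R * _) => w; lra.
    have split : nrm (g (Some u) + -1 * z ^+ m.+1) <= c * nrm u `^ a + 2 * t * (t / m.+1%:R) * nrm u ^+ 2.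
      rewrite mulN1r (le_trans (nrm_triangle (cexp (- (t%:C * u))) _ _))// lerD ?Hc//.
    rewrite (le_trans (ler_wpM2r (exprn_ge0 _ (ltW rho0)) split))// mulrDl [leRHS]mulrDl; apply: lerD.
      have -> : rho ^+ N = rho `^ a * rho `^ (N%:R - a).
        by rewrite -powRD ?(gt_eqF rho0) ?implybT// addrC subrK powR_mulrn// ltW.
      have p1 : nrm u `^ a * rho `^ a <= 1.
        rewrite -powRM ?nrm_ge0 ?(ltW rho0)//.
        have one : (1 : R) = 1 `^ a by rewrite powR1.
        by rewrite one ge0_ler_powR ?nnegrE ?mulr_ge0 ?nrm_ge0 ?(ltW rho0).
      have p2 : rho `^ (N%:R - a) <= lam `^ (a + 2 - N%:R) * rho ^+ 2.
        have -> : rho `^ (N%:R - a) = rho `^ (N%:R - a - 2) * rho ^+ 2.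
          by rewrite -powR_mulrn ?(ltW rho0)// -powRD ?(gt_eqF rho0) ?implybT// subrK.
        rewrite ler_wpM2r ?sqr_ge0// (_ : a + 2 - N%:R = - (N%:R - a - 2)); last by ring.
        rewrite powRN -powR_inv1 ?powR_ge0// -powRAC powR_inv1 ?(ltW l0)//.
        apply: ge0_ler_powR; rewrite ?nnegrE ?invr_ge0 ?(ltW l0) ?(ltW rho0)//.
        by move: aN; lra.
      rewrite (_ : c * _ * (_ * _) = c * (nrm u `^ a * rho `^ a * rho `^ (N%:R - a))); last first.
        by move: (nrm u `^ a) (rho `^ a) (rho `^ _) => x1 x2 x3; ring.
      rewrite /kinf -[leRHS]mulrA; apply: ler_wpM2l => //.
      by rewrite (le_trans (ler_wpM2r (powR_ge0 _ _) p1))// mul1r.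
    rewrite -[leLHS]mulrA; apply: ler_wpM2l; first by rewrite !mulr_ge0 ?(ltW t0) ?invr_ge0.
    have -> : nrm u ^+ 2 * rho ^+ N = (nrm u * rho) ^+ 2 * (rho ^+ (N - 4) * rho ^+ 2).
      have NE : N = (2 + (N - 4 + 2))%N by rewrite addnCA subnK.
      by rewrite {1}NE [rho ^+ (2 + _)]exprD [rho ^+ (_ + 2)]exprD exprMn mulrA.
    rewrite mulrA ler_piMl ?sqr_ge0// mulr_ile1 ?exprn_ge0 ?mulr_ge0 ?nrm_ge0 ?(ltW rho0)//.
      by rewrite exprn_ile1 ?mulr_ge0 ?nrm_ge0 ?(ltW rho0).
    by rewrite exprn_ile1 ?(ltW rho0).
  - by move=> y; have := tendsD (f'3 y) (tendsZ (-1) (T_tends (f3 y))); rewrite scaleN1r.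
move: main; rewrite /kinf mulrA -[key_const * c * _ * _]mulrA -powRD ?(gt_eqF l0) ?implybT//.
by rewrite (_ : a + 2 - N%:R + (theta - 2) = theta + a - N%:R)//; ring.
Qed.
End Approximant.
End KeyEstimate.

(** * The K-functional *)

Section KFunctional.
Context {R : realType} {X : completeNormedModType R[i]}.
Variable A : operator X.
Hypothesis A0 : dom A 0.
Variable x : X.
Local Notation K := (fun t => K_functional A t x).

Let Kset (t : R) : set R := [set nrm yz.1 + t * graph_norm A yz.2 | yz in
         [set yz : X * X | dom A yz.2 /\ x = yz.1 + yz.2]].

Let graph_norm_ge0 z : 0 <= graph_norm A z.
Proof. by rewrite addr_ge0 ?nrm_ge0. Qed.

Let Kset_lb t : 0 <= t -> lbound (Kset t) 0.
Proof. by move=> t0 _ [yz _ <-]; rewrite addr_ge0 ?nrm_ge0 ?mulr_ge0. Qed.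

Let Kset_neq0 t : Kset t !=set0.
Proof. by exists (nrm x + t * graph_norm A 0), (x, 0) => //=; rewrite addr0. Qed.

Lemma K_functional_ge0 t : 0 <= t -> 0 <= K_functional A t x.
Proof. by move=> t0; apply: lb_le_inf; [exact: Kset_neq0|exact: Kset_lb]. Qed.

Lemma K_functional_le s t : 0 <= s -> s <= t -> K_functional A s x <= K_functional A t x.
Proof.
move=> s0 st; apply: lb_le_inf; first exact: Kset_neq0.
move=> _ [yz H <-]; apply: (@le_trans _ _ (nrm yz.1 + s * graph_norm A yz.2)).
  by apply: ge_inf; [exists 0; exact: Kset_lb|exists yz].
by rewrite lerD2l ler_wpM2r.
Qed.

Lemma K_functional_adherent t e : 0 <= t -> 0 < e ->
  exists y z, [/\ dom A z, x = y + z & nrm y + t * graph_norm A z <= K_functional A t x + e].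
Proof.
move=> t0 e0; have hi : has_inf (Kset t) by split; [exact: Kset_neq0|exists 0; exact: Kset_lb].
have [_ [[y z] [/= dz xE] <-] H] := inf_adherent e0 hi.
by exists y, z; split=> //; exact: ltW.
Qed.

(** On ]2^-(k+1), 2^-k], of length 2^-(k+1), the integrand is at least 2^(k theta) 2^k K(2^-(k+1)),
    as K is nondecreasing; so each summand is at most twice the integral over its interval. *)
Lemma interp_dyadic_sum theta : 0 <= theta -> interp A theta 1 x ->
  exists C : R, forall J, \sum_(k < J) (2 `^ theta) ^+ k * K_functional A (2^-1 ^+ k.+1) x <= C.
Proof.
move=> th0; rewrite /interp /=.
set f := fun t : R => ((t `^ (- theta) * K t) `^ 1 / t)%:E => If.
have d0 k : (0 : R) < 2^-1 ^+ k by rewrite exprn_gt0 ?invr_gt0.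
have dS k : (2^-1 ^+ k.+1 : R) < 2^-1 ^+ k.
  by rewrite exprS gtr_pMl// invf_lt1// ltr1n.
have f0 t : `]0%R, +oo[%classic t -> (0 <= f t)%E.
  rewrite /= in_itv/= andbT => t0; rewrite lee_fin mulr_ge0 ?invr_ge0 ?powR_ge0//; exact: ltW.
have mf : measurable_fun (`]0%R, +oo[%classic : set R) f.
  (* Replacing t by max(t, 0) makes K nondecreasing on the whole line, hence measurable. *)
  apply: (eq_measurable_fun (fun t : R => (t `^ (- theta) * K_functional A (Num.max t 0) x * t `^ (-1))%:E)).
    move=> t; rewrite inE/= in_itv/= andbT => t0; rewrite /f (max_l (ltW t0)) powRr1.
      by rewrite powR_inv1// ltW.
    by rewrite mulr_ge0 ?powR_ge0// K_functional_ge0// ltW.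
  apply/measurable_EFinP; apply: measurable_funTS.
  apply: measurable_funM; last exact: measurable_powR.
  apply: measurable_funM; first exact: measurable_powR.
  apply: nondecreasing_measurable => // s t st.
  by apply: K_functional_le; rewrite ?ge_max !le_max ?st lexx orbT.
pose I (a b : R) : set R := [set` `]a, b]].
have mI a b : measurable (I a b) by exact: measurable_itv.
have Isub a b : 0 <= a -> I a b `<=` (`]0%R, +oo[%classic : set R).
  by move=> ha t; rewrite /I /= !in_itv/= andbT => /andP[H _]; rewrite (le_lt_trans _ H).
have muI a b : a < b -> lebesgue_measure (I a b) = (b - a)%:E.
  by move=> ab; rewrite /I lebesgue_measure_itv/= lte_fin ab -EFinD.
have piece k : (((2 `^ theta) ^+ k * K (2^-1 ^+ k.+1) / 2)%:E <=
    \int[lebesgue_measure]_(t in I (2^-1 ^+ k.+1)%R (2^-1 ^+ k)%R) f t)%E.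
  have -> : (((2 `^ theta) ^+ k * K (2^-1 ^+ k.+1) / 2)%:E =
     \int[lebesgue_measure]_(t in I (2^-1 ^+ k.+1)%R (2^-1 ^+ k)%R)
       (cst ((2 `^ theta) ^+ k * K (2^-1 ^+ k.+1) * 2 ^+ k)%:E t))%E.
    rewrite integral_cst; last exact: mI.
    rewrite [X in (_ * X)%E](muI _ _ (dS k)) -EFinM; congr (_%:E).
    have E2 : (2^-1 ^+ k : R) - 2^-1 ^+ k.+1 = 2^-1 * 2^-1 ^+ k by rewrite exprS; field.
    by rewrite E2 -[RHS]mulrA [2 ^+ k * _]mulrCA [2^-1 ^+ k]exprVn divff ?mulr1// expf_neq0.
  apply: ge0_le_integral => //.
  - exact: mI.
  - by move=> t _; rewrite /cst lee_fin !mulr_ge0 ?exprn_ge0 ?powR_ge0 ?K_functional_ge0// ltW.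
  - by apply: measurable_funS mf; [exact: measurable_itv|apply: Isub; rewrite ltW].
  move=> t; rewrite /I/= in_itv/= => /andP[t1 t2].
  have t0 : 0 < t by rewrite (lt_trans _ t1).
  rewrite /f /cst lee_fin powRr1 ?mulr_ge0 ?powR_ge0 ?K_functional_ge0 ?(ltW t0)//.
  apply: ler_pM; rewrite ?mulr_ge0 ?exprn_ge0 ?powR_ge0 ?K_functional_ge0 ?(ltW (d0 _))//.
    apply: ler_pM; rewrite ?exprn_ge0 ?powR_ge0 ?K_functional_ge0 ?(ltW (d0 _))//.
      rewrite powRN -[leRHS]div1r ler_pdivlMr ?powR_gt0// -powR_mulrn ?powR_ge0// -powRrM mulrC.
      rewrite [theta * _]mulrC powRrM powR_mulrn ?ler0n// -powRM ?exprn_ge0 ?(ltW t0)//.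
      rewrite [leRHS](_ : 1 = 1 `^ theta); last by rewrite powR1.
      rewrite ge0_ler_powR ?nnegrE ?mulr_ge0 ?exprn_ge0 ?(ltW t0)//.
      by rewrite -ler_pdivlMr ?exprn_gt0// div1r -exprVn.
    by rewrite K_functional_le ?(ltW t1)// ltW.
  by rewrite -[2 ^+ k]invrK lef_pV2 ?posrE ?invr_gt0 ?exprn_gt0// -exprVn.
have fin : (0 <= \int[lebesgue_measure]_(t in `]0%R, +oo[%classic) f t)%E by exact: integral_ge0.
exists (2 * fine (\int[lebesgue_measure]_(t in `]0%R, +oo[%classic) f t)) => J.
have H : ((\sum_(k < J) (2 `^ theta) ^+ k * K (2^-1 ^+ k.+1) / 2)%:E <=
   \int[lebesgue_measure]_(t in I (2^-1 ^+ J)%R 1%R) f t)%E.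
  elim: J => [|J IH].
    rewrite big_ord0 integral_ge0// => t; rewrite /I/= in_itv/= => /andP[E _].
    by rewrite f0//= in_itv/= andbT (lt_trans _ E).
  have sJ := Isub (2^-1 ^+ J.+1) 1 (ltW (d0 _)).
  have U : I (2^-1 ^+ J.+1) 1 = I (2^-1 ^+ J.+1) (2^-1 ^+ J) `|` I (2^-1 ^+ J) 1.
    by rewrite /I; apply: itv_bndbnd_setU; rewrite bnd_simp ?(ltW (dS _))// exprn_ile1 ?invr_ge0// invf_le1 ?ler1n.
  rewrite U ge0_integral_setU//=; try exact: mI.
  - by rewrite big_ord_recr/= addrC EFinD leeD.
  - by rewrite -U; apply: measurable_funS mf; first exact: measurable_itv.

  - by move=> t tU; apply/f0/sJ; rewrite U.
  - apply/disj_setPS => t [] /=; rewrite /I/= !in_itv/= => /andP[_ a1] /andP[a2 _].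
    by move: (lt_le_trans a2 a1); rewrite ltxx.
rewrite -ler_pdivrMl// mulrC big_distrl/= -lee_fin fineK ?ge0_fin_numE//.
apply: (le_trans H); apply: ge0_subset_integral => //; [exact: mI|exact/Isub/ltW].
Qed.
End KFunctional.

(** * Laplace approximation of power weights *)

Section LaplaceWeights.
Context {R : realType}.
Variables (al : R) (n0 : nat).
Hypotheses (al0 : 0 < al) (aln : al < n0.+1%:R).

Let gam : R := n0.+1%:R - al.
Let gam0 : 0 < gam. Proof. by rewrite subr_gt0. Qed.

(** A zero of order n0 at 0 and exponential decay at infinity. Being a combination of exponentials,
    it integrates against the semigroup to a combination of resolvents. *)
Definition lap_bump (s : R) : R := expR (- s) * (1 - expR (- s)) ^+ n0.

Definition lap_weight (y s : R) : R := expR (y * (1 - al)) * lap_bump (expR y * s).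

Let onem (s : R) : 0 <= s -> 0 <= 1 - expR (- s) <= s.
Proof.
move=> s0; rewrite subr_ge0 expR_le1 oppr_le0 s0/= lerBlDr addrC.
by have := expR_ge1Dx (- s); lra.
Qed.

Lemma lap_weight_ge0 y s : 0 <= s -> 0 <= lap_weight y s.
Proof.
move=> s0; rewrite mulr_ge0 ?expR_ge0// mulr_ge0 ?expR_ge0// exprn_ge0//.
by case/andP: (onem (mulr_ge0 (expR_ge0 y) s0)).
Qed.

Lemma lap_weight_le_exp y s : 0 <= s -> lap_weight y s <= expR (y * (1 - al)) * expR (- (expR y * s)).
Proof.
move=> s0; rewrite /lap_weight; have := mulr_ge0 (expR_ge0 y) s0; move: (expR y * s) => u u0.
rewrite ler_wpM2l ?expR_ge0// /lap_bump ler_piMr ?expR_ge0// exprn_ile1 ?(andP (onem u0)).1//.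
Qed.

Lemma lap_weight_le_pow y s : 0 <= s -> lap_weight y s <= expR (y * gam) * s ^+ n0.
Proof.
move=> s0; have u0 := mulr_ge0 (expR_ge0 y) s0.
rewrite (@le_trans _ _ (expR (y * (1 - al)) * (expR y * s) ^+ n0))//.
  rewrite ler_wpM2l ?expR_ge0// /lap_bump -[leRHS]mul1r; case/andP: (onem u0) => a b.
  by apply: ler_pM; rewrite ?expR_ge0 ?exprn_ge0 ?expR_le1 ?oppr_le0// lerXn2r ?nnegrE.
rewrite exprMn mulrA -expRM_natl -expRD ler_wpM2r ?exprn_ge0// ler_expR.
by rewrite le_eqVlt; apply/orP; left; apply/eqP; rewrite /gam -natr1; ring.
Qed.

(* s^(1-al) times the weight: a function g of e^y s alone, so that summing over
   y in h Z gives a function of s invariant under s -> e^h s. *)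
Definition lap_density (y s : R) : R := s `^ (1 - al) * lap_weight y s.

Lemma powR_lap_density y s : 0 < s -> s `^ (al - 1) * lap_density y s = lap_weight y s.
Proof.
move=> s0; rewrite /lap_density mulrA -powRD ?(gt_eqF s0) ?implybT//.
by rewrite addrA subrK subrr powRr0 mul1r.
Qed.

Lemma lap_density_ge0 y s : 0 <= s -> 0 <= lap_density y s.
Proof. by move=> s0; rewrite mulr_ge0 ?powR_ge0 ?lap_weight_ge0. Qed.

Let powR_expM z s (b : R) : 0 < s -> (expR z * s) `^ b = expR (z * b) * s `^ b.
Proof. by move=> s0; rewrite powRM ?expR_ge0 ?(ltW s0)// expRM. Qed.

Lemma lap_densityD y z s : 0 < s -> lap_density y (expR z * s) = lap_density (y + z) s.
Proof.
move=> s0; rewrite /lap_density /lap_weight powR_expM// mulrDl !expRD [expR y * _]mulrA.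
by rewrite -!mulrA mulrCA; congr (_ * _); rewrite mulrCA.
Qed.

(** For r = e^z >= 1, concavity gives 1 - e^(-ru) <= r (1 - e^(-u)); the n0 factors r and the power
    r^(1 - al) combine to r^gam. *)
Lemma lap_density_dilate y z s : 0 <= z -> 0 < s -> lap_density y (expR z * s) <= expR (gam * z) * lap_density y s.
Proof.
move=> z0 s0; have u0 : 0 < expR y * s by rewrite mulr_gt0 ?expR_gt0.
rewrite /lap_density /lap_weight powR_expM// [expR y * (_ * _)]mulrCA; move: (expR y * s) u0 => u u0.
have r1 : 1 <= expR z by rewrite -expR0 ler_expR.
have H : lap_bump (expR z * u) <= expR z ^+ n0 * lap_bump u.
  rewrite /lap_bump mulrCA -exprMn; apply: ler_pM; rewrite ?expR_ge0 ?exprn_ge0//.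
  - by rewrite (andP (onem _)).1// mulr_ge0 ?expR_ge0 ?ltW.
  - by rewrite ler_expR lerN2 ler_peMl// ltW.
  rewrite lerXn2r ?nnegrE ?mulr_ge0 ?expR_ge0 ?(andP (onem _)).1 ?mulr_ge0 ?expR_ge0 ?(ltW u0)//.
  set r := expR z in r1 *; have E : expR (- (r * u)) = expR (- u) * expR (- ((r - 1) * u)).
    by rewrite -expRD; congr expR; ring.
  have h1 := expR_ge1Dx (- ((r - 1) * u)).
  have h2 : expR (- u) * u <= 1 - expR (- u).
    rewrite -(ler_pM2l (expR_gt0 u)) mulrBr mulrA -expRD subrr expR0 mul1r mulr1.
    by have := expR_ge1Dx u; lra.
  have h3 : expR (- u) * (1 - (r - 1) * u) <= expR (- (r * u)) by rewrite E ler_wpM2l ?expR_ge0.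
  have h4 : (r - 1) * (expR (- u) * u) <= (r - 1) * (1 - expR (- u)) by rewrite ler_wpM2l ?subr_ge0.
  move: h3 h4; move: (expR (- u)) (expR (- (r * u))) => p q; nra.
have E : expR (gam * z) = expR (z * (1 - al)) * expR z ^+ n0.
  by rewrite -expRM_natl -expRD; congr expR; rewrite /gam -natr1; ring.
rewrite E.
set A := expR (z * _); set S := s `^ _; set Y := expR (y * _).
have -> : A * expR z ^+ n0 * (S * (Y * lap_bump u)) = A * S * Y * (expR z ^+ n0 * lap_bump u) by ring.
by rewrite [A * S * (Y * _)]mulrA ler_wpM2l// ?mulr_ge0 ?expR_ge0 ?powR_ge0.
Qed.

Definition lap_sum (h : R) (I : nat) (s : R) : R :=
  \sum_(k < I) (lap_density (k%:R * h) s + lap_density (- (k.+1%:R * h)) s).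

(** The sum over all y in h Z, as a supremum of partial sums of nonnegative terms. It is periodic in
    log s with period h, so for small h it is nearly constant, and s^(al-1) is nearly a multiple of
    a sum of weights. *)
Definition lap_profile (h s : R) : R := sup (range (lap_sum h ^~ s)).

Section Fixed_step.
Variable h : R.
Hypothesis h0 : 0 < h.
Local Notation F := (lap_sum h).
Local Notation P := (lap_profile h).

Let FS I s : F I.+1 s = F I s + (lap_density (I%:R * h) s + lap_density (- (I.+1%:R * h)) s).
Proof. by rewrite /lap_sum big_ord_recr. Qed.

Lemma lap_sum_nd s I J : 0 <= s -> (I <= J)%N -> F I s <= F J s.
Proof.
move=> s0 /subnKC <-; elim: (J - I)%N => [|k IH]; first by rewrite addn0.
by rewrite addnS (le_trans IH)// FS lerDl addr_ge0 ?lap_density_ge0.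
Qed.

Lemma geometric_exp_le c m n : 0 < c -> \sum_(m <= k < n) expR (- (k%:R * h * c)) <= expR (- (m%:R * h * c)) / (1 - expR (- (h * c))).
Proof.
move=> c0; have hc : 0 < h * c by rewrite mulr_gt0.
have E k : expR (- (k%:R * h * c)) = expR (- (h * c)) ^+ k.
  by rewrite -expRM_natl -mulrA mulrN.
rewrite (eq_bigr (fun k => expR (- (h * c)) ^+ k)); last by move=> k _; rewrite E.
by rewrite E geometric_sum_le// expR_ge0 expR_lt1 oppr_lt0.
Qed.

Definition lap_approx I s : R := \sum_(k < I) (lap_weight (k%:R * h) s + lap_weight (- (k.+1%:R * h)) s).

Lemma powR_lap_sum I s : 0 < s -> s `^ (al - 1) * F I s = lap_approx I s.
Proof.
move=> s0; rewrite /lap_sum mulr_sumr; apply: eq_bigr => k _.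
by rewrite mulrDr (powR_lap_density _ s0) (powR_lap_density _ s0).
Qed.

(** The [c i] and [s i] stand for the coefficients and nodes of a Riemann sum of e^(-omega s) ds. A
    weight with y >= 0 is dominated by an exponential, controlled by the Laplace bound [C1]; one
    with y < 0 is dominated by s^n0, controlled by the moment [C2]. *)
Lemma lap_approx_tail m (c s : nat -> R) (C1 C2 : R) I J : (I <= J)%N ->
  (forall i, 0 <= c i) -> (forall i, 0 < s i) -> 0 <= C1 -> 0 <= C2 ->
  (forall lam, 0 < lam -> \sum_(i < m) c i * expR (- (lam * s i)) <= C1 / lam) ->
  \sum_(i < m) c i * s i ^+ n0 <= C2 ->
  \sum_(i < m) c i * (lap_approx J (s i) - lap_approx I (s i)) <=
    C1 * (expR (- (I%:R * h * al)) / (1 - expR (- (h * al)))) +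
    C2 * (expR (- (I%:R * h * gam)) / (1 - expR (- (h * gam)))).
Proof.
move=> IJ c0 s0 C10 C20 H1 H2.
have E t : lap_approx J t - lap_approx I t =
   \sum_(I <= k < J) (lap_weight (k%:R * h) t + lap_weight (- (k.+1%:R * h)) t).
  by rewrite /lap_approx -!(big_mkord xpredT (fun k => lap_weight (k%:R * h) t + lap_weight (- (k.+1%:R * h)) t))
    (big_cat_nat (leq0n I) IJ)/= addrAC subrr add0r.
under eq_bigr do rewrite E mulr_sumr.
rewrite exchange_big/=.
apply: (@le_trans _ _ (\sum_(I <= k < J) (C1 * expR (- (k%:R * h * al)) + C2 * expR (- (k%:R * h * gam))))).
  apply: ler_sum => k _; under eq_bigr do rewrite mulrDr.
  rewrite big_split/= lerD//.
    apply: (@le_trans _ _ (\sum_(i < m) expR (k%:R * h * (1 - al)) * (c i * expR (- (expR (k%:R * h) * s i))))).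
      by apply: ler_sum => i _; rewrite [leRHS]mulrCA ler_wpM2l// lap_weight_le_exp// ltW.
    rewrite -mulr_sumr (le_trans (ler_wpM2l (expR_ge0 _) (H1 _ (expR_gt0 _))))//.
    rewrite mulrCA ler_wpM2l// -expRN -expRD ler_expR.
    by move: (k%:R * h) => u; lra.
  apply: (@le_trans _ _ (\sum_(i < m) expR (- (k.+1%:R * h) * gam) * (c i * s i ^+ n0))).
    by apply: ler_sum => i _; rewrite [leRHS]mulrCA ler_wpM2l// lap_weight_le_pow// ltW.
  rewrite -mulr_sumr (le_trans (ler_wpM2l (expR_ge0 _) H2))// mulrC ler_wpM2l// ler_expR.
  by rewrite mulNr lerN2 ler_wpM2r ?(ltW gam0)// ler_wpM2r ?(ltW h0)// ler_nat.
by rewrite big_split/= -!mulr_sumr lerD// ler_wpM2l// geometric_exp_le.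
Qed.

Let F_bounded s : 0 < s -> exists C, forall I, F I s <= C.
Proof.
move=> s0; have s0' := ltW s0; eexists => I.
have p0 : 0 <= s `^ (1 - al) by rewrite powR_ge0.
(* A pointwise bound is the tail estimate for a single node of weight s^(1 - al), starting from the
   empty sum. *)
have H := @lap_approx_tail 1 (fun=> s `^ (1 - al)) (fun=> s) (s `^ (1 - al) / s) (s `^ (1 - al) * s ^+ n0) 0 I
  (leq0n I) (fun=> p0) (fun=> s0).
have -> : F I s = \sum_(i < 1) s `^ (1 - al) * (lap_approx I s - lap_approx 0 s).
  have -> : lap_approx 0 s = 0 by rewrite /lap_approx big_ord0.
  rewrite big_ord1 -powR_lap_sum// subr0 mulrA -powRD ?(gt_eqF s0) ?implybT//.
  by rewrite addrA subrK subrr powRr0 mul1r.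
apply: H; rewrite ?mulr_ge0 ?invr_ge0 ?exprn_ge0 ?big_ord1//.
move=> lam l0; rewrite big_ord1 -mulrA ler_wpM2l// -invfM mulrC expRN lef_pV2 ?posrE ?expR_gt0 ?mulr_gt0//.
by rewrite (le_trans _ (expR_ge1Dx _))// lerDr.
Qed.

Let has_supF s : 0 < s -> has_sup (range (F ^~ s)).
Proof.
move=> s0; split; first by exists (F 0%N s), 0%N.
by have [C HC] := F_bounded s0; exists C => _ [I _ <-].
Qed.

Lemma lap_sum_le_profile I s : 0 < s -> F I s <= P s.
Proof. by move=> s0; apply: ub_le_sup; [exact: (has_supF s0).2|exists I]. Qed.

Lemma lap_profile_le s C : 0 < s -> (forall I, F I s <= C) -> P s <= C.
Proof. by move=> s0 H; apply: ge_sup; [exact: (has_supF s0).1|move=> _ [I _ <-]]. Qed.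

Lemma lap_sum_cvg s : 0 < s -> F I s @[I --> \oo] --> P s.
Proof.
move=> s0; apply: nondecreasing_cvgn; last exact: (has_supF s0).2.
by apply/nondecreasing_seqP => I; exact: lap_sum_nd (ltW s0) (leqnSn I).
Qed.

Let F_shift I s : 0 < s ->
  F I (expR h * s) + lap_density (- (I%:R * h)) s = F I s + lap_density (I%:R * h) s.
Proof.
move=> s0; elim: I => [|I IH]; first by rewrite /lap_sum !big_ord0 mul0r oppr0.
rewrite (FS I (expR h * s)) (FS I s) (lap_densityD (I%:R * h) h s0) (lap_densityD (- (I.+1%:R * h)) h s0).
have -> : I%:R * h + h = I.+1%:R * h by rewrite -[in RHS]natr1 mulrDl mul1r.
have -> : - (I.+1%:R * h) + h = - (I%:R * h) by rewrite -natr1 mulrDl mul1r opprD subrK.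
move: IH; move: (F _ _) (F _ _) (lap_density _ _) (lap_density _ _) (lap_density _ _) (lap_density _ _) => x1 x2 x3 x4 x5 x6; lra.
Qed.

Let P_shift s : 0 < s -> P (expR h * s) = P s.
Proof.
move=> s0; have u0 : 0 < expR h * s by rewrite mulr_gt0 ?expR_gt0.
apply/eqP; rewrite eq_le; apply/andP; split; apply: lap_profile_le => // I.
  rewrite (le_trans _ (lap_sum_le_profile I.+1 s0))// (@le_trans _ _ (F I s + lap_density (I%:R * h) s))//.
    by rewrite -F_shift// lerDl lap_density_ge0// ltW.
  by rewrite FS lerD2l lerDl lap_density_ge0// ltW.
rewrite (le_trans _ (lap_sum_le_profile I.+1 u0))// (@le_trans _ _ (F I s + lap_density (I%:R * h) s))//.
  by rewrite lerDl lap_density_ge0// ltW.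
rewrite -F_shift// FS lerD2l !lap_densityD//.
have -> : - (I.+1%:R * h) + h = - (I%:R * h) by rewrite -natr1 mulrDl mul1r opprD subrK.
by rewrite lerDr lap_density_ge0// ltW.
Qed.

Let P_dilate z s : 0 <= z -> 0 < s -> P (expR z * s) <= expR (gam * z) * P s.
Proof.
move=> z0 s0; have u0 : 0 < expR z * s by rewrite mulr_gt0 ?expR_gt0.
apply: lap_profile_le => // I; rewrite (@le_trans _ _ (expR (gam * z) * F I s))//.
  by rewrite /lap_sum mulr_sumr; apply: ler_sum => k _; rewrite mulrDr lerD// lap_density_dilate.
by rewrite ler_wpM2l ?expR_ge0// lap_sum_le_profile.
Qed.

Let P_shiftn k s : 0 < s -> P (expR (k%:R * h) * s) = P s.
Proof.
move=> s0; elim: k => [|k IH]; first by rewrite mul0r expR0 mul1r.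
by rewrite -natr1 mulrDl mul1r addrC expRD -mulrA P_shift// mulr_gt0 ?expR_gt0.
Qed.

(* By periodicity, s can be taken in [1, e^h]. *)
Lemma lap_profile_almost_cst s : 0 < s -> P s <= expR (gam * h) * P 1 /\ P 1 <= expR (gam * h) * P s.
Proof.
move=> s0.
have [z [z0 zh <-]] : exists z, [/\ 0 <= z, z <= h & P (expR z) = P s].
  have [k Hk] : exists k : nat, 0 <= ln s + k%:R * h.
    exists (Num.truncn (`|ln s| / h)).+1.
    by rewrite -lerBlDl sub0r (le_trans (ler_norm _))// normrN -ler_pdivrMr// ltW// truncnS_gt.
  pose y := ln s + k%:R * h; pose j := Num.truncn (y / h).
  have /andP[j1 j2] : j%:R <= y / h < j.+1%:R by apply: truncn_itv; rewrite divr_ge0 // ltW.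
  exists (y - j%:R * h); split.
  - by rewrite subr_ge0 -ler_pdivlMr.
  - rewrite lerBlDr (_ : h + _ = j.+1%:R * h) -?ler_pdivrMr//; first exact: ltW.
    by rewrite -natr1; ring.
  - have <- := P_shiftn k s0; have <- := P_shiftn j (expR_gt0 (y - j%:R * h)).
    by rewrite -expRD addrC subrK /y expRD lnK// mulrC.
have zpos : 0 <= h - z by rewrite subr_ge0.
have P0 s' : 0 < s' -> 0 <= P s'.
  by move=> ss; rewrite (le_trans _ (lap_sum_le_profile 0%N ss))// /lap_sum big_ord0.
have mono y : 0 <= y -> y <= h -> expR (gam * y) <= expR (gam * h).
  by move=> ? ?; rewrite ler_expR ler_wpM2l// ltW.
split.
  rewrite -[expR z]mulr1 (le_trans (P_dilate z0 ltr01))// ler_wpM2r ?P0 ?mono//.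
rewrite -(P_shift ltr01) mulr1 -[h in P (expR h)](subrK z) expRD (le_trans (P_dilate zpos (expR_gt0 z)))//.
by rewrite ler_wpM2r ?P0 ?expR_gt0 ?mono// gerBl.
Qed.

Lemma lap_profile_tail m (c s : nat -> R) (C1 C2 : R) I :
  (forall i, 0 <= c i) -> (forall i, 0 < s i) -> 0 <= C1 -> 0 <= C2 ->
  (forall lam, 0 < lam -> \sum_(i < m) c i * expR (- (lam * s i)) <= C1 / lam) ->
  \sum_(i < m) c i * s i ^+ n0 <= C2 ->
  \sum_(i < m) c i * (s i `^ (al - 1) * P (s i) - lap_approx I (s i)) <=
    C1 * (expR (- (I%:R * h * al)) / (1 - expR (- (h * al)))) +
    C2 * (expR (- (I%:R * h * gam)) / (1 - expR (- (h * gam)))).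
Proof.
move=> c0 s0 C10 C20 H1 H2; set U := leRHS.
have cv : \sum_(i < m) c i * (lap_approx J (s i) - lap_approx I (s i)) @[J --> \oo] -->
    \sum_(i < m) c i * (s i `^ (al - 1) * P (s i) - lap_approx I (s i)).
  move: m {H1 H2}; elim=> [|m IH]; first by under eq_fun do rewrite big_ord0; rewrite big_ord0; exact: cvg_cst.
  under eq_fun do rewrite big_ord_recr/=.
  rewrite big_ord_recr/=; apply: cvgD => //; apply: cvgM; first exact: cvg_cst.
  apply: cvgB; last exact: cvg_cst.
  under eq_fun do rewrite -powR_lap_sum//.
  by apply: cvgM; [exact: cvg_cst|exact: lap_sum_cvg].
rewrite -(cvg_lim (@Rhausdorff R) cv); apply: limr_le; first by apply/cvg_ex; eexists; exact: cv.
by exists I => // J /= IJ; exact: lap_approx_tail.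
Qed.
End Fixed_step.

Definition lap_floor : R := expR (- (al + 1)) * (expR (- expR 1) * (1 - expR (- 1)) ^+ n0).

Lemma lap_floor_gt0 : 0 < lap_floor.
Proof.
by rewrite !mulr_gt0 ?expR_gt0// exprn_gt0// subr_gt0 expR_lt1 oppr_lt0.
Qed.

(** The interval [0, 1[ contains m + 1 points of the lattice, each contributing at least
    [lap_floor]. The normalization 1 / P(1) is therefore of order h and later offsets sums of order
    1/h. *)
Lemma lap_profile_ge m : m.+1%:R * lap_floor <= lap_profile m.+1%:R^-1 1.
Proof.
have m0 : (0 : R) < m.+1%:R by rewrite ltr0n.
have h0 : (0 : R) < m.+1%:R^-1 by rewrite invr_gt0.
rewrite (le_trans _ (lap_sum_le_profile h0 m.+1 ltr01))//.
rewrite /lap_sum mulr_natl -[X in _ *+ X](card_ord m.+1) -sumr_const; apply: ler_sum => k _.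
rewrite -[leLHS]addr0 lerD ?lap_density_ge0//.
set y := _ * _; have y0 : 0 <= y by rewrite mulr_ge0 ?ler0n ?ltW.
have y1 : y <= 1 by rewrite ler_pdivrMr// mul1r ler_nat ltnW.
rewrite /lap_density powR1 mul1r /lap_weight mulr1 /lap_floor.
have e1 : 1 <= expR y by rewrite -expR0 ler_expR.
apply: ler_pM; rewrite ?expR_ge0 ?mulr_ge0 ?expR_ge0 ?exprn_ge0 ?subr_ge0 ?expR_le1 ?oppr_le0//.
  rewrite ler_expR; have := ler_wpM2r (ltW al0) y1.
  by rewrite mulrBr mulr1 mul1r; move: y0; move: (y * al) => z; lra.
apply: ler_pM; rewrite ?expR_ge0 ?exprn_ge0 ?subr_ge0 ?expR_le1 ?oppr_le0//.
  by rewrite ler_expR lerN2 ler_expR.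
rewrite lerXn2r ?nnegrE ?subr_ge0 ?expR_le1 ?oppr_le0 ?expR_ge0//.
by rewrite lerB// ler_expR lerN2.
Qed.

(** At step 1 the profile is comparable with a constant, and the tail estimate from I = 0 bounds the
    whole sum. *)
Lemma powR_weight_bound (C1 C2 : R) : 0 <= C1 -> 0 <= C2 ->
  exists2 C0 : R, 0 <= C0 & forall m (c s : nat -> R),
  (forall i, 0 <= c i) -> (forall i, 0 < s i) ->
  (forall lam, 0 < lam -> \sum_(i < m) c i * expR (- (lam * s i)) <= C1 / lam) ->
  \sum_(i < m) c i * s i ^+ n0 <= C2 ->
  \sum_(i < m) c i * s i `^ (al - 1) <= C0.
Proof.
move=> C10 C20.
have P1 := lap_profile_ge 0; rewrite mul1r invr1 in P1.
have P10 : 0 < lap_profile 1 1 by rewrite (lt_le_trans lap_floor_gt0).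
pose V := C1 * (expR (- (0%:R * 1 * al)) / (1 - expR (- (1 * al)))) +
    C2 * (expR (- (0%:R * 1 * gam)) / (1 - expR (- (1 * gam)))).
have V0 : 0 <= V by rewrite addr_ge0// mulr_ge0// divr_ge0 ?expR_ge0// subr_ge0 expR_le1 mul1r oppr_le0 ltW.
exists (expR (gam * 1) / lap_profile 1 1 * V).
  by rewrite !mulr_ge0 ?expR_ge0 ?invr_ge0 ?(ltW P10).
move=> m c s c0 s0 H1 H2.
have H := lap_profile_tail ltr01 0 c0 s0 C10 C20 H1 H2.
apply: le_trans (ler_wpM2l _ H); last by rewrite divr_ge0 ?expR_ge0 ?ltW.
rewrite mulr_sumr; apply: ler_sum => i _; rewrite /lap_approx big_ord0 subr0 mulrCA ler_wpM2l//.
rewrite mulrCA ler_peMr ?powR_ge0// mulrAC ler_pdivlMr// mul1r.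
by have [] := lap_profile_almost_cst ltr01 (s0 i).
Qed.

(** The first term is the oscillation of the profile, within a factor g of its value at 1; the
    second is the truncated tail. *)
Let relative_error (w v p A g : R) : 0 <= w -> 0 < p -> 0 < g -> v <= g * p -> p <= g * v -> A <= w * v ->
  `|w - p^-1 * A| <= (g - 1) * w + p^-1 * (w * v - A).
Proof.
move=> w0 p0 g0 q1 q2 Av.
have b1 : `|w - p^-1 * (w * v)| <= (g - 1) * w.
  rewrite (_ : w - _ = w * (1 - v / p)); last by ring.
  rewrite normrM ger0_norm// mulrC ler_wpM2r// ler_norml; apply/andP; split.
    have : v / p <= g by rewrite ler_pdivrMr.
    lra.
  have : g^-1 <= v / p by rewrite ler_pdivlMr// -ler_pdivlMl ?invr_gt0// invrK.
  have : 2 - g <= g^-1.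
    rewrite -(ler_pM2r g0) mulVf ?gt_eqF//.
    by have := sqr_ge0 (g - 1); rewrite expr2; lra.
  by move: (v / p) g^-1 => x y; lra.
rewrite (_ : w - p^-1 * A = (w - p^-1 * (w * v)) + p^-1 * (w * v - A)); last by ring.
by rewrite (le_trans (ler_normD _ _))// lerD// ger0_norm// mulr_ge0 ?invr_ge0 ?(ltW p0)// subr_ge0.
Qed.

Let half_frac_le (e c : R) : 0 <= e -> 0 <= c -> e / (2 * (c + 1)) * c <= e / 2.
Proof.
move=> e0 c0; have c1 : 0 < c + 1 by rewrite ltr_wpDl.
rewrite [leLHS](_ : _ = e / 2 * (c / (c + 1))); last by field; rewrite gt_eqF.
by rewrite ler_piMr ?divr_ge0// ler_pdivrMr// mul1r lerDl.
Qed.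

(** A small step makes the oscillation e^(gam h) - 1 negligible, then a large I the tail. The choice
    depends only on [C1] and [C2], so that it serves all Riemann sums simultaneously. *)
Lemma weight_approx (C1 C2 : R) : 0 <= C1 -> 0 <= C2 -> forall e, 0 < e ->
  exists k I, forall m (c s : nat -> R),
  (forall i, 0 <= c i) -> (forall i, 0 < s i) ->
  (forall lam, 0 < lam -> \sum_(i < m) c i * expR (- (lam * s i)) <= C1 / lam) ->
  \sum_(i < m) c i * s i ^+ n0 <= C2 ->
  \sum_(i < m) c i * `|s i `^ (al - 1) - (lap_profile k.+1%:R^-1 1)^-1 * lap_approx k.+1%:R^-1 I (s i)| <= e.
Proof.
move=> C10 C20 e e0; have [C0 C00 HC0] := powR_weight_bound C10 C20.
have [k Hk] : exists k : nat, (expR (gam * k.+1%:R^-1) - 1) * C0 <= e / 2.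
  have d0 : 0 < 2 * (expR gam * C0 + 1) by rewrite mulr_gt0// ltr_wpDl// mulr_ge0// expR_ge0.
  have [N HN] := step_small gam (divr_gt0 e0 d0); exists N; have {HN} := HN N (leqnn N).
  set x := gam / _ => xe; have x0 : 0 <= x by rewrite divr_ge0 ?(ltW gam0).
  have xg : x <= gam by rewrite ler_pdivrMr ?ltr0n// ler_peMr ?(ltW gam0)// ler1n.
  have E : expR x - 1 <= x * expR gam.
    rewrite (@le_trans _ _ (x * expR x))//; last by rewrite ler_wpM2l// ler_expR.
    rewrite -(ler_pM2r (expR_gt0 (- x))) mulrBl -mulrA -expRD subrr expR0 mulr1 mul1r.
    by have := expR_ge1Dx (- x); lra.
  rewrite (le_trans (ler_wpM2r C00 E))// -mulrA (le_trans (ler_wpM2r _ (ltW xe))) ?mulr_ge0 ?expR_ge0//.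
  by apply: half_frac_le; rewrite ?(ltW e0)// mulr_ge0// expR_ge0.
pose h : R := k.+1%:R^-1; have h0 : 0 < h by rewrite invr_gt0 ltr0n.
have P0 : 0 < lap_profile h 1 by rewrite (lt_le_trans _ (lap_profile_ge k))// mulr_gt0 ?ltr0n ?lap_floor_gt0.
have [I HI] : exists I : nat, (lap_profile h 1)^-1 * (C1 * (expR (- (I%:R * h * al)) / (1 - expR (- (h * al)))) +
    C2 * (expR (- (I%:R * h * gam)) / (1 - expR (- (h * gam))))) <= e / 2.
  pose cc := Num.min al gam; have cc0 : 0 < cc by rewrite lt_min al0 gam0.
  have d1 (c : R) : 0 < c -> 0 < 1 - expR (- (h * c)).
    by move=> c0; rewrite subr_gt0 expR_lt1 oppr_lt0 mulr_gt0.
  pose V := (lap_profile h 1)^-1 * (C1 / (1 - expR (- (h * al))) + C2 / (1 - expR (- (h * gam)))).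
  have V0 : 0 <= V by rewrite mulr_ge0 ?invr_ge0 ?(ltW P0)// addr_ge0// divr_ge0// ltW// d1.
  have q01 : 0 <= expR (- (h * cc)) < 1 by rewrite expR_ge0/= -subr_gt0 d1.
  have [I HI] := expr_small q01 (divr_gt0 e0 (mulr_gt0 (ltr0n R 2) (ltr_wpDl V0 ltr01))); exists I.
  have qI c : cc <= c -> expR (- (I%:R * h * c)) <= e / (2 * (V + 1)).
    move=> ccc; rewrite (le_trans _ HI)// -expRM_natl ler_expR mulrN lerN2 mulrA.
    by rewrite ler_wpM2l// mulr_ge0 ?ler0n// ltW.
  apply: (le_trans _ (half_frac_le (ltW e0) V0)).
  rewrite {2}/V [leRHS]mulrCA ler_wpM2l ?invr_ge0 ?(ltW P0)// [leRHS]mulrDr.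
  by rewrite lerD// [leRHS]mulrCA ler_wpM2l// ler_wpM2r ?invr_ge0 ?(ltW (d1 _ _))// qI// /cc ge_min lexx ?orbT.
exists k, I => m c s c0 s0 H1 H2; rewrite -/h.
rewrite [leRHS]splitr.
apply: (le_trans _ (lerD (le_trans (ler_wpM2l _ (HC0 m c s c0 s0 H1 H2)) Hk)
   (le_trans (ler_wpM2l _ (lap_profile_tail h0 I c0 s0 C10 C20 H1 H2)) HI))).
- rewrite !mulr_sumr -big_split/=; apply: ler_sum => i _.
  rewrite ![_ * (c i * _)]mulrCA -mulrDr ler_wpM2l//.
  have [q1 q2] := lap_profile_almost_cst h0 (s0 i).
  have AP : lap_approx h I (s i) <= s i `^ (al - 1) * lap_profile h (s i).
    by rewrite -(powR_lap_sum _ _ (s0 i)); exact: (ler_wpM2l (powR_ge0 _ _) (lap_sum_le_profile h0 I (s0 i))).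
  exact: relative_error (powR_ge0 _ _) P0 (expR_gt0 _) q1 q2 AP.
- by rewrite subr_ge0 -expR0 ler_expR mulr_ge0 ?(ltW gam0) ?(ltW h0).
- by rewrite invr_ge0 ltW.
Qed.
End LaplaceWeights.

(** * The approximation error *)

Section ApproximantFamily.
Context {R : realType} {X : completeNormedModType R[i]}.
Variable T : R -> {linear X -> X}.
Hypothesis Tsg : C0_semigroup T.
Variables (M omega : R).
Hypotheses (M1 : 1 <= M) (omega0 : 0 < omega).
Hypothesis TM : forall t x, 0 <= t -> nrm (T t x) <= M * expR (- (omega * t)) * nrm x.
Variable A : operator X.
Hypothesis A_gen : scale_op (-1) A = generator T.
Variables (Ct theta : R).
Hypotheses (Ct0 : 0 <= Ct) (theta0 : 0 <= theta) (theta1 : theta < 1).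
Hypothesis trans : forall h (m : {poly R[i]}) K, 0 < h <= 1 -> 0 < K ->
  (forall z, nrm z = 1 -> nrm m.[z] <= K) ->
  forall x, nrm (sg_horner T h m x) <= Ct * h `^ (- theta) * K * nrm x.
Variables pn qn : nat -> {poly R[i]}.
Hypothesis padeP : forall n, (0 < n)%N -> is_subdiagonal_pade n (pn n) (qn n).
Let M0 : 0 <= M. Proof. exact: le_trans M1. Qed.

Definition pade_error (n : nat) (t : R) (x : X) : X :=
  app (rat_op (pn n) (qn n) (scale_op (- t%:C) A)) x - T t x.
Local Notation B := pade_error.

Let approximant n t : (0 < n)%N -> 0 < t -> exists G g, [/\ step_calc T t G g,
   forall u, complex.Re u = 0 -> g (Some u) = (pn n).[- t%:C * u] / (qn n).[- t%:C * u] &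
   forall x, B n t x = G x - T t x].
Proof.
move=> n0 t0; have P := padeP n0; have [sp sq _ _ _] := P.
have spq : (size (pn n) <= size (qn n))%N by rewrite sp sq.
have [G [g [G1 G2 G3]]] := rational_step_calc Tsg M1 omega0 TM A_gen t0 spq (fun z z0 => pade_denominator_neq0 P z0).
by exists G, g; split=> // x; rewrite /pade_error G3.
Qed.

Let Re_tu (t : R) (u : R[i]) : complex.Re u = 0 -> complex.Re (- t%:C * u) = 0.
Proof. by case: u => a b /= ->; rewrite mulr0 oppr0 mul0r subr0. Qed.

Lemma pade_error_lin n t c x y : (0 < n)%N -> 0 < t -> B n t (c *: x + y) = c *: B n t x + B n t y.
Proof.
move=> n0 t0; have [G [g [G1 _ G3]]] := approximant n0 t0.
by rewrite !G3 (step_calc_lin _ _ _ G1) linearP scalerBr opprD addrACA.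
Qed.

Lemma pade_errorD n t x y : (0 < n)%N -> 0 < t -> B n t (x + y) = B n t x + B n t y.
Proof. by move=> n0 t0; have := pade_error_lin 1 x y n0 t0; rewrite !scale1r. Qed.

Lemma pade_error0 n t : (0 < n)%N -> 0 < t -> B n t 0 = 0.
Proof. by move=> n0 t0; apply: (addrI (B n t 0)); rewrite -pade_errorD// !addr0. Qed.

Lemma pade_errorZ n t c x : (0 < n)%N -> 0 < t -> B n t (c *: x) = c *: B n t x.
Proof. by move=> n0 t0; rewrite -[c *: x]addr0 pade_error_lin// pade_error0// addr0. Qed.

Lemma pade_error_sum n t (I : Type) (r : seq I) (Q : pred I) (F : I -> X) : (0 < n)%N -> 0 < t ->
  B n t (\sum_(i <- r | Q i) F i) = \sum_(i <- r | Q i) B n t (F i).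
Proof.
move=> n0 t0; elim: r => [|i r IH]; first by rewrite !big_nil pade_error0.
by rewrite !big_cons; case: ifP => // _; rewrite pade_errorD// IH.
Qed.

Lemma pade_error_bounded n t : (0 < n)%N -> 0 < t -> exists2 K : R, 0 <= K & forall x, nrm (B n t x) <= K * nrm x.
Proof.
move=> n0 t0; have [G [g [G1 _ G3]]] := approximant n0 t0.
have [K K0 HK] := step_calc_bounded G1; exists (K + M); first by rewrite addr_ge0.
move=> x; rewrite G3 (le_trans (nrmB _ _))// mulrDl lerD//.
exact: (sg_bounded M1 omega0 TM _ (ltW t0)).
Qed.

Local Notation K2 := (key_const M Ct theta * 2).

Lemma pade_error_resolvent2 n t lam Rl R2 : (0 < n)%N -> 0 < t -> 1 <= lam ->
  is_resolvent lam%:C A Rl -> is_resolvent (2 * lam)%:C A R2 ->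
  forall x, nrm (B n t (Rl (R2 x))) <= K2 * lam `^ (theta - 2) * nrm x.
Proof.
move=> n0 t0 l1 P1 P2 x; have [G [g [G1 G2 G3]]] := approximant n0 t0.
rewrite G3; apply: (key_bound_2 Tsg M1 omega0 TM A_gen Ct0 theta0 trans t0 G1 _ l1 P1 P2) => u u0.
rewrite G2//; apply: (pade_contractive (padeP n0)); by rewrite Re_tu.
Qed.

Lemma pade_error_resolventN a : 0 <= a -> exists2 C : R, 0 <= C &
  forall n t lam N Rl, (0 < n)%N -> a <= (2 * n + 2)%:R -> 0 < t -> 1 <= lam -> a + 4 <= N%:R ->
  is_resolvent lam%:C A Rl ->
  forall x, nrm (B n t (iter N Rl x)) <= C * (t / n.+1%:R) `^ a * lam `^ (theta + a - N%:R) * nrm x.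
Proof.
move=> a0; have [C C0 HC] := pade_symbol_error padeP a0.
exists (key_const M Ct theta * C); first by rewrite mulr_ge0 ?key_const_ge0.
move=> n t lam N Rl n0 an t0 l1 aN P x; have [G [g [G1 G2 G3]]] := approximant n0 t0.
have c0 : 0 <= C * (t / n.+1%:R) `^ a by rewrite mulr_ge0 ?powR_ge0.
rewrite G3 -[_ * C * _]mulrA; apply: (key_bound_N Tsg M1 omega0 TM A_gen Ct0 theta0 trans t0 G1 l1 P a0 aN c0).
move=> u u0; rewrite G2//.
have := HC n n0 an _ (Re_tu t u0); rewrite mulNr => H; apply: (le_trans H).
rewrite -mulrA ler_wpM2l// nrmN nrmM nrm_real gtr0_norm// -powRM ?nrm_ge0 ?divr_ge0 ?(ltW t0)//.
by rewrite mulrAC.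
Qed.

Lemma resolvent_family_exists : exists Rv : R -> X -> X, forall lam, 0 < lam -> [/\ is_resolvent lam%:C A (Rv lam),
  forall x, nrm (Rv lam x) <= M / (lam + omega) * nrm x &
  exists D : R -> X -> X,
   [/\ forall h, 0 < h -> disc_calc T h (fun z => h%:C / (1 - cexp (- (h%:C * lam%:C)) * z)) (D h),
       forall h x, 0 < h -> nrm (D h x) <= M * ((lam + omega)^-1 + h) * nrm x &
       forall x, rtends (fun h => D h x) (Rv lam x)]].
Proof.
have ex (lam : R) : exists Rl : X -> X, 0 < lam -> [/\ is_resolvent lam%:C A Rl,
  forall x, nrm (Rl x) <= M / (lam + omega) * nrm x &
  exists D : R -> X -> X,
   [/\ forall h, 0 < h -> disc_calc T h (fun z => h%:C / (1 - cexp (- (h%:C * lam%:C)) * z)) (D h),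
       forall h x, 0 < h -> nrm (D h x) <= M * ((lam + omega)^-1 + h) * nrm x &
       forall x, rtends (fun h => D h x) (Rl x)]].
  have [l0|ln] := ltP 0 lam; last by exists id.
  have [Rl [R1 R2 [D [D1 D2 D3]]]] := resolvent_exists Tsg M1 omega0 TM (l0 : 0 < complex.Re lam%:C) A_gen.
  by exists Rl => _; split=> //; exists D.
by have [Rv RvP] := choice ex; exists Rv.
Qed.

Variable Rv : R -> X -> X.
Hypothesis RvP : forall lam, 0 < lam -> [/\ is_resolvent lam%:C A (Rv lam),
  forall x, nrm (Rv lam x) <= M / (lam + omega) * nrm x &
  exists D : R -> X -> X,
   [/\ forall h, 0 < h -> disc_calc T h (fun z => h%:C / (1 - cexp (- (h%:C * lam%:C)) * z)) (D h),
       forall h x, 0 < h -> nrm (D h x) <= M * ((lam + omega)^-1 + h) * nrm x &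
       forall x, rtends (fun h => D h x) (Rv lam x)]].

Lemma resolvent_familyP lam : 0 < lam -> is_resolvent lam%:C A (Rv lam).
Proof. by move=> l0; have [] := RvP l0. Qed.

Lemma resolvent_family_le lam x : 0 < lam -> nrm (Rv lam x) <= M / (lam + omega) * nrm x.
Proof. by move=> l0; have [_ H _] := RvP l0; exact: H. Qed.

Let Rcalc lam : 0 < lam -> step_calc T 1 (Rv lam) (resolvent_symbol lam%:C).
Proof.
move=> l0; exact: (step_calc_resolvent Tsg M1 omega0 TM A_gen ltr01 (l0 : 0 < complex.Re lam%:C) (resolvent_familyP l0)).
Qed.

Lemma resolvent_familyB lam x y : 0 < lam -> Rv lam (x - y) = Rv lam x - Rv lam y.
Proof. by move=> l0; exact: step_calcB (Rcalc l0). Qed.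

Lemma resolvent_familyZ lam c x : 0 < lam -> Rv lam (c *: x) = c *: Rv lam x.
Proof. by move=> l0; exact: step_calcZ (Rcalc l0). Qed.

Lemma resolvent_familyD lam x y : 0 < lam -> Rv lam (x + y) = Rv lam x + Rv lam y.
Proof. by move=> l0; have := step_calc_lin 1 x y (Rcalc l0); rewrite !scale1r. Qed.

Lemma resolvent_family_comm lam mu x : 0 < lam -> 0 < mu -> Rv lam (Rv mu x) = Rv mu (Rv lam x).
Proof. by move=> l0 m0; exact: (step_calc_comm Tsg M1 omega0 TM ltr01 x (Rcalc l0) (Rcalc m0)). Qed.

Lemma resolvent_family_identity lam mu x : 0 < lam -> 0 < mu ->
  Rv lam x = Rv mu x + (mu - lam)%:C *: Rv mu (Rv lam x).
Proof.
move=> l0 m0; rewrite rmorphB /=.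
exact: (resolvent_identity' Tsg M1 omega0 TM A_gen ltr01 x (m0 : 0 < complex.Re mu%:C) (resolvent_familyP l0) (resolvent_familyP m0)).
Qed.

Lemma resolvent_family_small lam x : 0 < lam -> nrm (lam%:C *: Rv lam x) <= M * nrm x.
Proof.
move=> l0; rewrite nrmZr gtr0_norm// (le_trans (ler_wpM2l (ltW l0) (resolvent_family_le x l0)))//.
rewrite mulrA ler_wpM2r ?nrm_ge0// mulrCA ler_piMr// ler_pdivrMr ?addr_gt0// mul1r lerDl ltW//.
Qed.

Let q2 : 0 < (2 : R) `^ (theta - 1) < 1.
Proof.
rewrite powR_gt0//= -[ltRHS](powRr0 (2 : R)).
by rewrite /powR pnatr_eq0 /= ltr_expR ltr_pM2r ?subr_lt0// ln_gt0// ltr1n.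
Qed.

(* Telescoping R(l) = sum_j l_j R(l_j) R(2 l_j), with l_j = 2^j l. *)
Lemma pade_error_resolvent1 : exists2 C : R, 0 <= C & forall n t lam, (0 < n)%N -> 0 < t -> 1 <= lam ->
  forall x, nrm (B n t (Rv lam x)) <= C * lam `^ (theta - 1) * nrm x.
Proof.
have /andP[q0 q1] := q2; have k0 : 0 <= K2 by rewrite mulr_ge0 ?key_const_ge0.
(* theta < 1 makes the ratio 2^(theta - 1) of the telescoped series less than 1. *)
exists (K2 / (1 - 2 `^ (theta - 1))); first by rewrite divr_ge0// subr_ge0 ltW.
move=> n t lam n0 t0 l1 x; have l0 : 0 < lam := lt_le_trans ltr01 l1.
pose lj j := 2 ^+ j * lam.
have lj0 j : 0 < lj j by rewrite mulr_gt0// exprn_gt0.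
have lj1 j : 1 <= lj j by rewrite mulr_ege1// exprn_ege1// ler1n.
have ljS j : lj j.+1 = 2 * lj j by rewrite /lj exprS mulrA.
have tele J : Rv lam x = \sum_(j < J) (lj j)%:C *: Rv (lj j) (Rv (2 * lj j) x) + Rv (lj J) x.
  elim: J => [|J IH]; first by rewrite big_ord0 add0r /lj expr0 mul1r.
  rewrite big_ord_recr /= -addrA {1}IH; congr (_ + _).
  have l2 : 0 < 2 * lj J by rewrite mulr_gt0.
  rewrite ljS {1}(resolvent_family_identity x (lj0 J) l2) addrC resolvent_family_comm//.
  by congr (_ + _%:C *: _); ring.
have [K K0 HK] := pade_error_bounded n0 t0.
apply/ler_addgt0Pr => e e0.
have b0 : 0 < K * M * nrm x + 1 by rewrite ltr_wpDl// !mulr_ge0 ?nrm_ge0.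
(* [K] depends on [n] and [t], but it only multiplies the remainder [Rv (lj J) x], which J makes
   small. *)
have [J HJ] := dyadic_small (divr_gt0 e0 b0); have {}HJ := HJ J (leqnn J).
rewrite (tele J) pade_errorD// (le_trans (nrmD _ _))// lerD//; last first.
  rewrite (le_trans (HK _))// (le_trans (ler_wpM2l K0 (resolvent_family_le x (lj0 J))))//.
  have li : (lj J + omega)^-1 <= 2^-1 ^+ J.
    rewrite exprVn lef_pV2 ?posrE ?exprn_gt0 ?addr_gt0// (@le_trans _ _ (lj J))//.
      by rewrite /lj ler_peMr ?exprn_ge0.
    by rewrite lerDl ltW.
  rewrite (@le_trans _ _ (K * M * nrm x * (2^-1 ^+ J)))//.
    rewrite -[K * M * nrm x]mulrA [leLHS](_ : _ = K * (M * nrm x) * (lj J + omega)^-1); last by rewrite -[RHS]mulrA; congr (K * _); rewrite mulrAC.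
    by rewrite ler_wpM2l// !mulr_ge0 ?nrm_ge0.
  rewrite ltr_pdivlMr// in HJ; rewrite (le_trans _ (ltW HJ))// mulrC ler_wpM2l ?exprn_ge0 ?invr_ge0//.
  by rewrite lerDl.
rewrite pade_error_sum// (le_trans (nrm_sum _ _ _))//.
rewrite (@le_trans _ _ (\sum_(j < J) K2 * lam `^ (theta - 1) * nrm x * (2 `^ (theta - 1)) ^+ j))//.
  apply: ler_sum => j _; rewrite pade_errorZ// nrmZr gtr0_norm//.
  have l2 : 0 < 2 * lj j by rewrite mulr_gt0.
  have H := pade_error_resolvent2 n0 t0 (lj1 j) (resolvent_familyP (lj0 j)) (resolvent_familyP l2) x.
  rewrite (le_trans (ler_wpM2l (ltW (lj0 j)) H))//.
  have -> : lj j * (K2 * lj j `^ (theta - 2) * nrm x) = K2 * (lj j * lj j `^ (theta - 2)) * nrm x by ring.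
  have -> : lj j * lj j `^ (theta - 2) = lj j `^ (theta - 1).
    have -> : theta - 2 = (theta - 1) - 1 by ring.
    by rewrite powRB ?(gt_eqF (lj0 j)) ?implybT// powRr1 ?(ltW (lj0 j))// mulrCA mulfV ?mulr1// gt_eqF.
  rewrite /lj powRM ?exprn_ge0 ?(ltW l0)// -[2 ^+ j]powR_mulrn// -powRrM [j%:R * _]mulrC powRrM powR_mulrn ?powR_ge0//.
  by rewrite le_eqVlt; apply/orP; left; apply/eqP; ring.
rewrite -mulr_sumr -(big_mkord xpredT (fun j => (2 `^ (theta - 1)) ^+ j)) mulrC.
have q01 : 0 <= 2 `^ (theta - 1) < 1 by rewrite (ltW q0).
have := @geometric_sum_le R _ 0 J q01; rewrite expr0 div1r => G.
rewrite (le_trans (ler_wpM2r _ G)) ?mulr_ge0 ?powR_ge0 ?nrm_ge0//.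
by rewrite le_eqVlt; apply/orP; left; apply/eqP; ring.
Qed.

Let Tcomm_resolvent h x : 0 <= h -> T h (Rv 1 x) = Rv 1 (T h x).
Proof.
move=> h0; have [R1 R2] := resolvent_familyP ltr01.
have H : A (T h (Rv 1 x), T h (x - 1%:C *: Rv 1 x)).
  apply/(generatorP A_gen) => e e0; have [dl dl0 Hd] := (generatorP A_gen _ _).1 (R1 x) _ (divr_gt0 e0 (lt_le_trans ltr01 M1)).
  exists dl => // s sd; have /andP[s0 _] := sd.
  have -> : (s^-1)%:C *: (T h (Rv 1 x) - T s (T h (Rv 1 x))) - T h (x - 1%:C *: Rv 1 x) =
     T h ((s^-1)%:C *: (Rv 1 x - T s (Rv 1 x)) - (x - 1%:C *: Rv 1 x)).
    have TB a b : T h (a - b) = T h a - T h b by exact: linearB.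
    have -> : T s (T h (Rv 1 x)) = T h (T s (Rv 1 x)) by rewrite -!(sg_add Tsg) ?(ltW s0)// addrC.
    by rewrite [RHS]TB; congr (_ - _); rewrite linearZ_LR TB.
  rewrite (le_trans (sg_bounded M1 omega0 TM _ h0))// mulrC -ler_pdivlMr ?(lt_le_trans ltr01 M1)//.
  exact: Hd.
rewrite -[LHS](R2 _ _ H); congr (Rv 1 _).
by rewrite [T h (x - _)]linearB linearZ_LR addrCA subrr addr0.
Qed.

Let mu_resolvent_range x : tends (fun m : nat => m.+1%:R%:C *: Rv m.+1%:R (Rv 1 x)) (Rv 1 x).
Proof.
move=> e e0; have [R1 _] := resolvent_familyP ltr01.
have b0 : 0 < M * nrm (x - 1%:C *: Rv 1 x) + 1 by rewrite ltr_wpDl// mulr_ge0 ?nrm_ge0.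
have [N HN] := step_small 1 (divr_gt0 e0 b0); exists N => m mN.
have m0 : (0 : R) < m.+1%:R by rewrite ltr0n.
have [_ S2] := resolvent_familyP m0.
have E : Rv m.+1%:R (x - 1%:C *: Rv 1 x) = Rv 1 x - m.+1%:R%:C *: Rv m.+1%:R (Rv 1 x).
  have S := S2 _ _ (R1 x); rewrite resolvent_familyD// resolvent_familyZ// in S.
  by rewrite -[X in _ = X - _]S addrAC subrr add0r.
rewrite nrm_dist -E (le_trans (resolvent_family_le _ m0))//.
have := HN m mN; rewrite ltr_pdivlMr// => H; rewrite (le_trans _ (ltW H))// div1r mulrAC [leRHS]mulrC.
apply: ler_pM; rewrite ?mulr_ge0 ?nrm_ge0 ?invr_ge0 ?addr_ge0 ?(ltW m0) ?(ltW omega0) ?lerDl//.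
by rewrite lef_pV2 ?posrE ?addr_gt0// lerDl ltW.
Qed.

(** On the range of R(1) this follows from the resolvent estimate. That range is dense: the
    difference quotient of the shifted semigroup at R(1) v lies in it and tends to v. *)
Lemma mu_resolvent_tends v : tends (fun m : nat => m.+1%:R%:C *: Rv m.+1%:R v) v.
Proof.
move=> e e0; have M2 : 0 < 2 * (M + 1) by rewrite mulr_gt0// addr_gt0// (lt_le_trans ltr01).
have [R1 _] := resolvent_familyP ltr01.
have [dl dl0 Hd] := (shifted_generatorP Tsg M1 omega0 TM (ltr01 : 0 < complex.Re (1%:C : R[i])) A_gen _ _).1 (R1 v) _ (divr_gt0 e0 M2).
pose h := dl / 2; have h0 : 0 < h by rewrite divr_gt0.
have hd : 0 < h < dl by rewrite h0 /h ltr_pdivrMr// ltr_pMr// ltr1n.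
have := Hd h hd; set y := _ *: _.
have -> : 1%:C *: Rv 1 v + (v - 1%:C *: Rv 1 v) = v by rewrite addrC subrK.
have [z yE] : exists z, y = Rv 1 z.
  exists ((h^-1)%:C *: (v - cexp (- (h%:C * 1%:C)) *: T h v)); rewrite /y resolvent_familyZ// resolvent_familyB//.
  by rewrite resolvent_familyZ// Tcomm_resolvent// ltW.
move=> yv; have [N HN] := mu_resolvent_range z (divr_gt0 e0 (ltr0n R 2)); exists N => m mN.
have m0 : (0 : R) < m.+1%:R by rewrite ltr0n.
have -> : m.+1%:R%:C *: Rv m.+1%:R v - v = m.+1%:R%:C *: Rv m.+1%:R (v - y) + (y - v) + (m.+1%:R%:C *: Rv m.+1%:R y - y).
  rewrite resolvent_familyB// scalerBr addrAC [_ + (_ - y)]addrA subrK.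
  by rewrite addrA subrK.
rewrite (le_trans (nrmD _ _))// (splitr e) lerD//; last by rewrite yE HN.
rewrite (le_trans (nrmD _ _))// (@le_trans _ _ (M * nrm (y - v) + nrm (y - v)))//.
  by rewrite lerD2r (le_trans (resolvent_family_small _ m0))// ler_wpM2l// nrm_dist.
have M10 : 0 < M + 1 by rewrite addr_gt0// (lt_le_trans ltr01).
rewrite -[X in _ + X]mul1r -mulrDl mulrC -ler_pdivlMr// (le_trans yv)//.
by rewrite -mulrA -invfM.
Qed.

Let mu_resolvent_iter_tends N v :
  tends (fun m : nat => iter N (fun u => m.+1%:R%:C *: Rv m.+1%:R u) v) v.
Proof.
elim: N => [|N IH] e e0; first by exists 0%N => m _; rewrite /= subrr nrm0 ltW.
have M10 : 0 < 2 * M by rewrite mulr_gt0// (lt_le_trans ltr01).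
have [N1 H1] := IH _ (divr_gt0 e0 M10).
have [N2 H2] := mu_resolvent_tends v (divr_gt0 e0 (ltr0n R 2)).
exists (maxn N1 N2) => m; rewrite geq_max => /andP[m1 m2]; rewrite iterS.
have m0 : (0 : R) < m.+1%:R by rewrite ltr0n.
set y := iter N _ v.
have -> : m.+1%:R%:C *: Rv m.+1%:R y - v = m.+1%:R%:C *: Rv m.+1%:R (y - v) + (m.+1%:R%:C *: Rv m.+1%:R v - v).
  by rewrite resolvent_familyB// scalerBr addrA subrK.
rewrite (le_trans (nrmD _ _))// (splitr e) lerD ?H2//.
rewrite (le_trans (resolvent_family_small _ m0))// mulrC -ler_pdivlMr ?(lt_le_trans ltr01 M1)//.
by rewrite -mulrA -invfM H1.
Qed.

Let iter_resolventZ N c mu v : 0 < mu -> iter N (fun u => c *: Rv mu u) v = c ^+ N *: iter N (Rv mu) v.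
Proof.
move=> m0; elim: N => [|N IH]; first by rewrite expr0 scale1r.
by rewrite !iterS IH resolvent_familyZ// scalerA exprS.
Qed.

Let iter_resolvent_comm N mu v : 0 < mu -> Rv 1 (iter N (Rv mu) v) = iter N (Rv mu) (Rv 1 v).
Proof. by move=> m0; elim: N => //= N <-; rewrite resolvent_family_comm. Qed.

(** v is approximated by mu^5 R(mu)^5 v. The error term is handled by the bound on B R(1), uniform
    in n and t; the main term by the rate with a = 1, for which 5 = a + 4 resolvents are
    required. *)
Lemma pade_error_resolvent_tends v tau e : 0 < tau -> 0 < e -> exists N0, forall n t,
  (N0 <= n)%N -> (0 < n)%N -> 0 < t <= tau -> nrm (B n t (Rv 1 v)) <= e.
Proof.
move=> tau0 e0.
have [C1 C10 H1] := pade_error_resolvent1.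
have [C2 C20 H2] := pade_error_resolventN ler01.
have d0 : 0 < 2 * (C1 + 1) by rewrite mulr_gt0// ltr_wpDl.
have [m Hm] := mu_resolvent_iter_tends 5 v (divr_gt0 e0 d0).
have {Hm} := Hm m (leqnn m); have m0 : (0 : R) < m.+1%:R by rewrite ltr0n.
have m1 : (1 : R) <= m.+1%:R by rewrite ler1n.
rewrite iter_resolventZ//; set mu : R := m.+1%:R in m0 m1 *; set w := iter 5 _ v => vw.
pose C := mu ^+ 5 * (C2 * mu `^ (theta + 1 - 5) * nrm (Rv 1 v)) + 1.
have C0 : 0 < C by rewrite ltr_wpDl// !mulr_ge0 ?exprn_ge0 ?powR_ge0 ?nrm_ge0 ?(ltW m0).
have [N0 HN0] := step_small tau (divr_gt0 e0 (mulr_gt0 (ltr0n R 2) C0)).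
exists N0 => n t nN n0 /andP[t0 tt].
have -> : Rv 1 v = Rv 1 (v - mu%:C ^+ 5 *: w) + mu%:C ^+ 5 *: iter 5 (Rv mu) (Rv 1 v).
  by rewrite -iter_resolvent_comm// -/w resolvent_familyB// resolvent_familyZ// subrK.
rewrite pade_errorD// (le_trans (nrmD _ _))// (splitr e) lerD//.
  rewrite (le_trans (H1 n t 1 n0 t0 (lexx _) _))// powR1 mulr1 nrm_dist.
  rewrite (le_trans (ler_wpM2l C10 vw))// [leLHS](_ : _ = e / 2 * (C1 / (C1 + 1))); last by rewrite invfM; ring.
  rewrite ler_piMr ?divr_ge0 ?(ltW e0)//.
  by rewrite ler_pdivrMr ?mul1r ?lerDl// ltr_wpDl.
have nmu : nrm (mu%:C ^+ 5) = mu ^+ 5 by rewrite -rmorphXn/= nrm_real ger0_norm// exprn_ge0// ltW.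
rewrite pade_errorZ// nrmZ nmu.
have P : (1 : R) <= (2 * n + 2)%:R by rewrite ler1n addn_gt0 orbT.
have N5 : (1 : R) + 4 <= 5%:R by rewrite -[1 in leLHS]/(1%:R) -natrD.
have := H2 n t mu 5 (Rv mu) n0 P t0 m1 N5 (resolvent_familyP m0) (Rv 1 v) => H.
rewrite (le_trans (ler_wpM2l _ H)) ?exprn_ge0 ?(ltW m0)//.
have := HN0 n nN => H3.
have tn : t / n.+1%:R <= e / (2 * C).
  by rewrite (le_trans _ (ltW H3))// ler_pM2r ?invr_gt0 ?ltr0n.
rewrite powRr1; last by rewrite divr_ge0 ?ltW.
have -> : mu ^+ 5 * (C2 * (t / n.+1%:R) * mu `^ (theta + 1 - 5%:R) * nrm (Rv 1 v)) = (C - 1) * (t / n.+1%:R).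
  rewrite /C addrK; ring.
rewrite (@le_trans _ _ (C * (t / n.+1%:R)))//.
  by rewrite ler_wpM2r ?divr_ge0 ?(ltW t0)// gerBl.
by rewrite (le_trans (ler_wpM2l (ltW C0) tn))// [leLHS](_ : _ = e / 2)//; field; rewrite gt_eqF.
Qed.

Let dom_resolvent z : dom A z -> forall lam, 0 < lam -> z = Rv lam (lam%:C *: z + app A z).
Proof.
move=> dz lam l0; have [_ H] := resolvent_familyP l0.
have Az : A (z, app A z) by case: dz => w Hw; rewrite /app; exact: (@xgetPex _ 0 [set y | A (z, y)] (ex_intro _ w Hw)).
by rewrite (H _ _ Az).
Qed.

Let domA0 : dom A 0.
Proof.
have [H _] := resolvent_familyP ltr01; exists (0 - 1%:C *: Rv 1 0).
by rewrite -[X in (X, _)](_ : Rv 1 0 = 0)// -{1}[0 in LHS](scale0r 0) resolvent_familyZ// scale0r.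
Qed.

Let bounded_sum_tail (u : nat -> R) C e : (forall k, 0 <= u k) -> (forall J, \sum_(k < J) u k <= C) -> 0 < e ->
  exists k0, forall J, \sum_(k0 <= k < J) u k <= e.
Proof.
move=> u0 uC e0; pose S : set R := [set s | exists J : nat, s = \sum_(k < J) u k].
have hS : has_sup S by split; [exists (\sum_(k < 0) u k), 0%N|exists C => _ [J ->]].
have [_ [k0 ->] H] := sup_adherent e0 hS; exists k0 => J.
have [kJ|Jk] := leqP k0 J; last by rewrite big_geq ?(ltW e0)// ltnW.
have : \sum_(k < J) u k <= sup S by apply: ub_le_sup; [exact: hS.2|exists J].
rewrite -!(big_mkord xpredT u) in H *; rewrite (big_cat_nat (leq0n k0) kJ)/=.
move: H; set a := \sum_(0 <= i < k0) _; set b := \sum_(k0 <= i < J) _; lra.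
Qed.

Theorem pade_error_interp x : interp A theta 1 x -> forall tau e : R, 0 < tau -> 0 < e ->
  exists N0, forall n t, (N0 <= n)%N -> (0 < n)%N -> 0 < t <= tau -> nrm (B n t x) <= e.
Proof.
move=> /(interp_dyadic_sum domA0 theta0)[C HC] tau e tau0 e0.
have [C1 C10 H1] := pade_error_resolvent1.
pose h k : R := 2^-1 ^+ k.+1.
have h0 k : 0 < h k by rewrite exprn_gt0 ?invr_gt0.
(* The slack 4^-k for near minimizers stays summable against 2^(k theta), since theta < 1. *)
pose kap k : R := K_functional A (h k) x + 4^-1 ^+ k.
have ex k : exists yz : X * X, [/\ dom A yz.2, x = yz.1 + yz.2 & nrm yz.1 + h k * graph_norm A yz.2 <= kap k].
  have q4 : (0 : R) < 4^-1 ^+ k by rewrite exprn_gt0 ?invr_gt0.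
  by have [y [z H]] := K_functional_adherent domA0 x (ltW (h0 k)) q4; exists (y, z).
have [yz yzP] := choice ex.
pose y k := (yz k).1; pose z k := (yz k).2.
have yP k : nrm (y k) <= kap k.
  have [_ _ H] := yzP k; rewrite (le_trans _ H)// lerDl mulr_ge0 ?(ltW (h0 k))// addr_ge0 ?nrm_ge0//.
have AzP k : nrm (app A (z k)) <= 2 ^+ k.+1 * kap k.
  have [_ _ H] := yzP k; rewrite mulrC -ler_pdivrMr ?exprn_gt0// -exprVn mulrC (le_trans _ H)//.
  by rewrite ler_wpDl ?nrm_ge0// ler_wpM2l ?(ltW (h0 k))// lerDr nrm_ge0.
have kap0 k : 0 <= kap k by rewrite (le_trans _ (yP k)) ?nrm_ge0.
pose sg k := (2 `^ theta) ^+ k * kap k.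
have th2 : 1 <= (2 : R) `^ theta by rewrite -[leLHS](powRr0 2) ler_powR ?ler1n.
have th2' : (2 : R) `^ theta <= 2 by rewrite -[leRHS](powRr1 (ler0n R 2)) ler_powR ?ler1n// ltW.
have sg0 k : 0 <= sg k by rewrite mulr_ge0 ?exprn_ge0 ?powR_ge0.
have kapsg k : kap k <= sg k by rewrite ler_peMl ?exprn_ege1.
have sgC J : \sum_(k < J) sg k <= C + 2.
  rewrite (eq_bigr (fun k : 'I_J => (2 `^ theta) ^+ k * K_functional A (h k) x + (2 `^ theta / 4) ^+ k)); last first.
    by move=> k _; rewrite /sg /kap mulrDr expr_div_n exprVn.
  rewrite big_split/= lerD ?HC//.
  rewrite (@le_trans _ _ (\sum_(k < J) 2^-1 ^+ k))//.
    apply: ler_sum => k _; rewrite lerXn2r ?nnegrE ?divr_ge0 ?powR_ge0 ?invr_ge0//.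
    by rewrite ler_pdivrMr//; move: th2'; set u := _ `^ _; lra.
  rewrite -(big_mkord xpredT (fun k => (2^-1 : R) ^+ k)) (le_trans (geometric_sum_le _ _ (_ : 0 <= 2^-1 < 1)))//.
    by rewrite invr_ge0 ler0n invf_lt1 ?ltr1n.
  by rewrite expr0 div1r (_ : 1 - 2^-1 = 2^-1) ?invrK//; field.
have d0 : 0 < 3 * (C1 * 10 + 1) by rewrite mulr_gt0// ltr_wpDl// mulr_ge0.
have [k0 Hk0] := bounded_sum_tail sg0 sgC (divr_gt0 e0 d0).
have [dz0 _ _] := yzP k0.
have [N0 HN0] := pade_error_resolvent_tends (1%:C *: z k0 + app A (z k0)) tau0 (divr_gt0 e0 (ltr0n R 3)).
exists N0 => n t nN n0 t0t; have /andP[t0 tt] := t0t.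
have {HN0} := HN0 n t nN n0 t0t; rewrite -dom_resolvent// => Hz.
have [K K0 HK] := pade_error_bounded n0 t0.
have Bd k : nrm (B n t (z k.+1 - z k)) <= C1 * 5 * (sg k + sg k.+1).
  have [dz1 x1 _] := yzP k.+1; have [dz x0 _] := yzP k.
  have l0 : (0 : R) < 2 ^+ k by rewrite exprn_gt0.
  (* At lam = 2^k the vectors lam z and A z are of comparable size, 2^k times the K-functional; with
     the factor lam^(theta - 1) this gives the summable 2^(k theta). *)
  rewrite [z k.+1](dom_resolvent dz1 l0) [z k](dom_resolvent dz l0) -resolvent_familyB//.
  rewrite (le_trans (H1 n t _ n0 t0 (exprn_ege1 _ (ler1n R 2)) _))//.
  rewrite opprD addrACA -scalerBr.
  have E : z k.+1 - z k = y k - y k.+1.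
    by apply/eqP; rewrite subr_eq addrAC -[y k + _]x0 x1 addrAC subrr add0r.
  have N1 : nrm ((2 ^+ k)%:C *: (z k.+1 - z k) + (app A (z k.+1) - app A (z k))) <= 2 ^+ k * (5 * (kap k + kap k.+1)).
    rewrite (le_trans (nrmD _ _))// nrmZr gtr0_norm// E.
    rewrite (le_trans (lerD (ler_wpM2l (ltW l0) (le_trans (nrmB _ _) (lerD (yP k) (yP k.+1))))
       (le_trans (nrmB _ _) (lerD (AzP k.+1) (AzP k)))))//.
    rewrite !exprS; have := mulr_ge0 (ltW l0) (kap0 k); have := mulr_ge0 (ltW l0) (kap0 k.+1).
    move: (2 ^+ k) (kap k) (kap k.+1) => a b c; lra.
  have pe : (2 ^+ k) `^ (theta - 1) = (2 `^ theta) ^+ k / 2 ^+ k.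
    have <- : (2 ^+ k : R) `^ theta = (2 `^ theta) ^+ k by rewrite -(powR_mulrn _ (ler0n R 2)) -(powR_mulrn _ (powR_ge0 _ _)) -!powRrM mulrC.
    by rewrite powRD ?(gt_eqF l0) ?implybT// powR_inv1 ?(ltW l0).
  apply: (le_trans (ler_wpM2l _ N1)); rewrite ?mulr_ge0 ?powR_ge0// pe.
  have -> : C1 * ((2 `^ theta) ^+ k / 2 ^+ k) * (2 ^+ k * (5 * (kap k + kap k.+1))) =
     C1 * 5 * ((2 `^ theta) ^+ k * (kap k + kap k.+1)).
    by move: (_ ^+ k) (2 ^+ k) (gt_eqF l0) => u v v0; field; rewrite v0.
  rewrite ler_wpM2l ?mulr_ge0// mulrDr lerD2l /sg exprS ler_wpM2r// ler_peMl ?exprn_ge0 ?powR_ge0//.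
(* [J] may depend on [n] and [t] through [K]: it only serves to discard the last remainder [y L],
   whereas [k0] is chosen before them. *)
have [J HJ] := bounded_sum_tail sg0 sgC (divr_gt0 (divr_gt0 e0 (ltr0n R 3)) (ltr_wpDl K0 ltr01)).
pose L := maxn k0 J.
have xE : x = z k0 + \sum_(k0 <= k < L) (z k.+1 - z k) + y L.
  by rewrite telescope_sumr ?leq_maxl// [z k0 + _]addrC subrK addrC; have [_ ? _] := yzP L.
rewrite xE !pade_errorD// pade_error_sum//.
have e3 : e = e / 3 + e / 3 + e / 3 by field.
rewrite (le_trans (nrmD _ _))// [leRHS]e3 lerD//; last first.
  rewrite (le_trans (HK _))// (le_trans (ler_wpM2l K0 (le_trans (yP L) (kapsg L))))//.
  have sL : sg L <= e / 3 / (K + 1).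
    by rewrite (le_trans _ (HJ L.+1))// big_nat_recr ?leq_maxr//= lerDr sumr_ge0.
  rewrite (le_trans (ler_wpM2l K0 sL))// mulrA ler_pdivrMr ?ltr_wpDl// mulrC ler_wpM2l ?divr_ge0 ?(ltW e0)//.
  by rewrite lerDl.
rewrite (le_trans (nrmD _ _))// lerD//.
rewrite (le_trans (nrm_sum _ _ _))// (le_trans (ler_sum _ (fun k _ => Bd k)))//.
rewrite -big_distrr big_split/=.
have S2 : \sum_(k0 <= k < L) sg k.+1 <= e / (3 * (C1 * 10 + 1)).
  rewrite (le_trans _ (Hk0 L.+1))// -(big_add1 _ _ k0 L.+1 xpredT sg)/=.
  have [kL|Lk] := leqP k0 L; last by rewrite big_geq ?sumr_ge0// leqW.
  by rewrite [leRHS]big_ltn ?ltnS// lerDr.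
rewrite (le_trans (ler_wpM2l _ (lerD (Hk0 L) S2))) ?mulr_ge0//.
rewrite [leLHS](_ : _ = e / 3 * (C1 * 10 / (C1 * 10 + 1))); last first.
  by field; rewrite gt_eqF// ltr_wpDl// mulr_ge0.
rewrite ler_piMr ?divr_ge0 ?(ltW e0)// ler_pdivrMr ?mul1r ?lerDl//.
by rewrite ltr_wpDl ?mulr_ge0.
Qed.

(** * The fractional power through Riemann sums and resolvents *)

Definition lap_node (a b : R) (m i : nat) : R := a + i.+1%:R * ((b - a) / m.+1%:R).

Definition lap_rsum (u : X) (a b : R) (m : nat) (f : R -> R) : X :=
  \sum_(i < m.+1) ((b - a) / m.+1%:R * f (lap_node a b m i))%:C *: T (lap_node a b m i) u.

(** The intervals [1/(k+1), k+2] exhaust the half-line and are nondegenerate already for k = 0. *)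
Definition lap_start (k : nat) : R := k.+1%:R^-1.
Definition lap_stop (k : nat) : R := k.+2%:R.

(* v is the improper integral of f(s) T(s) u over the half-line, as an iterated
   limit of right-tagged Riemann sums. *)
Definition represents (u : X) (f : R -> R) (v : X) : Prop :=
  exists K0 vk, (forall k, (K0 <= k)%N -> tends (fun m => lap_rsum u (lap_start k) (lap_stop k) m f) (vk k)) /\
    tends vk v.

Let startP k : 0 < lap_start k /\ 0 < lap_stop k - lap_start k.
Proof.
have h : (0 : R) < k.+1%:R^-1 by rewrite invr_gt0 ltr0n.
split=> //; rewrite subr_gt0 (@le_lt_trans _ _ 1) ?ltr1n//.
by rewrite invf_le1 ?ltr0n// ler1n.
Qed.

Lemma represents_lin u f g v w (c e : R) : represents u f v -> represents u g w ->
  represents u (fun s => c * f s + e * g s) (c%:C *: v + e%:C *: w).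
Proof.
move=> [K1 [v1 [H1 L1]]] [K2 [v2 [H2 L2]]].
exists (maxn K1 K2), (fun k => c%:C *: v1 k + e%:C *: v2 k); split; last by apply: tendsD; exact: tendsZ.
move=> k; rewrite geq_max => /andP[k1 k2].
have := tendsD (tendsZ c%:C (H1 k k1)) (tendsZ e%:C (H2 k k2)).
move/tends_eventually; apply; exists 0%N => m _.
rewrite /lap_rsum !scaler_sumr -big_split/=; apply: eq_bigr => i _.
by rewrite !scalerA -scalerDl; congr (_ *: _); rewrite -!rmorphM -rmorphD/=; congr (_%:C); ring.
Qed.

Lemma represents_ext u f g v : (forall s, 0 < s -> f s = g s) -> represents u f v -> represents u g v.
Proof.
move=> fg [K [vk [H L]]]; exists K, vk; split=> // k kK.
move/tends_eventually: (H k kK); apply; exists 0%N => m _; apply: eq_bigr => i _; rewrite fg//.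
have [s0 d0] := startP k.
by rewrite /lap_node addr_gt0// mulr_gt0 ?ltr0n// divr_gt0 ?ltr0n.
Qed.

Let resolvent_increment lam u e : 0 < lam -> 0 < e -> exists2 dl : R, 0 < dl & forall h, 0 < h < dl ->
  nrm (Rv lam u - (expR (- (lam * h)))%:C *: T h (Rv lam u) - h%:C *: u) <= h * e.
Proof.
move=> l0 e0; have [R1 _] := resolvent_familyP l0.
have [dl dl0 H] := (shifted_generatorP Tsg M1 omega0 TM (l0 : 0 < complex.Re lam%:C) A_gen _ _).1 (R1 u) _ e0.
exists dl => // h hd; have /andP[h0 _] := hd; have := H h hd.
have -> : cexp (- (h%:C * lam%:C)) = (expR (- (lam * h)))%:C.
  by rewrite -rmorphM -rmorphN/= [h * _]mulrC /cexp /= cos0 sin0 mulr1.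
rewrite [lam%:C *: _ + _]addrC subrK => H'.
have -> : Rv lam u - (expR (- (lam * h)))%:C *: T h (Rv lam u) - h%:C *: u =
  h%:C *: ((h^-1)%:C *: (Rv lam u - (expR (- (lam * h)))%:C *: T h (Rv lam u)) - u).
  by rewrite scalerBr scalerA -rmorphM divff ?gt_eqF// scale1r.
by rewrite nrmZr gtr0_norm// ler_wpM2l// ltW.
Qed.

(* e^(-lam s) T(s) R(lam) u is a primitive of - e^(-lam s) T(s) u. *)
Let exp_rsum lam u a b : 0 < lam -> 0 < a -> 0 < b - a ->
  tends (fun m => lap_rsum u a b m (fun s => expR (- (lam * s))))
    ((expR (- (lam * a)))%:C *: T a (Rv lam u) - (expR (- (lam * b)))%:C *: T b (Rv lam u)).
Proof.
move=> l0 a0 ba e e0; set r := Rv lam u.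
have b0 : 0 < b by lra.
have TZ s (c : R[i]) v : T s (c *: v) = c *: T s v by exact: linearZ.
have TB s v w : T s (v - w) = T s v - T s w by exact: linearB.
pose Y s := (expR (- (lam * s)))%:C *: T s r.
have YD s h : 0 <= s -> 0 <= h -> Y (s + h) = (expR (- (lam * s)))%:C *: T s ((expR (- (lam * h)))%:C *: T h r).
  by move=> s0 h0; rewrite /Y (sg_add Tsg)// TZ scalerA -rmorphM -expRD mulrDr opprD.
have Yle s v : 0 <= s -> nrm ((expR (- (lam * s)))%:C *: T s v) <= M * nrm v.
  move=> s0; rewrite nrmZr ger0_norm ?expR_ge0//.
  rewrite (@le_trans _ _ (1 * (M * nrm v)))//; last by rewrite mul1r.
  apply: ler_pM; rewrite ?expR_ge0 ?nrm_ge0 ?expR_le1 ?oppr_le0 ?mulr_ge0 ?(ltW l0)//.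
  exact: (sg_bounded M1 omega0 TM).
pose C := M * ((b - a) + 4) + 1.
have C0 : 0 < C by rewrite ltr_wpDl// mulr_ge0// addr_ge0// ltW.
have [dl dl0 Hd] := resolvent_increment u l0 (divr_gt0 e0 C0).
have q0 : 0 < Num.min dl (Num.min 1 (e / C / (nrm u + 1))).
  by rewrite !lt_min dl0 ltr01 !divr_gt0// ltr_wpDl ?nrm_ge0.
have [N HN] := step_small (b - a) q0; exists N => m mN.
have := HN m mN; rewrite !lt_min => /and3P[h1 h2 h3].
pose h := (b - a) / m.+1%:R; rewrite -/h in h1 h2 h3.
have h0 : 0 < h by rewrite divr_gt0 ?ltr0n.
have hd : 0 < h < dl by rewrite h0 h1.
have {}Hd := Hd h hd.
have nodeE i : lap_node a b m i = a + i.+1%:R * h by [].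
have nge i : 0 <= a + i%:R * h by rewrite addr_ge0 ?(ltW a0)// mulr_ge0 ?ler0n// ltW.
have [dlt rE dle] : exists2 dlt, h%:C *: u = r - (expR (- (lam * h)))%:C *: T h r - dlt & nrm dlt <= h * (e / C).
  by exists (r - (expR (- (lam * h)))%:C *: T h r - h%:C *: u); rewrite ?subKr.
pose G s v := (expR (- (lam * s)))%:C *: T s v.
have GB s v w : G s (v - w) = G s v - G s w by rewrite /G TB scalerBr.
have term i : (h * expR (- (lam * lap_node a b m i)))%:C *: T (lap_node a b m i) u =
    - (Y (a + i.+2%:R * h) - Y (a + i.+1%:R * h)) - G (a + i.+1%:R * h) dlt.
  have -> : (h * expR (- (lam * lap_node a b m i)))%:C *: T (lap_node a b m i) u = G (a + i.+1%:R * h) (h%:C *: u).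
    by rewrite nodeE /G TZ scalerA -rmorphM/= mulrC.
  have YT : Y (a + i.+2%:R * h) = G (a + i.+1%:R * h) ((expR (- (lam * h)))%:C *: T h r).
    by rewrite /G -YD ?nge ?(ltW h0)//; congr Y; rewrite -[i.+2%:R]natr1 mulrDl mul1r addrA.
  by rewrite rE YT opprB !GB.
have bE : b = a + m.+1%:R * h by rewrite /h mulrC divfK ?pnatr_eq0// addrC subrK.
have Yd s : 0 <= s -> Y (s + h) - Y s = - G s (h%:C *: u + dlt).
  move=> s0; rewrite YD ?(ltW h0)// rE subrK /G TB scalerBr opprB; congr (_ - _).
have E : lap_rsum u a b m (fun s => expR (- (lam * s))) - (Y a - Y b) =
   G b (h%:C *: u + dlt) - G a (h%:C *: u + dlt) - \sum_(i < m.+1) G (a + i.+1%:R * h) dlt.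
  rewrite /lap_rsum (eq_bigr _ (fun (i : 'I_m.+1) _ => term i)) big_split/= !sumrN.
  rewrite -(big_mkord xpredT (fun i => Y (a + i.+2%:R * h) - Y (a + i.+1%:R * h))).
  rewrite telescope_sumr// addrAC; congr (_ - _); rewrite -[m.+2%:R]natr1 mulrDl !mul1r addrA -bE.
  rewrite -[G b _]opprK -(Yd b (ltW b0)) -[G a _]opprK -(Yd a (ltW a0)).
  by rewrite !opprB addrACA [RHS]addrACA [Y b + _]addrC.
have hu : nrm (h%:C *: u + dlt) <= 2 * (e / C).
  rewrite (le_trans (nrmD _ _))// nrmZr gtr0_norm//.
  have e1 : h * nrm u <= e / C.
    rewrite ltr_pdivlMr ?ltr_wpDl ?nrm_ge0// in h3; rewrite (le_trans _ (ltW h3))// ler_wpM2l ?(ltW h0)// lerDl//.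
  have e2 : h * (e / C) <= e / C by rewrite ler_piMl ?divr_ge0 ?(ltW e0) ?(ltW C0)// ltW.
  by rewrite mulr_natl mulr2n lerD// (le_trans dle).
rewrite E.
have S : nrm (\sum_(i < m.+1) G (a + i.+1%:R * h) dlt) <= M * ((b - a) * (e / C)).
  rewrite (le_trans (nrm_sum _ _ _))// (@le_trans _ _ (\sum_(i < m.+1) M * (h * (e / C))))//.
    apply: ler_sum => i _; rewrite (le_trans (Yle _ _ (nge _)))// ler_wpM2l//.
  rewrite sumr_const card_ord -mulr_natl mulrCA ler_wpM2l// mulrA /h [m.+1%:R * _]mulrC divfK ?pnatr_eq0//.
rewrite (le_trans (nrmB _ _))// (le_trans (lerD (le_trans (nrmB _ _) (lerD (le_trans (Yle b _ (ltW b0)) (ler_wpM2l M0 hu)) (le_trans (Yle a _ (ltW a0)) (ler_wpM2l M0 hu)))) S))//.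
rewrite [leLHS](_ : _ = (C - 1) * (e / C)); last by rewrite /C addrK; ring.
rewrite mulrBl mul1r [C * _]mulrC divfK ?gt_eqF// gerBl divr_ge0 ?(ltW e0)//; exact: ltW.
Qed.

(** The primitive tends to R(lam) u at the left end and to 0 at the right end, where exponential
    decay is bounded by 1 / (omega b). *)
Lemma represents_exp lam u : 0 < lam -> represents u (fun s => expR (- (lam * s))) (Rv lam u).
Proof.
move=> l0; set r := Rv lam u.
exists 0%N, (fun k => (expR (- (lam * lap_start k)))%:C *: T (lap_start k) r - (expR (- (lam * lap_stop k)))%:C *: T (lap_stop k) r).
split=> [k _|e e0]; first by have [? ?] := startP k; exact: exp_rsum.
have [dl dl0 Hd] := resolvent_increment u l0 ltr01.
pose V := nrm u + 1 + M / omega * nrm r.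
have V0 : 0 < V by rewrite ltr_pwDl ?ltr_wpDl ?nrm_ge0// mulr_ge0 ?nrm_ge0// divr_ge0 ?(ltW omega0).
have q0 : 0 < Num.min dl (e / V) by rewrite lt_min dl0 divr_gt0.
have [N HN] := step_small 1 q0; exists N => k kN.
have := HN k kN; rewrite div1r -/(lap_start k) lt_min => /andP[h1 h2].
have [a0 _] := startP k; set a := lap_start k in a0 h1 h2 *; set b := lap_stop k.
have b0 : 0 < b by rewrite ltr0n.
have H := Hd a; rewrite a0 h1 in H; have {}H := H isT.
rewrite addrAC (le_trans (nrmB _ _))//.
have H1 : nrm ((expR (- (lam * a)))%:C *: T a r - r) <= a * (nrm u + 1).
  rewrite nrm_dist -[_ - _](subrK (a%:C *: u)) (le_trans (nrmD _ _))// mulrDr addrC lerD//.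
  by rewrite nrmZr gtr0_norm.
have H2 : nrm ((expR (- (lam * b)))%:C *: T b r) <= a * (M / omega * nrm r).
  rewrite nrmZr ger0_norm ?expR_ge0// (@le_trans _ _ (1 * (M * expR (- (omega * b)) * nrm r)))//.
    apply: ler_pM; rewrite ?expR_ge0 ?nrm_ge0 ?expR_le1 ?oppr_le0 ?mulr_ge0 ?(ltW l0) ?(ltW b0)//.
    by apply: TM; exact: ltW.
  rewrite mul1r mulrA ler_wpM2r ?nrm_ge0// mulrCA ler_wpM2l//.
  rewrite expRN -invfM lef_pV2 ?posrE ?expR_gt0 ?mulr_gt0 ?ltr0n//.
  rewrite (le_trans _ (expR_ge1Dx _))// [leLHS]mulrC ler_wpDl// ler_wpM2l ?(ltW omega0)// ler_nat.
  exact: leqnSn.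
rewrite (le_trans (lerD H1 H2))// -mulrDr -/V.
by rewrite (le_trans (ler_wpM2r (ltW V0) (ltW h2)))// divfK ?gt_eqF.
Qed.

(** The product R(mu) R(mu + lam) ... R(mu + (k - 1) lam). *)
Fixpoint resolvent_chain (k : nat) (lam mu : R) (v : X) : X :=
  if k is k'.+1 then Rv mu (resolvent_chain k' lam (mu + lam) v) else v.

Let chain_recr k lam mu v : resolvent_chain k.+1 lam mu v = resolvent_chain k lam mu (Rv (mu + k%:R * lam) v).
Proof.
elim: k mu => [|k IH] mu; first by rewrite /= mul0r addr0.
rewrite [LHS]/= -/(resolvent_chain k.+1 lam (mu + lam) v) IH /=; congr (Rv mu (resolvent_chain _ _ _ (Rv _ _))).
by rewrite -[k.+1%:R]natr1; ring.
Qed.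

Let chain_comm k lam mu nu v : 0 < lam -> 0 < mu -> 0 < nu ->
  Rv nu (resolvent_chain k lam mu v) = resolvent_chain k lam mu (Rv nu v).
Proof.
by move=> l0 + n0; elim: k mu => //= k IH mu m0; rewrite resolvent_family_comm// IH// addr_gt0.
Qed.

Let chainB k lam mu v w : 0 < lam -> 0 < mu ->
  resolvent_chain k lam mu (v - w) = resolvent_chain k lam mu v - resolvent_chain k lam mu w.
Proof.
by move=> l0; elim: k mu => //= k IH mu m0; rewrite IH ?addr_gt0// resolvent_familyB.
Qed.

Let chainZ k lam mu c v : 0 < lam -> 0 < mu ->
  resolvent_chain k lam mu (c *: v) = c *: resolvent_chain k lam mu v.
Proof.
by move=> l0; elim: k mu => //= k IH mu m0; rewrite IH ?addr_gt0// resolvent_familyZ.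
Qed.

(** The two products share their middle factors; the resolvent identity for the extreme ones, at mu
    and mu + (k + 1) lam, gives the difference. *)
Let chain_diff k lam mu v : 0 < lam -> 0 < mu ->
  resolvent_chain k.+1 lam mu v - resolvent_chain k.+1 lam (mu + lam) v =
  (k.+1%:R * lam)%:C *: resolvent_chain k.+2 lam mu v.
Proof.
move=> l0 m0; have ml : 0 < mu + lam by rewrite addr_gt0.
have kl : 0 < mu + k.+1%:R * lam by rewrite addr_gt0// mulr_gt0 ?ltr0n.
rewrite [X in X - _]/= (chain_recr k lam (mu + lam)) chain_comm// -chainB//.
have -> : mu + lam + k%:R * lam = mu + k.+1%:R * lam by rewrite -natr1; ring.
rewrite (resolvent_family_identity v m0 kl) addrAC subrr add0r chainZ//.
have -> : mu + k.+1%:R * lam - mu = k.+1%:R * lam by ring.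
congr (_ *: _); rewrite -[RHS]/(Rv mu (resolvent_chain k.+1 lam (mu + lam) v)) chain_recr.
rewrite -chain_comm//.
have -> : mu + lam + k%:R * lam = mu + k.+1%:R * lam by rewrite -natr1; ring.
by rewrite !chain_comm// resolvent_family_comm.
Qed.

(* Both sides are the k-th difference in mu, with step lam, of e^(-mu s) and R(mu). *)
Lemma represents_bump k lam mu u : 0 < lam -> 0 < mu ->
  represents u (fun s => expR (- (mu * s)) * (1 - expR (- (lam * s))) ^+ k)
    ((k`!%:R * lam ^+ k)%:C *: resolvent_chain k.+1 lam mu u).
Proof.
move=> l0; elim: k mu => [|k IH] mu m0.
  rewrite fact0 expr0 mulr1 scale1r; apply: represents_ext (represents_exp u m0) => s s0.
  by rewrite expr0 mulr1.
have := represents_lin 1 (-1) (IH mu m0) (IH (mu + lam) (addr_gt0 m0 l0)).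
rewrite scale1r rmorphN rmorph1 scaleN1r -scalerBr chain_diff// scalerA -rmorphM.
have -> : k`!%:R * lam ^+ k * (k.+1%:R * lam) = k.+1`!%:R * lam ^+ k.+1.
  by rewrite factS natrM exprS; ring.
apply: represents_ext => s s0.
rewrite mulrDl opprD expRD exprS; ring.
Qed.

Lemma represents_weight al n0 y u :
  represents u (lap_weight al n0 y)
    ((expR (y * (1 - al)) * (n0`!%:R * expR y ^+ n0))%:C *: resolvent_chain n0.+1 (expR y) (expR y) u).
Proof.
have e0 := expR_gt0 y.
have := represents_lin (expR (y * (1 - al))) 0 (represents_bump n0 u e0 e0) (represents_bump n0 u e0 e0).
rewrite scale0r addr0 scalerA -rmorphM; apply: represents_ext => s s0.
by rewrite mul0r addr0 /lap_weight /lap_bump.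
Qed.

Lemma represents0 u : represents u (fun=> 0) 0.
Proof.
have := represents_lin 0 0 (represents_exp u ltr01) (represents_exp u ltr01).
by rewrite !scale0r addr0; apply: represents_ext => s _; rewrite !mul0r addr0.
Qed.

Definition weight_value (al : R) (n0 : nat) (y : R) (u : X) : X :=
  (expR (y * (1 - al)) * (n0`!%:R * expR y ^+ n0))%:C *: resolvent_chain n0.+1 (expR y) (expR y) u.

Lemma represents_approx al n0 h I u : represents u (lap_approx al n0 h I)
  (\sum_(k < I) (weight_value al n0 (k%:R * h) u + weight_value al n0 (- (k.+1%:R * h)) u)).
Proof.
elim: I => [|I IH].
  by rewrite big_ord0; apply: represents_ext (represents0 u) => s _; rewrite /lap_approx big_ord0.
rewrite big_ord_recr/=.
have W := represents_lin 1 1 (represents_weight al n0 (I%:R * h) u) (represents_weight al n0 (- (I.+1%:R * h)) u).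
have := represents_lin 1 1 IH W.
rewrite !scale1r; apply: represents_ext => s _.
by rewrite !mul1r /lap_approx big_ord_recr.
Qed.

Let rint_rsum al u a b v : 0 < b - a -> is_rint (fun t => (t `^ (al - 1))%:C *: T t u) a b v ->
  tends (fun m => lap_rsum u a b m (fun s => s `^ (al - 1))) v.
Proof.
move=> ba Hv e e0; have [dl dl0 Hd] := Hv e e0.
have [N HN] := step_small (b - a) dl0; exists N => m mN.
pose h := (b - a) / m.+1%:R; have h0 : 0 < h by rewrite divr_gt0 ?ltr0n.
have hd : h < dl := HN m mN.
have sS i : a + i.+1%:R * h - (a + i%:R * h) = h by rewrite -natr1; ring.
have := Hd m.+1 (fun i => a + i%:R * h) (lap_node a b m); rewrite mul0r addr0.
have -> : a + m.+1%:R * h = b by rewrite /h mulrC divfK ?pnatr_eq0// addrC subrK.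
move=> /(_ erefl erefl) H; apply/ltW; apply: le_lt_trans (H _).
  rewrite /lap_rsum le_eqVlt; apply/orP; left; apply/eqP; congr (nrm (_ - _)).
  by apply: eq_bigr => i _; rewrite sS scalerA -rmorphM.
move=> i _; rewrite sS /lap_node -/h; split=> //.
by rewrite lerD2l ler_wpM2r ?ler_nat// ltW.
Qed.

(** The two-parameter improper integral is followed along the intervals fixed above; equal spacing
    and right tags form one admissible family of partitions. *)
Lemma represents_rint0y al u J : is_rint0y (fun t => (t `^ (al - 1))%:C *: T t u) J ->
  represents u (fun s => s `^ (al - 1)) J.
Proof.
move=> HJ; set f := fun t => _ in HJ.
have near_all e : 0 < e -> exists K, forall k, (K <= k)%N ->
    exists2 v, is_rint f (lap_start k) (lap_stop k) v & nrm (v - J) < e.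
  move=> e0; case: (HJ e e0) => -[PA PB] /= [/nbhs_right0P HA [c [_ HB]]] sub.
  case: HA => d /= d0 HA.
  have [N HN] := step_small 1 d0.
  exists (maxn N (Num.truncn c)) => k; rewrite geq_max => /andP[k1 k2].
  apply: (sub (lap_start k, lap_stop k)); split=> /=.
    have [s0 _] := startP k; have := HN k k1; rewrite div1r -/(lap_start k) => sd.
    by rewrite -[lap_start k]add0r; apply: HA => //; rewrite /= sub0r normrN gtr0_norm.
  apply: HB; rewrite (lt_le_trans (truncnS_gt _))// ler_nat ltnS.
  by rewrite (leq_trans k2) ?leqnSn.
have [K1 H1] := near_all 1 ltr01.
have ex k : exists v, (K1 <= k)%N -> is_rint f (lap_start k) (lap_stop k) v.
  have [kK|] := boolP (K1 <= k)%N; last by exists 0.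
  by have [v Hv _] := H1 k kK; exists v.
have [vk vkP] := choice ex.
exists K1, vk; split=> [k kK|e e0]; first by have [_ ?] := startP k; apply: rint_rsum => //; exact: vkP.
have [K2 H2] := near_all e e0; exists (maxn K1 K2) => k; rewrite geq_max => /andP[k1 k2].
have [v Hv vJ] := H2 k k2; have [_ d0] := startP k.
by rewrite (tends_unique (rint_rsum d0 (vkP k k1)) (rint_rsum d0 Hv)) ltW.
Qed.

(** Right tags and a decreasing integrand keep every Riemann sum below the integral over the
    half-line. *)
Lemma lap_rsum_tail lam k m : 0 < lam ->
  \sum_(i < m.+1) (lap_stop k - lap_start k) / m.+1%:R * expR (- (lam * lap_node (lap_start k) (lap_stop k) m i)) <= lam^-1.
Proof.
move=> l0; have [s0 d0] := startP k; set a := lap_start k in s0 d0 *; set b := lap_stop k in d0 *.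
pose h := (b - a) / m.+1%:R; have h0 : 0 < h by rewrite divr_gt0 ?ltr0n.
rewrite -/h -(big_mkord xpredT (fun i => h * expR (- (lam * lap_node a b m i)))).
rewrite (@le_trans _ _ (\sum_(0 <= i < m.+1) lam^-1 * - (expR (- (lam * (i.+1%:R * h))) - expR (- (lam * (i%:R * h))))))//.
  apply: ler_sum => i _; rewrite -ler_pdivrMl ?invr_gt0// invrK opprB.
  have E : expR (- (lam * (i%:R * h))) = expR (- (lam * (i.+1%:R * h))) * expR (lam * h).
    by rewrite -expRD -natr1; congr expR; ring.
  rewrite E mulrA (@le_trans _ _ (lam * h * expR (- (lam * (i.+1%:R * h)))))//.
    rewrite ler_wpM2l ?(mulr_ge0 (ltW l0) (ltW h0))// ler_expR lerN2 ler_wpM2l ?(ltW l0)//.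
    by rewrite /lap_node -/h lerDr ltW.
  have := expR_ge1Dx (lam * h); have := expR_gt0 (- (lam * (i.+1%:R * h))).
  move: (expR (- (lam * (i.+1%:R * h)))) (expR (lam * h)) (lam * h) => p q r; nra.
rewrite -mulr_sumr sumrN telescope_sumr// opprB mul0r mulr0 oppr0 expR0.
by rewrite ler_piMr ?invr_ge0 ?(ltW l0)// gerBl expR_ge0.
Qed.

Let pow_exp_bound n0 : exists2 C : R, 0 <= C & forall s, 0 <= s -> s ^+ n0 * expR (- (omega * s)) <= C * expR (- (omega / 2 * s)).
Proof.
case: n0 => [|n].
  exists 1 => // s s0; rewrite expr0 ler_wpM2l// ler_expR lerN2 ler_wpM2r// ler_pdivrMr// ler_peMr ?ler1n//; exact: ltW.
pose c := n.+1%:R * 2 / omega; have c0 : 0 < c by rewrite divr_gt0 ?mulr_gt0 ?ltr0n.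
exists (c ^+ n.+1) => [|s s0]; first by rewrite exprn_ge0// ltW.
have -> : expR (- (omega * s)) = expR (- (omega / 2 * s)) * expR (- (omega / 2 * s)).
  by rewrite -expRD; congr expR; field.
rewrite mulrA ler_wpM2r ?expR_ge0//.
have H : s / c <= expR (s / c) by rewrite (le_trans _ (expR_ge1Dx _))// lerDr.
have {}H : (s / c) ^+ n.+1 <= expR (s / c) ^+ n.+1 by rewrite lerXn2r ?nnegrE ?expR_ge0 ?(divr_ge0 s0 (ltW c0)).
have E : expR (s / c) ^+ n.+1 = expR (omega / 2 * s).
  rewrite -expRM_natl; congr expR; rewrite /c; field.
  by rewrite gt_eqF// -[1 + _]/(1%:R + _) -natrD pnatr_eq0.
rewrite E expr_div_n ler_pdivrMr ?exprn_gt0// in H.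
rewrite (le_trans (ler_wpM2r (expR_ge0 _) H))// mulrAC -expRD subrr expR0 mul1r//.
Qed.

(** Weights that are close in the discrete L^1 norm with density e^(-omega s), uniformly over the
    Riemann sums, represent vectors that are close, by stability. *)
Lemma represents_dist u f g v w e : represents u f v -> represents u g w ->
  (forall k m, \sum_(i < m.+1) (lap_stop k - lap_start k) / m.+1%:R *
     expR (- (omega * lap_node (lap_start k) (lap_stop k) m i)) *
     `|f (lap_node (lap_start k) (lap_stop k) m i) - g (lap_node (lap_start k) (lap_stop k) m i)| <= e) ->
  nrm (v - w) <= M * e * nrm u.
Proof.
move=> [K1 [v1 [H1 L1]]] [K2 [v2 [H2 L2]]] H.
have L : tends (fun k => v1 (k + maxn K1 K2)%N - v2 (k + maxn K1 K2)%N) (v - w).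
  apply: tendsB.
    by move=> d d0; have [N HN] := L1 d d0; exists N => k kN; apply: HN; exact: leq_trans (leq_addr _ _).
  by move=> d d0; have [N HN] := L2 d d0; exists N => k kN; apply: HN; exact: leq_trans (leq_addr _ _).
apply: (tends_le L) => k; set k' := (k + _)%N.
have k1 : (K1 <= k')%N by rewrite (leq_trans (leq_maxl K1 K2)) ?leq_addl.
have k2 : (K2 <= k')%N by rewrite (leq_trans (leq_maxr K1 K2)) ?leq_addl.
apply: (tends_le (tendsB (H1 k' k1) (H2 k' k2))) => m.
have [s0 d0] := startP k'; have n0 i : 0 < lap_node (lap_start k') (lap_stop k') m i.
  by rewrite addr_gt0// mulr_gt0 ?ltr0n// divr_gt0 ?ltr0n.
have h0 : 0 < (lap_stop k' - lap_start k') / m.+1%:R by rewrite divr_gt0 ?ltr0n.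
rewrite /lap_rsum -sumrB (le_trans (nrm_sum _ _ _))// (le_trans _ (ler_wpM2r (nrm_ge0 u) (ler_wpM2l M0 (H k' m))))//.
rewrite mulr_sumr mulr_suml; apply: ler_sum => i _.
set s := lap_node _ _ _ _; set h := _ / _ in h0 *.
rewrite -scalerBl -rmorphB/= -mulrBr nrmZr normrM gtr0_norm//.
rewrite (le_trans (ler_wpM2l _ (TM u (ltW (n0 i)))))//; first by rewrite mulr_ge0// ltW.
by rewrite -/s le_eqVlt; apply/orP; left; apply/eqP; ring.
Qed.

(** The rate is known for powers of one resolvent. R(mu) = R(nu) (1 + (nu - mu) R(mu)) exchanges the
    factors one by one, and the hypothesis on [nu] keeps (nu - mu) R(mu) bounded by M / omega +
    M. *)
Let chain_factor k lam mu nu v : 0 < lam -> 0 < mu -> 0 < nu ->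
  (forall j : nat, `|nu - (mu + j%:R * lam)| <= 1 + (mu + j%:R * lam)) ->
  exists2 v', resolvent_chain k lam mu v = iter k (Rv nu) v' & nrm v' <= (1 + (M / omega + M)) ^+ k * nrm v.
Proof.
move=> l0 + n0; elim: k mu => [|k IH] mu m0 H; first by exists v; rewrite ?expr0 ?mul1r.
have ml : 0 < mu + lam by rewrite addr_gt0.
have [|v' E Hv] := IH _ ml.
  by move=> j; have := H j.+1; rewrite -natr1 mulrDl mul1r [_ * lam + lam]addrC addrA.
exists (v' + (nu - mu)%:C *: Rv mu v').
  rewrite iterSr resolvent_familyD// resolvent_familyZ// -resolvent_family_identity//= E.
  by elim: k {IH E Hv} => //= k <-; rewrite resolvent_family_comm.
rewrite (le_trans (nrmD _ _))// nrmZr exprS -mulrA.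
apply: (@le_trans _ _ ((1 + (M / omega + M)) * nrm v')); last first.
  by rewrite ler_wpM2l// !addr_ge0 ?divr_ge0// ltW.
rewrite mulrDl mul1r lerD2l.
have := H 0%N; rewrite mul0r addr0 => H0.
rewrite (le_trans (ler_pM _ _ H0 (resolvent_family_le v' m0))) ?nrm_ge0// mulrA ler_wpM2r ?nrm_ge0//.
have mo : 0 < mu + omega by rewrite addr_gt0.
rewrite mulrDl mul1r lerD//.
  by rewrite ler_wpM2l// lef_pV2 ?posrE// lerDr ltW.
by rewrite mulrCA ler_piMr// ler_pdivrMr// mul1r lerDl ltW.
Qed.

(** The rate requires lam >= 1. For y >= 0 the resolvents are compared with R(e^y), for y <= 0 with
    R(1); both bounds decay exponentially in |y| for al between theta + a and n0 + 1. *)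
Lemma pade_error_weight al n0 a : 0 <= a -> a + 4 <= n0.+1%:R -> exists2 C : R, 0 <= C &
  forall n t y u, (0 < n)%N -> a <= (2 * n + 2)%:R -> 0 < t ->
  (0 <= y -> nrm (B n t (weight_value al n0 y u)) <= C * (t / n.+1%:R) `^ a * nrm u * expR (- (y * (al - theta - a)))) /\
  (y <= 0 -> nrm (B n t (weight_value al n0 y u)) <= C * (t / n.+1%:R) `^ a * nrm u * expR (y * (n0.+1%:R - al))).
Proof.
move=> a0 aN; have [C C0 HC] := pade_error_resolventN a0.
pose c := (1 + (M / omega + M)) ^+ n0.+1.
have c0 : 0 <= c by rewrite exprn_ge0// !addr_ge0 ?divr_ge0// ltW.
exists (n0`!%:R * C * c) => [|n t y u n1 an t0]; first by rewrite !mulr_ge0.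
have l0 := expR_gt0 y; set tau := (t / _) `^ a; have tau0 : 0 <= tau by rewrite powR_ge0.
have key nu : 1 <= nu -> (forall j : nat, `|nu - (expR y + j%:R * expR y)| <= 1 + (expR y + j%:R * expR y)) ->
    nrm (B n t (weight_value al n0 y u)) <=
    n0`!%:R * C * c * tau * nrm u * (expR (y * (1 - al)) * expR y ^+ n0 * nu `^ (theta + a - n0.+1%:R)).
  move=> n1' H; have nu0 : 0 < nu by rewrite (lt_le_trans ltr01).
  have [v E Hv] := chain_factor n0.+1 u l0 l0 nu0 H.
  have w0 : 0 <= expR (y * (1 - al)) * (n0`!%:R * expR y ^+ n0) by rewrite !mulr_ge0 ?expR_ge0 ?exprn_ge0 ?expR_ge0.
  rewrite /weight_value pade_errorZ// nrmZr ger0_norm// E.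
  apply: (le_trans (ler_wpM2l w0 (HC n t nu n0.+1 _ n1 an t0 n1' aN (resolvent_familyP nu0) v))).
  rewrite -/tau; set p := nu `^ _; have p0 : 0 <= p by rewrite powR_ge0.
  apply: (@le_trans _ _ (expR (y * (1 - al)) * (n0`!%:R * expR y ^+ n0) * (C * tau * p * (c * nrm u)))).
    by rewrite ler_wpM2l// ler_wpM2l// !mulr_ge0.
  by rewrite le_eqVlt; apply/orP; left; apply/eqP; move: (expR _) (_ ^+ n0) n0`!%:R (nrm u) => x1 x2 x3 x4; ring.
have en (z : R) : expR y ^+ n0 = expR (y * n0%:R) by rewrite -expRM_natl mulrC.
split=> y0.
  have y1 : 1 <= expR y by rewrite -expR0 ler_expR.
  apply: (le_trans (key _ y1 _)).
    move=> j; have j0 : 0 <= j%:R * expR y by rewrite mulr_ge0 ?ler0n ?ltW.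
    by rewrite opprD addrA subrr add0r normrN ger0_norm// addrA lerDr addr_ge0 ?expR_ge0.
  rewrite -[leRHS]mulr1 -[leRHS]mulrA ler_wpM2l ?mulr_ge0 ?nrm_ge0//.
  rewrite (en 0) -expRM -!expRD mulr1 ler_expR le_eqVlt; apply/orP; left; apply/eqP.
  by rewrite -natr1; ring.
have := key 1 (lexx 1); rewrite powR1 mulr1 => {}key.
apply: (le_trans (key _)).
  move=> j; have j0 : 0 <= expR y + j%:R * expR y by rewrite addr_ge0 ?mulr_ge0 ?ler0n ?ltW.
  by rewrite (le_trans (ler_normB _ _))// normr1 (ger0_norm j0).
rewrite ler_wpM2l ?mulr_ge0 ?nrm_ge0//.
rewrite (en 0) -!expRD ler_expR le_eqVlt; apply/orP; left; apply/eqP.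
by rewrite -natr1; ring.
Qed.

Let inv_one_sub_exp_le (x : R) : 0 < x -> (1 - expR (- x))^-1 <= 1 + x^-1.
Proof.
move=> x0; have d0 : 0 < 1 - expR (- x) by rewrite subr_gt0 expR_lt1 oppr_lt0.
rewrite -[leLHS]mul1r ler_pdivrMr// expRN.
have E : 1 + x <= expR x := expR_ge1Dx x.
have e0 := expR_gt0 x.
have H : (expR x)^-1 <= (1 + x)^-1 by rewrite lef_pV2 ?posrE// addr_gt0.
have F : 1 = (1 + x^-1) * (1 - (1 + x)^-1).
  by field; rewrite !gt_eqF// addr_gt0.
by rewrite [leLHS]F ler_wpM2l ?addr_ge0 ?invr_ge0 ?(ltW x0)// lerB.
Qed.

Theorem pade_error_powR al a : 0 <= a -> a + theta < al -> exists2 C : R, 0 <= C &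
  forall n t u J, (0 < n)%N -> a <= (2 * n + 2)%:R -> 0 < t ->
  is_rint0y (fun t => (t `^ (al - 1))%:C *: T t u) J ->
  nrm (B n t J) <= C * (t / n.+1%:R) `^ a * nrm u.
Proof.
move=> a0 aal; have al0 : 0 < al by rewrite (le_lt_trans _ aal)// addr_ge0.
(* Large enough for a + 4 resolvent factors and for al < n0 + 1. *)
pose n0 := (Num.truncn (a + 4 + al)).
have n0P : a + 4 + al < n0.+1%:R by exact: truncnS_gt.
have aN : a + 4 <= n0.+1%:R by rewrite (le_trans _ (ltW n0P))// lerDl ltW.
have aln : al < n0.+1%:R by rewrite (le_lt_trans _ n0P)// lerDr addr_ge0.
pose gam := n0.+1%:R - al; have gam0 : 0 < gam by rewrite subr_gt0.
pose dl := al - theta - a; have dl0 : 0 < dl by rewrite /dl; lra.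
have [C C0 HC] := pade_error_weight al a0 aN.
have [Cp Cp0 HCp] := pow_exp_bound n0.
have fl0 := lap_floor_gt0 al n0.
pose Q := (1 + dl^-1) + (1 + gam^-1).
have Q0 : 0 <= Q by rewrite !addr_ge0 ?invr_ge0 ?ltW.
exists (C * (Q / lap_floor al n0)) => [|n t u J n1 an t0 HJ]; first by rewrite mulr_ge0// divr_ge0// ltW.
(* [K] depends on [n] and [t]; it only multiplies the approximation error of the weight, which is
   sent to 0 with them fixed. *)
have [K K0 HK] := pade_error_bounded n1 t0.
set tau := (t / _) `^ a; have tau0 : 0 <= tau by rewrite powR_ge0.
apply/ler_addgt0Pr => e e0.
have b0 : 0 < K * (M * nrm u) + 1 by rewrite ltr_wpDl// !mulr_ge0 ?nrm_ge0.
have om2 : 0 < omega / 2 by rewrite divr_gt0.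
have C20 : 0 <= Cp * (omega / 2)^-1 by rewrite mulr_ge0// invr_ge0 ltW.
have [k [I HI]] := weight_approx al0 aln ler01 C20 (divr_gt0 e0 b0).
pose h : R := k.+1%:R^-1; have h0 : 0 < h by rewrite invr_gt0 ltr0n.
pose p := lap_profile al n0 h 1.
have pk : k.+1%:R * lap_floor al n0 <= p := lap_profile_ge al0 aln k.
have p0 : 0 < p by rewrite (lt_le_trans _ pk)// mulr_gt0// ltr0n.
pose S := \sum_(k < I) (weight_value al n0 (k%:R * h) u + weight_value al n0 (- (k.+1%:R * h)) u).
have repV : represents u (fun s => p^-1 * lap_approx al n0 h I s) ((p^-1)%:C *: S).
  have := represents_lin p^-1 0 (represents_approx al n0 h I u) (represents0 u).
  by rewrite scaler0 addr0; apply: represents_ext => s _; rewrite mulr0 addr0.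
have D : nrm (J - (p^-1)%:C *: S) <= M * (e / (K * (M * nrm u) + 1)) * nrm u.
  apply: (represents_dist (represents_rint0y HJ) repV) => j m.
  have [s0 d0] := startP j; set a' := lap_start j; set b' := lap_stop j.
  have nd i : 0 < lap_node a' b' m i by rewrite addr_gt0// mulr_gt0 ?ltr0n// divr_gt0 ?ltr0n.
  have hh : 0 < (b' - a') / m.+1%:R by rewrite divr_gt0 ?ltr0n.
  apply: (HI m.+1 (fun i => (b' - a') / m.+1%:R * expR (- (omega * lap_node a' b' m i))) (lap_node a' b' m)) => //.
  - by move=> i; rewrite mulr_ge0 ?expR_ge0// ltW.
  - move=> lam l0; rewrite div1r (le_trans _ (lap_rsum_tail j m l0))//.
    apply: ler_sum => i _; rewrite ler_wpM2r ?expR_ge0// ler_piMr ?(ltW hh)// expR_le1 oppr_le0.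
    by rewrite mulr_ge0// ltW.
  - rewrite (le_trans _ (ler_wpM2l Cp0 (lap_rsum_tail j m om2)))// mulr_sumr.
    apply: ler_sum => i _; rewrite -/a' -/b' mulrCA -[leLHS]mulrA ler_wpM2l ?(ltW hh)//.
    by rewrite mulrC HCp// ltW.
have BV : nrm (B n t ((p^-1)%:C *: S)) <= C * (Q / lap_floor al n0) * tau * nrm u.
  rewrite pade_errorZ// nrmZr gtr0_norm ?invr_gt0// /S pade_error_sum//.
  have c0 : 0 <= C * tau * nrm u by rewrite !mulr_ge0 ?nrm_ge0.
  have H : nrm (\sum_(k < I) B n t (weight_value al n0 (k%:R * h) u + weight_value al n0 (- (k.+1%:R * h)) u)) <=
     C * tau * nrm u * ((1 - expR (- (h * dl)))^-1 + (1 - expR (- (h * gam)))^-1).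
    rewrite (le_trans (nrm_sum _ _ _))//.
    apply: (@le_trans _ _ (\sum_(k < I) C * tau * nrm u * (expR (- (k%:R * h * dl)) + expR (- (k%:R * h * gam))))).
      apply: ler_sum => i _; rewrite pade_errorD// (le_trans (nrmD _ _))// mulrDr.
      have y0 : 0 <= i%:R * h by rewrite mulr_ge0 ?ler0n// ltW.
      have y1 : - (i.+1%:R * h) <= 0 by rewrite oppr_le0 mulr_ge0 ?ler0n// ltW.
      have [H1 _] := HC n t _ u n1 an t0 : (0 <= i%:R * h -> _) /\ _.
      have [_ H2] := HC n t (- (i.+1%:R * h)) u n1 an t0.
      rewrite lerD ?(H1 y0)// (le_trans (H2 y1))// ler_wpM2l// ler_expR mulNr lerN2 ler_wpM2r ?(ltW gam0)//.
      by rewrite ler_wpM2r ?ler_nat// ltW.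
    rewrite -mulr_sumr ler_wpM2l// big_split/=.
    have G c : 0 < c -> \sum_(i < I) expR (- (i%:R * h * c)) <= (1 - expR (- (h * c)))^-1.
      move=> c1; rewrite -(big_mkord xpredT (fun i => expR (- (i%:R * h * c)))).
      by rewrite (le_trans (geometric_exp_le h0 _ _ c1))// !mul0r oppr0 expR0 div1r.
    by rewrite lerD// G.
  apply: (le_trans (ler_wpM2l _ H)); first by rewrite invr_ge0 ltW.
  (* Each geometric series is of order 1/h = k + 1, which the lower bound [pk] of the normalization
     [p] cancels. *)
  have Hx c : 0 < c -> (1 - expR (- (h * c)))^-1 <= k.+1%:R * (1 + c^-1).
    move=> c1; rewrite (le_trans (inv_one_sub_exp_le (mulr_gt0 h0 c1)))// mulrDr mulr1 lerD ?ler1n//.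
    by rewrite invfM invrK.
  have S2 : (1 - expR (- (h * dl)))^-1 + (1 - expR (- (h * gam)))^-1 <= k.+1%:R * Q.
    by rewrite /Q [leRHS]mulrDr lerD ?Hx.
  apply: (@le_trans _ _ (p^-1 * (C * tau * nrm u * (k.+1%:R * Q)))).
    by rewrite ler_wpM2l ?invr_ge0 ?(ltW p0)// ler_wpM2l.
  have -> : p^-1 * (C * tau * nrm u * (k.+1%:R * Q)) = C * tau * nrm u * Q * (k.+1%:R / p) by ring.
  have -> : C * (Q / lap_floor al n0) * tau * nrm u = C * tau * nrm u * Q * (lap_floor al n0)^-1 by ring.
  by apply: (ler_wpM2l (mulr_ge0 c0 Q0)); rewrite ler_pdivrMr// [leRHS]mulrC ler_pdivlMr.
rewrite -[J](subrK ((p^-1)%:C *: S)) pade_errorD// (le_trans (nrmD _ _))// addrC lerD//.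
rewrite (le_trans (HK _))// (le_trans (ler_wpM2l K0 D))//.
have -> : K * (M * (e / (K * (M * nrm u) + 1)) * nrm u) = e * ((K * (M * nrm u)) / (K * (M * nrm u) + 1)) by ring.
by rewrite ler_piMr ?(ltW e0)// ler_pdivrMr// mul1r lerDl.
Qed.

End ApproximantFamily.

Theorem proposition7p3 (R : realType) (X : completeNormedModType R[i])
    (X_nonzero : exists x : X, x != 0)
    (d : measure_display) (Omega : measurableType d) (P : probability Omega R)
    (gam : nat -> Omega -> R[i]) (gamP : gaussian_sequence P gam)
    (A : operator X) (T : R -> {linear X -> X})
    (T_semigroup : C0_semigroup T)
    (A_generates : scale_op (-1) A = generator T)
    (T_stable : exponentially_stable T)
    (T_invertible : forall t, 0 <= t -> invertible_op (T t))
    (p q : R) (p_range : 1 <= p <= 2) (q_range : 2 <= q)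
    (X_type : has_type P X gam p) (X_cotype : has_cotype P X gam q)
    (pn qn : nat -> {poly R[i]})
    (padeP : forall n, (0 < n)%N -> is_subdiagonal_pade n (pn n) (qn n))
    (alpha a : R) (alpha_gt : p^-1 - q^-1 < alpha)
    (a_range : 0 < a < alpha - p^-1 + q^-1) :
  (exists2 C : R, 0 <= C &
     forall (t : R) (n : nat) (x : X),
       0 < t -> (0 < n)%N -> alpha / 2 - 1 < n%:R -> dom (fpow T alpha) x ->
       nrm (app (rat_op (pn n) (qn n) (scale_op (- t%:C) A)) x - T t x)
         <= C * t `^ a * n.+1%:R `^ (- a) * nrm (app (fpow T alpha) x))
  /\
  (forall x, interp A (p^-1 - q^-1) 1 x ->
   forall tau eps : R, 0 < tau -> 0 < eps ->
     \forall n \near \oo, forall t, 0 < t <= tau ->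
       nrm (app (rat_op (pn n) (qn n) (scale_op (- t%:C) A)) x - T t x) < eps).
Proof.
have [M [omega [M1 omega0 TM]]] := T_stable.
have [Ct Ct0 trans] := transference T_semigroup T_stable T_invertible gamP p_range q_range X_type X_cotype.
pose theta := p^-1 - q^-1.
have /andP[p1 p2] := p_range.
have p0 : 0 < p by rewrite (lt_le_trans ltr01).
have q0 : 0 < q by rewrite (lt_le_trans _ q_range).
have theta0 : 0 <= theta by rewrite subr_ge0 lef_pV2 ?posrE// (le_trans p2).
have theta1 : theta < 1 by rewrite ltrBlDr (le_lt_trans (_ : _ <= 1)) ?invf_le1// ltrDl invr_gt0.
have {}trans h (m : {poly R[i]}) K : 0 < h <= 1 -> 0 < K -> (forall z, nrm z = 1 -> nrm m.[z] <= K) ->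
    forall x, nrm (sg_horner T h m x) <= Ct * h `^ (- theta) * K * nrm x.
  by rewrite opprB; exact: trans.
have [Rv RvP] := resolvent_family_exists T_semigroup M1 omega0 TM A_generates.
have /andP[a0 aal] := a_range.
split; last first.
  move=> x xi tau eps tau0 eps0.
  have [N0 HN0] := pade_error_interp T_semigroup M1 omega0 TM A_generates Ct0 theta0 theta1 trans padeP RvP xi tau0
    (divr_gt0 eps0 (ltr0n R 2)).
  exists (maxn N0 1) => // n /=; rewrite geq_max => /andP[nN n0] t t0.
  by rewrite (le_lt_trans (HN0 n t nN n0 t0))// ltr_pdivrMr// ltr_pMr// ltr1n.
have aal' : a + theta < alpha by rewrite /theta; lra.
have [C C0 HC] := pade_error_powR T_semigroup M1 omega0 TM A_generates Ct0 theta0 trans padeP RvP (ltW a0) aal'.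
exists (`|(Gamma alpha)^-1| * C); first by rewrite mulr_ge0.
move=> t n x t0 n0 an dx.
(* a < alpha < 2n + 2, by the condition on n and theta >= 0. *)
have an' : a <= (2 * n + 2)%:R.
  by rewrite natrD natrM ltW//; move: theta0; rewrite /theta; lra.
set u := app (fpow T alpha) x.
have [J HJ xE] : fpow T alpha (x, u).
  by case: dx => w Hw; exact: (@xgetPex _ 0 [set y | fpow T alpha (x, y)] (ex_intro _ w Hw)).
have := HC n t u J n0 an' t0 HJ.
rewrite -[_ - _]/(pade_error T A pn qn n t x) (xE : x = _).
rewrite (pade_errorZ T_semigroup M1 omega0 TM A_generates padeP)// nrmZr => H.
rewrite (le_trans (ler_wpM2l (normr_ge0 _) H))// !mulrA le_eqVlt; apply/orP; left; apply/eqP.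
have n1 : (0 : R) < n.+1%:R by rewrite ltr0n.
by rewrite powRM ?invr_ge0 ?(ltW t0) ?(ltW n1)// -[n.+1%:R^-1]powR_inv1 ?(ltW n1)// -powRrM mulN1r !mulrA.
Qed.
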